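(* Let $\sigma$ be an invertible ergodic measure-preserving transformation of a probability space $(\Omega,\mathbb P)$. Let $0<R<1$ and let $\mathcal T=(T_\omega)_{\omega\in\Omega}$ be a family of finite Blaschke products, depending measurably on $\omega$, satisfying $r:=r_{\mathcal T}(R)<R$. Let $\mathcal L_\omega$ denote the Perron-Frobenius operator of $T_\omega$, acting on the Hilbert space $H^2(A_R)$. Then the cocycle $(\mathcal L_\omega)$ is compact and the following hold. (1) (Random fixed point) There exists a measurable map $x\colon\Omega\to\overline{D_r}$, $\omega\mapsto x_\omega$, such that $T_\omega(x_\omega)=x_{\sigma(\omega)}$ for a.e. $\omega$; and for a.e. $\omega$ and all $z\in D_R$, $T^{(N)}_{\sigma^{-N}\omega}(z):=T_{\sigma^{-1}\omega}\circ\cdots\circ T_{\sigma^{-N}\omega}(z)\to x_\omega$ as $N\to\infty$. (2) (Critical random fixed point) If $\mathbb P(\{\omega\colon T_\omega'(x_\omega)=0\})>0$, then the Lyapunov spectrum of the cocycle $(\mathcal L_\omega)$ is $0$ with multiplicity $1$, and $-\infty$ with infinite multiplicity. (3) (Generic case) If $\mathbb P(\{\omega\colon T_\omega'(x_\omega)=0\})=0$, define $\Lambda=\int\log|T_\omega'(x_\omega)|\,d\mathbb P(\omega)$. Then $\Lambda\le\log(r/R)<0$. If $\Lambda=-\infty$, then the Lyapunov spectrum of the cocycle is $0$ with multiplicity $1$, and $-\infty$ with infinite multiplicity. If $\Lambda>-\infty$, then the Lyapunov spectrum of the cocycle is $0$ with multiplicity $1$, and $n\Lambda$ with multiplicity $2$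 for each $n\in\mathbb N=\{1,2,\dots\}$. The Oseledets space with exponent $0$ is spanned by $\frac1{z-x_\omega}-\frac1{z-1/\bar x_\omega}$. For each $j\ge1$ the Oseledets space with exponent $j\Lambda$ is spanned by two functions, one a linear combination of $1/(z-x_\omega)^2,\ldots,1/(z-x_\omega)^{j+1}$ with a pole of order $j+1$ at $x_\omega$; the other a linear combination of $z^{k-1}/(1-\bar x_\omega z)^{k+1}$, $k=1,\ldots,j$, with a pole of order $j+1$ at $1/\bar x_\omega$.
   Context: Notation: $D_\rho=\{|z|<\rho\}$, $C_\rho=\{|z|=\rho\}$, $A_R=\{z\colon R<|z|<1/R\}$. A finite Blaschke product is a map $T(z)=\zeta\prod_{j=1}^n\frac{z-\zeta_j}{1-\bar\zeta_jz}$ with $n\ge1$, $|\zeta|=1$, $|\zeta_j|<1$, viewed as a rational map of $\hat{\mathbb C}$. Set $r_T(R)=\max_{|z|=R}|T(z)|$ and $r_{\mathcal T}(R)=\operatorname{ess\,sup}_{\omega}r_{T_\omega}(R)$. A map $\omega\mapsto T_\omega$ is measurable if the parameters $n,\zeta,\zeta_1,\dots,\zeta_n$ are Borel measurable functions of $\omega$. $H^2(A_R)$ is the Hardy–Hilbert space of analytic functions on $A_R$ with $L^2$ boundary extension to $\partial A_R$, with inner product $\langle f,g\rangle=\frac1{2\pi}\int_{\partial A_R}f\bar g\,\frac{|dz|}{|z|}$; an orthonormal basis is $\{(R^{2n}+R^{-2n})^{-1/2}z^n\colon n\in\mathbb Z\}$. The Perron-Frobenius operator of $T$ is $\mathcal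 L_Tf(z)=\sum_i f(\tau_i(z))\tau_i'(z)$ where the $\tau_i$ are the inverse branches of $T|_{C_1}$, i.e. $\mathcal L_Tf(z)=\sum_{y\in T^{-1}z}f(y)/T'(y)$; for $f\in H^2(A_R)$ and $r_T(R)<R$, $\mathcal L_Tf$ is the element of $H^2(A_R)$ given on $C_1$ by this formula. $\mathcal L_\omega=\mathcal L_{T_\omega}$ and $\mathcal L^{(n)}_\omega=\mathcal L_{\sigma^{n-1}\omega}\circ\cdots\circ\mathcal L_\omega$. Lyapunov spectrum: the cocycle is compact if $\mathcal L_\omega$ is a compact operator for a.e. $\omega$. For a compact cocycle with $\lim\frac1n\log\|\mathcal L_\omega^{(n)}\|=\lambda_1>-\infty$, the Multiplicative Ergodic Theorem gives finite exponents $\lambda_1>\lambda_2>\cdots$ (finitely or infinitely many), and for a.e. $\omega$ finite-dimensional Oseledets spaces $V_i(\omega)$ of a.e. constant dimension $m_i$ (the multiplicity), with $\mathcal L_\omega V_i(\omega)=V_i(\sigma\omega)$ and $\frac1n\log\|\mathcal L^{(n)}_\omega f\|\to\lambda_i$ for $f\in V_i(\omega)\setminus\{0\}$, and for each $j$ a closed equivariant complement $F_j(\omega)$ of $V_1(\omega)\oplus\cdots\oplus V_j(\omega)$ with $\limsup\frac1n\log\|\mathcal L^{(n)}_\omega f\|\le\lambda_{j+1}$ for $f\in F_j(\omega)$ (with $\lambda_{j+1}:=-\infty$ if $\lambda_j$ is the last finite exponent). ''$0$ with multiplicity $1$ and $-\infty$ with infinite multiplicity'' means the only finite exponent is $\lambda_1=0$,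 with $m_1=1$. Conventions: when $x_\omega=0$, $1/\bar x_\omega=\infty$, $1/(z-\infty)$ is the zero function, and the order of a pole at $\infty$ is measured by: $f$ has order $n\ge1$ at $\infty$ if $f(z)\sim bz^{n-2}$ as $z\to\infty$ with $b\neq0$. *)

(* Defs.v *)
From HB Require Import structures.
From mathcomp Require Import all_boot all_order all_algebra.
From mathcomp Require Import all_classical all_reals all_analysis ess_sup_inf.
From mathcomp.real_closed Require Import complex.

Set Implicit Arguments.
Unset Strict Implicit.
Unset Printing Implicit Defensive.

Import Order.TTheory GRing.Theory Num.Theory.
Import numFieldNormedType.Exports.

Local Open Scope classical_set_scope.
Local Open Scope ring_scope.

(* Naming the structure makes K[i] inherit the topology and the normed module
   structure that the library puts on every numClosedFieldType. *)
Definition Cplx (K : realType) : numClosedFieldType := K[i]%C.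

(* The modulus as an element of K; the library's `|z| is (cabs z)%:C. *)
Definition cabs (K : realType) (z : Cplx K) : K := Normc.normc z.

Definition cbar (K : realType) (z : Cplx K) : Cplx K := conjc z.

Definition circle_pt (K : realType) (s t : K) : Cplx K :=
  Complex (s * cos t) (s * sin t).

Definition annulus (K : realType) (R : K) : set (Cplx K) :=
  [set z | R < cabs z < R^-1].

Definition cmeasurable (K : realType) (d : measure_display)
    (Omega : measurableType d) (D : set Omega) (f : Omega -> Cplx K) : Prop :=
  measurable_fun D (fun w => complex.Re (f w)) /\
  measurable_fun D (fun w => complex.Im (f w)).

Section Blaschke.
Variable K : realType.
Local Notation C := (Cplx K).

Record blaschke := Blaschke {
  bl_rot : C;
  bl_zeros : seq C;
  bl_rot_unit : cabs bl_rot = 1;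
  bl_deg_gt0 : (0 < size bl_zeros)%N;
  bl_zeros_disc : forall a, a \in bl_zeros -> cabs a < 1
}.

(* Only evaluated on the closed unit disc, which contains no pole. *)
Definition bl_fun (T : blaschke) (z : C) : C :=
  bl_rot T * \prod_(a <- bl_zeros T) ((z - a) / (1 - cbar a * z)).

Definition bl_max (T : blaschke) (R : K) : K :=
  sup [set cabs (bl_fun T z) | z in [set z : C | cabs z = R]].

(* The j-th zero is only constrained where the degree exceeds j. *)
Definition measurable_family (d : measure_display) (Omega : measurableType d)
    (T : Omega -> blaschke) : Prop :=
  [/\ measurable_fun setT (fun w => size (bl_zeros (T w))),
      cmeasurable setT (fun w => bl_rot (T w)) &
      forall j : nat, cmeasurable [set w | (j < size (bl_zeros (T w)))%N]
                                  (fun w => nth 0 (bl_zeros (T w)) j)].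

End Blaschke.

Section Dynamics.
Variables (Omega X : Type).

(* cocycle sigma L n w = L (sigma^(n-1) w) o ... o L (sigma w) o L w *)
Fixpoint cocycle (sigma : Omega -> Omega) (L : Omega -> X -> X) (n : nat)
    (w : Omega) (f : X) : X :=
  if n is m.+1 then L (iter m sigma w) (cocycle sigma L m w f) else f.

End Dynamics.

(* sigma is invertible (inverse sigmaV), bimeasurable, preserves P and is
   ergodic. *)
Definition invertible_ergodic (K : realType) (d : measure_display)
    (Omega : measurableType d) (P : probability Omega K)
    (sigma sigmaV : Omega -> Omega) : Prop :=
  [/\ cancel sigma sigmaV /\ cancel sigmaV sigma,
      measurable_fun setT sigma /\ measurable_fun setT sigmaV,
      forall A : set Omega, measurable A -> P (sigma @^-1` A) = P A &
      forall A : set Omega, measurable A -> sigma @^-1` A = A ->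
        P A = 0%E \/ P A = 1%E].

Section Hardy.
Variables (K : realType) (R : K).
Local Notation C := (Cplx K).

Definition angles : set K := `[0, 2 * pi]%classic.

(* g, as a function of the angle, is the L^2 limit of t |-> f (s e^{it}) as s
   goes to the radius of a boundary circle along the filter F. *)
Definition is_L2_trace (f : C -> C) (F : set_system K) (g : K -> C) : Prop :=
  [/\ cmeasurable (angles : set (measurableTypeR K)) g,
      (\int[@lebesgue_measure K]_(t in angles)
          ((cabs (g t)) ^+ 2)%:E < +oo)%E &
      (\int[@lebesgue_measure K]_(t in angles)
          ((cabs (f (circle_pt s t) - g t)) ^+ 2)%:E)%E @[s --> F] --> 0%E].

(* An element of H^2(A_R) is a function on A_R; it is represented by its
   extension by 0 to the plane, so that equality in H^2(A_R) is equality of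
   functions. *)
Definition hardy : set (C -> C) :=
  [set f | [/\ forall z, ~ annulus R z -> f z = 0,
               forall z, annulus R z -> derivable f z 1,
               exists g, is_L2_trace f R^'+ g &
               exists g, is_L2_trace f R^-1^'- g]].

(* Boundary values are determined almost everywhere. *)
Definition L2_trace (f : C -> C) (F : set_system K) : K -> C :=
  xget (cst 0) [set g | is_L2_trace f F g].

(* |dz|/|z| = dt on each boundary circle z = s e^{it}. *)
Definition hardy_norm (f : C -> C) : K :=
  Num.sqrt ((2 * pi)^-1 *
    (fine (\int[@lebesgue_measure K]_(t in angles)
             ((cabs (L2_trace f R^'+ t)) ^+ 2)%:E)%E +
     fine (\int[@lebesgue_measure K]_(t in angles)
             ((cabs (L2_trace f R^-1^'- t)) ^+ 2)%:E)%E)).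

Definition restrict_annulus (f : C -> C) : C -> C :=
  patch (fun=> 0) (annulus R) f.

Definition hardy_cvg (u : nat -> C -> C) (f : C -> C) : Prop :=
  hardy_norm (u n - f) @[n --> \oo] --> 0.

Definition hardy_subspace (E : set (C -> C)) : Prop :=
  [/\ E `<=` hardy, E 0 &
      forall (a : C) f g, E f -> E g -> E (a *: f + g)].

Definition hardy_closed (E : set (C -> C)) : Prop :=
  forall (u : nat -> C -> C) f, (forall n, E (u n)) -> hardy f ->
    hardy_cvg u f -> E f.

Definition lin_span (s : seq (C -> C)) : set (C -> C) :=
  [set f | exists c : nat -> C, f = \sum_(i < size s) c i *: nth 0 s i].

Definition lin_free (s : seq (C -> C)) : Prop :=
  forall c : nat -> C, \sum_(i < size s) c i *: nth 0 s i = 0 ->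
    forall i, (i < size s)%N -> c i = 0.

Definition has_dim (E : set (C -> C)) (m : nat) : Prop :=
  exists s, [/\ size s = m, lin_free s & E = lin_span s].

(* H^2(A_R) is the algebraic direct sum of V 0, ..., V j and E. *)
Definition direct_decomposition (j : nat) (V : nat -> set (C -> C))
    (E : set (C -> C)) : Prop :=
  (forall f, hardy f -> exists (v : nat -> C -> C) g,
     [/\ forall i, (i <= j)%N -> V i (v i), E g &
         f = \sum_(i < j.+1) v i + g]) /\
  (forall (v : nat -> C -> C) g,
     (forall i, (i <= j)%N -> V i (v i)) -> E g ->
     \sum_(i < j.+1) v i + g = 0 ->
     (forall i, (i <= j)%N -> v i = 0) /\ g = 0).

Definition op_norm (L : (C -> C) -> (C -> C)) : \bar K :=
  ereal_sup [set (hardy_norm (L f))%:E |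
              f in [set f | hardy f /\ hardy_norm f <= 1]].

Definition compact_operator (L : (C -> C) -> (C -> C)) : Prop :=
  [/\ forall f, hardy f -> hardy (L f),
      forall (a : C) f g, hardy f -> hardy g ->
        L (a *: f + g) = a *: L f + L g &
      forall u : nat -> C -> C,
        (forall n, hardy (u n)) ->
        (exists M : K, forall n, hardy_norm (u n) <= M) ->
        exists (phi : nat -> nat) (g : C -> C),
          [/\ {homo phi : m n / (m < n)%N}, hardy g &
              hardy_cvg (fun n => L (u (phi n))) g]].

(* On C_1 the Perron-Frobenius operator sums over the preimages under T, which
   are distinct and all lie on C_1. *)
Definition is_perron_frobenius (T : blaschke K) (f g : C -> C) : Prop :=
  hardy g /\
  forall z : C, cabs z = 1 ->
    g z = \sum_(y \in [set y : C | cabs y = 1 /\ bl_fun T y = z])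
            f y / derive1 (bl_fun T) y.

Definition perron_frobenius (T : blaschke K) (f : C -> C) : C -> C :=
  xget 0 [set g | is_perron_frobenius T f g].

End Hardy.

Section Lyapunov.
Variables (K : realType) (R : K) (d : measure_display).
Variables (Omega : measurableType d) (P : probability Omega K).
Variables (sigma : Omega -> Omega).
Variable (L : Omega -> (Cplx K -> Cplx K) -> (Cplx K -> Cplx K)).
Local Notation C := (Cplx K).

Definition compact_cocycle : Prop :=
  {ae P, forall w, compact_operator R (L w)}.

Definition growth (w : Omega) (f : C -> C) (n : nat) : \bar K :=
  (n%:R^-1%:E * lne (hardy_norm R (cocycle sigma L n w f))%:E)%E.

(* Indices start at 0.  The finite values of lam are the exponents, in
   decreasing order; once -oo is reached, lam stays there.  Only the m i, V i
   and F i with lam i finite matter, and F j is the complement of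
   V 0 + ... + V j. *)
Record oseledets_splitting (lam : nat -> \bar K) (m : nat -> nat)
    (V F : nat -> Omega -> set (C -> C)) : Prop := {
  os_top : lam 0%N \is a fin_num;
  os_decr : forall i, (lam i.+1 < lam i)%E \/
                      (lam i = -oo /\ lam i.+1 = -oo)%E;
  os_norm : {ae P, forall w,
    (n%:R^-1%:E * lne (op_norm R (cocycle sigma L n w)))%E
      @[n --> \oo] --> lam 0%N};
  os_mult : forall i, (-oo < lam i)%E -> (0 < m i)%N;
  os_space : forall i, (-oo < lam i)%E -> {ae P, forall w,
    [/\ hardy_subspace R (V i w), has_dim (V i w) (m i),
        L w @` V i w = V i (sigma w) &
        forall f, V i w f -> f <> 0 ->
          growth w f n @[n --> \oo] --> lam i]};
  os_complement : forall j, (-oo < lam j)%E -> {ae P, forall w,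
    [/\ hardy_subspace R (F j w), hardy_closed R (F j w),
        direct_decomposition R j (V^~ w) (F j w),
        L w @` F j w `<=` F j (sigma w) &
        forall f, F j w f -> (limn_esup (growth w f) <= lam j.+1)%E]}
}.

Definition lyapunov_spectrum (lam : nat -> \bar K) (m : nat -> nat) : Prop :=
  exists V F, oseledets_splitting lam m V F.

(* 0 with multiplicity 1, and -oo with infinite multiplicity. *)
Definition trivial_spectrum : Prop :=
  lyapunov_spectrum (fun i => if i == 0%N then 0%E else -oo%E) (fun=> 1%N).

End Lyapunov.

Section Poles.
Variable K : realType.
Local Notation C := (Cplx K).

(* Points of the Riemann sphere: None is infinity. *)
Definition sphere_pt := option C.

Definition inv_conj (x : C) : sphere_pt :=
  if x == 0 then None else Some (cbar x)^-1.

(* 1/(z - p), which is 0 when p is infinity. *)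
Definition simple_fraction (p : sphere_pt) (z : C) : C :=
  if p is Some a then (z - a)^-1 else 0.

(* At infinity the condition is f(z) ~ b z^(n-2), written with z = 1/u. *)
Definition pole_of_order (p : sphere_pt) (n : nat) (f : C -> C) : Prop :=
  (0 < n)%N /\ exists2 b : C, b != 0 &
    match p with
    | Some a => (z - a) ^+ n * f z @[z --> a^'] --> b
    | None => u ^+ n / u ^+ 2 * f u^-1 @[u --> (0 : C)^'] --> b
    end.

End Poles.

(* Main.v *)
Require Import Defs.
From HB Require Import structures.
From mathcomp Require Import all_boot all_order all_algebra.
From mathcomp Require Import all_classical all_reals all_analysis ess_sup_inf.
From mathcomp.real_closed Require Import complex.
From mathcomp Require Import measurable_realfun ring lra.
Import Order.TTheory GRing.Theory Num.Theory.
Import numFieldNormedType.Exports.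
Set Implicit Arguments.
Unset Strict Implicit.
Unset Printing Implicit Defensive.
Local Open Scope classical_set_scope.
Local Open Scope ring_scope.

(** The cut-offs R < s < s0 < 1 and r < r' < R are chosen so that every T_omega maps D_s0 into
    D_r'; strict contraction of the pseudo-hyperbolic kind then gives the random fixed point as a
    pullback limit. On the annulus the transfer operator is the integral operator
    Lf(w) = (1/2 pi i) (integral over C_s of f(z) / (w - T z) dz, plus its reflection in C_1), so the pairing
    of Lf with a holomorphic h is the pairing of f with h o T. Hence everything is dual to
    composition with the maps T^(n), whose Taylor expansion at x_omega is governed by the
    multipliers: the coefficient functionals of the linearising coordinate (a Koenigs limit of
    (T^(n) - x) / (T^(n))'(x)) and their reflections kill or scale the polar parts at x_omega and
    at 1/conj(x_omega), which yields the two eigenvalue-like directions with growth j Lambda.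
    The growth of the multipliers comes from the maximal ergodic inequality; Lambda <= log (r/R)
    is the Schwarz-Pick lemma on D_R, the hyperbolic density contributing only a coboundary. *)

(** The Perron-Frobenius operator is prescribed on C_1 only, as a sum over inverse branches, a form
    in which neither iterates nor estimates are accessible. All work is done with [transfer]:
    duality gives its iteration law at once, and its images are holomorphic on r' < |w| < 1/r', so
    that suprema over the closed annulus stand in for the Hilbert norm. The formula on C_1 enters
    once, through the partial fractions of 1/(w - T z) and unique continuation from C_1. Two
    Oseledets directions occur at each level because reflection in C_1 commutes with the operator;
    at level 0 they merge, since f and its reflection have conjugate pairings with 1. The splitting
    is written down explicitly, the complements being common kernels of bounded functionals; the
    multiplicative ergodic theorem is not invoked. Off an invariant set of full measure the maps are
    replaced by 0, so that orbits and fixed points exist everywhere. Multipliers that vanish, or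
    whose logarithm is not integrable, are handled by adding a small d > 0: the logarithm becomes
    bounded and its integral as negative as desired. *)

Arguments cabs [K] z : simpl never.
Arguments cbar [K] z : simpl never.
Arguments circle_pt [K] s t : simpl never.

(** * The real-valued modulus and the embedding of the reals *)

Section Modulus.
Variable K : realType.
Local Notation C := (Cplx K).
Implicit Types (x y : K) (z w : C).

Definition rc x : C := Complex x 0.

Lemma normE z : `|z| = rc (cabs z).
Proof. by case: z. Qed.

Lemma rcD x y : rc (x + y) = rc x + rc y. Proof. exact: (rmorphD (real_complex K)). Qed.
Lemma rcM x y : rc (x * y) = rc x * rc y. Proof. exact: (rmorphM (real_complex K)). Qed.
Lemma rcB x y : rc (x - y) = rc x - rc y. Proof. exact: (rmorphB (real_complex K)). Qed.
Lemma rc0 : rc 0 = 0. Proof. by []. Qed.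
Lemma rc1 : rc 1 = 1. Proof. by []. Qed.
Lemma rcV x : rc x^-1 = (rc x)^-1. Proof. exact: (fmorphV (real_complex K)). Qed.
Lemma rcX x n : rc (x ^+ n) = rc x ^+ n. Proof. exact: (rmorphXn (real_complex K)). Qed.
Lemma rc_nat n : rc n%:R = n%:R. Proof. exact: (rmorph_nat (real_complex K)). Qed.
Lemma rc_inj : injective rc. Proof. by move=> x y []. Qed.
Lemma rc_eq0 x : (rc x == 0) = (x == 0).
Proof. by rewrite -rc0 (inj_eq rc_inj). Qed.

Lemma rc_le x y : (rc x <= rc y) = (x <= y). Proof. exact: lecR. Qed.
Lemma rc_lt x y : (rc x < rc y) = (x < y). Proof. exact: ltcR. Qed.

Lemma cabs_ge0 z : 0 <= cabs z.
Proof. by rewrite -rc_le -normE normr_ge0. Qed.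

Lemma cabs_rc x : cabs (rc x) = `|x|.
Proof. by rewrite /cabs /= expr0n /= addr0 sqrtr_sqr. Qed.

Lemma cabs0 : cabs (0 : C) = 0. Proof. exact: Normc.normc0. Qed.
Lemma cabs1 : cabs (1 : C) = 1. Proof. exact: Normc.normc1. Qed.
Lemma cabsM z w : cabs (z * w) = cabs z * cabs w. Proof. exact: Normc.normcM. Qed.
Lemma cabsV z : cabs z^-1 = (cabs z)^-1. Proof. exact: Normc.normcV. Qed.
Lemma cabsN z : cabs (- z) = cabs z. Proof. by apply: rc_inj; rewrite -!normE normrN. Qed.
Lemma cabsBC z w : cabs (z - w) = cabs (w - z). Proof. by rewrite -cabsN opprB. Qed.
Lemma cabsX z n : cabs (z ^+ n) = cabs z ^+ n.
Proof. by elim: n => [|n IH]; rewrite ?expr0 ?cabs1// !exprS cabsM IH. Qed.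
Lemma cabsD z w : cabs (z + w) <= cabs z + cabs w.
Proof. by rewrite -rc_le rcD -!normE ler_normD. Qed.
Lemma cabsB z w : cabs (z - w) <= cabs z + cabs w.
Proof. by rewrite (le_trans (cabsD _ _))// cabsN. Qed.
Lemma cabs_sub_ge z w : cabs z - cabs w <= cabs (z - w).
Proof. by have := cabsD (z - w) w; rewrite subrK lerBlDr. Qed.
Lemma cabs_eq0 z : (cabs z == 0) = (z == 0).
Proof. by rewrite -rc_eq0 -normE normr_eq0. Qed.
Lemma cabs_gt0 z : (0 < cabs z) = (z != 0).
Proof. by rewrite lt_neqAle cabs_ge0 andbT eq_sym cabs_eq0. Qed.
Lemma cabs_nat n : cabs (n%:R : C) = n%:R.
Proof. by rewrite -rc_nat cabs_rc normr_nat. Qed.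
Lemma cabs_sum (I : Type) (s : seq I) (P : pred I) (F : I -> C) :
  cabs (\sum_(i <- s | P i) F i) <= \sum_(i <- s | P i) cabs (F i).
Proof.
elim/big_rec2: _ => [|i y1 y2 _ h]; first by rewrite cabs0.
by rewrite (le_trans (cabsD _ _))// lerD2l.
Qed.
Lemma cabs_prod (I : Type) (s : seq I) (P : pred I) (F : I -> C) :
  cabs (\prod_(i <- s | P i) F i) = \prod_(i <- s | P i) cabs (F i).
Proof.
by elim/big_rec2: _ => [|i y1 y2 _ <-]; rewrite ?cabs1 ?cabsM.
Qed.

Lemma cbarD z w : cbar (z + w) = cbar z + cbar w. Proof. exact: (rmorphD (conjc)). Qed.
Lemma cbarM z w : cbar (z * w) = cbar z * cbar w. Proof. exact: (rmorphM (conjc)). Qed.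
Lemma cbarN z : cbar (- z) = - cbar z. Proof. exact: (rmorphN (conjc)). Qed.
Lemma cbarB z w : cbar (z - w) = cbar z - cbar w. Proof. exact: (rmorphB (conjc)). Qed.
Lemma cbarV z : cbar z^-1 = (cbar z)^-1. Proof. exact: (fmorphV (conjc)). Qed.
Lemma cbarX z n : cbar (z ^+ n) = cbar z ^+ n. Proof. exact: (rmorphXn (conjc)). Qed.
Lemma cbarK : involutive (@cbar K). Proof. exact: conjcK. Qed.
Lemma cbar0 : cbar 0 = 0 :> C. Proof. exact: conjc0. Qed.
Lemma cbar1 : cbar 1 = 1 :> C. Proof. exact: conjc1. Qed.
Lemma cbar_rc x : cbar (rc x) = rc x. Proof. exact: conjc_real. Qed.
Lemma cbar_sum (I : Type) (s : seq I) (P : pred I) (F : I -> C) :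
  cbar (\sum_(i <- s | P i) F i) = \sum_(i <- s | P i) cbar (F i).
Proof. exact: (rmorph_sum conjc). Qed.
Lemma cabs_bar z : cabs (cbar z) = cabs z.
Proof. by apply: rc_inj; rewrite -!normE normcJ. Qed.
Lemma cbar_eq0 z : (cbar z == 0) = (z == 0). Proof. exact: conjc_eq0. Qed.
Lemma mul_cbar z : z * cbar z = rc (cabs z ^+ 2).
Proof. by rewrite rcX -normE sqr_normc. Qed.

Lemma re_le_cabs z : `|complex.Re z| <= cabs z.
Proof. by rewrite -rc_le -normE; exact: normc_ge_Re. Qed.
Lemma im_le_cabs z : `|complex.Im z| <= cabs z.
Proof.
have := re_le_cabs (z * 'i%C); rewrite cabsM.
have -> : complex.Re (z * 'i%C) = - complex.Im z by exact: ReiNIm.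
by rewrite normrN {2}/cabs /= expr0n /= add0r expr1n sqrtr1 mulr1.
Qed.
Lemma cabs_le_reim z : cabs z <= `|complex.Re z| + `|complex.Im z|.
Proof.
have -> : cabs z = cabs (rc (complex.Re z) + 'i%C * rc (complex.Im z) : C).
  by rewrite {1}[z]complexE.
have ci : cabs ('i%C : C) = 1 by rewrite /cabs /= expr0n /= add0r expr1n sqrtr1.
by rewrite (le_trans (cabsD _ _))// cabsM !cabs_rc ci mul1r.
Qed.
Lemma cabs2E z : cabs z ^+ 2 = complex.Re z ^+ 2 + complex.Im z ^+ 2.
Proof. by apply: rc_inj; rewrite [RHS]add_Re2_Im2 rcX normE. Qed.

End Modulus.
Arguments rc {K} x : simpl never.

(** * Limits in the complex plane with real radii *)

Section Limits.
Variable K : realType.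
Local Notation C := (Cplx K).

(** The norm of [Cplx K] and the radii of its balls are themselves complex numbers; a positive one
    is real, which lets every epsilon be taken in [K] from here on. *)
Lemma nbhs_cabs (z : C) (A : set C) :
  nbhs z A <-> exists2 e : K, 0 < e & forall y, cabs (y - z) < e -> A y.
Proof.
split.
  move=> /nbhs_ballP [e /= e0 zA].
  have er : e = rc (complex.Re e).
    by case: e e0 {zA} => a b; rewrite ltcE /= => /andP[/eqP -> _].
  rewrite er in e0 zA; exists (complex.Re e); first by rewrite -rc_lt.
  by move=> y yz; apply: zA; rewrite /ball/= normE rc_lt cabsBC.
move=> [e e0 zA]; apply/nbhs_ballP; exists (rc e) => /=; first by rewrite rc_lt.
by move=> y; rewrite /ball/= normE rc_lt cabsBC; exact: zA.
Qed.

Lemma cvg_cabsP (T : Type) (F : set_system T) {FF : Filter F} (u : T -> C) (l : C) :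
  u @ F --> l <-> (fun x => cabs (u x - l)) @ F --> (0 : K).
Proof.
split=> h.
  apply/cvgrPdist_lt => e e0; move/cvgrPdist_lt : h => /(_ (rc e)).
  rewrite rc_lt => /(_ e0); apply: filterS => x.
  by rewrite normE rc_lt sub0r normrN ger0_norm ?cabs_ge0// cabsBC.
apply/cvgrPdist_lt => e e0.
have er : e = rc (complex.Re e).
  by case: e e0 => a b; rewrite ltcE /= => /andP[/eqP -> _].
rewrite er in e0 *; move/cvgrPdist_lt : h => /(_ (complex.Re e)).
rewrite -rc_lt => /(_ e0); apply: filterS => x.
by rewrite normE rc_lt sub0r normrN ger0_norm ?cabs_ge0// cabsBC.
Qed.

Lemma cvg_cabs_lt (T : Type) (F : set_system T) {FF : Filter F} (u : T -> C) (l : C) :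
  u @ F --> l <-> forall e : K, 0 < e -> \forall x \near F, cabs (u x - l) < e.
Proof.
rewrite cvg_cabsP; split => [/cvgrPdist_lt h e /h|h].
  apply: filterS => x; by rewrite sub0r normrN ger0_norm ?cabs_ge0.
apply/cvgrPdist_lt => e /h; apply: filterS => x.
by rewrite sub0r normrN ger0_norm ?cabs_ge0.
Qed.

Lemma continuous_cabsP (f : C -> C) (z : C) :
  {for z, continuous f} <->
  forall e : K, 0 < e -> exists2 d : K, 0 < d &
    forall y, cabs (y - z) < d -> cabs (f y - f z) < e.
Proof.
have [h1 h2] := @cvg_cabs_lt _ (nbhs z) _ f (f z); split => [/h1 h e e0|h].
  by have /nbhs_cabs := h e e0.
by apply: h2 => e e0; apply/nbhs_cabs; exact: h.
Qed.

Lemma cvg_reim (T : Type) (F : set_system T) {FF : Filter F} (u : T -> C) (l : C) :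
  u @ F --> l <->
  (fun x => complex.Re (u x)) @ F --> complex.Re l /\
  (fun x => complex.Im (u x)) @ F --> complex.Im l.
Proof.
have reB (a b : C) : complex.Re (a - b) = complex.Re a - complex.Re b.
  by case: a b => [? ?] [? ?].
have imB (a b : C) : complex.Im (a - b) = complex.Im a - complex.Im b.
  by case: a b => [? ?] [? ?].
split=> [/cvg_cabs_lt h|[/cvgrPdist_lt hr /cvgrPdist_lt hi]].
  split; apply/cvgrPdist_lt => e /h; apply: filterS => x; apply: le_lt_trans.
    by rewrite cabsBC -reB re_le_cabs.
  by rewrite cabsBC -imB im_le_cabs.
apply/cvg_cabs_lt => e e0; have e20 : 0 < e / 2 by rewrite divr_gt0.
move: (hr _ e20) (hi _ e20); apply: filterS2 => x hx hy.
rewrite (le_lt_trans (cabs_le_reim _))// reB imB [ltRHS](splitr e).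
by rewrite ltrD// distrC.
Qed.

Lemma cauchy_cvg_cplx (u : nat -> C) :
  (forall e : K, 0 < e -> exists N, forall n m, (N <= n)%N -> (N <= m)%N ->
     cabs (u n - u m) < e) -> exists l : C, u @ \oo --> l.
Proof.
move=> h.
have reB (a b : C) : complex.Re (a - b) = complex.Re a - complex.Re b.
  by case: a b => [? ?] [? ?].
have imB (a b : C) : complex.Im (a - b) = complex.Im a - complex.Im b.
  by case: a b => [? ?] [? ?].
have cv (g : C -> K) : (forall a b, g (a - b) = g a - g b) ->
    (forall a, `|g a| <= cabs a) -> cvgn (g \o u).
  move=> gB gle; apply/cauchy_cvgP/cauchy_exP => e e0.
  have [N hN] := h e e0; exists (g (u N)); exists N => // n /= Nn.
  by rewrite /ball /= -gB (le_lt_trans (gle _))// hN.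
have cr := cv _ reB (@re_le_cabs K); have ci := cv _ imB (@im_le_cabs K).
exists (Complex (limn (@complex.Re K \o u)) (limn (@complex.Im K \o u))).
by apply/cvg_reim; split.
Qed.

End Limits.

(** * Integration of continuous functions over the unit interval *)

Section Mean.
Variable K : realType.
Local Notation C := (Cplx K).
Implicit Types (h g : K -> C) (t : K).

(** A Riemann sum at left end points. Dyadic partitions are used because cutting the interval at 1/2
    turns a sum of level N+1 into two sums of level N, which allows induction on N. *)
Definition dmean h (N : nat) : C :=
  (2 ^+ N)^-1 * \sum_(k < 2 ^ N) h (k%:R / 2 ^+ N).

(** The integral of h over [0, 1]. Contour integrals have continuous integrands, so this elementary
    integral carries the whole complex analysis and takes complex values directly. *)
Definition mean h : C := xget 0 [set m | dmean h N @[N --> \oo] --> m].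

Record seg_cont h : Prop :=
  SegCont { seg_contP : forall t, 0 <= t <= 1 -> {for t, continuous h} }.

Lemma seg_cont_unif h : seg_cont h -> forall e : K, 0 < e ->
  exists2 d : K, 0 < d & forall t t', 0 <= t <= 1 -> 0 <= t' <= 1 ->
    `|t - t'| < d -> cabs (h t - h t') < e.
Proof.
move=> hc e e0.
have /compact_near_coveringP cpt : compact `[0 : K, 1]%classic by exact: segment_compact.
have e20 : 0 < e / 2 by rewrite divr_gt0.
(* Compactness in its near-covering form, along the filter of small d > 0, delivers one d for all
   t. *)
have [|d /= d0 hd] := cpt K (0 : K)^'+ (fun d t => forall t', `|t - t'| < d ->
    cabs (h t - h t') < e) _ _.
  move=> t; rewrite /= in_itv /= => t01.
  have /cvg_cabs_lt/(_ _ e20) := seg_contP hc t01.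
  move=> /nbhs_ballP[d /= d0 hd].
  have d20 : 0 < d / 2 by rewrite divr_gt0.
  exists (ball t (d / 2), [set x | x < d / 2]) => /=.
    split; first exact: nbhsx_ballx.
    by exists (d / 2) => //= x /=; rewrite sub0r normrN => + x0; rewrite gtr0_norm.
  move=> [y x] /= [] ty xd t' yt'.
  have h1 := hd y; have h2 := hd t'.
  have -> : h y - h t' = (h y - h t) - (h t' - h t) by rewrite opprB addrA subrK.
  rewrite (le_lt_trans (cabsB _ _))// [ltRHS](splitr e) ltrD//.
    apply: h1; apply: le_ball ty; lra.
  apply: h2; rewrite /ball /=.
  have -> : t - t' = (t - y) + (y - t') by rewrite addrA subrK.
  rewrite (le_lt_trans (ler_normD _ _))// [ltRHS](splitr d) ltrD//.
  exact: lt_trans xd.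
have d20 : 0 < d / 2 by rewrite divr_gt0.
exists (d / 2) => // t t' t01 t'01 tt'.
have db : ball_ Num.norm (0 : K) d (d / 2).
  by rewrite /= sub0r normrN gtr0_norm// ltr_pdivrMr// mulr_natr mulr2n ltrDl.
by apply: (hd _ db) => //=; rewrite in_itv.
Qed.

Lemma dmean_bisect h N : dmean h N.+1 =
  (dmean (fun t => h (t / 2)) N + dmean (fun t => h ((1 + t) / 2)) N) / 2.
Proof.
rewrite /dmean -mulrDr mulrAC -invfM -exprSr; congr (_ * _).
rewrite expnS mul2n -addnn big_split_ord /=; congr (_ + _); apply: eq_bigr => i _.
  by congr h; rewrite exprSr invfM mulrA.
have n0 : (2 ^+ N : K) != 0 by rewrite expf_neq0// pnatr_eq0.
congr h; rewrite natrD natrX exprS; field; exact: n0.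
Qed.

Lemma dmean_const_dist h (c : C) (M : K) N :
  (forall t, 0 <= t <= 1 -> cabs (h t - c) <= M) -> cabs (dmean h N - c) <= M.
Proof.
move=> hM; have n0 : (2 ^+ N : C) != 0 by rewrite expf_neq0// pnatr_eq0.
have p0 : 0 < (2 ^+ N : K) by rewrite exprn_gt0.
have -> : dmean h N - c = (2 ^+ N)^-1 * \sum_(k < 2 ^ N) (h (k%:R / 2 ^+ N) - c).
  by rewrite sumrB sumr_const card_ord -[c *+ _]mulr_natl natrX mulrBr mulKf.
rewrite cabsM cabsV cabsX cabs_nat ler_pdivrMl//.
rewrite (le_trans (cabs_sum _ _ _))//.
have -> : 2 ^+ N * M = \sum_(k < 2 ^ N) M by rewrite sumr_const card_ord -[M *+ _]mulr_natl natrX.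
apply: ler_sum => i _; apply: hM; rewrite divr_ge0 ?ler0n ?exprn_ge0//=.
by rewrite ler_pdivrMr// mul1r -natrX ler_nat ltnW.
Qed.

(** Refinement only moves sample points within intervals of length 2^-N. By induction through
    [dmean_bisect], the error is the oscillation at that scale. *)
Lemma dmean_dist h (e : K) N M : (N <= M)%N ->
  (forall t t', 0 <= t <= 1 -> 0 <= t' <= 1 -> `|t - t'| <= 2 ^- N ->
    cabs (h t - h t') <= e) ->
  cabs (dmean h M - dmean h N) <= e.
Proof.
elim: N M h => [|N IH] M h.
  move=> _ he; have -> : dmean h 0 = h 0.
    by rewrite /dmean expr0 invr1 mul1r big_ord_recl big_ord0 addr0 mul0r.
  apply: dmean_const_dist => t /andP[t0 t1]; apply: he; rewrite ?t0 ?t1 ?lexx ?ler01//.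
  by rewrite subr0 ger0_norm// expr0 invr1.
case: M => // M NM he; rewrite !dmean_bisect.
have half t t' : `|t - t'| <= 2 ^- N -> `|(t - t') / 2| <= 2 ^- N.+1.
  move=> tt'; rewrite normrM exprSr invfM ler_pM//.
  by rewrite ger0_norm// invr_ge0.
have := IH M (fun t => h (t / 2)) NM.
have := IH M (fun t => h ((1 + t) / 2)) NM.
set a := dmean _ M; set b := dmean _ N; set c := dmean _ M; set d := dmean _ N.
move=> hab hcd.
have -> : (c + a) / 2 - (d + b) / 2 = ((c - d) + (a - b)) / 2 by field.
rewrite cabsM cabsV cabs_nat ler_pdivrMr// mulr_natr mulr2n.
rewrite (le_trans (cabsD _ _))// lerD//.
  apply: hcd => t t' t01 t'01 tt'; apply: he; [lra|lra|].
  by rewrite -mulrBl half.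
apply: hab => t t' t01 t'01 tt'; apply: he; [lra|lra|].
by rewrite -mulrBl (_ : _ - _ = t - t') ?half//; ring.
Qed.

Lemma exp2V_lt (d : K) : 0 < d -> exists N : nat, 2 ^- N < d.
Proof.
move=> d0; have : (2^-1 : K) ^+ n @[n --> \oo] --> (0 : K).
  by apply: cvg_expr; rewrite ger0_norm ?invr_ge0// invf_lt1// ltr1n.
move=> /cvgrPdist_lt /(_ _ d0) [N _ /(_ N (leqnn N))] /=.
by rewrite sub0r normrN exprVn ger0_norm ?invr_ge0 ?exprn_ge0// => h; exists N.
Qed.

Lemma dmean_cvg h : seg_cont h -> dmean h N @[N --> \oo] --> mean h.
Proof.
move=> hc; suff [l hl] : exists l : C, dmean h @ \oo --> l.
  by have := @xgetPex _ 0 [set m : C | dmean h N @[N --> \oo] --> m] (ex_intro _ l hl).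
apply: cauchy_cvg_cplx => e e0.
have e30 : 0 < e / 3 by rewrite divr_gt0.
have [d d0 hd] := seg_cont_unif hc e30; have [N hN] := exp2V_lt d0.
exists N => n m Nn Nm.
have -> : dmean h n - dmean h m = (dmean h n - dmean h N) - (dmean h m - dmean h N).
  by rewrite opprB addrA subrK.
have hh k : (N <= k)%N -> cabs (dmean h k - dmean h N) <= e / 3.
  move=> Nk; apply: dmean_dist => // t t' t01 t'01 tt'; apply/ltW/hd => //.
  exact: le_lt_trans hN.
rewrite (le_lt_trans (cabsB _ _))// (le_lt_trans (lerD (hh _ Nn) (hh _ Nm)))//; lra.
Qed.

Lemma mean_eqP h m : dmean h N @[N --> \oo] --> m -> mean h = m.
Proof. move=> hm; apply: xget_unique => // y hy.
exact: (cvg_unique (F := dmean h @ \oo) _ hy hm).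
Qed.

Lemma cabs_lim_le (u : nat -> C) (l c : C) (M : K) : u @ \oo --> l ->
  (\forall n \near \oo, cabs (u n - c) <= M) -> cabs (l - c) <= M.
Proof.
move=> /cvg_cabs_lt ul uM; apply/ler_addgt0Pr => e e0.
near \oo => n; have h1 : cabs (u n - l) < e by near: n; apply: ul.
have h2 : cabs (u n - c) <= M by near: n.
have -> : l - c = (u n - c) - (u n - l) by ring.
by rewrite (le_trans (cabsB _ _))// lerD// ltW.
Unshelve. all: by end_near. Qed.

(** The error depends on h through its modulus of continuity alone, so it is uniform over
    equicontinuous families. This uniformity takes the place of Fubini in [pair_inner]. *)
Lemma mean_rate h (e : K) N : seg_cont h ->
  (forall t t', 0 <= t <= 1 -> 0 <= t' <= 1 -> `|t - t'| <= 2 ^- N ->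
    cabs (h t - h t') <= e) ->
  cabs (mean h - dmean h N) <= e.
Proof.
move=> hc he; apply: (cabs_lim_le (dmean_cvg hc)).
by exists N => // M /= NM; apply: dmean_dist.
Qed.

Lemma mean_dist h c (M : K) : seg_cont h ->
  (forall t, 0 <= t <= 1 -> cabs (h t - c) <= M) -> cabs (mean h - c) <= M.
Proof.
move=> hc hM; apply: (cabs_lim_le (dmean_cvg hc)).
by apply: nearW => n; apply: dmean_const_dist.
Qed.

Lemma mean_le h (M : K) : seg_cont h ->
  (forall t, 0 <= t <= 1 -> cabs (h t) <= M) -> cabs (mean h) <= M.
Proof.
by move=> hc hM; rewrite -(subr0 (mean h)); apply: mean_dist => // t; rewrite subr0; apply: hM.
Qed.

Lemma eq_mean h g : (forall t, 0 <= t <= 1 -> h t = g t) -> mean h = mean g.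
Proof.
move=> hg; suff e : dmean h = dmean g by rewrite /mean e.
apply/funext => N; rewrite /dmean; congr (_ * _); apply: eq_bigr => i _.
apply: hg; rewrite divr_ge0 ?ler0n ?exprn_ge0//=.
by rewrite ler_pdivrMr ?exprn_gt0// mul1r -natrX ler_nat ltnW.
Qed.

Lemma dmeanD h g N : dmean (fun t => h t + g t) N = dmean h N + dmean g N.
Proof. by rewrite /dmean big_split mulrDr. Qed.
Lemma dmeanZ c h N : dmean (fun t => c * h t) N = c * dmean h N.
Proof. by rewrite /dmean -mulr_sumr mulrCA. Qed.

Lemma meanD h g : seg_cont h -> seg_cont g ->
  mean (fun t => h t + g t) = mean h + mean g.
Proof.
move=> hc gc; apply: mean_eqP; under eq_fun do rewrite dmeanD.
by apply: cvgD; exact: dmean_cvg.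
Qed.

Lemma meanZ c h : seg_cont h -> mean (fun t => c * h t) = c * mean h.
Proof.
move=> hc; apply: mean_eqP; under eq_fun do rewrite dmeanZ.
by apply: cvgMr; exact: dmean_cvg.
Qed.

Lemma mean_cst c : mean (fun=> c) = c.
Proof.
apply: mean_eqP; have -> : dmean (fun=> c) = cst c; last exact: cvg_cst.
apply/funext => N; apply/eqP; rewrite -subr_eq0 -cabs_eq0 eq_le cabs_ge0 andbT.
by apply: dmean_const_dist => t _; rewrite subrr cabs0.
Qed.

Lemma mean_bar h : seg_cont h -> mean (fun t => cbar (h t)) = cbar (mean h).
Proof.
move=> hc; apply: mean_eqP; apply/cvg_cabs_lt => e e0.
have /cvg_cabs_lt/(_ _ e0) := dmean_cvg hc; apply: filterS => N.
rewrite -(cabs_bar (_ - _)) cbarB.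
by rewrite /dmean cbarM cbar_sum cbarV cbarX -[2]rc_nat cbar_rc.
Qed.

Lemma seg_cont_left h : seg_cont h -> seg_cont (fun t => h (t / 2)).
Proof.
move=> hc; split=> t t01; apply: (@continuous_comp _ _ _ (fun t => t / 2) h).
  exact: (cvgMl cvg_id).
by apply: (seg_contP hc); lra.
Qed.

Lemma seg_cont_right h : seg_cont h -> seg_cont (fun t => h ((1 + t) / 2)).
Proof.
move=> hc; split=> t t01; apply: (@continuous_comp _ _ _ (fun t => (1 + t) / 2) h).
  apply: (@cvgMl _ _ _ _ (fun t : K => 1 + t)); apply: cvgD; [exact: cvg_cst|exact: cvg_id].
by apply: (seg_contP hc); lra.
Qed.

Lemma mean_bisect h : seg_cont h -> mean h =
  (mean (fun t => h (t / 2)) + mean (fun t => h ((1 + t) / 2))) / 2.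
Proof.
move=> hc; apply: mean_eqP; rewrite -(cvg_shiftS (dmean h)) /=.
rewrite (_ : (fun n => dmean h n.+1) = (fun N => (dmean (fun t => h (t / 2)) N +
  dmean (fun t => h ((1 + t) / 2)) N) / 2)); last by apply/funext => N; exact: dmean_bisect.
apply: cvgMl; apply: cvgD; apply: dmean_cvg; [exact: seg_cont_left|exact: seg_cont_right].
Qed.

(** Bisection shows that the mean m solves m = m/2 + 1/4. *)
Lemma mean_id : mean (fun t => rc t) = 2^-1.
Proof.
have ic : seg_cont (fun t => rc t).
  split=> t _; apply/cvg_cabs_lt => e e0; apply/nbhs_ballP; exists e => //= y.
  by rewrite /ball /= -rcB cabs_rc distrC.
have := mean_bisect ic.
have -> : (fun t => rc (t / 2)) = (fun t => 2^-1 * rc t).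
  by apply/funext => t; rewrite rcM rcV rc_nat mulrC.
have -> : (fun t => rc ((1 + t) / 2)) = (fun t => 2^-1 + 2^-1 * rc t).
  by apply/funext => t; rewrite rcM rcV rc_nat mulrC rcD mulrDr mulr1.
have ic2 : seg_cont (fun t => 2^-1 * rc t) by split=> t t01; apply: cvgMr; exact: (seg_contP ic).
have cc : seg_cont (fun=> 2^-1 : C) by split=> t _; exact: cvg_cst.
rewrite (meanD cc ic2) mean_cst (meanZ _ ic) => h.
have : 4 * mean (fun t => rc t) = 4 * ((2^-1 * mean (fun t => rc t) +
      (2^-1 + 2^-1 * mean (fun t => rc t))) / 2) by rewrite -h.
set m := mean _ => hm.
have {}hm : 4 * m = 2 * m + 1 by rewrite hm; field.
have : 2 * m = 1 by have -> : 2 * m = 4 * m - 2 * m; [ring|rewrite hm; ring].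
by move=> h2; apply: (@mulfI _ 2); rewrite ?pnatr_eq0// h2 mulfV ?pnatr_eq0.
Qed.

End Mean.

(** * Complex differentiability in epsilon-delta form *)

Section Derivatives.

(** Stated over any [numFieldType], so as to serve the real exponential, cosine and sine as well as
    complex functions. *)
Lemma is_deriveP (R : numFieldType) (f : R -> R) (z l : R) :
  is_derive z 1 f l <-> forall e : R, 0 < e -> exists2 d : R, 0 < d &
    forall h, `|h| < d -> `|f (z + h) - f z - l * h| <= e * `|h|.
Proof.
have key h : h != 0 -> h^-1 *: ((f \o shift z) (h *: (1 : R)) - f z) =
    (f (z + h) - f z) / h.
  by move=> h0; rewrite /= /shift /= [h *: 1]mulr1 addrC -(addrC z) [LHS]mulrC addrC.
split=> [[df <-] e e0|H].
  have /cvgrPdist_lt/(_ _ e0)/nbhs_ballP[d /= d0 hd] := df.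
  exists d => // h hd'; have [->|h0] := eqVneq h 0.
    by rewrite addr0 subrr mulr0 subr0 normr0 mulr0.
  have := hd h; rewrite /ball /= sub0r normrN => /(_ hd' h0); rewrite key//.
  rewrite -[lim _]/('D_1 f z) => /ltW hh.
  have -> : f (z + h) - f z - 'D_1 f z * h = - (('D_1 f z - (f (z + h) - f z) / h) * h).
    by field.
  by rewrite normrN normrM ler_wpM2r.
have cv : (fun h => h^-1 *: ((f \o shift z) (h *: (1 : R)) - f z)) @ 0^' --> l.
  apply/cvgrPdist_lt => e e0.
  have e20 : 0 < e / 2 by rewrite divr_gt0.
  have [d d0 hd] := H _ e20; apply/nbhs_ballP; exists d => //= h.
  rewrite /ball /= sub0r normrN => hd' h0; rewrite key//.
  have h0' : 0 < `|h| by rewrite normr_gt0.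
  have -> : l - (f (z + h) - f z) / h = - ((f (z + h) - f z - l * h) / h) by field.
  rewrite normrN normrM normfV ltr_pdivrMr// (le_lt_trans (hd _ hd'))//.
  by rewrite ltr_pM2r// ltr_pdivrMr// mulr_natr mulr2n ltrDl.
by split; [apply/cvg_ex; exists l|exact: cvg_lim cv].
Qed.

Variable K : realType.
Local Notation C := (Cplx K).
Implicit Types (f g : C -> C) (z w : C).

Definition cderiv f z (l : C) := is_derive z 1 f l.
Definition hol f z := exists l, cderiv f z l.

Lemma cderivP f z l : cderiv f z l <-> forall e : K, 0 < e -> exists2 d : K, 0 < d &
    forall h, cabs h < d -> cabs (f (z + h) - f z - l * h) <= e * cabs h.
Proof.
rewrite /cderiv is_deriveP; split => H e e0.
  have [|d d0 hd] := H (rc e); first by rewrite rc_lt.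
  have er : d = rc (complex.Re d).
    by case: d d0 {hd} => a b; rewrite ltcE /= => /andP[/eqP -> _].
  rewrite er in d0 hd; exists (complex.Re d); first by rewrite -rc_lt.
  by move=> h; rewrite -rc_lt -rc_le -normE => /hd; rewrite rcM normE.
have er : e = rc (complex.Re e).
  by case: e e0 => a b; rewrite ltcE /= => /andP[/eqP -> _].
rewrite er in e0 *; rewrite -[0]rc0 rc_lt in e0.
have [d d0 hd] := H _ e0; exists (rc d); first by rewrite rc_lt.
by move=> h; rewrite !normE rc_lt -rcM rc_le; exact: hd.
Qed.

Lemma cderiv_hol f z l : cderiv f z l -> hol f z.
Proof. by exists l. Qed.
Lemma holE f z : hol f z <-> derivable f z 1.
Proof. by split=> [[l []]|/derivableP] //; exact: cderiv_hol. Qed.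
Lemma cderiv_derive1 f z l : cderiv f z l -> derive1 f z = l.
Proof. by move=> [_ <-]; rewrite derive1E. Qed.
Lemma cderiv_unique f z l l' : cderiv f z l -> cderiv f z l' -> l = l'.
Proof. by move=> [_ <-] [_ <-]. Qed.

Lemma hol_cont f z : hol f z -> {for z, continuous f}.
Proof. by move=> /holE/derivable1_diffP/differentiable_continuous. Qed.

Lemma cd_cst (c : C) z : cderiv (fun=> c) z 0.
Proof. exact: is_derive_cst. Qed.
Lemma cd_id z : cderiv (fun x => x) z 1.
Proof. exact: is_derive_id. Qed.
Lemma cdD f g z a b : cderiv f z a -> cderiv g z b ->
  cderiv (fun x => f x + g x) z (a + b).
Proof. exact: is_deriveD. Qed.
Lemma cdN f z a : cderiv f z a -> cderiv (fun x => - f x) z (- a).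
Proof. exact: is_deriveN. Qed.
Lemma cdB f g z a b : cderiv f z a -> cderiv g z b ->
  cderiv (fun x => f x - g x) z (a - b).
Proof. exact: is_deriveB. Qed.
Lemma cdM f g z a b : cderiv f z a -> cderiv g z b ->
  cderiv (fun x => f x * g x) z (f z * b + g z * a).
Proof. exact: is_deriveM. Qed.
Lemma cdV f z a : f z != 0 -> cderiv f z a ->
  cderiv (fun x => (f x)^-1) z (- a / f z ^+ 2).
Proof.
move=> h0 [df <-]; split; first exact: derivableV.
rewrite (deriveV h0 df) -[LHS]/(- (f z) ^- 2 * 'D_1 f z).
by rewrite !mulNr mulrC.
Qed.
Lemma cd_comp f g z a b : cderiv f z a -> cderiv g (f z) b ->
  cderiv (fun x => g (f x)) z (b * a).
Proof.
move=> /cderivP hf /cderivP hg; apply/cderivP => e e0.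
pose A := cabs a + 1; have A0 : 0 < A by rewrite ltr_wpDl// cabs_ge0.
pose B := cabs b + 1; have B0 : 0 < B by rewrite ltr_wpDl// cabs_ge0.
have [d1 d10 hd1] := hf 1 ltr01.
have [|d2 d20 hd2] := hf (e / (2 * B)); first by rewrite divr_gt0// mulr_gt0.
have [|d3 d30 hd3] := hg (e / (2 * A)); first by rewrite divr_gt0// mulr_gt0.
exists (Num.min (Num.min d1 d2) (d3 / A)); first by rewrite !lt_min d10 d20 divr_gt0.
move=> h; rewrite !lt_min => /andP[/andP[h1 h2] h3].
set k := f (z + h) - f z.
have kA : cabs k <= A * cabs h.
  have -> : k = (k - a * h) + a * h by rewrite subrK.
  by rewrite (le_trans (cabsD _ _))// cabsM mulrDl mul1r [leRHS]addrC lerD// -[leRHS]mul1r hd1.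
have kd : cabs k < d3 by rewrite (le_lt_trans kA)// mulrC -ltr_pdivlMr.
have := hd3 _ kd; have -> : f z + k = f (z + h) by rewrite /k addrC subrK.
move=> hk.
have -> : g (f (z + h)) - g (f z) - b * a * h =
  (g (f (z + h)) - g (f z) - b * k) + b * (k - a * h) by ring.
rewrite (le_trans (cabsD _ _))// cabsM [e](splitr e) mulrDl lerD//.
  rewrite (le_trans hk)// (_ : _ * cabs k = (e / 2) * (A^-1 * cabs k)).
    by rewrite ler_wpM2l ?divr_ge0 ?(ltW e0)// ler_pdivrMl.
  by rewrite invfM !mulrA.
rewrite (@le_trans _ _ (cabs b * (e / (2 * B) * cabs h)))//.
  by rewrite ler_wpM2l ?cabs_ge0// hd2.
rewrite mulrA ler_wpM2r ?cabs_ge0// (_ : cabs b * _ = (e / 2) * (cabs b / B)).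
  by rewrite ler_piMr ?divr_ge0 ?(ltW e0)// ler_pdivrMr// mul1r /B lerDl.
by rewrite invfM; ring.
Qed.

Lemma hol_cst (c : C) z : hol (fun=> c) z. Proof. exact: cderiv_hol (cd_cst c z). Qed.
Lemma hol_id z : hol (fun x => x) z. Proof. exact: cderiv_hol (cd_id z). Qed.
Lemma holD f g z : hol f z -> hol g z -> hol (fun x => f x + g x) z.
Proof. by move=> [a ha] [b hb]; exact: cderiv_hol (cdD ha hb). Qed.
Lemma holN f z : hol f z -> hol (fun x => - f x) z.
Proof. by move=> [a ha]; exact: cderiv_hol (cdN ha). Qed.
Lemma holB f g z : hol f z -> hol g z -> hol (fun x => f x - g x) z.
Proof. by move=> [a ha] [b hb]; exact: cderiv_hol (cdB ha hb). Qed.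
Lemma holM f g z : hol f z -> hol g z -> hol (fun x => f x * g x) z.
Proof. by move=> [a ha] [b hb]; exact: cderiv_hol (cdM ha hb). Qed.
Lemma holV f z : f z != 0 -> hol f z -> hol (fun x => (f x)^-1) z.
Proof. by move=> h0 [a ha]; exact: cderiv_hol (cdV h0 ha). Qed.
Lemma holX f n z : hol f z -> hol (fun x => f x ^+ n) z.
Proof.
move=> hf; elim: n => [|n IH].
  rewrite (_ : (fun x => _) = (fun=> 1)); first exact: hol_cst.
  by apply/funext => x; rewrite expr0.
rewrite (_ : (fun x => _) = (fun x => f x * f x ^+ n)); first exact: holM.
by apply/funext => x; rewrite exprS.
Qed.
Lemma hol_comp f g z : hol f z -> hol g (f z) -> hol (fun x => g (f x)) z.
Proof. by move=> [a ha] [b hb]; exact: cderiv_hol (cd_comp ha hb). Qed.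
Lemma hol_sum (I : Type) (s : seq I) (P : pred I) (F : I -> C -> C) z :
  (forall i, P i -> hol (F i) z) -> hol (fun x => \sum_(i <- s | P i) F i x) z.
Proof.
move=> hF; elim: s => [|i s IH].
  rewrite (_ : (fun x => _) = (fun=> 0)); first exact: hol_cst.
  by apply/funext => x; rewrite big_nil.
rewrite (_ : (fun x => _) = (fun x => (if P i then F i x else 0) + \sum_(j <- s | P j) F j x)).
  apply: holD; last exact: IH.
  by case Pi: (P i); [exact: hF|exact: hol_cst].
by apply/funext => x; rewrite big_cons; case: ifP => _; rewrite ?add0r.
Qed.
Lemma cderiv_ext f g z l (d : K) : 0 < d -> (forall x, cabs (x - z) < d -> f x = g x) ->
  cderiv f z l -> cderiv g z l.
Proof.
by move=> d0 fg; apply: near_eq_is_derive; apply/nbhs_cabs; exists d => // y /fg.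
Qed.
Lemma hol_ext f g z (d : K) : 0 < d -> (forall x, cabs (x - z) < d -> f x = g x) ->
  hol f z -> hol g z.
Proof. by move=> d0 fg [l hl]; exists l; apply: cderiv_ext hl; [exact: d0|]. Qed.

Lemma cderiv_sq f z l (d M : K) : 0 < d ->
  (forall h, cabs h < d -> cabs (f (z + h) - f z - l * h) <= M * cabs h ^+ 2) ->
  cderiv f z l.
Proof.
move=> d0 hM; apply/cderivP => e e0.
have M0 : 0 < `|M| + 1 by rewrite ltr_wpDl.
exists (Num.min d (e / (`|M| + 1))); first by rewrite lt_min d0 divr_gt0.
move=> h; rewrite lt_min => /andP[hd he]; rewrite (le_trans (hM _ hd))//.
rewrite expr2 mulrA ler_wpM2r ?cabs_ge0//.
rewrite ltr_pdivlMr// in he; rewrite ltW// (le_lt_trans _ he)// mulrC.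
by rewrite ler_wpM2l ?cabs_ge0// (le_trans (ler_norm _))// lerDl.
Qed.

Lemma cderiv_bar f z l : cderiv f z l ->
  cderiv (fun x => cbar (f (cbar x))) (cbar z) (cbar l).
Proof.
move=> /cderivP hf; apply/cderivP => e /hf[d d0 hd]; exists d => // h hh.
have := hd (cbar h); rewrite cabs_bar => /(_ hh); rewrite -(cabs_bar (_ - _)).
by rewrite !cbarB cbarM !cbarK cbarD cbarK.
Qed.

Lemma hol_bar f z : hol f (cbar z) -> hol (fun x => cbar (f (cbar x))) z.
Proof. by move=> [l /cderiv_bar]; rewrite cbarK => /cderiv_hol. Qed.

End Derivatives.

(** * Means over centred circles *)

Section Circle.
Variable K : realType.
Local Notation C := (Cplx K).
Implicit Types (F G : C -> C) (s t : K).

Definition circ s t : C := circle_pt s (2 * pi * t).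

Lemma circle_ptE s t : circle_pt s t = rc s * circle_pt 1 t.
Proof. by rewrite /circle_pt /rc; apply/eqP; rewrite eq_complex /= !mul1r !mul0r subr0 addr0 !eqxx. Qed.

Lemma cabs_circle_pt s t : 0 <= s -> cabs (circle_pt s t) = s.
Proof.
move=> s0; apply/eqP; rewrite -(eqrXn2 (n := 2))// ?cabs_ge0// cabs2E /=.
by rewrite !exprMn -mulrDr cos2Dsin2 mulr1.
Qed.

Lemma cabs_circ s t : 0 <= s -> cabs (circ s t) = s.
Proof. exact: cabs_circle_pt. Qed.

Lemma circle_ptD s s' t t' : circle_pt s t * circle_pt s' t' = circle_pt (s * s') (t + t').
Proof.
rewrite /circle_pt cosD sinD; apply/eqP; rewrite eq_complex /=.
by apply/andP; split; apply/eqP; ring.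
Qed.

Lemma circle_pt_cont s : continuous (circle_pt s : K -> C).
Proof.
move=> t; apply/cvg_reim; split => /=.
  by apply: cvgMr; exact: continuous_cos.
by apply: cvgMr; exact: continuous_sin.
Qed.

Lemma circ_cont_t s : continuous (circ s).
Proof.
move=> t; apply: (@continuous_comp _ _ _ (fun t => 2 * pi * t) (circle_pt s)).
  exact: (cvgMr cvg_id).
exact: circle_pt_cont.
Qed.

Record circ_cont s F : Prop :=
  CircCont { circ_contP : forall z, cabs z = s -> {for z, continuous F} }.

Lemma seg_cont_circ s F : 0 <= s -> circ_cont s F -> seg_cont (fun t => F (circ s t)).
Proof.
move=> s0 cF; split=> t _; apply: (@continuous_comp _ _ _ (circ s) F); first exact: circ_cont_t.
by apply: (circ_contP cF); rewrite cabs_circ.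
Qed.

Lemma ccD s F G : circ_cont s F -> circ_cont s G -> circ_cont s (fun z => F z + G z).
Proof. by move=> [cF] [cG]; split=> z zs; exact: (cvgD (cF z zs) (cG z zs)). Qed.
Lemma ccB s F G : circ_cont s F -> circ_cont s G -> circ_cont s (fun z => F z - G z).
Proof. by move=> [cF] [cG]; split=> z zs; exact: (cvgB (cF z zs) (cG z zs)). Qed.
Lemma ccM s F G : circ_cont s F -> circ_cont s G -> circ_cont s (fun z => F z * G z).
Proof. by move=> [cF] [cG]; split=> z zs; exact: (cvgM (cF z zs) (cG z zs)). Qed.
Lemma ccV s F : (forall z, cabs z = s -> F z != 0) -> circ_cont s F ->
  circ_cont s (fun z => (F z)^-1).
Proof. by move=> F0 [cF]; split=> z zs; exact: (cvgV (F0 z zs) (cF z zs)). Qed.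
Lemma cc_hol s F : (forall z, cabs z = s -> hol F z) -> circ_cont s F.
Proof. by move=> hF; split=> z /hF/hol_cont. Qed.
Lemma cc_cst s c : circ_cont s (fun=> c).
Proof. by apply: cc_hol => z _; exact: hol_cst. Qed.
Lemma cc_id s : circ_cont s (fun z => z).
Proof. by apply: cc_hol => z _; exact: hol_id. Qed.
Lemma ccX s F n : circ_cont s F -> circ_cont s (fun z => F z ^+ n).
Proof.
move=> cF; elim: n => [|n IH].
  rewrite (_ : (fun z => _) = (fun=> 1)); first exact: cc_cst.
  by apply/funext => x; rewrite expr0.
rewrite (_ : (fun z => _) = (fun z => F z * F z ^+ n)); first exact: ccM.
by apply/funext => x; rewrite exprS.
Qed.

(** On a centred circle dz = i z dt for the angle t, so 1/(2 pi i) times the contour integral of F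
    is [cmean s (fun z => z * F z)]. This is the origin of the factor z in all Cauchy formulas
    below. *)
Definition cmean s F : C := mean (fun t => F (circ s t)).

Lemma eq_cmean s F G : 0 <= s -> (forall z, cabs z = s -> F z = G z) ->
  cmean s F = cmean s G.
Proof. by move=> s0 FG; apply: eq_mean => t _; apply: FG; rewrite cabs_circ. Qed.

Lemma cmeanD s F G : 0 <= s -> circ_cont s F -> circ_cont s G ->
  cmean s (fun z => F z + G z) = cmean s F + cmean s G.
Proof. by move=> s0 cF cG; rewrite /cmean meanD//; exact: seg_cont_circ. Qed.

Lemma cmeanZ s c F : 0 <= s -> circ_cont s F ->
  cmean s (fun z => c * F z) = c * cmean s F.
Proof. by move=> s0 cF; rewrite /cmean meanZ//; exact: seg_cont_circ. Qed.

Lemma cmeanB s F G : 0 <= s -> circ_cont s F -> circ_cont s G ->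
  cmean s (fun z => F z - G z) = cmean s F - cmean s G.
Proof.
move=> s0 cF cG; have -> : cmean s (fun z => F z - G z) = cmean s (fun z => F z + -1 * G z).
  by apply: eq_cmean => // z _; rewrite mulN1r.
rewrite (cmeanD s0 cF (ccM (cc_cst _ _) cG)).
by rewrite (cmeanZ _ s0 cG) mulN1r.
Qed.

Lemma cmean_le s F (M : K) : 0 <= s -> circ_cont s F ->
  (forall z, cabs z = s -> cabs (F z) <= M) -> cabs (cmean s F) <= M.
Proof.
move=> s0 cF hM; apply: mean_le; first exact: seg_cont_circ.
by move=> t _; apply: hM; rewrite cabs_circ.
Qed.

Lemma cmean_cst s c : cmean s (fun=> c) = c.
Proof. exact: mean_cst. Qed.

Lemma cmean_bar s F : 0 <= s -> circ_cont s F ->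
  cmean s (fun z => cbar (F z)) = cbar (cmean s F).
Proof. by move=> s0 cF; rewrite /cmean mean_bar//; exact: seg_cont_circ. Qed.

End Circle.

(** * Goursat's lemma for parallelograms *)

Section Goursat.
Variable K : realType.
Local Notation C := (Cplx K).
Implicit Types (F : C -> C) (p u v d : C).

Definition seg_int F p d : C := d * mean (fun t => F (p + rc t * d)).

(** Parallelograms are chosen because halving both sides yields four translates of one figure, so a
    nested sequence is described by a corner and a scale. *)
Definition par_int F p u v : C :=
  seg_int F p u + seg_int F (p + u) v - seg_int F (p + v) u - seg_int F p v.

Definition seg_contF F p d := seg_cont (fun t => F (p + rc t * d)).

Lemma rc_continuous : continuous (@rc K).
Proof.
move=> t; apply/cvg_cabs_lt => e e0; apply/nbhs_ballP; exists e => //= y.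
by rewrite /ball /= -rcB cabs_rc distrC.
Qed.

Lemma seg_cont_line F p d : (forall t : K, 0 <= t <= 1 ->
  {for p + rc t * d, continuous F}) -> seg_contF F p d.
Proof.
move=> hF; split=> t t01.
apply: (@continuous_comp _ _ _ (fun t => p + rc t * d) F); last exact: hF.
apply: cvgD; first exact: cvg_cst.
by apply: cvgM; [exact: rc_continuous|exact: cvg_cst].
Qed.

Lemma seg_int_bisect F p d : seg_contF F p d ->
  seg_int F p d = seg_int F p (d / 2) + seg_int F (p + d / 2) (d / 2).
Proof.
move=> hc; rewrite /seg_int (mean_bisect hc).
have -> : (fun t => F (p + rc (t / 2) * d)) = (fun t => F (p + rc t * (d / 2))).
  by apply/funext => t; congr F; rewrite rcM rcV rc_nat; ring.
have -> : (fun t => F (p + rc ((1 + t) / 2) * d)) = (fun t => F (p + d / 2 + rc t * (d / 2))).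
  by apply/funext => t; congr F; rewrite rcM rcV rc_nat rcD rc1; ring.
ring.
Qed.

(** The integral of the affine part is explicit through [mean_id], so no primitive has to be
    introduced. *)
Lemma seg_int_dist F p d (c l z0 : C) (M : K) : seg_contF F p d ->
  (forall t : K, 0 <= t <= 1 ->
    cabs (F (p + rc t * d) - (c + l * (p + rc t * d - z0))) <= M) ->
  cabs (seg_int F p d - d * (c + l * (p - z0) + l * d / 2)) <= cabs d * M.
Proof.
move=> hc hM.
have rcc : seg_cont (@rc K) by split=> t _; exact: rc_continuous.
have c1 : seg_cont (fun=> - (c + l * (p - z0)) : C) by split=> t _; exact: cvg_cst.
have c2 : seg_cont (fun t => - (l * d) * rc t).
  by split=> t _; apply: cvgM; [exact: cvg_cst|exact: rc_continuous].
have c3 : seg_cont (fun t => - (c + l * (p - z0)) + - (l * d) * rc t).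
  by split=> t t01; exact: (cvgD (seg_contP c1 t01) (seg_contP c2 t01)).
have e : mean (fun t => F (p + rc t * d) - (c + l * (p + rc t * d - z0))) =
    mean (fun t => F (p + rc t * d)) - (c + l * (p - z0) + l * d / 2).
  transitivity (mean (fun t => F (p + rc t * d) + (- (c + l * (p - z0)) + - (l * d) * rc t))).
    by apply: eq_mean => t _; ring.
  by rewrite (meanD hc c3) (meanD c1 c2) mean_cst (meanZ _ rcc) mean_id; ring.
rewrite /seg_int -mulrBr -e cabsM ler_wpM2l ?cabs_ge0//; apply: mean_le => //.
have c4 : seg_cont (fun t => F (p + rc t * d) + (- (c + l * (p - z0)) + - (l * d) * rc t)).
  by split=> t t01; exact: (cvgD (seg_contP hc t01) (seg_contP c3 t01)).
have <- : (fun t => F (p + rc t * d) + (- (c + l * (p - z0)) + - (l * d) * rc t)) =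
  (fun t => F (p + rc t * d) - (c + l * (p + rc t * d - z0))).
  by apply/funext => t; ring.
exact: c4.
Qed.

Lemma par_int_bisect F p u v :
  (forall a b : K, 0 <= a <= 1 -> 0 <= b <= 1 ->
     {for p + rc a * u + rc b * v, continuous F}) ->
  par_int F p u v =
    par_int F p (u / 2) (v / 2) + par_int F (p + u / 2) (u / 2) (v / 2) +
    (par_int F (p + v / 2) (u / 2) (v / 2) +
     par_int F (p + u / 2 + v / 2) (u / 2) (v / 2)).
Proof.
move=> hF.
have hu (b : K) : 0 <= b <= 1 -> seg_contF F (p + rc b * v) u.
  move=> b01; apply: seg_cont_line => t t01.
  by have := hF _ _ t01 b01; rewrite -addrA [rc t * u + _]addrC addrA.
have hv (a : K) : 0 <= a <= 1 -> seg_contF F (p + rc a * u) v.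
  by move=> a01; apply: seg_cont_line => t t01; exact: hF.
have h0 : 0 <= (0 : K) <= 1 by rewrite lexx ler01.
have h1 : 0 <= (1 : K) <= 1 by rewrite lexx ler01.
have hu0 := hu _ h0; have hu1 := hu _ h1; have hv0 := hv _ h0; have hv1 := hv _ h1.
rewrite rc0 mul0r addr0 in hu0; rewrite rc0 mul0r addr0 in hv0.
rewrite rc1 mul1r in hu1; rewrite rc1 mul1r in hv1.
rewrite /par_int (seg_int_bisect hu0) (seg_int_bisect hu1) (seg_int_bisect hv0).
rewrite (seg_int_bisect hv1).
have -> : p + u / 2 + u / 2 = p + u by field.
have -> : p + v / 2 + v / 2 = p + v by field.
have -> : p + v / 2 + u / 2 = p + u / 2 + v / 2 by ring.
have -> : p + u / 2 + v / 2 + u / 2 = p + u + v / 2 by field.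
have -> : p + u / 2 + v / 2 + v / 2 = p + v + u / 2 by field.
ring.
Qed.

(** Around the boundary the contributions of the affine part cancel; what remains is the deviation M
    times the perimeter. *)
Lemma par_int_le F p u v (c l z0 : C) (M : K) :
  (forall a b : K, 0 <= a <= 1 -> 0 <= b <= 1 ->
     {for p + rc a * u + rc b * v, continuous F}) ->
  (forall a b : K, 0 <= a <= 1 -> 0 <= b <= 1 ->
     cabs (F (p + rc a * u + rc b * v) - (c + l * (p + rc a * u + rc b * v - z0))) <= M) ->
  cabs (par_int F p u v) <= 2 * (cabs u + cabs v) * M.
Proof.
move=> hF hM.
have h0 : 0 <= (0 : K) <= 1 by rewrite lexx ler01.
have h1 : 0 <= (1 : K) <= 1 by rewrite lexx ler01.
have hu (b : K) : 0 <= b <= 1 ->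
    cabs (seg_int F (p + rc b * v) u - u * (c + l * (p + rc b * v - z0) + l * u / 2))
    <= cabs u * M.
  move=> b01; apply: seg_int_dist.
    apply: seg_cont_line => t t01.
    by have := hF _ _ t01 b01; rewrite -addrA [rc t * u + _]addrC addrA.
  move=> t t01; have -> : p + rc b * v + rc t * u = p + rc t * u + rc b * v by ring.
  exact: hM.
have hv (a : K) : 0 <= a <= 1 ->
    cabs (seg_int F (p + rc a * u) v - v * (c + l * (p + rc a * u - z0) + l * v / 2))
    <= cabs v * M.
  move=> a01; apply: seg_int_dist; first by apply: seg_cont_line => t t01; exact: hF.
  by move=> t t01; exact: hM.
have := hu _ h0; have := hu _ h1; have := hv _ h0; have := hv _ h1.
rewrite rc0 rc1 !mul0r !mul1r !addr0 /par_int.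
set a := seg_int F p u; set b := seg_int F (p + u) v.
set a' := seg_int F (p + v) u; set b' := seg_int F p v => k1 k2 k3 k4.
have -> : a + b - a' - b' =
  (a - u * (c + l * (p - z0) + l * u / 2)) + (b - v * (c + l * (p + u - z0) + l * v / 2))
  - (a' - u * (c + l * (p + v - z0) + l * u / 2)) - (b' - v * (c + l * (p - z0) + l * v / 2)).
  ring.
apply: le_trans (cabsB _ _) _; apply: le_trans (lerD (cabsB _ _) (lexx _)) _.
apply: le_trans (lerD (lerD (cabsD _ _) (lexx _)) (lexx _)) _.
have -> : 2 * (cabs u + cabs v) * M = cabs u * M + cabs v * M + cabs u * M + cabs v * M.
  ring.
by rewrite !lerD.
Qed.

Lemma half_interval (a e : K) : 0 <= a -> a + e <= 1 -> 0 <= e ->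
  [/\ 0 <= e / 2, 0 <= a + e / 2, a + e / 2 <= 1, a + e / 2 + e / 2 <= 1 & a <= a + e / 2].
Proof. by move=> *; split; lra. Qed.

Lemma le_one_of_four (x a b c d : K) : x <= a + b + (c + d) ->
  [\/ x <= 4 * a, x <= 4 * b, x <= 4 * c | x <= 4 * d].
Proof.
move=> h; have [|h1] := leP x (4 * a); first by constructor 1.
have [|h2] := leP x (4 * b); first by constructor 2.
have [|h3] := leP x (4 * c); first by constructor 3.
constructor 4; lra.
Qed.

Lemma dist_in_interval (a b c e : K) : a <= b <= a + e -> a <= c <= a + e -> `|b - c| <= e.
Proof. by move=> *; rewrite ler_norml; lra. Qed.

Lemma subinterval (a e t : K) : 0 <= a -> a + e <= 1 -> 0 <= e -> 0 <= t <= 1 ->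
  0 <= a + t * e <= 1 /\ a <= a + t * e <= a + e.
Proof.
move=> a0 a1 e0 /andP[t0 t1].
have : 0 <= t * e <= e by rewrite mulr_ge0//= ler_piMl.
by split; lra.
Qed.

Lemma goursat F p u v :
  (forall a b : K, 0 <= a <= 1 -> 0 <= b <= 1 -> hol F (p + rc a * u + rc b * v)) ->
  par_int F p u v = 0.
Proof.
move=> hF.
(* A triple ((a, b), e) encodes the sub-parallelogram with corner p + a u + b v and sides e u and e
   v; [ok] says that it lies inside the original one. *)
pose I (x : K * K * K) := par_int F (p + rc x.1.1 * u + rc x.1.2 * v) (rc x.2 * u) (rc x.2 * v).
pose ok (x : K * K * K) := [/\ 0 <= x.1.1, x.1.1 + x.2 <= 1, 0 <= x.1.2, x.1.2 + x.2 <= 1 & 0 <= x.2].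
have okF x : ok x -> forall a b : K, 0 <= a <= 1 -> 0 <= b <= 1 ->
    exists a' b' : K, [/\ 0 <= a' <= 1, 0 <= b' <= 1,
      p + rc x.1.1 * u + rc x.1.2 * v + rc a * (rc x.2 * u) + rc b * (rc x.2 * v) =
      p + rc a' * u + rc b' * v, x.1.1 <= a' <= x.1.1 + x.2 & x.1.2 <= b' <= x.1.2 + x.2].
  move=> [x1 x2 x3 x4 x5] a b a01 b01.
  have [h1 h2] := subinterval x1 x2 x5 a01; have [h3 h4] := subinterval x3 x4 x5 b01.
  exists (x.1.1 + a * x.2), (x.1.2 + b * x.2); split => //.
  by rewrite !rcD !rcM; ring.
(* Among the four quarters at least one carries a quarter of the modulus of the integral. *)
have step x : exists y, ok x ->
    [/\ ok y, y.2 = x.2 / 2, x.1.1 <= y.1.1 <= x.1.1 + x.2 / 2,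
        x.1.2 <= y.1.2 <= x.1.2 + x.2 / 2 & cabs (I x) <= 4 * cabs (I y)].
  have [okx|nokx] := pselect (ok x); last by exists x.
  have hc (a b : K) : 0 <= a <= 1 -> 0 <= b <= 1 ->
    {for p + rc x.1.1 * u + rc x.1.2 * v + rc a * (rc x.2 * u) + rc b * (rc x.2 * v),
      continuous F}.
    move=> a01 b01; have [a' [b' [ha hb -> _ _]]] := okF _ okx _ _ a01 b01.
    exact/hol_cont/hF.
  pose y1 := (x.1.1, x.1.2, x.2 / 2).
  pose y2 := (x.1.1 + x.2 / 2, x.1.2, x.2 / 2).
  pose y3 := (x.1.1, x.1.2 + x.2 / 2, x.2 / 2).
  pose y4 := (x.1.1 + x.2 / 2, x.1.2 + x.2 / 2, x.2 / 2).
  have Ix : I x = I y1 + I y2 + (I y3 + I y4).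
    rewrite /I (par_int_bisect hc) /=.
    rewrite !rcD !rcM !rcV !rc_nat.
    have -> : rc x.2 / 2 * u = rc x.2 * u / 2 by ring.
    have -> : rc x.2 / 2 * v = rc x.2 * v / 2 by ring.
    set X := rc x.1.1; set Y := rc x.1.2; set Z := rc x.2.
    have -> : p + (X + Z / 2) * u + Y * v = p + X * u + Y * v + Z * u / 2 by ring.
    have -> : p + X * u + (Y + Z / 2) * v = p + X * u + Y * v + Z * v / 2 by ring.
    by have -> : p + (X + Z / 2) * u + (Y + Z / 2) * v =
      p + X * u + Y * v + Z * u / 2 + Z * v / 2 by ring.
  have [x1 x2 x3 x4 x5] := okx.
  have sel y : ok y -> y.2 = x.2 / 2 -> x.1.1 <= y.1.1 <= x.1.1 + x.2 / 2 ->
      x.1.2 <= y.1.2 <= x.1.2 + x.2 / 2 -> cabs (I x) <= 4 * cabs (I y) ->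
      exists y, ok x ->
    [/\ ok y, y.2 = x.2 / 2, x.1.1 <= y.1.1 <= x.1.1 + x.2 / 2,
        x.1.2 <= y.1.2 <= x.1.2 + x.2 / 2 & cabs (I x) <= 4 * cabs (I y)].
    by move=> *; exists y.
  have [k1 k2 k3 k4 k5] := half_interval x1 x2 x5.
  have [k1' k2' k3' k4' k5'] := half_interval x3 x4 x5.
  have le4 : cabs (I x) <= cabs (I y1) + cabs (I y2) + (cabs (I y3) + cabs (I y4)).
    rewrite Ix; apply: le_trans (cabsD _ _) _; apply: lerD; exact: cabsD.
  have r1 : x.1.1 <= x.1.1 <= x.1.1 + x.2 / 2 by rewrite lexx k5.
  have r2 : x.1.2 <= x.1.2 <= x.1.2 + x.2 / 2 by rewrite lexx k5'.
  have r3 : x.1.1 <= x.1.1 + x.2 / 2 <= x.1.1 + x.2 / 2 by rewrite lexx k5.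
  have r4 : x.1.2 <= x.1.2 + x.2 / 2 <= x.1.2 + x.2 / 2 by rewrite lexx k5'.
  case: (le_one_of_four le4) => l.
  - exact: (sel y1 (And5 x1 k3 x3 k3' k1) erefl r1 r2 l).
  - exact: (sel y2 (And5 k2 k4 x3 k3' k1) erefl r3 r2 l).
  - exact: (sel y3 (And5 x1 k3 k2' k4' k1) erefl r1 r4 l).
  - exact: (sel y4 (And5 k2 k4 k2' k4' k1) erefl r3 r4 l).
have [nxt hn] := choice step.
pose st n := iter n nxt (0, 0, 1).
have ok0 : ok (0, 0, 1) by rewrite /ok /= add0r lexx ler01.
have okn n : ok (st n) by elim: n => [//|n IH] /=; have [] := hn _ IH.
have st2 n : (st n).2 = 2 ^- n.
  elim: n => [|n IH] /=; first by rewrite expr0 invr1.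
  by have [_ -> _ _ _] := hn _ (okn n); rewrite -/(st n) IH exprSr invfM.
have stI n : cabs (I (st 0%N)) <= 4 ^+ n * cabs (I (st n)).
  elim: n => [|n IH]; first by rewrite expr0 mul1r.
  have [_ _ _ _ h] := hn _ (okn n); apply: le_trans IH _; rewrite exprSr -mulrA.
  by apply: ler_wpM2l; [rewrite exprn_ge0|exact: h].
have mon (g : K * K * K -> K) : (forall x y, ok x -> y = nxt x -> g x <= g y <= g x + x.2 / 2) ->
    forall n m, (n <= m)%N -> g (st n) <= g (st m) /\ g (st m) + (st m).2 <= g (st n) + (st n).2.
  move=> hg n m /subnK <-; elim: (m - n)%N => [|k [IH1 IH2]]; first by [].
  rewrite addSn; have := hg _ _ (okn (k + n)%N) erefl; have := hn _ (okn (k + n)%N).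
  rewrite -/(st (k + n).+1) -[nxt _]/(st (k + n).+1) => -[_ -> _ _ _] /andP[h1 h2].
  split; first exact: le_trans h1.
  apply: le_trans IH2; rewrite [leRHS](_ : _ = g (st (k + n)%N) + (st (k + n)%N).2 / 2 + (st (k + n)%N).2 / 2).
    by rewrite lerD2r.
  by rewrite -addrA -splitr.
(* Nested intervals, applied below to each of the two corner parameters: the supremum of the left
   ends lies in all of them. *)
have lim (g : K * K * K -> K) : (forall x y, ok x -> y = nxt x -> g x <= g y <= g x + x.2 / 2) ->
    exists a, forall n, g (st n) <= a <= g (st n) + (st n).2.
  move=> hg; pose S := [set g (st n) | n in setT].
  have ub n : ubound S (g (st n) + (st n).2).
    move=> _ [m _ <-]; have [nm|mn] := leqP n m.
      have [_ h] := mon _ hg _ _ nm; apply: le_trans h.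
      by rewrite lerDl; have [] := okn m.
    have [h _] := mon _ hg _ _ (ltnW mn); apply: le_trans h _.
    by rewrite lerDl; have [] := okn n.
  have hs : has_sup S by split; [exists (g (st 0%N)); exists 0%N|exists (g (st 0%N) + (st 0%N).2); exact: ub].
  exists (sup S) => n; apply/andP; split; first by apply: (ub_le_sup hs.2); exists n.
  by apply: ge_sup; [exact: hs.1|exact: ub].
have [al hal] := lim (fun x => x.1.1) (fun x y okx e =>
  let: And5 _ _ h _ _ := hn _ okx in eq_ind_r (fun y => _ <= y.1.1 <= _) h e).
have [be hbe] := lim (fun x => x.1.2) (fun x y okx e =>
  let: And5 _ _ _ h _ := hn _ okx in eq_ind_r (fun y => _ <= y.1.2 <= _) h e).
have h0 := hal 0%N; have h0' := hbe 0%N; rewrite /= !add0r in h0 h0'.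
pose z0 := p + rc al * u + rc be * v.
have [l hl] := hF _ _ h0 h0'.
pose D := cabs u + cabs v; have D0 : 0 <= D by rewrite addr_ge0// cabs_ge0.
have I0 : I (st 0%N) = par_int F p u v by rewrite /I /= !rc0 !mul0r !addr0 !rc1 !mul1r.
apply/eqP; rewrite -cabs_eq0 eq_le cabs_ge0 andbT -I0.
suff hh (e : K) : 0 < e -> cabs (I (st 0%N)) <= 2 * D * (e * D).
  apply/ler_addgt0Pr => e e0; rewrite add0r.
  have D1 : 0 < 2 * D * D + 1 by rewrite ltr_wpDl// !mulr_ge0.
  apply: (le_trans (hh (e / (2 * D * D + 1)) _)); first by rewrite divr_gt0.
  set X := 2 * D * D + 1 in D1 *; have -> : 2 * D * (e / X * D) = e * (2 * D * D / X) by ring.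
  by rewrite ler_piMr ?(ltW e0)// ler_pdivrMr// mul1r /X lerDl.
move=> e0.
have /cderivP/(_ _ e0)[d d0 hd] := hl.
have [N hN] : exists N, 2 ^- N * D < d.
  have [N hN] := exp2V_lt (divr_gt0 d0 (ltr_wpDl D0 ltr01)); exists N.
  rewrite ltr_pdivlMr ?ltr_wpDl// in hN; apply: le_lt_trans hN.
  by rewrite ler_wpM2l ?invr_ge0 ?exprn_ge0// lerDl.
apply: le_trans (stI N) _.
have PN : 0 < (2 ^- N : K) by rewrite invr_gt0 exprn_gt0.
have key : cabs (I (st N)) <= 2 * (cabs (rc (st N).2 * u) + cabs (rc (st N).2 * v)) *
    (e * (2 ^- N * D)).
  apply: (@par_int_le _ _ _ _ (F z0) l z0) => a b a01 b01;
    have [a' [b' [ha hb -> ha' hb']]] := okF _ (okn N) _ _ a01 b01.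
    exact/hol_cont/hF.
  set z := p + _ + _.
  have zz0 : cabs (z - z0) <= 2 ^- N * D.
    have -> : z - z0 = rc (a' - al) * u + rc (b' - be) * v by rewrite /z /z0 !rcB; ring.
    apply: le_trans (cabsD _ _) _; rewrite !cabsM !cabs_rc mulrDr.
    have := hal N; have := hbe N; rewrite st2 in ha' hb' *; move=> h1 h2.
    by rewrite lerD// ler_wpM2r ?cabs_ge0//; apply: dist_in_interval; eassumption.
  have := hd (z - z0) (le_lt_trans zz0 hN).
  have -> : z0 + (z - z0) = z by rewrite addrC subrK.
  move=> hz.
  have -> : F z - (F z0 + l * (z - z0)) = F z - F z0 - l * (z - z0) by ring.
  by apply: le_trans hz _; rewrite ler_wpM2l ?(ltW e0).
(* The factor 4^N lost in the selections is balanced exactly by the perimeter and the diameter, each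
   of order 2^-N. *)
apply: (@le_trans _ _ (4 ^+ N * (2 * (cabs (rc (st N).2 * u) + cabs (rc (st N).2 * v)) *
    (e * (2 ^- N * D))))); first by rewrite ler_wpM2l ?exprn_ge0.
rewrite !cabsM !cabs_rc st2 (gtr0_norm PN) -mulrDr -/D.
have -> : (4 ^+ N : K) = 2 ^+ N * 2 ^+ N by rewrite -exprMn; congr (_ ^+ _); ring.
have P0 : (2 ^+ N : K) != 0 by rewrite expf_neq0// pnatr_eq0.
by rewrite le_eqVlt; apply/orP; left; apply/eqP; field.
Qed.

End Goursat.

(** * The complex exponential and invariance of circle means under change of radius *)

Section CircleConst.
Variable K : realType.
Local Notation C := (Cplx K).
Implicit Types (f : C -> C).

Definition cexp (w : C) : C := rc (expR (complex.Re w)) * circle_pt 1 (complex.Im w).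

Lemma cexpD w h : cexp (w + h) = cexp w * cexp h.
Proof.
have er : complex.Re (w + h) = complex.Re w + complex.Re h by case: (w) (h) => [? ?] [? ?].
have ei : complex.Im (w + h) = complex.Im w + complex.Im h by case: (w) (h) => [? ?] [? ?].
have e : circle_pt 1 (complex.Im w + complex.Im h) =
    circle_pt 1 (complex.Im w) * circle_pt 1 (complex.Im h) :> C.
  by rewrite circle_ptD mulr1.
by rewrite /cexp er ei e expRD rcM; ring.
Qed.

Lemma cexp0 : cexp 0 = 1.
Proof. by rewrite /cexp /= expR0 /circle_pt sin0 cos0 mulr1 mulr0 rc1 mul1r. Qed.

Lemma cabs_cexp w : cabs (cexp w) = expR (complex.Re w).
Proof.
by rewrite /cexp cabsM cabs_rc cabs_circle_pt// mulr1 ger0_norm// expR_ge0.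
Qed.

(** The functional equation reduces everything to w = 0, where the real derivatives of exponential,
    cosine and sine are combined. *)
Lemma cexp_cderiv w : cderiv cexp w (cexp w).
Proof.
suff h0 : cderiv cexp 0 1.
  apply/cderivP => e e0; have A0 : 0 < cabs (cexp w) by rewrite cabs_cexp expR_gt0.
  have /cderivP/(_ (e / cabs (cexp w)))[|d d0 hd] := h0; first by rewrite divr_gt0.
  exists d => // h /hd; rewrite add0r cexp0 mul1r cexpD => hh.
  have -> : cexp w * cexp h - cexp w - cexp w * h = cexp w * (cexp h - 1 - h) by ring.
  by rewrite cabsM mulrC -ler_pdivlMr// mulrAC.
apply/cderivP => e e0.
(* The bounds [b1] to [b4] add up to six times e' |h|; e' <= 1 is what gives |exp x - 1| <= 2 |h|
   and |exp x| <= 2. *)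
pose e' := Num.min 1 (e / 6); have e'0 : 0 < e' by rewrite lt_min ltr01 divr_gt0.
have e'1 : e' <= 1 by rewrite ge_min lexx.
have /is_deriveP/(_ _ e'0)[d1 d10 hd1] := is_derive_expR (0 : K).
have /is_deriveP/(_ _ e'0)[d2 d20 hd2] := is_derive_cos (0 : K).
have /is_deriveP/(_ _ e'0)[d3 d30 hd3] := is_derive_sin (0 : K).
exists (Num.min (Num.min d1 d2) (Num.min d3 (e' / 2))).
  by rewrite !lt_min d10 d20 d30 divr_gt0.
move=> h; rewrite !lt_min => /andP[/andP[k1 k2] /andP[k3 k4]].
set x := complex.Re h; set y := complex.Im h; rewrite add0r cexp0 mul1r.
have hx : `|x| <= cabs h := re_le_cabs h; have hy : `|y| <= cabs h := im_le_cabs h.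
have := hd1 x (le_lt_trans hx k1); have := hd2 y (le_lt_trans hy k2).
have := hd3 y (le_lt_trans hy k3).
rewrite !add0r expR0 cos0 sin0 subr0 oppr0 mul0r subr0 !mul1r.
set E := expR x; set co := cos y; set si := sin y => hs hc hE.
have -> : cexp h - 1 - h = rc (E * (co - 1)) + rc (E - 1 - x) +
    'i%C * (rc (E * (si - y)) + rc ((E - 1) * y)).
  rewrite /cexp -/x -/y -/E /circle_pt !mul1r -/co -/si.
  rewrite [h in LHS](_ : h = Complex x y); last by rewrite /x /y; case: (h).
  by rewrite /rc; apply/eqP; rewrite eq_complex /=; apply/andP; split; apply/eqP; ring.
have E2 : `|E - 1| <= 2 * cabs h.
  have -> : E - 1 = (E - 1 - x) + x by ring.
  apply: le_trans (ler_normD _ _) _; rewrite mulr2n mulrDl mul1r lerD//.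
  by apply: le_trans hE _; apply: le_trans hx; rewrite ler_piMl.
have E3 : `|E| <= 2.
  have -> : E = (E - 1) + 1 by ring.
  apply: le_trans (ler_normD _ _) _; rewrite normr1 mulr2n lerD//.
  apply: le_trans E2 _; rewrite mulrC -ler_pdivlMr//; apply: ltW; apply: lt_le_trans k4 _.
  by rewrite ler_pM2r.
have ci : cabs ('i%C : C) = 1 by rewrite /cabs /= expr0n /= add0r expr1n sqrtr1.
have b1 : cabs (rc (E * (co - 1)) : C) <= 2 * (e' * cabs h).
  rewrite cabs_rc normrM ler_pM//; apply: le_trans hc _; by rewrite ler_pM2l.
have b2 : cabs (rc (E - 1 - x) : C) <= e' * cabs h.
  by rewrite cabs_rc; apply: le_trans hE _; rewrite ler_pM2l.
have b3 : cabs (rc (E * (si - y)) : C) <= 2 * (e' * cabs h).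
  rewrite cabs_rc normrM ler_pM//; apply: le_trans hs _; by rewrite ler_pM2l.
have b4 : cabs (rc ((E - 1) * y) : C) <= e' * cabs h.
  rewrite cabs_rc normrM ler_pM//; apply: le_trans E2 _.
  by rewrite mulrC -ler_pdivlMr// ltW.
have b5 : cabs ('i%C * (rc (E * (si - y)) + rc ((E - 1) * y)) : C) <= 3 * (e' * cabs h).
  by rewrite cabsM ci mul1r; apply: le_trans (cabsD _ _) _; lra.
apply: le_trans (cabsD _ _) _.
have b6 : cabs (rc (E * (co - 1)) + rc (E - 1 - x) : C) <= 3 * (e' * cabs h).
  by apply: le_trans (cabsD _ _) _; lra.
apply: le_trans (lerD b6 b5) _.
have : e' <= e / 6 by rewrite ge_min lexx orbT.
rewrite ler_pdivlMr// => e6; have h0 := cabs_ge0 h.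
have -> : 3 * (e' * cabs h) + 3 * (e' * cabs h) = e' * 6 * cabs h by ring.
by rewrite ler_wpM2r.
Qed.

Lemma cexp_circ (x t : K) : cexp (rc x + rc t * ('i%C * rc (2 * pi))) = circ (expR x) t.
Proof.
rewrite /cexp /circ [RHS]circle_ptE.
have er : complex.Re (rc x + rc t * ('i%C * rc (2 * pi))) = x by rewrite /rc /=; ring.
have ei : complex.Im (rc x + rc t * ('i%C * rc (2 * pi))) = 2 * pi * t.
  by rewrite /rc /=; ring.
by rewrite er ei.
Qed.

Lemma cexp_per w : cexp (w + 'i%C * rc (2 * pi)) = cexp w.
Proof.
rewrite cexpD -[RHS]mulr1.
have -> : 'i%C * rc (2 * pi) = rc 0 + rc 1 * ('i%C * rc (2 * pi)) :> C.
  by rewrite rc0 rc1 add0r mul1r.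
rewrite cexp_circ expR0 /circ /circle_pt !mul1r mulr1.
by rewrite mulr_natl cos2pi sin2pi.
Qed.

Lemma convex_itv (x y c : K) : 0 <= c <= 1 -> x <= y ->
  x <= x + c * (y - x) <= y /\ x <= y + c * (x - y) <= y.
Proof.
move=> /andP[c0 c1] xy.
have k1 : c * (y - x) <= y - x by rewrite ler_piMl// subr_ge0.
have k2 : 0 <= c * (y - x) by rewrite mulr_ge0// subr_ge0.
have -> : c * (x - y) = - (c * (y - x)) by ring.
by split; lra.
Qed.

(** Pulled back by the exponential, the region between the circles becomes a rectangle of height 2
    pi. In [goursat] the horizontal sides cancel by periodicity, and the vertical sides are the two
    means. *)
Lemma circle_const f (a b s s' : K) : 0 <= a ->
  (forall z, a < cabs z < b -> hol f z) -> a < s < b -> a < s' < b ->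
  cmean s f = cmean s' f.
Proof.
move=> a0 hf /andP[as_ sb] /andP[as'_ s'b].
have s0 := le_lt_trans a0 as_; have s'0 := le_lt_trans a0 as'_.
pose x := ln s; pose x' := ln s'.
have ex : expR x = s by rewrite lnK.
have ex' : expR x' = s' by rewrite lnK.
pose F w := f (cexp w); pose v : C := 'i%C * rc (2 * pi).
have hF (c d : K) : 0 <= c <= 1 -> 0 <= d <= 1 ->
    hol F (rc x + rc c * rc (x' - x) + rc d * v).
  move=> c01 d01; apply: hol_comp; first exact: cderiv_hol (cexp_cderiv _).
  rewrite -rcM -rcD cexp_circ; apply: hf; rewrite cabs_circ ?expR_ge0//.
  have [xx'|x'x] := leP x x'.
    have [h _] := convex_itv c01 xx'.
    have [h1 h2] : s <= expR (x + c * (x' - x)) /\ expR (x + c * (x' - x)) <= s'.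
      by rewrite -[in X in X <= _ /\ _]ex -[in X in _ /\ _ <= X]ex' !ler_expR; case/andP: h.
    by rewrite (lt_le_trans as_ h1) (le_lt_trans h2 s'b).
  have [_ h] := convex_itv c01 (ltW x'x).
  have [h1 h2] : s' <= expR (x + c * (x' - x)) /\ expR (x + c * (x' - x)) <= s.
    by rewrite -[in X in X <= _ /\ _]ex' -[in X in _ /\ _ <= X]ex !ler_expR; case/andP: h.
  by rewrite (lt_le_trans as'_ h1) (le_lt_trans h2 sb).
have := goursat hF; rewrite /par_int /seg_int.
have m1 : mean (fun t => F (rc x + rc t * v)) = cmean s f.
  by apply: eq_mean => t _; rewrite /F cexp_circ ex.
have m2 : mean (fun t => F (rc x + rc (x' - x) + rc t * v)) = cmean s' f.
  apply: eq_mean => t _; rewrite /F -rcD cexp_circ.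
  have -> : x + (x' - x) = x' by rewrite addrC subrK.
  by rewrite ex'.
have m3 : mean (fun t => F (rc x + v + rc t * rc (x' - x))) =
    mean (fun t => F (rc x + rc t * rc (x' - x))).
  apply: eq_mean => t _; rewrite /F.
  have -> : rc x + v + rc t * rc (x' - x) = rc x + rc t * rc (x' - x) + v by ring.
  by rewrite cexp_per.
rewrite m1 m2 m3; set A := rc (x' - x) * _ => h.
have v0 : v != 0.
  rewrite mulf_neq0//.
    by rewrite -cabs_gt0 /cabs /= expr0n /= add0r expr1n sqrtr1.
  by rewrite rc_eq0 mulf_neq0// ?pnatr_eq0// gt_eqF// pi_gt0.
have : v * (cmean s' f - cmean s f) = 0 by rewrite -h; ring.
by move=> /eqP; rewrite mulf_eq0 (negbTE v0) subr_eq0 => /eqP.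
Qed.

End CircleConst.

(** * Cauchy's integral formula and Cauchy-type integrals *)

Section Cauchy.
Variable K : realType.
Local Notation C := (Cplx K).
Implicit Types (f g : C -> C) (z w y : C) (s a b : K).

Lemma scM (F G : K -> C) : seg_cont F -> seg_cont G -> seg_cont (fun t => F t * G t).
Proof. by move=> [cF] [cG]; split=> t t01; exact: (cvgM (cF t t01) (cG t t01)). Qed.
Lemma scD (F G : K -> C) : seg_cont F -> seg_cont G -> seg_cont (fun t => F t + G t).
Proof. by move=> [cF] [cG]; split=> t t01; exact: (cvgD (cF t t01) (cG t t01)). Qed.
Lemma scC (c : C) : seg_cont (fun=> c).
Proof. by split=> t t01; exact: cvg_cst. Qed.

Lemma seg_bounded (U : K -> C) : seg_cont U ->
  exists B : K, forall t, 0 <= t <= 1 -> cabs (U t) <= B.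
Proof.
move=> cU.
have [d d0 hd] := seg_cont_unif cU ltr01.
have [N hN] := exp2V_lt d0.
exists (1 + \sum_(k < (2 ^ N).+1) cabs (U (k%:R / 2 ^+ N))) => t /andP[t0 t1].
have PN : 0 < (2 ^+ N : K) by rewrite exprn_gt0.
pose k := Num.truncn (t * 2 ^+ N).
have /andP[k1 k2] : k%:R <= t * 2 ^+ N < k.+1%:R.
  by apply: Num.Theory.truncn_itv; rewrite mulr_ge0// ltW.
have kN : (k < (2 ^ N).+1)%N.
  rewrite ltnS -(ler_nat K) natrX (le_trans k1)// -[leRHS]mul1r ler_wpM2r// ltW.
rewrite (bigD1 (Ordinal kN))//= addrA.
have -> : U t = (U t - U (k%:R / 2 ^+ N)) + U (k%:R / 2 ^+ N) by rewrite subrK.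
rewrite -[leLHS]addr0; apply: lerD; last by apply: sumr_ge0 => i _; exact: cabs_ge0.
apply: le_trans (cabsD _ _) _; rewrite lerD2r; apply/ltW/hd; first by rewrite t0.
  by rewrite divr_ge0 ?(ltW PN)//= ler_pdivrMr// (le_trans k1)// ler_wpM2r// ltW.
apply: le_lt_trans hN; have -> : t - k%:R / 2 ^+ N = (t * 2 ^+ N - k%:R) / 2 ^+ N.
  by field; rewrite gt_eqF.
rewrite normrM normfV (gtr0_norm PN) ler_pdivrMr// mulVf ?gt_eqF//.
by rewrite ger0_norm ?subr_ge0// lerBlDl natr1 ltW.
Qed.

(** Continuity at the points of a compact path holds uniformly in a tube around it. Points off the
    path are included, as is needed to compare circles of different radii. *)
Lemma path_cont_unif (ga : K -> C) f : continuous ga ->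
  (forall t, 0 <= t <= 1 -> {for ga t, continuous f}) -> forall e : K, 0 < e ->
  exists2 d : K, 0 < d & forall t, 0 <= t <= 1 -> forall z, cabs (z - ga t) < d ->
    cabs (f z - f (ga t)) < e.
Proof.
move=> gac fc e e0.
have /compact_near_coveringP cpt : compact `[0 : K, 1]%classic by exact: segment_compact.
have e20 : 0 < e / 2 by rewrite divr_gt0.
have [|d /= d0 hd] := cpt K (0 : K)^'+ (fun d t => forall z, cabs (z - ga t) < d ->
    cabs (f z - f (ga t)) < e) _ _.
  move=> t; rewrite /= in_itv /= => t01.
  have /continuous_cabsP/(_ _ e20)[d d0 hd] := fc t t01.
  have d20 : 0 < d / 2 by rewrite divr_gt0.
  have /cvg_cabs_lt/(_ _ d20)/nbhs_ballP[d' /= d'0 hd'] := gac t.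
  exists (ball t d', [set x | x < d / 2]) => /=.
    split; first exact: nbhsx_ballx.
    by exists (d / 2) => //= x /=; rewrite sub0r normrN => + x0; rewrite gtr0_norm.
  move=> [u x] /= [] tu xd z zu.
  have gu : cabs (ga u - ga t) < d / 2 by exact: hd'.
  have -> : f z - f (ga u) = (f z - f (ga t)) - (f (ga u) - f (ga t)) by ring.
  rewrite (le_lt_trans (cabsB _ _))// [ltRHS](splitr e) ltrD//.
    apply: hd; have -> : z - ga t = (z - ga u) + (ga u - ga t) by ring.
    by rewrite (le_lt_trans (cabsD _ _))// [ltRHS](splitr d) ltrD// (lt_trans zu).
  by apply: hd; rewrite (lt_trans gu)// ltr_pdivrMr// mulr_natr mulr2n ltrDl.
have d20 : 0 < d / 2 by rewrite divr_gt0.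
have db : ball_ Num.norm (0 : K) d (d / 2).
  by rewrite /= sub0r normrN gtr0_norm// ltr_pdivrMr// mulr_natr mulr2n ltrDl.
by exists (d / 2) => // t t01 z zt; apply: (hd _ db) => //=; rewrite in_itv.
Qed.

Lemma cmean_near f s0 (e : K) : 0 <= s0 -> circ_cont s0 f -> 0 < e ->
  exists2 d : K, 0 < d & forall s, 0 <= s -> `|s - s0| < d -> circ_cont s f ->
    cabs (cmean s f - cmean s0 f) <= e.
Proof.
move=> s00 fc e0.
have fc' t : 0 <= t <= 1 -> {for circ s0 t, continuous f}.
  by move=> _; apply: (circ_contP fc); rewrite cabs_circ.
have [d d0 hd] := path_cont_unif (@circ_cont_t K s0) fc' e0.
exists d => // s sge ss0 fcs.
have h1 := seg_cont_circ sge fcs; have h2 := seg_cont_circ s00 fc.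
have h3 : seg_cont (fun t => -1 * f (circ s0 t)).
  by split=> t t01; exact: (cvgM (cvg_cst _) (seg_contP h2 t01)).
have h4 : seg_cont (fun t => f (circ s t) + -1 * f (circ s0 t)).
  by split=> t t01; exact: (cvgD (seg_contP h1 t01) (seg_contP h3 t01)).
have -> : cmean s f - cmean s0 f = mean (fun t => f (circ s t) + -1 * f (circ s0 t)).
  by rewrite (meanD h1 h3) (meanZ _ h2) mulN1r.
apply: (mean_le h4) => t t01; rewrite mulN1r ltW//; apply: hd => //.
rewrite /circ circle_ptE [X in _ - X]circle_ptE -mulrBl -rcB cabsM cabs_rc.
by rewrite cabs_circle_pt// mulr1.
Qed.

Lemma cmean_disc f b s : 0 < s < b -> (forall z, cabs z < b -> hol f z) ->
  cmean s f = f 0.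
Proof.
move=> /andP[s0 sb] hf; apply/eqP; rewrite -subr_eq0 -cabs_eq0 eq_le cabs_ge0 andbT.
apply/ler_addgt0Pr => e e0; rewrite add0r.
have b0 := lt_trans s0 sb.
have f0 : hol f 0 by apply: hf; rewrite cabs0.
have /continuous_cabsP/(_ _ e0)[d d0 hd] := hol_cont f0.
pose s' := Num.min (d / 2) (b / 2).
have s'0 : 0 < s' by rewrite lt_min !divr_gt0.
have s'b : s' < b.
  apply: le_lt_trans (_ : b / 2 < b); first by rewrite ge_min lexx orbT.
  by rewrite ltr_pdivrMr// mulr_natr mulr2n ltrDl.
have s'd : s' < d.
  apply: le_lt_trans (_ : d / 2 < d); first by rewrite ge_min lexx.
  by rewrite ltr_pdivrMr// mulr_natr mulr2n ltrDl.
rewrite (@circle_const _ f 0 b s s')//; last 3 first.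
- by move=> z /andP[_ zb]; exact: hf.
- by rewrite s0.
- by rewrite s'0.
have cf : circ_cont s' f by apply: cc_hol => z zs; apply: hf; rewrite zs.
apply: mean_dist; first exact: seg_cont_circ (ltW s'0) cf.
by move=> t _; apply/ltW/hd; rewrite subr0 cabs_circ// ltW.
Qed.

Lemma cmean_mul_disc f b s : 0 < s < b -> (forall z, cabs z < b -> hol f z) ->
  cmean s (fun z => z * f z) = 0.
Proof.
move=> sb hf; rewrite (cmean_disc sb) ?mul0r// => z zb.
by apply: holM; [exact: hol_id|exact: hf].
Qed.

Lemma cmean_kernel_out w s : 0 < s < cabs w -> cmean s (fun z => z / (z - w)) = 0.
Proof.
move=> sw; apply: (cmean_mul_disc sw) => z zw; apply: holV.
  by rewrite subr_eq0; apply: contraTneq zw => ->; rewrite ltxx.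
by apply: holB; [exact: hol_id|exact: hol_cst].
Qed.

(** The circle is pushed outwards, where z/(z - w) tends to 1. The radius [S] is chosen so that
    |w|/(S - |w|) <= e. *)
Lemma cmean_kernel_in w s : cabs w < s -> cmean s (fun z => z / (z - w)) = 1.
Proof.
move=> ws; apply/eqP; rewrite -subr_eq0 -cabs_eq0 eq_le cabs_ge0 andbT.
apply/ler_addgt0Pr => e e0; rewrite add0r.
have w0 := cabs_ge0 w; have s0 := le_lt_trans w0 ws.
pose S := s + cabs w + cabs w / e.
have we : 0 <= cabs w / e by rewrite divr_ge0// ltW.
have sS : s <= S by rewrite /S -addrA lerDl addr_ge0.
have hl z : cabs w < cabs z -> z - w != 0.
  by rewrite subr_eq0; apply: contraTneq => ->; rewrite ltxx.
have hh z : cabs w < cabs z -> hol (fun z => z / (z - w)) z.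
  move=> zw; apply: holM; first exact: hol_id.
  apply: holV; first exact: hl.
  by apply: holB; [exact: hol_id|exact: hol_cst].
rewrite (@circle_const _ (fun z => z / (z - w)) (cabs w) (S + 1) s S)//; last 3 first.
- by move=> z /andP[zw _]; exact: hh.
- by rewrite ws (le_lt_trans sS)// ltrDl.
- by rewrite (lt_le_trans ws sS) /= ltrDl ltr01.
have S0 : 0 <= S by exact: le_trans (ltW s0) sS.
apply: mean_dist.
  apply: (@seg_cont_circ _ S (fun z => z / (z - w)) S0); apply: cc_hol => z zS; apply: hh.
  by rewrite zS (lt_le_trans ws).
move=> t _; set z := circ S t; have zS : cabs z = S by rewrite cabs_circ.
have zw : z - w != 0 by apply: hl; rewrite zS (lt_le_trans ws).
have -> : z / (z - w) - 1 = w / (z - w) by field.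
rewrite cabsM cabsV ler_pdivrMr ?cabs_gt0// -ler_pdivrMl// mulrC.
apply: le_trans (cabs_sub_ge _ _); rewrite zS.
have -> : S - cabs w = s + cabs w / e by rewrite /S; ring.
by rewrite lerDr ltW.
Qed.

(** The difference quotient [g] at w is continuous at w and holomorphic elsewhere. The means of z g
    z are thus constant on either side of the circle through w, and continuity in the radius makes
    the two constants equal; the kernel means then isolate f w. *)
Lemma cauchy_annulus f a b w s1 s2 : 0 <= a ->
  (forall z, a < cabs z < b -> hol f z) -> a < s1 -> s1 < cabs w -> cabs w < s2 -> s2 < b ->
  f w = cmean s2 (fun z => z * f z / (z - w)) - cmean s1 (fun z => z * f z / (z - w)).
Proof.
move=> a0 hf as1 s1w ws2 s2b.
have s10 := le_lt_trans a0 as1.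
have wab : a < cabs w < b by rewrite (lt_trans as1 s1w) (lt_trans ws2 s2b).
have [l hl] := hf w wab.
pose g z := if z == w then l else (f z - f w) / (z - w).
have gh z : a < cabs z < b -> z != w -> hol g z.
  move=> zab zw; have zw' : 0 < cabs (z - w) by rewrite cabs_gt0 subr_eq0.
  apply: (@hol_ext _ (fun x => (f x - f w) / (x - w)) _ _ _ zw').
    move=> x xz; rewrite /g; case: eqP => // xw.
    by move: xz; rewrite xw cabsBC ltxx.
  apply: holM; first by apply: holB; [exact: hf|exact: hol_cst].
  apply: holV; first by rewrite subr_eq0.
  by apply: holB; [exact: hol_id|exact: hol_cst].
have gw : {for w, continuous g}.
  apply/continuous_cabsP => e e0; have e20 : 0 < e / 2 by rewrite divr_gt0.
  have /cderivP/(_ _ e20)[d d0 hd] := hl; exists d => // y yw.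
  rewrite /g eqxx; case: eqP => [_|/eqP yw0]; first by rewrite subrr cabs0.
  have yw1 : 0 < cabs (y - w) by rewrite cabs_gt0 subr_eq0.
  have := hd _ yw; have -> : w + (y - w) = y by ring.
  have -> : (f y - f w) / (y - w) - l = (f y - f w - l * (y - w)) / (y - w).
    by field; rewrite subr_eq0.
  move=> h; rewrite cabsM cabsV ltr_pdivrMr//; apply: le_lt_trans h _.
  by rewrite ltr_pM2r// ltr_pdivrMr// mulr_natr mulr2n ltrDl.
have gc s : a < s < b -> circ_cont s g.
  move=> sab; split=> z zs; have [->|zw] := eqVneq z w; first exact: gw.
  by apply: hol_cont; apply: gh; rewrite ?zs.
pose h z := z * g z.
have hc s : a < s < b -> circ_cont s h by move=> /gc hg; exact: (ccM (cc_id _) hg).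
have hh z : a < cabs z < b -> z != w -> hol h z.
  by move=> zab zw; apply: holM; [exact: hol_id|exact: gh].
have half1 : cmean s1 h = cmean (cabs w) h.
  apply/eqP; rewrite -subr_eq0 -cabs_eq0 eq_le cabs_ge0 andbT.
  apply/ler_addgt0Pr => e e0; rewrite add0r.
  have [d d0 hd] := cmean_near (cabs_ge0 w) (hc _ wab) e0.
  pose s := Num.max s1 (cabs w - d / 2).
  have d20 : 0 < d / 2 by rewrite divr_gt0.
  have ss1 : s1 <= s by rewrite le_max lexx.
  have sw : s < cabs w by rewrite gt_max s1w ltrBlDr ltrDl.
  rewrite (@circle_const _ h a (cabs w) s1 s)//; last 3 first.
  - move=> z /andP[za zw]; apply: hh; first by rewrite za (lt_trans zw)//; case/andP: wab.
    by apply: contraTneq zw => ->; rewrite ltxx.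
  - by rewrite as1.
  - by rewrite (lt_le_trans as1 ss1).
  apply: hd; first by rewrite (le_trans _ ss1)// ltW.
    rewrite distrC gtr0_norm ?subr_gt0// ltrBlDl -ltrBlDr lt_max.
    by apply/orP; right; rewrite ltrD2l ltrN2 ltr_pdivrMr// mulr_natr mulr2n ltrDl.
  by apply: hc; rewrite (lt_le_trans as1 ss1) (lt_trans sw)//; case/andP: wab.
have half2 : cmean s2 h = cmean (cabs w) h.
  apply/eqP; rewrite -subr_eq0 -cabs_eq0 eq_le cabs_ge0 andbT.
  apply/ler_addgt0Pr => e e0; rewrite add0r.
  have [d d0 hd] := cmean_near (cabs_ge0 w) (hc _ wab) e0.
  pose s := Num.min s2 (cabs w + d / 2).
  have d20 : 0 < d / 2 by rewrite divr_gt0.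
  have ss2 : s <= s2 by rewrite ge_min lexx.
  have sw : cabs w < s by rewrite lt_min ws2 ltrDl.
  rewrite (@circle_const _ h (cabs w) b s2 s)//; first last.
  - by rewrite sw (le_lt_trans ss2).
  - by rewrite ws2.
  - move=> z /andP[za zw]; apply: hh; first by rewrite zw (lt_trans _ za)//; case/andP: wab.
    by apply: contraTneq za => ->; rewrite ltxx.
  - exact: cabs_ge0.
  apply: hd; first by rewrite (le_trans _ (ltW sw))// cabs_ge0.
    rewrite gtr0_norm ?subr_gt0// ltrBlDl gt_min.
    by apply/orP; right; rewrite ltrD2l ltr_pdivrMr// mulr_natr mulr2n ltrDl.
  by apply: hc; rewrite (lt_trans _ sw) ?(le_lt_trans ss2)//; case/andP: wab.
have split_h s : a < s < b -> s != cabs w ->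
    cmean s h = cmean s (fun z => z * f z / (z - w)) - f w * cmean s (fun z => z / (z - w)).
  move=> sab sw; have sge : 0 <= s by rewrite ltW// (le_lt_trans a0)//; case/andP: sab.
  have zw z : cabs z = s -> z - w != 0.
    by move=> zs; rewrite subr_eq0; apply: contraNneq sw => <-; rewrite zs.
  have c1 : circ_cont s (fun z => z / (z - w)).
    apply: ccM; [exact: cc_id|apply: ccV; first exact: zw].
    by apply: ccB; [exact: cc_id|exact: cc_cst].
  have c2 : circ_cont s (fun z => z * f z / (z - w)).
    apply: ccM; last by (apply: ccV; [exact: zw|apply: ccB; [exact: cc_id|exact: cc_cst]]).
    by apply: ccM; [exact: cc_id|apply: cc_hol => z zs; apply: hf; rewrite zs].
  rewrite -(cmeanZ _ sge c1) -(cmeanB sge c2 (ccM (cc_cst _ _) c1)).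
  apply: eq_cmean => // z zs; rewrite /h /g; case: eqP => [e|_].
    by have := zw _ zs; rewrite e subrr eqxx.
  ring.
have := half1; rewrite -half2 split_h; last 2 first.
- by rewrite as1 (lt_trans s1w)//; case/andP: wab.
- by rewrite lt_eqF.
rewrite split_h; last 2 first.
- by rewrite s2b (lt_trans _ ws2)//; case/andP: wab.
- by rewrite gt_eqF.
rewrite cmean_kernel_out; last by rewrite s10.
rewrite cmean_kernel_in// mulr0 mulr1 subr0 => ->; ring.
Qed.

Lemma cauchy_disc f b w s : (forall z, cabs z < b -> hol f z) -> cabs w < s -> s < b ->
  cmean s (fun z => z * f z / (z - w)) = f w.
Proof.
move=> hf ws sb; have s0 := le_lt_trans (cabs_ge0 w) ws.
have [->|w0] := eqVneq w 0.
  rewrite -(@cmean_disc f b s) ?s0//; apply: eq_cmean; first exact: ltW.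
  by move=> z zs; rewrite subr0 mulrAC mulfV ?mul1r// -cabs_gt0 zs.
have w0' : 0 < cabs w by rewrite cabs_gt0.
have w20 : 0 < cabs w / 2 < cabs w.
  by rewrite divr_gt0//= ltr_pdivrMr// mulr_natr mulr2n ltrDl.
case/andP: (w20) => w20a w20b.
rewrite [RHS](@cauchy_annulus f 0 b w (cabs w / 2) s)//; last first.
  by move=> z /andP[_]; exact: hf.
have -> : cmean (cabs w / 2) (fun z => z * f z / (z - w)) = 0.
  rewrite -[RHS](@cmean_mul_disc (fun z => f z / (z - w)) (cabs w) (cabs w / 2) w20).
    by apply: eq_cmean => [|z _]; [exact: ltW|rewrite mulrA].
  move=> z zw; apply: holM; first by apply: hf; rewrite (lt_trans zw)// (lt_trans ws).
  apply: holV; first by rewrite subr_eq0; apply: contraTneq zw => ->; rewrite ltxx.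
  by apply: holB; [exact: hol_id|exact: hol_cst].
by rewrite subr0.
Qed.

(** The second-order error has the closed form U B^2 h^2/((A - w B)^2 (A - (w + h) B)), whose last
    factor is at least g/2 for small h. The denominator A - w B covers both kernels of the transfer
    operator: A = -g, B = -1 for the inner one and A = 1, B = g for the outer one. *)
Lemma cauchy_type_cderiv (U A B : K -> C) (w : C) (g : K) :
  seg_cont U -> seg_cont A -> seg_cont B -> 0 < g ->
  (forall t, 0 <= t <= 1 -> g <= cabs (A t - w * B t)) ->
  cderiv (fun w => mean (fun t => U t / (A t - w * B t))) w
    (mean (fun t => U t * B t / (A t - w * B t) ^+ 2)).
Proof.
move=> cU cA cB g0 hg.
have [BU hBU] := seg_bounded cU; have [B0 hB0] := seg_bounded cB.
have t01 : 0 <= (0 : K) <= 1 by rewrite lexx ler01.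
have B00 : 0 <= B0 := le_trans (cabs_ge0 _) (hB0 _ t01).
have BU0 : 0 <= BU := le_trans (cabs_ge0 _) (hBU _ t01).
have B1 : 0 < B0 + 1 by rewrite ltr_wpDl.
pose d := g / 2 / (B0 + 1).
have g20 : 0 < g / 2 by rewrite divr_gt0.
have d0 : 0 < d by rewrite divr_gt0.
have vw h t : cabs h < d -> 0 <= t <= 1 -> g / 2 <= cabs (A t - (w + h) * B t).
  move=> hh tt; have -> : A t - (w + h) * B t = (A t - w * B t) - h * B t by ring.
  apply: le_trans (cabs_sub_ge _ _); rewrite lerBrDr.
  apply: le_trans (hg _ tt); rewrite [leRHS](splitr g) lerD2l cabsM.
  rewrite ltr_pdivlMr// in hh; apply: le_trans (ltW hh).
  by rewrite ler_wpM2l ?cabs_ge0// (le_trans (hB0 _ tt))// lerDl.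
have nz h t : cabs h < d -> 0 <= t <= 1 -> A t - (w + h) * B t != 0.
  by move=> hh tt; rewrite -cabs_gt0 (lt_le_trans g20)// vw.
pose I h t := (A t - (w + h) * B t)^-1.
have cI h : cabs h < d -> seg_cont (I h).
  move=> hh; split=> t tt; apply: (cvgV (nz _ _ hh tt)).
  exact: (cvgB (seg_contP cA tt) (cvgM (cvg_cst _) (seg_contP cB tt))).
have h0 : cabs (0 : C) < d by rewrite cabs0.
have c0 := scM cU (cI _ h0).
have c2 : seg_cont (fun t => U t * B t * (I 0 t * I 0 t)).
  exact: scM (scM cU cB) (scM (cI _ h0) (cI _ h0)).
apply: (@cderiv_sq _ _ _ _ d (BU * B0 ^+ 2 * (2 / g ^+ 3))) => // h hh.
have ch := scM cU (cI _ hh).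
have -> : mean (fun t => U t / (A t - w * B t)) = mean (fun t => U t * I 0 t).
  by apply: eq_mean => t _; rewrite /I addr0.
have -> : mean (fun t => U t * B t / (A t - w * B t) ^+ 2) =
    mean (fun t => U t * B t * (I 0 t * I 0 t)).
  by apply: eq_mean => t _; rewrite /I addr0 expr2 invfM.
have c1 := scM (scC (- 1)) c0; have c3 := scM (scC (- h)) c2.
have -> : mean (fun t => U t / (A t - (w + h) * B t)) - mean (fun t => U t * I 0 t) -
    mean (fun t => U t * B t * (I 0 t * I 0 t)) * h =
    mean (fun t => U t * I h t + -1 * (U t * I 0 t) + - h * (U t * B t * (I 0 t * I 0 t))).
  rewrite (meanD (scD ch c1) c3) (meanD ch c1) (meanZ _ c0) (meanZ _ c2) /I; ring.
apply: (mean_le (scD (scD ch c1) c3)) => t tt.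
have n1 := nz _ _ hh tt; have n0 := nz _ _ h0 tt; rewrite /I addr0 in n0 *.
have -> : U t * (A t - (w + h) * B t)^-1 + -1 * (U t * (A t - w * B t)^-1) +
    - h * (U t * B t * ((A t - w * B t)^-1 * (A t - w * B t)^-1)) =
    U t * B t ^+ 2 * (h ^+ 2 / ((A t - w * B t) ^+ 2 * (A t - (w + h) * B t))).
  by field; rewrite n0 n1.
rewrite cabsM -mulrA ler_pM ?cabs_ge0//.
  rewrite cabsM ler_pM ?cabs_ge0//; first exact: hBU.
  by rewrite cabsX lerXn2r ?nnegrE ?cabs_ge0// hB0.
rewrite cabsM cabsV cabsX [leRHS]mulrC ler_wpM2l ?exprn_ge0 ?cabs_ge0//.
have -> : 2 / g ^+ 3 = (g ^+ 2 * (g / 2))^-1 by field; rewrite gt_eqF.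
rewrite lef_pV2 ?posrE ?mulr_gt0 ?exprn_gt0// ?cabs_gt0 ?mulf_neq0 ?expf_neq0//.
rewrite cabsM cabsX ler_pM ?exprn_ge0 ?(ltW g20) ?(ltW g0)//; last exact: vw.
by rewrite lerXn2r ?nnegrE ?cabs_ge0 ?(ltW g0)// hg.
Qed.

Lemma cauchy_type_hol (U V : K -> C) (w : C) (g : K) :
  seg_cont U -> seg_cont V -> 0 < g -> (forall t, 0 <= t <= 1 -> g <= cabs (V t - w)) ->
  hol (fun w => mean (fun t => U t / (V t - w))) w.
Proof.
move=> cU cV g0 hg.
have hg' t : 0 <= t <= 1 -> g <= cabs (V t - w * 1) by move=> tt; rewrite mulr1 hg.
have [l hl] := cderiv_hol (cauchy_type_cderiv cU cV (scC 1) g0 hg'); exists l.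
apply: (@cderiv_ext _ _ _ _ _ _ ltr01 _ hl) => x _.
by apply: eq_mean => t _; rewrite mulr1.
Qed.

End Cauchy.

(** * Identity theorem, maximum principle and difference quotients *)

Section Consequences.
Variable K : realType.
Local Notation C := (Cplx K).
Implicit Types (f g : C -> C) (z w y : C) (s a b : K).

Lemma geo_le0 (x c q : K) : 0 <= q < 1 -> (forall N, x <= c * q ^+ N) -> x <= 0.
Proof.
move=> /andP[q0 q1] h; have cv : c * q ^+ N @[N --> \oo] --> c * 0.
  by apply: cvgMr; apply: cvg_expr; rewrite ger0_norm.
rewrite mulr0 in cv; rewrite -(cvg_lim _ cv)//; apply: limr_ge.
  by apply/cvg_ex; exists 0.
exact: nearW.
Qed.

Lemma pow_le_base (x M c : K) : 0 <= x -> 0 <= M ->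
  (forall k, x ^+ k <= c * M ^+ k) -> x <= M.
Proof.
move=> x0 M0 h; rewrite leNgt; apply/negP => Mx.
have xp := le_lt_trans M0 Mx.
suff : (1 : K) <= 0 by rewrite ler10.
apply: (@geo_le0 1 c (M / x)); first by rewrite divr_ge0//= ltr_pdivrMr// mul1r.
move=> N; have := h N; rewrite exprMn exprVn mulrA ler_pdivlMr ?mul1r//.
exact: exprn_gt0.
Qed.

Lemma circ_surj s z : 0 < s -> cabs z = s -> exists2 t : K, 0 <= t <= 1 & z = circ s t.
Proof.
move=> s0 zs; case: z zs => x y zs.
have h : x ^+ 2 + y ^+ 2 = s ^+ 2 by have := cabs2E (Complex x y : C); rewrite zs.
have sn : s != 0 by rewrite gt_eqF.
pose c := x / s.
have c1 : -1 <= c <= 1.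
  rewrite -ler_norml normrM normfV (gtr0_norm s0) ler_pdivrMr// mul1r.
  have := re_le_cabs (Complex x y : C); by rewrite zs.
have pi0 := pi_gt0 K.
have p2 : 2 * pi != 0 :> K by rewrite gt_eqF// mulr_gt0.
have ca : cos (acos c) = c by rewrite acosK.
have sa : sin (acos c) = `|y| / s.
  have e : 1 - c ^+ 2 = (`|y| / s) ^+ 2.
    rewrite /c !expr_div_n real_normK ?num_real//.
    by rewrite -[1](@divff _ (s ^+ 2)) ?expf_neq0// -h; ring.
  by rewrite sin_acos// e sqrtr_sqr ger0_norm// divr_ge0// ltW.
have a0 : 0 <= acos c by exact: acos_ge0.
have api : acos c <= pi by exact: acos_lepi.
have [y0|y0] := leP 0 y.
  exists (acos c / (2 * pi)).
    rewrite divr_ge0 ?mulr_ge0 ?(ltW pi0)//= ler_pdivrMr ?mulr_gt0// mul1r.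
    by apply: (le_trans api); rewrite ler_peMl ?(ltW pi0)// ler1n.
  rewrite /circ /circle_pt.
  have -> : 2 * pi * (acos c / (2 * pi)) = acos c by rewrite mulrC divfK.
  by rewrite ca sa (ger0_norm y0) /c; congr Complex; field.
exists (1 - acos c / (2 * pi)).
  rewrite subr_ge0 lerBlDr lerDl divr_ge0 ?mulr_ge0 ?(ltW pi0)// andbT.
  rewrite ler_pdivrMr ?mulr_gt0// mul1r.
  by apply: (le_trans api); rewrite ler_peMl ?(ltW pi0)// ler1n.
rewrite /circ /circle_pt.
have -> : 2 * pi * (1 - acos c / (2 * pi)) = - acos c + pi *+ 2.
  by rewrite mulrBr mulr1 [_ * (acos c / _)]mulrC divfK// addrC mulr_natl.
rewrite cosD2pi sinD2pi cosN sinN ca sa (ltr0_norm y0) /c.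
by congr Complex; field.
Qed.

Lemma circ_bounded s f : 0 < s -> circ_cont s f ->
  exists2 B : K, 0 <= B & forall z, cabs z = s -> cabs (f z) <= B.
Proof.
move=> s0 fc; have [B hB] := seg_bounded (seg_cont_circ (ltW s0) fc).
have hB' z : cabs z = s -> cabs (f z) <= B.
  by move=> /(circ_surj s0)[t t01 ->]; exact: hB.
exists B => //; apply: (le_trans (cabs_ge0 (f (circ s 0)))); apply: hB'.
by rewrite cabs_circ// ltW.
Qed.

Lemma cc_kernel s w : cabs w != s -> circ_cont s (fun z => (z - w)^-1).
Proof.
move=> ws; apply: ccV; last by apply: ccB; [exact: cc_id|exact: cc_cst].
by move=> z zs; rewrite subr_eq0; apply: contraNneq ws => <-; rewrite zs.
Qed.

(** The mean of f u vanishes on every circle for each u holomorphic on the annulus. Multiplying the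
    kernel z/(z - w) by w/z on the outer circle, or by z/w on the inner one, changes it by such a u;
    these factors have modulus below 1, and iteration drives both Cauchy integrals to 0. *)
Lemma identity_circle f a b s0 w : 0 <= a -> (forall z, a < cabs z < b -> hol f z) ->
  a < s0 < b -> (forall z, cabs z = s0 -> f z = 0) -> a < cabs w < b -> f w = 0.
Proof.
move=> a0 hf s0ab f0 /andP[aw wb].
pose s1 := (a + cabs w) / 2; pose s2 := (cabs w + b) / 2.
have [as1 s1w] : a < s1 /\ s1 < cabs w by rewrite /s1; split; lra.
have [ws2 s2b] : cabs w < s2 /\ s2 < b by rewrite /s2; split; lra.
have s10 := le_lt_trans a0 as1; have w0 := lt_trans s10 s1w; have s20 := lt_trans w0 ws2.
have s00 : 0 < s0 by case/andP: s0ab => /(le_lt_trans a0).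
have wn0 : w != 0 by rewrite -cabs_gt0.
have fc s : a < s < b -> circ_cont s f by move=> sab; apply: cc_hol => z zs; apply: hf; rewrite zs.
have van (u : C -> C) s : a < s < b -> (forall z, a < cabs z < b -> hol u z) ->
    cmean s (fun z => f z * u z) = 0.
  move=> sab hu; rewrite (@circle_const _ (fun z => f z * u z) a b s s0)//.
    rewrite -[RHS](cmean_cst s0 0); apply: eq_cmean; first exact: ltW.
    by move=> z /f0 ->; rewrite mul0r.
  by move=> z zab; apply: holM; [exact: hf|exact: hu].
have gen s (q : C -> C) (r : K) (B : K) : a < s < b -> cabs w != s ->
    (forall z, a < cabs z < b -> hol q z) -> (forall z, cabs z = s -> cabs (q z) <= r) ->
    0 <= r < 1 -> (forall z, cabs z = s -> z - w != 0) ->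
    (forall z, cabs z = s -> cabs (z * f z / (z - w)) <= B) ->
    (exists u, (forall z, a < cabs z < b -> hol u z) /\
      forall z, cabs z = s -> (1 - q z) * (z / (z - w)) = u z) ->
    cmean s (fun z => z * f z / (z - w)) = 0.
  move=> sab ws hq qr r01 zw hB [u [hu qu]].
  have sge : 0 <= s by case/andP: sab => /(le_lt_trans a0)/ltW.
  have kc := cc_kernel ws.
  have c1 : circ_cont s (fun z => z * f z / (z - w)).
    by apply: ccM; [apply: ccM; [exact: cc_id|exact: fc]|exact: kc].
  have cq : circ_cont s q by apply: cc_hol => z zs; apply: hq; rewrite zs.
  have step N : cmean s (fun z => z * f z / (z - w)) =
      cmean s (fun z => q z ^+ N * (z * f z / (z - w))).
    elim: N => [|N ->]; first by apply: eq_cmean => // z _; rewrite expr0 mul1r.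
    have cN n : circ_cont s (fun z => q z ^+ n * (z * f z / (z - w))).
      by apply: ccM; [exact: ccX|exact: c1].
    apply/eqP; rewrite -subr_eq0 -(cmeanB sge (cN _) (cN _)).
    rewrite -(van (fun z => q z ^+ N * u z) s sab); last first.
      by move=> z zab; apply: holM; [apply: holX; exact: hq|exact: hu].
    apply/eqP; apply: eq_cmean => // z zs; rewrite -(qu z zs) exprS; ring.
  apply/eqP; rewrite -cabs_eq0 eq_le cabs_ge0 andbT.
  apply: (@geo_le0 _ B r r01) => N; rewrite (step N) mulrC.
  apply: cmean_le => //; first by apply: ccM; [exact: ccX|exact: c1].
  move=> z zs; rewrite cabsM cabsX ler_pM ?exprn_ge0 ?cabs_ge0//; last exact: hB.
  by case/andP: r01 => r0 _; rewrite lerXn2r ?nnegrE ?cabs_ge0// qr.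
have zne z : a < cabs z < b -> z != 0.
  by move=> /andP[az _]; rewrite -cabs_gt0 (le_lt_trans a0).
have b1 s : a < s < b -> cabs w != s ->
    exists B, forall z, cabs z = s -> cabs (z * f z / (z - w)) <= B.
  move=> sab ws; have s0' : 0 < s by case/andP: sab => /(le_lt_trans a0).
  have [|B _ hB] := @circ_bounded s (fun z => z * f z / (z - w)) s0'; last by exists B.
  by apply: ccM; [apply: ccM; [exact: cc_id|exact: fc]|exact: cc_kernel].
have zw s z : cabs w != s -> cabs z = s -> z - w != 0.
  by move=> ws zs; rewrite subr_eq0; apply: contraNneq ws => <-; rewrite zs.
have s1ab : a < s1 < b by rewrite as1 (lt_trans s1w).
have s2ab : a < s2 < b by rewrite s2b (lt_trans aw).
have ws1 : cabs w != s1 by rewrite gt_eqF.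
have ws2' : cabs w != s2 by rewrite lt_eqF.
rewrite (cauchy_annulus a0 hf as1 s1w ws2 s2b).
have [B1 hB1] := b1 _ s1ab ws1; have [B2 hB2] := b1 _ s2ab ws2'.
rewrite (gen s2 (fun z => w / z) (cabs w / s2) B2 s2ab ws2')//; first last.
- exists (fun=> 1); split=> [z _|z zs]; first exact: hol_cst.
  by field; rewrite (zw _ _ ws2' zs) zne// zs.
- by move=> z; exact: zw.
- by rewrite divr_ge0 ?cabs_ge0 ?(ltW s20)//= ltr_pdivrMr// mul1r.
- by move=> z zs; rewrite cabsM cabsV zs.
- move=> z zab; apply: holM; first exact: hol_cst.
  by apply: holV; [exact: zne|exact: hol_id].
rewrite (gen s1 (fun z => z / w) (s1 / cabs w) B1 s1ab ws1)//; first last.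
- exists (fun z => - (z / w)); split=> [z _|z zs].
    by apply: holN; apply: holM; [exact: hol_id|exact: hol_cst].
  by field; rewrite (zw _ _ ws1 zs) wn0.
- by move=> z; exact: zw.
- by rewrite divr_ge0 ?cabs_ge0 ?(ltW s10)//= ltr_pdivrMr// mul1r.
- by move=> z zs; rewrite cabsM cabsV zs.
- by move=> z zab; apply: holM; [exact: hol_id|exact: hol_cst].
by rewrite subr0.
Qed.

(** Cauchy's formula for f^k gives |f w|^k <= s/(s - |w|) M^k, and letting k grow removes the
    constant. *)
Lemma max_principle f b s (M : K) w : (forall z, cabs z < b -> hol f z) -> 0 < s < b ->
  0 <= M -> (forall z, cabs z = s -> cabs (f z) <= M) -> cabs w <= s -> cabs (f w) <= M.
Proof.
move=> hf /andP[s0 sb] M0 fM; rewrite le_eqVlt => /orP[/eqP|ws]; first exact: fM.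
apply: (@pow_le_base _ _ (s / (s - cabs w))) => [|//|k]; first exact: cabs_ge0.
have hk z : cabs z < b -> hol (fun x => f x ^+ k) z by move=> zb; apply: holX; exact: hf.
have sge := ltW s0; have sw : 0 < s - cabs w by rewrite subr_gt0.
rewrite -cabsX -(cauchy_disc hk ws sb); apply: cmean_le => //.
  apply: ccM; last by apply: cc_kernel; rewrite lt_eqF.
  by apply: ccM; [exact: cc_id|apply: cc_hol => z zs; apply: hk; rewrite zs].
move=> z zs; rewrite !cabsM cabsV zs mulrAC; apply: ler_pM.
- by rewrite divr_ge0// cabs_ge0.
- exact: cabs_ge0.
- rewrite ler_wpM2l// lef_pV2 ?posrE//.
    by apply: le_trans (cabs_sub_ge _ _); rewrite zs.
  by apply: lt_le_trans sw _; apply: le_trans (cabs_sub_ge _ _); rewrite zs.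
- by rewrite cabsX lerXn2r ?nnegrE ?cabs_ge0// fM.
Qed.

Definition dq g y z : C := if z == y then derive1 g y else (g z - g y) / (z - y).

(** One integral represents the quotient on and off the diagonal, so holomorphy in z and a bound
    free of z - y follow without treating the removable singularity. *)
Lemma dq_cauchy g b s y z : (forall z, cabs z < b -> hol g z) -> cabs y < s -> cabs z < s ->
  s < b -> dq g y z = cmean s (fun x => x * g x / (x - y) / (x - z)).
Proof.
move=> hg ys zs sb; have s0 := le_lt_trans (cabs_ge0 y) ys; have sge := ltW s0.
have gc : circ_cont s g by apply: cc_hol => x xs; apply: hg; rewrite xs.
have ky : circ_cont s (fun x => (x - y)^-1) by apply: cc_kernel; rewrite lt_eqF.
have kz v : cabs v < s -> circ_cont s (fun x => (x - v)^-1).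
  by move=> vs; apply: cc_kernel; rewrite lt_eqF.
have cu : circ_cont s (fun x => x * g x / (x - y)).
  by apply: ccM; [apply: ccM; [exact: cc_id|exact: gc]|exact: ky].
have cug v : cabs v < s -> circ_cont s (fun x => x * g x / (x - v)).
  by move=> vs; apply: ccM; [apply: ccM; [exact: cc_id|exact: gc]|exact: kz].
pose Phi v := cmean s (fun x => x * g x / (x - y) / (x - v)).
have eqv v : cabs v < s -> g v - g y = (v - y) * Phi v.
  move=> vs; rewrite -(cauchy_disc hg vs sb) -(cauchy_disc hg ys sb).
  rewrite -(cmeanB sge (cug _ vs) (cug _ ys)).
  rewrite /Phi -(cmeanZ _ sge (ccM cu (kz _ vs))); apply: eq_cmean => // x xs.
  have ne u : cabs u < s -> x - u != 0.
    by move=> us; rewrite subr_eq0; apply: contraTneq us => <-; rewrite xs ltxx.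
  by field; rewrite !ne.
rewrite /dq; case: eqP => [zy|/eqP zy]; last first.
  by rewrite eqv// mulrAC mulfV ?mul1r// subr_eq0.
have [l hl] : hol Phi y.
  apply: (@cauchy_type_hol _ (fun t => (fun x => x * g x / (x - y)) (circ s t)) (circ s) y
    (s - cabs y)).
  - exact: (seg_cont_circ sge cu).
  - exact: (seg_cont_circ sge (cc_id s)).
  - by rewrite subr_gt0.
  - by move=> t _; apply: le_trans (cabs_sub_ge _ _); rewrite cabs_circ.
rewrite zy; apply: cderiv_derive1.
have sy : 0 < s - cabs y by rewrite subr_gt0.
apply: (@cderiv_ext _ (fun v => g y + (v - y) * Phi v) _ _ _ _ sy).
  move=> x xy; rewrite -eqv; first by rewrite addrC subrK.
  have -> : x = (x - y) + y by rewrite subrK.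
  by rewrite (le_lt_trans (cabsD _ _))// -ltrBrDr.
have := cdD (cd_cst (g y) y) (cdM (cdB (cd_id y) (cd_cst y y)) hl).
by rewrite subrr mul0r subr0 mulr1 !add0r.
Qed.

Lemma dq_bound g b s (M : K) y z : (forall z, cabs z < b -> hol g z) -> cabs y < s -> cabs z < s ->
  s < b -> (forall x, cabs x = s -> cabs (g x) <= M) ->
  cabs (dq g y z) <= s * M / ((s - cabs y) * (s - cabs z)).
Proof.
move=> hg ys zs sb gM; rewrite (dq_cauchy hg ys zs sb).
have s0 := le_lt_trans (cabs_ge0 y) ys; have sge := ltW s0.
apply: cmean_le => //.
  apply: ccM; last by apply: cc_kernel; rewrite lt_eqF.
  apply: ccM; last by apply: cc_kernel; rewrite lt_eqF.
  by apply: ccM; [exact: cc_id|apply: cc_hol => x xs; apply: hg; rewrite xs].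
move=> x xs; rewrite !cabsM !cabsV xs invfM mulrA.
have k v : cabs v < s -> 0 <= (cabs (x - v))^-1 <= (s - cabs v)^-1.
  move=> vs; have sv : 0 < s - cabs v by rewrite subr_gt0.
  have h : s - cabs v <= cabs (x - v) by apply: le_trans (cabs_sub_ge _ _); rewrite xs.
  by rewrite invr_ge0 cabs_ge0 lef_pV2 ?posrE// (lt_le_trans sv).
have /andP[k1 k2] := k _ ys; have /andP[k3 k4] := k _ zs.
by rewrite !ler_pM ?mulr_ge0 ?cabs_ge0// gM.
Qed.

Lemma dqE g b y z : (forall z, cabs z < b -> hol g z) ->
  g z = g y + (z - y) * dq g y z.
Proof.
move=> hg; rewrite /dq; case: eqP => [->|/eqP zy]; first by rewrite subrr mul0r addr0.
by field; rewrite subr_eq0.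
Qed.

Lemma dqyy g y : dq g y y = derive1 g y.
Proof. by rewrite /dq eqxx. Qed.

Lemma dq_hol g b y z : (forall z, cabs z < b -> hol g z) -> cabs y < b -> cabs z < b ->
  hol (dq g y) z.
Proof.
move=> hg yb zb; pose m := Num.max (cabs y) (cabs z).
have mb : m < b by rewrite gt_max yb zb.
pose s := (m + b) / 2; have ms : m < s by rewrite /s; lra.
have sb : s < b by rewrite /s; lra.
have ys : cabs y < s by apply: le_lt_trans ms; rewrite le_max lexx.
have zs : cabs z < s by apply: le_lt_trans ms; rewrite le_max lexx orbT.
have s0 := le_lt_trans (cabs_ge0 y) ys; have sge := ltW s0.
have gc : circ_cont s g by apply: cc_hol => x xs; apply: hg; rewrite xs.
have cu : circ_cont s (fun x => x * g x / (x - y)).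
  by apply: ccM; [apply: ccM; [exact: cc_id|exact: gc]|apply: cc_kernel; rewrite lt_eqF].
have sz : 0 < s - cabs z by rewrite subr_gt0.
apply: (@hol_ext _ (fun v => cmean s (fun x => x * g x / (x - y) / (x - v))) _ _ _ sz).
  move=> x xz; rewrite -(dq_cauchy hg ys _ sb)//.
  have -> : x = (x - z) + z by rewrite subrK.
  by rewrite (le_lt_trans (cabsD _ _))// -ltrBrDr.
apply: (@cauchy_type_hol _ (fun t => (fun x => x * g x / (x - y)) (circ s t)) (circ s) z
  (s - cabs z)).
- exact: (seg_cont_circ sge cu).
- exact: (seg_cont_circ sge (cc_id s)).
- exact: sz.
- by move=> t _; apply: le_trans (cabs_sub_ge _ _); rewrite cabs_circ.
Qed.

End Consequences.

(** * Reflection in the unit circle *)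

Section Reflection.
Variable K : realType.
Local Notation C := (Cplx K).
Implicit Types (f g : C -> C) (z w : C) (R s : K).

Definition cinv z : C := (cbar z)^-1.
(** The weight z^-2 is that of a differential form: up to sign, [refl f] dz is the conjugate of the
    pull-back of f dz by [cinv]. The transfer operator acts on such forms, hence commutes with
    [refl]. *)
Definition refl f z : C := (z^-1) ^+ 2 * cbar (f (cinv z)).

Lemma cabs_cinv z : cabs (cinv z) = (cabs z)^-1.
Proof. by rewrite cabsV cabs_bar. Qed.
Lemma cinvK : involutive cinv.
Proof. by move=> z; rewrite /cinv cbarV cbarK invrK. Qed.
Lemma cbar_cinv z : cbar (cinv z) = z^-1.
Proof. by rewrite /cinv cbarV cbarK. Qed.

Lemma annulus_cinv R z : 0 < R -> annulus R z -> annulus R (cinv z).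
Proof.
move=> R0 /andP[h1 h2]; have z0 := lt_trans R0 h1; have Ri : 0 < R^-1 by rewrite invr_gt0.
rewrite /annulus /= cabs_cinv -[X in X < _]invrK !ltf_pV2 ?posrE//.
by rewrite h1 h2.
Qed.

Lemma reflK f z : z != 0 -> refl (refl f) z = f z.
Proof.
move=> z0; rewrite /refl cinvK cbarM cbarX cbarV cbar_cinv invrK cbarK mulrA -exprMn.
by rewrite mulVf// expr1n mul1r.
Qed.

Lemma refl_hol f z : z != 0 -> hol f (cinv z) -> hol (refl f) z.
Proof.
move=> z0 hf; have hi : hol (fun x => x^-1) z by apply: holV => //; exact: hol_id.
apply: holM; first by apply: holX.
apply: (@hol_ext _ (fun x => cbar (f (cbar x^-1))) _ _ _ ltr01).
  by move=> x _; rewrite /cinv cbarV.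
apply: (@hol_comp _ (fun x => x^-1) (fun x => cbar (f (cbar x)))) => //.
by apply: hol_bar; rewrite cbarV.
Qed.

Lemma cmean_cinv s f : 0 < s -> cmean s (fun z => f (cinv z)) = cmean s^-1 f.
Proof.
move=> s0; apply: eq_mean => t _; congr f.
rewrite /cinv /circ [circle_pt s _]circle_ptE [RHS]circle_ptE cbarM cbar_rc invfM -rcV.
set u := circle_pt 1 _; have u1 : cabs u = 1 by exact: cabs_circle_pt.
have u0 : u != 0 by rewrite -cabs_gt0 u1.
have := mul_cbar u; rewrite u1 expr1n rc1 => h.
by rewrite (_ : (cbar u)^-1 = u)//; apply: (mulIf (_ : cbar u != 0)); rewrite ?cbar_eq0// mulVf ?cbar_eq0.
Qed.

End Reflection.

(** * The transfer operator as an integral operator and its duality with composition *)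

Section Transfer.
Variables (K : realType) (R s s0 r' : K).
Local Notation C := (Cplx K).
Hypothesis hrad : [/\ 0 < r', r' < R, R < s, s < s0 & s0 < 1].
Implicit Types (f g h : C -> C) (z w : C).

Let r'0 : 0 < r'. Proof. by case: hrad. Qed.
Let r'R : r' < R. Proof. by case: hrad. Qed.
Let Rs : R < s. Proof. by case: hrad. Qed.
Let ss0 : s < s0. Proof. by case: hrad. Qed.
Let s01 : s0 < 1. Proof. by case: hrad. Qed.
Let R0 : 0 < R. Proof. exact: lt_trans r'R. Qed.
Let s_gt0 : 0 < s. Proof. exact: lt_trans Rs. Qed.
Let s_ge0 : 0 <= s. Proof. exact: ltW. Qed.
Let s_lt1 : s < 1. Proof. exact: lt_trans s01. Qed.

Definition an f := forall z, annulus R z -> hol f z.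
Definition selfmap g := forall z, cabs z < s0 -> hol g z /\ cabs (g z) <= r'.

(** This is 1/(2 pi i) times the integral of f h dz over C_s. Against h holomorphic in the disc it
    sees only the part of f that is singular inside; the other part of f is read off from
    [refl f]. *)
Definition pair f h : C := cmean s (fun z => z * f z * h z).
Definition inner_op g f w : C := pair f (fun z => (w - g z)^-1).
(** The reflection of the inner operator applied to [refl f], less its w^-1 term. That correction
    removes the singularity at w = 0, so the result is holomorphic on |w| < 1/r' and is annihilated
    by pairings with functions holomorphic in the disc. *)
Definition outer_op g f w : C := cbar (pair (refl f) (fun z => g z / (1 - cbar w * g z))).
Definition transfer g f w : C := inner_op g f w + outer_op g f w.

Lemma s_annulus z : cabs z = s -> annulus R z.
Proof.
move=> zs; rewrite /annulus /= zs Rs (lt_trans s_lt1)// invf_gt1//.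
exact: lt_trans s_lt1.
Qed.

Lemma an_cc f : an f -> circ_cont s f.
Proof. by move=> hf; apply: cc_hol => z /s_annulus/hf. Qed.

Lemma annulus_neq0 z : annulus R z -> z != 0.
Proof. by move=> /andP[h _]; rewrite -cabs_gt0 (lt_trans R0). Qed.

Lemma an_refl f : an f -> an (refl f).
Proof.
move=> hf z zR; apply: refl_hol; first exact: annulus_neq0.
by apply: hf; exact: annulus_cinv.
Qed.

Lemma disc_cc h : (forall z, cabs z < s0 -> hol h z) -> circ_cont s h.
Proof. by move=> hh; apply: cc_hol => z zs; apply: hh; rewrite zs. Qed.

Lemma selfmap_cc g : selfmap g -> circ_cont s g.
Proof. by move=> hg; apply: disc_cc => z /hg[]. Qed.

Lemma pair_cc f h : circ_cont s f -> circ_cont s h -> circ_cont s (fun z => z * f z * h z).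
Proof. by move=> cf ch; apply: ccM => //; apply: ccM => //; exact: cc_id. Qed.

Lemma pair_le f h (M N : K) : circ_cont s f -> circ_cont s h ->
  (forall z, cabs z = s -> cabs (f z) <= M) -> (forall z, cabs z = s -> cabs (h z) <= N) ->
  cabs (pair f h) <= M * N.
Proof.
move=> cf ch fM hN; apply: cmean_le => //; first exact: pair_cc.
move=> z zs; rewrite !cabsM zs; have := fM _ zs; have := hN _ zs.
have := cabs_ge0 (f z); have := cabs_ge0 (h z) => h1 h2 h3 h4.
rewrite ler_pM ?mulr_ge0 ?cabs_ge0//; apply: le_trans h4.
by rewrite ler_piMl ?cabs_ge0// ltW.
Qed.

Lemma eq_pair f f' h h' : (forall z, cabs z = s -> f z = f' z) ->
  (forall z, cabs z = s -> h z = h' z) -> pair f h = pair f' h'.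
Proof. by move=> ff hh; apply: eq_cmean => // z zs; rewrite ff// hh. Qed.

Lemma pairD f f' h : circ_cont s f -> circ_cont s f' -> circ_cont s h ->
  pair (fun z => f z + f' z) h = pair f h + pair f' h.
Proof.
move=> cf cf' ch; rewrite /pair -(cmeanD s_ge0 (pair_cc cf ch) (pair_cc cf' ch)).
by apply: eq_cmean => // z _; ring.
Qed.
Lemma pairZ c f h : circ_cont s f -> circ_cont s h ->
  pair (fun z => c * f z) h = c * pair f h.
Proof.
move=> cf ch; rewrite /pair -(cmeanZ _ s_ge0 (pair_cc cf ch)).
by apply: eq_cmean => // z _; ring.
Qed.
Lemma pairDr f h h' : circ_cont s f -> circ_cont s h -> circ_cont s h' ->
  pair f (fun z => h z + h' z) = pair f h + pair f h'.
Proof.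
move=> cf ch ch'; rewrite /pair -(cmeanD s_ge0 (pair_cc cf ch) (pair_cc cf ch')).
by apply: eq_cmean => // z _; ring.
Qed.
Lemma pairZr c f h : circ_cont s f -> circ_cont s h ->
  pair f (fun z => c * h z) = c * pair f h.
Proof.
move=> cf ch; rewrite /pair -(cmeanZ _ s_ge0 (pair_cc cf ch)).
by apply: eq_cmean => // z _; ring.
Qed.
Lemma pair_sumr (I : Type) (l : seq I) (F : I -> C -> C) f : circ_cont s f ->
  (forall i, circ_cont s (F i)) ->
  pair f (fun z => \sum_(i <- l) F i z) = \sum_(i <- l) pair f (F i).
Proof.
move=> cf cF; elim: l => [|i l IH].
  rewrite big_nil -[RHS](cmean_cst s 0); apply: eq_cmean => // z _.
  by rewrite big_nil mulr0.
rewrite big_cons -IH -pairDr//; last first.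
  elim: l {IH} => [|j l IH].
    rewrite (_ : (fun z => _) = (fun=> 0)); first exact: cc_cst.
    by apply/funext => z; rewrite big_nil.
  rewrite (_ : (fun z => _) = (fun z => F j z + \sum_(k <- l) F k z)); first exact: ccD.
  by apply/funext => z; rewrite big_cons.
by apply: eq_pair => // z _; rewrite big_cons.
Qed.

Lemma pair_disc f h : (forall z, cabs z < s0 -> hol f z) ->
  (forall z, cabs z < s0 -> hol h z) -> pair f h = 0.
Proof.
move=> hf hh; rewrite -[RHS](@cmean_mul_disc _ (fun z => f z * h z) s0 s).
- by apply: eq_cmean => // z _; rewrite mulrA.
- by rewrite s_gt0.
- by move=> z zs; apply: holM; [exact: hf|exact: hh].
Qed.

Lemma inner_gap g w z : selfmap g -> r' < cabs w -> cabs z < s0 ->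
  cabs w - r' <= cabs (w - g z).
Proof.
move=> hg rw zs; apply: le_trans (cabs_sub_ge _ _); rewrite lerD2l lerN2.
by have [] := hg _ zs.
Qed.

Lemma inner_neq0 g w z : selfmap g -> r' < cabs w -> cabs z < s0 -> w - g z != 0.
Proof.
move=> hg rw zs; rewrite -cabs_gt0; apply: lt_le_trans (inner_gap hg rw zs).
by rewrite subr_gt0.
Qed.

Lemma outer_gap g w z : selfmap g -> cabs z < s0 -> 1 - cabs w * r' <= cabs (1 - cbar w * g z).
Proof.
move=> hg zs; apply: le_trans (cabs_sub_ge _ _); rewrite cabs1 lerD2l lerN2 cabsM cabs_bar.
by rewrite ler_wpM2l ?cabs_ge0//; have [] := hg _ zs.
Qed.

Lemma outer_neq0 g w z : selfmap g -> cabs w < r'^-1 -> cabs z < s0 -> 1 - cbar w * g z != 0.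
Proof.
move=> hg rw zs; rewrite -cabs_gt0; apply: lt_le_trans (outer_gap w hg zs).
by rewrite subr_gt0 -ltr_pdivlMr// mul1r.
Qed.

Lemma inner_kernel_hol g w z : selfmap g -> r' < cabs w -> cabs z < s0 ->
  hol (fun z => (w - g z)^-1) z.
Proof.
move=> hg rw zs; apply: holV; first exact: inner_neq0.
by apply: holB; [exact: hol_cst|have [] := hg _ zs].
Qed.

Lemma outer_kernel_hol g w z : selfmap g -> cabs w < r'^-1 -> cabs z < s0 ->
  hol (fun z => g z / (1 - cbar w * g z)) z.
Proof.
move=> hg rw zs; have [hgz _] := hg _ zs; apply: holM => //; apply: holV; first exact: outer_neq0.
by apply: holB; [exact: hol_cst|apply: holM; [exact: hol_cst|]].
Qed.

Lemma inner_kernel_cc g w : selfmap g -> r' < cabs w -> circ_cont s (fun z => (w - g z)^-1).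
Proof. by move=> hg rw; apply: disc_cc => z; exact: inner_kernel_hol. Qed.
Lemma outer_kernel_cc g w : selfmap g -> cabs w < r'^-1 ->
  circ_cont s (fun z => g z / (1 - cbar w * g z)).
Proof. by move=> hg rw; apply: disc_cc => z; exact: outer_kernel_hol. Qed.

Lemma inner_hol g f w : selfmap g -> circ_cont s f -> r' < cabs w -> hol (inner_op g f) w.
Proof.
move=> hg cf rw.
have cU := seg_cont_circ s_ge0 (ccM (cc_id s) cf).
have cA := seg_cont_circ s_ge0 (ccM (cc_cst s (- 1)) (selfmap_cc hg)).
have g0 : 0 < cabs w - r' by rewrite subr_gt0.
have hgap t : 0 <= t <= 1 -> cabs w - r' <= cabs (-1 * g (circ s t) - w * -1).
  move=> _; have -> : -1 * g (circ s t) - w * -1 = w - g (circ s t) by ring.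
  by apply: inner_gap; rewrite ?cabs_circ.
have [l hl] := cderiv_hol (cauchy_type_cderiv cU cA (scC (- 1)) g0 hgap); exists l.
apply: (@cderiv_ext _ _ _ _ _ _ ltr01 _ hl) => x _; apply: eq_mean => t _.
by have -> : -1 * g (circ s t) - x * -1 = x - g (circ s t) by ring.
Qed.

Lemma outer_hol g f w : selfmap g -> circ_cont s (refl f) -> cabs w < r'^-1 ->
  hol (outer_op g f) w.
Proof.
move=> hg cf rw.
apply: (@hol_bar _ (fun v => pair (refl f) (fun z => g z / (1 - v * g z)))).
have cg := selfmap_cc hg.
have cU := seg_cont_circ s_ge0 (ccM (ccM (cc_id s) cf) cg).
have cB := seg_cont_circ s_ge0 cg.
have g0 : 0 < 1 - cabs w * r' by rewrite subr_gt0 -ltr_pdivlMr// mul1r.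
have hgap t : 0 <= t <= 1 -> 1 - cabs w * r' <= cabs (1 - cbar w * g (circ s t)).
  by move=> _; apply: outer_gap; rewrite ?cabs_circ.
have [l hl] := cderiv_hol (cauchy_type_cderiv cU (scC 1) cB g0 hgap); exists l.
apply: (@cderiv_ext _ _ _ _ _ _ ltr01 _ hl) => x _; apply: eq_mean => t _.
by rewrite mulrA.
Qed.

Lemma transfer_hol g f w : selfmap g -> circ_cont s f -> circ_cont s (refl f) ->
  r' < cabs w < r'^-1 -> hol (transfer g f) w.
Proof. by move=> hg cf cf' /andP[h1 h2]; apply: holD; [exact: inner_hol|exact: outer_hol]. Qed.

Lemma annulus_radii w : annulus R w -> r' < cabs w < r'^-1.
Proof.
move=> /andP[h1 h2]; rewrite (lt_trans r'R)//= (lt_trans h2)//.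
by rewrite ltf_pV2 ?posrE.
Qed.

Lemma inner_le g f w (M : K) : selfmap g -> circ_cont s f ->
  (forall z, cabs z = s -> cabs (f z) <= M) -> R <= cabs w ->
  cabs (inner_op g f w) <= M / (R - r').
Proof.
move=> hg cf fM Rw; have rw := lt_le_trans r'R Rw.
apply: pair_le => //; first exact: inner_kernel_cc.
move=> z zs; rewrite cabsV lef_pV2 ?posrE ?subr_gt0//.
  by apply: le_trans (inner_gap hg rw _); rewrite ?lerD2r// zs.
by rewrite cabs_gt0 inner_neq0// zs.
Qed.

Lemma outer_le g f w (M : K) : selfmap g -> circ_cont s (refl f) ->
  (forall z, cabs z = s -> cabs (refl f z) <= M) -> cabs w <= R^-1 ->
  cabs (outer_op g f w) <= M / (1 - r' / R).
Proof.
move=> hg cf fM wR; rewrite cabs_bar.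
have wr : cabs w < r'^-1 by rewrite (le_lt_trans wR)// ltf_pV2 ?posrE.
have q0 : 0 < 1 - r' / R by rewrite subr_gt0 ltr_pdivrMr// mul1r.
apply: pair_le => //; first exact: outer_kernel_cc.
move=> z zs; have zs0 : cabs z < s0 by rewrite zs.
have gz : cabs (g z) <= 1.
  have [_ h] := hg _ zs0; rewrite (le_trans h)// ltW// (lt_trans r'R)// (lt_trans Rs)//.
rewrite cabsM cabsV -[leRHS]mul1r ler_pM ?invr_ge0 ?cabs_ge0//.
rewrite lef_pV2 ?posrE//; last by rewrite cabs_gt0 outer_neq0.
apply: le_trans (outer_gap w hg zs0); rewrite lerD2l lerN2 mulrC.
by rewrite ler_wpM2l// ltW.
Qed.

Lemma dmean_mean (G : K -> K -> C) N : (forall t, seg_cont (G t)) ->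
  seg_cont (fun u => dmean (fun t => G t u) N) /\
  dmean (fun t => mean (G t)) N = mean (fun u => dmean (fun t => G t u) N).
Proof.
move=> cG.
have key n (P : nat -> K) : seg_cont (fun u => \sum_(k < n) G (P k) u) /\
    \sum_(k < n) mean (G (P k)) = mean (fun u => \sum_(k < n) G (P k) u).
  elim: n => [|n [IH1 IH2]].
    have -> : (fun u => \sum_(k < 0) G (P k) u) = (fun=> 0).
      by apply/funext => u; rewrite big_ord0.
    by split; [exact: scC|rewrite big_ord0 mean_cst].
  have -> : (fun u => \sum_(k < n.+1) G (P k) u) =
      (fun u => \sum_(k < n) G (P k) u + G (P n) u).
    by apply/funext => u; rewrite big_ord_recr.
  split; first exact: scD.
  by rewrite big_ord_recr /= IH2 meanD.
have [h1 h2] := key (2 ^ N)%N (fun k => k%:R / 2 ^+ N).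
split; first exact: scM (scC _) h1.
by rewrite /dmean h2 meanZ.
Qed.

(** An exchange of integrals in which one of them is a Riemann sum: a finite sum commutes with
    [mean], and by [mean_rate] it is close, uniformly in the other variable, to Cauchy's formula for
    h at g z. Uniformity comes from g mapping C_s into the disc of radius r' < s. *)
Lemma pair_inner g f h : selfmap g -> circ_cont s f -> (forall z, cabs z < s0 -> hol h z) ->
  pair (inner_op g f) h = pair f (fun z => h (g z)).
Proof.
move=> hg cf hh.
have hgz z : cabs z = s -> cabs (g z) <= r' by move=> zs; have [] := hg z; rewrite ?zs.
have r's0 : r' < s0 by rewrite (lt_trans r'R)// (lt_trans Rs).
have r's : r' < s by rewrite (lt_trans r'R).
have chg : circ_cont s (fun z => h (g z)).
  apply: disc_cc => z /hg[h1 h2]; apply: hol_comp => //; apply: hh.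
  exact: le_lt_trans h2 _.
have [B B0 hB] := circ_bounded s_gt0 cf.
have ch := disc_cc hh; have [D D0 hD] := circ_bounded s_gt0 ch.
have csr : 0 < s - r' by rewrite subr_gt0.
pose H t := circ s t * h (circ s t).
have cH : seg_cont H := seg_cont_circ s_ge0 (ccM (cc_id s) ch).
have cW : seg_cont (circ s) by split=> t _; exact: circ_cont_t.
have cin : circ_cont s (inner_op g f).
  by apply: cc_hol => w ws; apply: inner_hol => //; rewrite ws.
have cX := seg_cont_circ s_ge0 (pair_cc cin ch).
apply/eqP; rewrite -subr_eq0 -cabs_eq0 eq_le cabs_ge0 andbT.
apply/ler_addgt0Pr => e e0; rewrite add0r.
(* Chosen so that the final bound [B * q] equals eta (c1 - 1). *)
pose c1 := B / (s - r') + B * D / (s - r') ^+ 2 + 1.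
have c10 : 0 < c1.
  by rewrite /c1 ltr_wpDl// addr_ge0// ?divr_ge0 ?mulr_ge0 ?exprn_ge0// ltW.
pose eta := e / c1; have eta0 : 0 < eta by rewrite divr_gt0.
have [d1 d10 hd1] := seg_cont_unif cH eta0.
have [d2 d20 hd2] := seg_cont_unif cW eta0.
have [N0 hN0] := exp2V_lt d10; have [N1 hN1] := exp2V_lt d20.
apply: (cabs_lim_le (dmean_cvg cX)); exists (maxn N0 N1) => // N /=.
rewrite geq_max => /andP[NN0 NN1].
pose G t u := H t * (circ s u * f (circ s u) / (circ s t - g (circ s u))).
have cG t : seg_cont (G t).
  apply: scM; first exact: scC.
  have rw : r' < cabs (circ s t) by rewrite cabs_circ.
  exact: (seg_cont_circ s_ge0 (ccM (ccM (cc_id s) cf) (inner_kernel_cc hg rw))).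
have [cD eD] := dmean_mean N cG.
have -> : dmean (fun t => circ s t * inner_op g f (circ s t) * h (circ s t)) N =
    dmean (fun t => mean (G t)) N.
  rewrite /dmean; congr (_ * _); apply: eq_bigr => i _; set t := _ / _.
  have rw : r' < cabs (circ s t) by rewrite cabs_circ.
  rewrite /G (meanZ _ (seg_cont_circ s_ge0 (ccM (ccM (cc_id s) cf) (inner_kernel_cc hg rw)))).
  by rewrite /H /inner_op /pair /cmean mulrAC.
rewrite eD.
have cP := seg_cont_circ s_ge0 (pair_cc cf chg).
have cP1 := scM (scC (- 1)) cP.
have -> : mean (fun u => dmean (fun t => G t u) N) - pair f (fun z => h (g z)) =
    mean (fun u => dmean (fun t => G t u) N +
      -1 * (circ s u * f (circ s u) * h (g (circ s u)))).
  by rewrite (meanD cD cP1) (meanZ _ cP) mulN1r.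
apply: (mean_le (scD cD cP1)) => u u01.
set z := circ s u; have zs : cabs z = s by rewrite cabs_circ.
have gz := hgz z zs; have gs : cabs (g z) < s := le_lt_trans gz r's.
have wne t : circ s t - g z != 0.
  rewrite subr_eq0; apply: contraTneq gs => <-; rewrite cabs_circ//; by rewrite ltxx.
have gap t : s - r' <= cabs (circ s t - g z).
  by apply: le_trans (cabs_sub_ge _ _); rewrite cabs_circ// lerD2l lerN2.
pose Q t := H t / (circ s t - g z).
have cQ : seg_cont Q.
  have gsn : cabs (g z) != s by rewrite lt_eqF.
  exact: (seg_cont_circ s_ge0 (ccM (ccM (cc_id s) ch) (cc_kernel gsn))).
have mQ : mean Q = h (g z).
  exact: (cauchy_disc hh gs ss0).
have -> : dmean (fun t => G t u) N = z * f z * dmean Q N.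
  by rewrite -dmeanZ /dmean; congr (_ * _); apply: eq_bigr => i _; rewrite /G /Q -/z; ring.
rewrite -mQ mulN1r -mulrBr cabsM.
have fz : cabs (z * f z) <= B.
  by rewrite cabsM zs; apply: le_trans (hB _ zs); rewrite ler_piMl ?cabs_ge0// ltW.
pose q := eta / (s - r') + D * eta / (s - r') ^+ 2.
have rate : cabs (dmean Q N - mean Q) <= q.
  rewrite cabsBC; apply: (mean_rate cQ) => t t' t01 t'01 tt'.
  have k1 : cabs (H t - H t') <= eta.
    apply/ltW/hd1 => //; apply: le_lt_trans tt' (le_lt_trans _ hN0).
    by rewrite lef_pV2 ?posrE ?exprn_gt0// ler_eXn2l// ltr1n.
  have k2 : cabs (circ s t - circ s t') <= eta.
    apply/ltW/hd2 => //; apply: le_lt_trans tt' (le_lt_trans _ hN1).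
    by rewrite lef_pV2 ?posrE ?exprn_gt0// ler_eXn2l// ltr1n.
  have -> : Q t - Q t' = (H t - H t') / (circ s t - g z) -
      H t' * (circ s t - circ s t') / ((circ s t - g z) * (circ s t' - g z)).
    by rewrite /Q; field; rewrite !wne.
  apply: le_trans (cabsB _ _) _; apply: lerD.
    rewrite cabsM cabsV ler_pM ?invr_ge0 ?cabs_ge0//.
    by rewrite lef_pV2 ?posrE ?cabs_gt0.
  rewrite !cabsM cabsV cabsM expr2 ler_pM ?invr_ge0 ?mulr_ge0 ?cabs_ge0//.
    rewrite ler_pM ?mulr_ge0 ?cabs_ge0// cabs_circ//; apply: le_trans (hD (circ s t') _).
      by rewrite ler_piMl ?cabs_ge0// ltW.
    by rewrite cabs_circ.
  rewrite lef_pV2 ?posrE ?mulr_gt0 ?cabs_gt0//.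
  by rewrite ler_pM ?(ltW csr)//; exact: gap.
apply: (@le_trans _ _ (B * q)); first by rewrite ler_pM ?cabs_ge0.
have -> : B * q = eta * (c1 - 1) by rewrite /q /c1; ring.
apply: (@le_trans _ _ (eta * c1)); first by rewrite ler_wpM2l ?(ltW eta0)// lerBlDr lerDl.
by rewrite /eta divfK// gt_eqF.
Qed.

(** The outer part is holomorphic in the disc and pairs to 0, so only [pair_inner] is left. *)
Lemma pair_transfer g f h : selfmap g -> an f -> (forall z, cabs z < s0 -> hol h z) ->
  pair (transfer g f) h = pair f (fun z => h (g z)).
Proof.
move=> hg hf hh; have cf := an_cc hf; have cf' := an_cc (an_refl hf); have ch := disc_cc hh.
have s0r : s0 < r'^-1.
  rewrite (lt_trans s01)// invf_gt1// (lt_trans r'R)// (lt_trans Rs)//.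
have ho z : cabs z < s0 -> hol (outer_op g f) z.
  by move=> zs; apply: outer_hol => //; apply: lt_trans s0r.
rewrite -(pair_inner hg cf hh) /transfer pairD//; last 2 first.
- by apply: cc_hol => w ws; apply: inner_hol => //; rewrite ws (lt_trans r'R).
- exact: disc_cc.
by rewrite (pair_disc ho hh) addr0.
Qed.

(** Reflection exchanges the circles of radius s and 1/s, and the mean of z f z is the same on
    both. *)
Lemma pair1_refl f : an f -> pair (refl f) (fun=> 1) = cbar (pair f (fun=> 1)).
Proof.
move=> hf; have sR : annulus R (rc s : C).
  by apply: s_annulus; rewrite cabs_rc ger0_norm.
have hh z : R < cabs z < R^-1 -> hol (fun x => x * f x) z.
  by move=> zR; apply: holM; [exact: hol_id|exact: hf].
have e : cmean s (fun z => z * f z) = cmean s^-1 (fun z => z * f z).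
  apply: (@circle_const _ _ R R^-1) => //; first exact: ltW.
    by move: sR; rewrite /annulus /= cabs_rc ger0_norm.
  have := annulus_cinv R0 sR.
  by rewrite /annulus /= cabs_cinv cabs_rc ger0_norm.
have e1 : pair f (fun=> 1) = cmean s (fun z => z * f z).
  by apply: eq_cmean => // z _; rewrite mulr1.
have c2 : circ_cont s (fun z => z * refl f z).
  by apply: ccM; [exact: cc_id|exact/an_cc/an_refl].
have e2 : pair (refl f) (fun=> 1) = cmean s (fun z => z * refl f z).
  by apply: eq_cmean => // z _; rewrite mulr1.
rewrite e1 e e2 -(cmean_cinv (fun z => z * f z) s_gt0) -[LHS]cbarK -(cmean_bar s_ge0 c2).
have -> // : cmean s (fun z => cbar (z * refl f z)) = cmean s (fun z => cinv z * f (cinv z)).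
apply: eq_cmean => // z /s_annulus/annulus_neq0 z0.
have -> : z * refl f z = z^-1 * cbar (f (cinv z)) by rewrite /refl; field.
by rewrite cbarM cbarV cbarK.
Qed.

(** Reflection interchanges the inner and the outer operator up to two terms in w^-1, which cancel
    by [pair1_refl]. *)
Lemma refl_transfer g f w : selfmap g -> an f -> annulus R w ->
  refl (transfer g f) w = transfer g (refl f) w.
Proof.
move=> hg hf wR; have w0 := annulus_neq0 wR.
have cf := an_cc hf; have cf' := an_cc (an_refl hf).
have /andP[rw wr] := annulus_radii wR.
have c1 : circ_cont s (fun=> 1 : C) by exact: cc_cst.
have cb0 : cbar w != 0 by rewrite cbar_eq0.
have cI (v : C) : cabs v < r'^-1 -> circ_cont s (fun z => (1 - cbar v * g z)^-1).
  move=> vr; apply: disc_cc => z zs; have [hgz _] := hg _ zs; apply: holV.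
    exact: outer_neq0.
  by apply: holB; [exact: hol_cst|apply: holM; [exact: hol_cst|]].
have e1 : (w^-1) ^+ 2 * cbar (inner_op g f (cinv w)) = outer_op g (refl f) w +
    w^-1 * cbar (pair f (fun=> 1)).
  have -> : outer_op g (refl f) w =
      cbar ((cbar w)^-1 * pair f (fun z => (1 - cbar w * g z)^-1) +
            - (cbar w)^-1 * pair f (fun=> 1)).
    have cIw := cI w wr.
    rewrite -!pairZr// -pairDr; last 3 first.
    - exact: cf.
    - by apply: ccM; [exact: cc_cst|exact: cIw].
    - exact: cc_cst.
    congr cbar; apply: eq_pair => z zs.
      by rewrite reflK//; apply/annulus_neq0/s_annulus.
    have n0 : 1 - cbar w * g z != 0 by apply: outer_neq0; rewrite ?zs.
    by field; rewrite n0 cb0.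
  have -> : inner_op g f (cinv w) = cbar w * pair f (fun z => (1 - cbar w * g z)^-1).
    rewrite -pairZr; [|exact: cf|exact: cI].
    apply: eq_pair => // z zs; have n0 : 1 - cbar w * g z != 0 by apply: outer_neq0; rewrite ?zs.
    have e3 : cinv w - g z = (1 - cbar w * g z) / cbar w by rewrite /cinv; field.
    by rewrite e3 invfM invrK mulrC.
  rewrite !cbarD !cbarM cbarN cbarV cbarK; field; exact: w0.
have e2 : (w^-1) ^+ 2 * cbar (outer_op g f (cinv w)) = inner_op g (refl f) w -
    w^-1 * pair (refl f) (fun=> 1).
  have cK : circ_cont s (fun z => (w - g z)^-1) by exact: inner_kernel_cc.
  have -> : inner_op g (refl f) w - w^-1 * pair (refl f) (fun=> 1) =
      pair (refl f) (fun z => (w - g z)^-1 + - w^-1 * 1).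
    rewrite pairDr//; last exact: ccM (cc_cst _ _) c1.
    by rewrite (pairZr _ cf' c1) mulNr.
  rewrite /outer_op cbarK -pairZr//; last first.
    apply: outer_kernel_cc => //; rewrite cabs_cinv ltf_pV2 ?posrE ?cabs_gt0//.
  apply: eq_pair => // z zs; rewrite cbar_cinv.
  have n0 : w - g z != 0 by apply: inner_neq0; rewrite ?zs.
  have e3 : 1 - w^-1 * g z = (w - g z) / w by field.
  by rewrite e3; field; rewrite n0 w0.
rewrite /refl /transfer cbarD mulrDr -/(transfer _ _) e1 e2 pair1_refl//; ring.
Qed.

(** The kernels of h are admissible test functions, so both halves reduce to [pair_transfer], the
    outer one after [refl_transfer]. *)
Lemma transfer_comp g h f w : selfmap g -> selfmap h -> an f -> annulus R w ->
  transfer h (transfer g f) w = transfer (fun z => h (g z)) f w.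
Proof.
move=> hg hh hf wR; have /andP[rw wr] := annulus_radii wR; congr (_ + _).
  rewrite /inner_op pair_transfer// => z zs; exact: inner_kernel_hol.
rewrite /outer_op; congr cbar.
rewrite -(@pair_transfer g (refl f) (fun z => h z / (1 - cbar w * h z)))//.
- by apply: eq_pair => // z /s_annulus zs; rewrite refl_transfer.
- exact: an_refl.
- by move=> z zs; exact: outer_kernel_hol.
Qed.

Lemma eq_transfer g g' f f' w : (forall z, cabs z = s -> g z = g' z) ->
  (forall z, annulus R z -> f z = f' z) -> transfer g f w = transfer g' f' w.
Proof.
move=> gg ff; have ffs z : cabs z = s -> f z = f' z by move=> /s_annulus/ff.
congr (_ + _).
  by apply: eq_pair => // z zs; rewrite gg.
congr cbar; apply: eq_pair => z zs; last by rewrite gg.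
by rewrite /refl ff//; apply: annulus_cinv => //; exact: s_annulus.
Qed.

Lemma transfer_lin g a f f' w : selfmap g -> an f -> an f' -> annulus R w ->
  transfer g (fun z => a * f z + f' z) w = a * transfer g f w + transfer g f' w.
Proof.
move=> hg hf hf' wR; have /andP[rw wr] := annulus_radii wR.
have c := an_cc hf; have c' := an_cc hf'.
have d := an_cc (an_refl hf); have d' := an_cc (an_refl hf').
have k := inner_kernel_cc hg rw; have k' := outer_kernel_cc hg wr.
have e1 : inner_op g (fun z => a * f z + f' z) w = a * inner_op g f w + inner_op g f' w.
  rewrite /inner_op pairD//; last exact: ccM (cc_cst _ _) c.
  by rewrite pairZ.
have e2 : outer_op g (fun z => a * f z + f' z) w = a * outer_op g f w + outer_op g f' w.
  rewrite /outer_op -[a in RHS]cbarK -cbarM -cbarD -pairZ// -pairD//.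
    by congr cbar; apply: eq_pair => // z _; rewrite /refl cbarD cbarM; ring.
  exact: ccM (cc_cst _ _) d.
rewrite /transfer e1 e2; ring.
Qed.

End Transfer.

(** * Blaschke products on the circle and partial fractions over a fibre *)

Section Blaschke.
Variable K : realType.
Local Notation C := (Cplx K).
Implicit Types (z w y a : C) (l : seq C).

Lemma cabs_lt1_sq a : cabs a < 1 -> cabs a ^+ 2 < 1.
Proof. by move=> a1; rewrite expr_lt1// cabs_ge0. Qed.

Lemma blaschke_identity a z : cabs (1 - cbar a * z) ^+ 2 - cabs (z - a) ^+ 2 =
  (1 - cabs a ^+ 2) * (1 - cabs z ^+ 2).
Proof.
apply: rc_inj.
transitivity ((1 - cbar a * z) * cbar (1 - cbar a * z) - (z - a) * cbar (z - a)).
  by rewrite !mul_cbar rcB.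
rewrite rcM !rcB rc1 -!mul_cbar !cbarB cbarM cbarK cbar1; ring.
Qed.

Lemma den_neq0 a z : cabs a < 1 -> cabs z <= 1 -> 1 - cbar a * z != 0.
Proof.
move=> a1 z1; rewrite subr_eq0; apply: contraTneq a1 => h.
have := cabs1 K; rewrite h cabsM cabs_bar => e.
by rewrite -leNgt -e ler_piMr// cabs_ge0.
Qed.

Lemma factor_lt a z : cabs a < 1 -> cabs z < 1 -> cabs (z - a) < cabs (1 - cbar a * z).
Proof.
move=> a1 z1; rewrite -(@ltr_pXn2r _ 2)// ?nnegrE ?cabs_ge0// -subr_gt0 blaschke_identity.
by rewrite mulr_gt0// subr_gt0 cabs_lt1_sq.
Qed.
Lemma factor_eq a z : cabs z = 1 -> cabs (z - a) = cabs (1 - cbar a * z).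
Proof.
move=> z1; apply/eqP; rewrite -(eqrXn2 (n := 2))// ?cabs_ge0// eq_sym -subr_eq0.
by rewrite blaschke_identity z1 expr1n subrr mulr0.
Qed.
Lemma factor_gt a z : cabs a < 1 -> 1 < cabs z -> cabs (1 - cbar a * z) < cabs (z - a).
Proof.
move=> a1 z1; rewrite -(@ltr_pXn2r _ 2)// ?nnegrE ?cabs_ge0// -subr_lt0 blaschke_identity.
by rewrite pmulr_rlt0 ?subr_lt0 ?exprn_egt1// subr_gt0 cabs_lt1_sq.
Qed.

Definition num_fun l z : C := \prod_(a <- l) (z - a).
Definition den_fun l z : C := \prod_(a <- l) (1 - cbar a * z).
Definition bprod l z : C := \prod_(a <- l) ((z - a) / (1 - cbar a * z)).

Definition in_disc l := forall a, a \in l -> cabs a < 1.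

Lemma in_disc_cons a l : in_disc (a :: l) -> cabs a < 1 /\ in_disc l.
Proof.
move=> h; split=> [|b bl]; apply: h; first exact: mem_head.
by rewrite in_cons bl orbT.
Qed.

Lemma bprodE l z : bprod l z = num_fun l z / den_fun l z.
Proof. by rewrite /bprod big_split /= prodfV. Qed.

Lemma den_fun_neq0 l z : in_disc l -> cabs z <= 1 -> den_fun l z != 0.
Proof.
move=> hl z1; rewrite /den_fun prodf_seq_neq0; apply/allP => a al; apply/implyP => _.
exact: den_neq0 (hl _ al) z1.
Qed.

Lemma bprod_hol l z : in_disc l -> cabs z <= 1 -> hol (bprod l) z.
Proof.
move=> + z1; elim: l => [|a l IH] hl.
  rewrite (_ : bprod [::] = (fun=> 1)); first exact: hol_cst.
  by apply/funext => x; rewrite /bprod big_nil.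
have [a1 hl'] := in_disc_cons hl.
rewrite (_ : bprod (a :: l) = (fun z => (z - a) / (1 - cbar a * z) * bprod l z)).
  apply: holM; last exact: IH.
  apply: holM; first by apply: holB; [exact: hol_id|exact: hol_cst].
  apply: holV; first exact: den_neq0.
  by apply: holB; [exact: hol_cst|apply: holM; [exact: hol_cst|exact: hol_id]].
by apply/funext => x; rewrite /bprod big_cons.
Qed.

Lemma num_den_lt l z : in_disc l -> (0 < size l)%N -> cabs z < 1 ->
  cabs (num_fun l z) < cabs (den_fun l z).
Proof.
move=> hl + z1; elim: l hl => [//|a [|b l] IH] hl _; have [a1 hl'] := in_disc_cons hl.
  by rewrite /num_fun /den_fun !big_seq1 factor_lt.
rewrite /num_fun /den_fun big_cons [X in _ < cabs X]big_cons !cabsM.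
by rewrite ltr_pM ?cabs_ge0 ?factor_lt ?IH.
Qed.
Lemma num_den_gt l z : in_disc l -> (0 < size l)%N -> 1 < cabs z ->
  cabs (den_fun l z) < cabs (num_fun l z).
Proof.
move=> hl + z1; elim: l hl => [//|a [|b l] IH] hl _; have [a1 hl'] := in_disc_cons hl.
  by rewrite /num_fun /den_fun !big_seq1 factor_gt.
rewrite /num_fun /den_fun big_cons [X in _ < cabs X]big_cons !cabsM.
by rewrite ltr_pM ?cabs_ge0 ?factor_gt ?IH.
Qed.

Lemma bprod_le1 l z : in_disc l -> cabs z <= 1 -> cabs (bprod l z) <= 1.
Proof.
move=> + z1; elim: l => [|a l IH] hl; first by rewrite /bprod big_nil cabs1.
have [a1 hl'] := in_disc_cons hl.
rewrite /bprod big_cons cabsM mulr_ile1 ?cabs_ge0//; last exact: IH.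
rewrite cabsM cabsV ler_pdivrMr ?mul1r ?cabs_gt0 ?den_neq0//.
move: z1; rewrite le_eqVlt => /orP[/eqP z1|z1]; first by rewrite factor_eq.
by rewrite ltW// factor_lt.
Qed.

(** On the unit circle this is y T'(y)/T(y), a sum of Poisson kernels. It is real and positive,
    hence the preimages of a point of the circle are simple. *)
Definition logder l y : K := \sum_(a <- l) (1 - cabs a ^+ 2) / cabs (y - a) ^+ 2.

Lemma bprod_cderiv l y : in_disc l -> cabs y = 1 ->
  cderiv (bprod l) y (bprod l y * y^-1 * rc (logder l y)).
Proof.
move=> + y1; have y0 : y != 0 by rewrite -cabs_gt0 y1.
elim: l => [|a l IH] hl.
  rewrite /logder big_nil rc0 mulr0 (_ : bprod [::] = (fun=> 1)); first exact: cd_cst.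
  by apply/funext => x; rewrite /bprod big_nil.
have [a1 hl'] := in_disc_cons hl; have {}IH := IH hl'.
have e : bprod (a :: l) = (fun z => (z - a) / (1 - cbar a * z) * bprod l z).
  by apply/funext => x; rewrite /bprod big_cons.
have n0 : 1 - cbar a * y != 0 by apply: den_neq0; rewrite ?y1.
have ya : y - a != 0.
  by rewrite subr_eq0; apply: contraTneq a1 => <-; rewrite y1 ltxx.
have d1 := cdB (cd_id y) (cd_cst a y).
have d2 := cdB (cd_cst 1 y) (cdM (cd_cst (cbar a) y) (cd_id y)).
have d3 := @cdV _ (fun x => 1 - cbar a * x) y _ n0 d2.
have := cdM (cdM d1 d3) IH; rewrite -e => h.
apply: (is_derive_eq h).
have yb : cbar y = y^-1.
  by apply: (mulfI y0); rewrite mul_cbar y1 expr1n rc1 mulfV.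
have ya2 : rc (cabs (y - a) ^+ 2) = (y - a) * (y^-1 - cbar a).
  by rewrite -mul_cbar cbarB yb.
have n1 : y^-1 - cbar a != 0 by rewrite -yb -cbarB cbar_eq0.
have n2 : 1 - y * cbar a != 0 by rewrite mulrC.
rewrite e /logder big_cons rcD rcM rcV ya2 rcB rc1 -mul_cbar.
set L := rc _; set B := bprod l y.
have n3 : 1 + - cbar a * y != 0 by rewrite mulNr.
by field; rewrite y0 n3 ya.
Qed.

Lemma logder_gt0 l y : in_disc l -> (0 < size l)%N -> cabs y = 1 -> 0 < logder l y.
Proof.
move=> hl + y1; elim: l hl => [//|a l IH] hl _; have [a1 hl'] := in_disc_cons hl.
have p : 0 < (1 - cabs a ^+ 2) / cabs (y - a) ^+ 2.
  rewrite divr_gt0 ?subr_gt0 ?cabs_lt1_sq// exprn_gt0// cabs_gt0 subr_eq0.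
  by apply: contraTneq a1 => <-; rewrite y1 ltxx.
rewrite /logder big_cons; case: l IH hl' {hl} => [|b l] IH hl'; first by rewrite big_nil addr0.
by rewrite addr_gt0// IH.
Qed.

Local Open Scope ring_scope.

Lemma horner_cderiv (p : {poly C}) z : cderiv (fun x => p.[x]) z p^`().[z].
Proof.
elim/poly_ind: p => [|p c IH].
  rewrite deriv0 horner0 (_ : (fun x => _) = (fun=> 0)); first exact: cd_cst.
  by apply/funext => x; rewrite horner0.
rewrite (_ : (fun x => _) = (fun x => p.[x] * x + c)); last first.
  by apply/funext => x; rewrite hornerMXaddC.
have := cdD (cdM IH (cd_id z)) (cd_cst c z); rewrite addr0 mulr1.
by rewrite derivD derivM derivX derivC addr0 mulr1 !hornerE addrC mulrC.
Qed.

Definition num_poly l : {poly C} := \prod_(a <- l) ('X - a%:P).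
Definition den_poly l : {poly C} := \prod_(a <- l) (1 - (cbar a) *: 'X).

Lemma num_polyE l z : (num_poly l).[z] = num_fun l z.
Proof. by rewrite horner_prod; apply: eq_bigr => a _; rewrite !hornerE. Qed.
Lemma den_polyE l z : (den_poly l).[z] = den_fun l z.
Proof. by rewrite horner_prod; apply: eq_bigr => a _; rewrite !hornerE. Qed.

Lemma size_num_poly l : size (num_poly l) = (size l).+1.
Proof. by rewrite size_prod_XsubC. Qed.
(** The degree drops as soon as some zero is 0; the coefficient at the nominal degree is therefore
    recorded beside the bound. *)
Lemma size_den_poly l : (size (den_poly l) <= (size l).+1)%N /\
  (den_poly l)`_(size l) = \prod_(a <- l) (- cbar a).
Proof.
elim: l => [|a l [IH1 IH2]]; first by rewrite /den_poly !big_nil size_poly1 coef1.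
have e : den_poly (a :: l) = den_poly l - cbar a *: ('X * den_poly l).
  by rewrite /den_poly big_cons mulrBl mul1r scalerAl.
split.
  rewrite e (leq_trans (size_polyD _ _))// geq_max size_polyN (leq_trans IH1) ?leqnSn//=.
  rewrite (leq_trans (size_scale_leq _ _))// (leq_trans (size_polyMleq _ _))//.
  by rewrite size_polyX add2n /= ltnS.
rewrite e coefB coefZ coefXM /= IH2 big_cons.
by rewrite (nth_default _ IH1) sub0r mulNr.
Qed.

Lemma partial_fraction_term (t e G x y : C) : t != 0 -> e != 0 -> G != 0 -> x - y != 0 ->
  - t^-1 * e * G / (e * ((x - y) * G)) = t^-1 / (y - x).
Proof.
move=> t0 e0 G0 xy; have yx : y - x != 0 by rewrite -opprB oppr_eq0.
by field; rewrite t0 G0 yx e0 xy.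
Qed.

Section PartialFractions.
Variables (l : seq C) (rot w : C).
Hypotheses (hl : in_disc l) (l0 : (0 < size l)%N) (rot1 : cabs rot = 1) (w1 : cabs w = 1).

Let n := size l.
Let T z := rot * bprod l z.
(** Its roots are the solutions of T y = w. The coefficient [d] at degree n is nonzero because |q| <
    1 while w and [rot] have modulus 1. *)
Let D : {poly C} := w *: den_poly l - rot *: num_poly l.
Let q : C := \prod_(a <- l) (- cbar a).
Let d : C := w * q - rot.

Let DE z : D.[z] = w * den_fun l z - rot * num_fun l z.
Proof. by rewrite !hornerE num_polyE den_polyE. Qed.

Let q_lt1 : cabs q < 1.
Proof.
rewrite /q cabs_prod; elim: l hl l0 => [//|a l' IH] hl' _.
have [a1 hl''] := in_disc_cons hl'; rewrite big_cons cabsN cabs_bar.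
case: l' IH hl'' {hl'} => [|b l'] IH hl''; first by rewrite big_nil mulr1.
rewrite -[ltRHS]mulr1 ltr_pM ?cabs_ge0//; last exact: IH.
by rewrite -cabs_prod cabs_ge0.
Qed.

Let d0 : d != 0.
Proof.
rewrite subr_eq0; apply: contraTneq q_lt1 => e.
by rewrite -leNgt -rot1 -e cabsM w1 mul1r.
Qed.

Let sizeD : size D = n.+1 /\ lead_coef D = d.
Proof.
have [h1 h2] := size_den_poly l.
have cD : D`_n = d.
  rewrite /D coefB !coefZ h2; congr (_ - _).
  have := monicP (monic_prod_XsubC l predT id); rewrite /lead_coef size_num_poly /= => ->.
  by rewrite mulr1.
have sD : (size D <= n.+1)%N.
  rewrite (leq_trans (size_polyD _ _))// geq_max size_polyN.
  by rewrite !(leq_trans (size_scale_leq _ _)) ?size_num_poly.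
have : size D = n.+1.
  by apply/eqP; rewrite eqn_leq sD ltnNge; apply/negP => h; move: cD d0; rewrite nth_default// => <-; rewrite eqxx.
by move=> h; split => //; rewrite /lead_coef h.
Qed.

Let root_circle y : root D y -> cabs y = 1.
Proof.
rewrite /root DE subr_eq0 => /eqP e.
have {}e : cabs (den_fun l y) = cabs (num_fun l y).
  by rewrite -[LHS]mul1r -[RHS]mul1r -{1}w1 -rot1 -!cabsM e.
have [h|h|//] := ltgtP (cabs y) 1.
  by have := num_den_lt hl l0 h; rewrite e ltxx.
by have := num_den_gt hl l0 h; rewrite e ltxx.
Qed.

Let DT z : cabs z <= 1 -> D.[z] = den_fun l z * (w - T z).
Proof.
move=> z1; rewrite DE /T bprodE; field; exact: den_fun_neq0.
Qed.

Let root_T y : cabs y = 1 -> root D y = (T y == w).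
Proof.
move=> y1; rewrite /root DT ?y1// mulf_eq0 (negbTE (den_fun_neq0 hl _)) ?y1//=.
by rewrite subr_eq0 eq_sym.
Qed.

Let T_cderiv y : cabs y = 1 -> cderiv T y (T y * y^-1 * rc (logder l y)).
Proof.
move=> y1; have := cdM (cd_cst rot y) (bprod_cderiv hl y1).
by rewrite mulr0 addr0 !mulrA.
Qed.

Let derivD y : cabs y = 1 -> T y = w -> D^`().[y] = - (den_fun l y * derive1 T y).
Proof.
move=> y1 Ty; have hD := horner_cderiv D y.
have hQ := horner_cderiv (den_poly l) y; have hP := horner_cderiv (num_poly l) y.
have y0 : y != 0 by rewrite -cabs_gt0 y1.
rewrite (cderiv_derive1 (T_cderiv y1)).
have hQT := cdM hQ (T_cderiv y1).
have e : cderiv (fun z => (den_poly l).[z] * T z) y (rot * (num_poly l)^`().[y]).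
  have hr := cdM (cd_cst rot y) hP; rewrite mulr0 addr0 in hr.
  have [e0 e00 he0] : exists2 e : K, 0 < e & forall x, cabs (x - y) < e -> den_fun l x != 0.
    have /hol_cont/continuous_cabsP : hol (den_fun l) y.
      by exists (den_poly l)^`().[y]; apply: (cderiv_ext ltr01 _ hQ) => x _; rewrite den_polyE.
    have dy0 : den_fun l y != 0 by apply: den_fun_neq0; rewrite ?y1.
    move=> /(_ (cabs (den_fun l y))); rewrite cabs_gt0 => /(_ dy0)[e0 e00 he]; exists e0 => //.
    by move=> x /he; apply: contraTneq => ->; rewrite sub0r cabsN ltxx.
  apply: (cderiv_ext e00 _ hr) => x /he0 dx.
  by rewrite num_polyE den_polyE /T bprodE; field.
have := cderiv_unique e hQT; rewrite den_polyE Ty => k.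
by rewrite /D derivB !derivZ hornerD hornerN !hornerZ k; ring.
Qed.

Let derivT_neq0 y : cabs y = 1 -> T y = w -> derive1 T y != 0.
Proof.
move=> y1 Ty; have y0 : y != 0 by rewrite -cabs_gt0 y1.
rewrite (cderiv_derive1 (T_cderiv y1)) Ty !mulf_neq0 ?invr_eq0//.
  by rewrite -cabs_gt0 w1.
by rewrite rc_eq0 gt_eqF// logder_gt0.
Qed.

(** Partial fractions of 1/(w - T z) in z, with value q/d at infinity. The polynomial [E], which
    measures the failure of the identity, has degree below the number of roots of [D] and vanishes
    at each of them. *)
Lemma blaschke_fiber : exists ys : seq C, [/\ uniq ys,
  [set` ys] = [set y | cabs y = 1 /\ T y = w] &
  forall z, cabs z <= 1 -> T z != w ->
    (w - T z)^-1 = q / d + \sum_(y <- ys) (derive1 T y)^-1 / (y - z)].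
Proof.
have [sD lD] := sizeD.
have [ys eD] := closed_field_poly_normal D; rewrite lD in eD.
have rD y : root D y = (y \in ys).
  by rewrite eD rootZ// root_prod_XsubC.
have ysP y : y \in ys -> cabs y = 1 /\ T y = w.
  move=> yys; have h : root D y by rewrite rD.
  by have y1 := root_circle h; split => //; apply/eqP; rewrite -root_T.
have rem_eq y : y \in ys -> D^`().[y] = d * \prod_(x <- rem y ys) (y - x).
  move=> yys; rewrite eD (perm_big _ (perm_to_rem yys)) big_cons /= derivZ derivM derivXsubC mul1r.
  rewrite hornerZ hornerD hornerM hornerXsubC subrr mul0r addr0; congr (_ * _).
  by rewrite horner_prod; apply: eq_bigr => x _; rewrite hornerXsubC.
have D'0 y : y \in ys -> D^`().[y] != 0.
  move=> /ysP[y1 Ty]; rewrite derivD// oppr_eq0 mulf_neq0//; last exact: derivT_neq0.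
  by apply: den_fun_neq0; rewrite ?y1.
have nrem y : y \in ys -> y \notin rem y ys.
  move=> yys; apply: contra (D'0 _ yys) => h.
  rewrite (rem_eq _ yys) (perm_big _ (perm_to_rem h)) big_cons /=.
  by rewrite subrr mul0r mulr0.
have uys : uniq ys.
  apply: count_mem_uniq => x; have [xys|/count_memPn ->//] := boolP (x \in ys).
  have := perm_to_rem xys => /permP/(_ (pred1 x)) -> /=; rewrite eqxx.
  by move: (nrem _ xys) => /count_memPn ->.
have sys : size ys = n.
  by apply/eqP; rewrite -eqSS -sD eD size_scale// size_prod_XsubC.
exists ys; split => //.
  apply/seteqP; split => y /=; first exact: ysP.
  by move=> [y1 Ty]; rewrite -rD root_T// Ty.
pose k y := - (derive1 T y)^-1 * d.
pose E : {poly C} := den_poly l - (q / d) *: D -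
  \sum_(y <- ys) k y *: \prod_(x <- rem y ys) ('X - x%:P).
have E0 : E = 0.
  apply/eqP/negPn/negP => En0.
  have : (size ys < size E)%N.
    apply: max_poly_roots => //; apply/allP => y yys.
    have [y1 Ty] := ysP _ yys.
    have zz : \sum_(x <- ys | x != y) (k x *: \prod_(u <- rem x ys) ('X - u%:P)).[y] = 0.
      apply: big1_seq => x /andP[xy xys]; rewrite hornerZ horner_prod (bigD1_seq y)/=; last 2 first.
      - by rewrite mem_rem_uniq// !inE eq_sym xy.
      - exact: rem_uniq.
      by rewrite hornerXsubC subrr mul0r mulr0.
    rewrite /root /E !(hornerD, hornerN) horner_sum hornerZ (bigD1_seq y)//= zz addr0.
    have : root D y by rewrite rD.
    rewrite /root => /eqP ->; rewrite mulr0 subr0 den_polyE hornerZ /k.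
    have := rem_eq _ yys; rewrite derivD// horner_prod.
    have -> : \prod_(i <- rem y ys) ('X - i%:P).[y] = \prod_(i <- rem y ys) (y - i).
      by apply: eq_bigr => i _; rewrite hornerXsubC.
    move=> h; rewrite -mulrA -h; have t0 := derivT_neq0 y1 Ty.
    by rewrite mulNr mulrN opprK mulrCA mulVf// mulr1 subrr.
  rewrite sys; apply/negP; rewrite -leqNgt.
  have s1 : (size (den_poly l - (q / d) *: D)%R <= n)%N.
    have [h1 h2] := size_den_poly l.
    apply/leq_sizeP => j; rewrite leq_eqVlt => /orP[/eqP <-|nj].
      rewrite coefB coefZ h2 -/q.
      have -> : D`_n = d by rewrite -lD /lead_coef sD.
      by rewrite divfK// subrr.
    rewrite coefB coefZ (nth_default _ (leq_trans h1 nj)) (_ : D`_j = 0) ?mulr0 ?subrr//.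
    by rewrite nth_default// sD.
  rewrite /E (leq_trans (size_polyD _ _))// geq_max s1 size_polyN /=.
  apply: (leq_trans (size_sum _ _ _)).
  apply/bigmax_leqP_seq => y yys _; apply: (leq_trans (size_scale_leq _ _)).
  rewrite size_prod_XsubC size_rem// sys prednK//; exact: l0.
move=> z z1 Tzw.
have Dz0 : D.[z] != 0.
  rewrite DT// mulf_neq0 ?den_fun_neq0// subr_eq0 eq_sym; exact: Tzw.
have -> : (w - T z)^-1 = den_fun l z / D.[z].
  by rewrite DT// invfM mulrA mulfV ?mul1r// den_fun_neq0.
have e : den_fun l z - q / d * D.[z] =
    \sum_(y <- ys) (k y *: \prod_(x <- rem y ys) ('X - x%:P)).[z].
  apply/eqP; rewrite -subr_eq0 -horner_sum -hornerZ -den_polyE.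
  by rewrite -!hornerN -!hornerD -/E E0 horner0.
have -> : den_fun l z / D.[z] = q / d + (den_fun l z - q / d * D.[z]) / D.[z].
  by field; rewrite Dz0 d0.
rewrite e; congr (_ + _); rewrite mulr_suml; apply: eq_big_seq => y yys.
have [y1 Ty] := ysP _ yys.
have ezD : D.[z] = d * ((z - y) * \prod_(x <- rem y ys) (z - x)).
  rewrite eD (perm_big _ (perm_to_rem yys)) big_cons /= hornerZ hornerM hornerXsubC horner_prod.
  by congr (_ * (_ * _)); apply: eq_bigr => x _; rewrite hornerXsubC.
have ep : (\prod_(x <- rem y ys) ('X - x%:P)).[z] = \prod_(x <- rem y ys) (z - x).
  by rewrite horner_prod; apply: eq_bigr => x _; rewrite hornerXsubC.
rewrite hornerZ ep; move: Dz0; rewrite ezD; set G := \prod_(x <- _) _.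
rewrite !mulf_eq0 !negb_or => /and3P[_ zy G0]; have t0 := derivT_neq0 y1 Ty.
by rewrite partial_fraction_term.
Qed.

End PartialFractions.

End Blaschke.

(** * The integral operator agrees with the Perron-Frobenius formula on the unit circle *)

Section PerronFrobenius.
Variables (K : realType) (R s s0 r' : K).
Local Notation C := (Cplx K).
Hypothesis hrad : [/\ 0 < r', r' < R, R < s, s < s0 & s0 < 1].
Implicit Types (f g h : C -> C) (z w : C).

Let R0 : 0 < R. Proof. by case: hrad => *; apply: lt_trans (_ : r' < R). Qed.
Let Rs : R < s. Proof. by case: hrad. Qed.
Let s_gt0 : 0 < s. Proof. exact: lt_trans Rs. Qed.
Let s_lt1 : s < 1. Proof. by case: hrad => *; apply: lt_trans (_ : s0 < 1). Qed.

(** Cauchy's formula on the circles of radius s and 1/s, the outer circle being carried to C_s by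
    reflection. It has the shape of [transfer] for the identity map. *)
Lemma cauchy_split f w : an R f -> s < cabs w < s^-1 ->
  f w = inner_op s (fun z => z) f w + outer_op s (fun z => z) f w.
Proof.
move=> hf /andP[sw ws]; have w0 : w != 0 by rewrite -cabs_gt0 (lt_trans s_gt0).
have sR : s^-1 < R^-1 by rewrite ltf_pV2 ?posrE.
rewrite (cauchy_annulus (ltW R0) hf Rs sw ws sR) addrC; congr (_ + _).
  rewrite -mulN1r -cmeanZ ?(ltW s_gt0)//; last first.
    apply: ccM; last by apply: cc_kernel; rewrite gt_eqF.
    by apply: ccM; [exact: cc_id|exact: (an_cc hrad)].
  apply: eq_cmean => [|z zs]; first exact: ltW.
  by rewrite -[w - z]opprB invrN mulrN mulN1r.
rewrite -(cmean_cinv (fun z => z * f z / (z - w)) s_gt0) /outer_op.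
have hk z : cabs z = s -> 1 - cbar w * z != 0.
  move=> zs; rewrite subr_eq0; apply: contraTneq ws => h.
  rewrite -leNgt -(ler_pM2r s_gt0) mulVf ?gt_eqF// -(cabs1 K) h cabsM cabs_bar zs.
  by [].
rewrite /pair -cmean_bar ?(ltW s_gt0)//; last first.
  apply: ccM; first by apply: ccM; [exact: cc_id|exact: (an_cc hrad (an_refl hrad hf))].
  apply: ccM; first exact: cc_id.
  apply: ccV; first exact: hk.
  by apply: ccB; [exact: cc_cst|apply: ccM; [exact: cc_cst|exact: cc_id]].
apply: eq_cmean => [|z zs]; first exact: ltW.
have z0 : z != 0 by rewrite -cabs_gt0 zs.
have cz0 : cbar z != 0 by rewrite cbar_eq0.
have n1 : 1 - w * cbar z != 0.
  by have := hk z zs; rewrite -cbar_eq0 cbarB cbarM cbarK cbar1.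
have n2 : (cbar z)^-1 - w != 0.
  have -> : (cbar z)^-1 - w = (1 - w * cbar z) / cbar z by field.
  by rewrite mulf_neq0 ?invr_eq0.
have -> : cbar (z * refl f z * (z / (1 - cbar w * z))) =
    cbar z * ((cbar z)^-1 ^+ 2 * f (cinv z)) * (cbar z / (1 - w * cbar z)).
  have e1 : cbar (refl f z) = (cbar z)^-1 ^+ 2 * f (cinv z).
    by rewrite /refl cbarM cbarK cbarX cbarV.
  have e2 : cbar (1 - cbar w * z) = 1 - w * cbar z by rewrite cbarB cbarM cbarK cbar1.
  have e3 : cbar (z / (1 - cbar w * z)) = cbar z / (1 - w * cbar z) by rewrite cbarM cbarV e2.
  by rewrite cbarM e3 cbarM e1.
have -> : cinv z * f (cinv z) / (cinv z - w) = (cbar z)^-1 * f (cinv z) / ((cbar z)^-1 - w) by [].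
have -> : (cbar z)^-1 - w = (1 - w * cbar z) / cbar z by field.
by move: (f _) => u; field; rewrite n1 cz0.
Qed.

Lemma cbar_prod (I : Type) (l : seq I) (F : I -> C) :
  cbar (\prod_(i <- l) F i) = \prod_(i <- l) cbar (F i).
Proof. exact: (rmorph_prod conjc). Qed.

Lemma unit_bar w : cabs w = 1 -> cbar w = w^-1.
Proof.
move=> w1; have w0 : w != 0 by rewrite -cabs_gt0 w1.
by apply: (mulfI w0); rewrite mul_cbar w1 expr1n rc1 mulfV.
Qed.

Lemma outer_unit g f w : cabs w = 1 -> circ_cont s (refl f) -> circ_cont s g ->
  (forall z, cabs z = s -> w - g z != 0) ->
  outer_op s g f w = cbar (w ^+ 2 * inner_op s g (refl f) w - w * pair s (refl f) (fun=> 1)).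
Proof.
move=> w1 cf cg gw; have w0 : w != 0 by rewrite -cabs_gt0 w1.
have ck : circ_cont s (fun z => (w - g z)^-1).
  by apply: ccV; [exact: gw|apply: ccB; [exact: cc_cst|exact: cg]].
have c1 : circ_cont s (fun=> 1 : C) := cc_cst _ _.
rewrite /inner_op -mulNr -(pairZr hrad _ cf ck) -(pairZr hrad _ cf c1).
rewrite -(pairDr hrad cf (ccM (cc_cst _ _) ck) (ccM (cc_cst _ _) c1)).
congr cbar; apply: (eq_pair hrad) => // z zs; have n := gw _ zs.
have n1 : 1 - w^-1 * g z = (w - g z) / w by field.
by rewrite (unit_bar w1) n1; move: (g z) n => u n; field; rewrite n w0.
Qed.

Lemma selfmap_lt1 g z : selfmap s0 r' g -> cabs z = s -> cabs (g z) < 1.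
Proof.
case: hrad => r'0 r'R _ ss0 s01 hg zs; have [|_ h] := hg z; first by rewrite zs.
by rewrite (le_lt_trans h)// (lt_trans r'R)// (lt_trans Rs).
Qed.

(** Partial fractions turn the kernel at w into Cauchy kernels at the preimages, and [cauchy_split]
    reassembles these into the values of f there. The rest is a multiple of the pairing of f with 1,
    whose coefficient is 0 by [key]. *)
Lemma transfer_fiber (T : blaschke K) f w : selfmap s0 r' (bl_fun T) -> an R f -> cabs w = 1 ->
  transfer s (bl_fun T) f w =
  \sum_(y \in [set y : C | cabs y = 1 /\ bl_fun T y = w]) f y / derive1 (bl_fun T) y.
Proof.
move=> hT hf w1; have w0 : w != 0 by rewrite -cabs_gt0 w1.
pose l := bl_zeros T; have hl : in_disc l := @bl_zeros_disc _ T.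
have [ys [uys fys pf]] := blaschke_fiber hl (bl_deg_gt0 T) (bl_rot_unit T) w1.
have {}fys : [set` ys] = [set y : C | cabs y = 1 /\ bl_fun T y = w] := fys.
rewrite -fys -fsbig_seq//.
pose q : C := \prod_(a <- l) - cbar a.
pose c := q / (w * q - bl_rot T).
pose k y := (derive1 (bl_fun T) y)^-1.
have {}pf z : cabs z <= 1 -> cabs (bl_fun T z) < 1 ->
    (w - bl_fun T z)^-1 = c + \sum_(y <- ys) k y / (y - z).
  move=> z1 Tz; apply: pf => //; apply: contraTneq Tz => h.
  by rewrite /bl_fun -[\prod_(_ <- _) _]/(bprod l z) h w1 ltxx.
have ysP y : y \in ys -> cabs y = 1 /\ bl_fun T y = w.
  by move=> yys; have : [set` ys] y by []; rewrite fys.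
have cT := selfmap_cc hrad hT.
have Tw z : cabs z = s -> w - bl_fun T z != 0.
  move=> zs; rewrite subr_eq0; apply: contraTneq (selfmap_lt1 hT zs) => <-.
  by rewrite w1 ltxx.
have cf := an_cc hrad hf; have cf' := an_cc hrad (an_refl hrad hf).
pose kn y z : C := if y \in ys then (y - z)^-1 else 0.
have ckn y : circ_cont s (kn y).
  rewrite /kn; have [yys|_] := boolP (y \in ys); last exact: cc_cst.
  have [y1 _] := ysP _ yys.
  apply: ccV; last by apply: ccB; [exact: cc_cst|exact: cc_id].
  move=> z zs; rewrite subr_eq0; apply: contraTneq s_lt1 => h.
  by rewrite -zs -h y1 ltxx.
have c1 : circ_cont s (fun=> 1 : C) := cc_cst _ _.
have inE g : circ_cont s g -> inner_op s (bl_fun T) g w =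
    c * pair s g (fun=> 1) + \sum_(y <- ys) k y * pair s g (kn y).
  move=> cg; have ckk y : circ_cont s (fun z => k y * kn y z) := ccM (cc_cst _ _) (ckn y).
  have e : \sum_(y <- ys) k y * pair s g (kn y) = \sum_(y <- ys) pair s g (fun z => k y * kn y z).
    by apply: eq_bigr => y _; rewrite (pairZr hrad _ cg (ckn y)).
  rewrite e -(pair_sumr hrad _ cg ckk) -(pairZr hrad _ cg c1).
  rewrite -(pairDr hrad cg (ccM (cc_cst _ _) c1)); last first.
    elim: (ys) => [|y ys' IH].
      rewrite (_ : (fun z => _) = (fun=> 0)); first exact: cc_cst.
      by apply/funext => z; rewrite big_nil.
    rewrite (_ : (fun z => _) = (fun z => k y * kn y z + \sum_(i <- ys') k i * kn i z)).
      exact: ccD.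
    by apply/funext => z; rewrite big_cons.
  apply: (eq_pair hrad) => // z zs; rewrite pf; last 2 first.
  - by rewrite zs ltW.
  - exact: selfmap_lt1.
  rewrite mulr1; congr (_ + _); apply: eq_big_seq => y yys.
  by rewrite /kn yys.
have knE g y : y \in ys -> pair s g (kn y) = inner_op s (fun z => z) g y.
  by move=> yys; apply: (eq_pair hrad) => // z _; rewrite /kn yys.
have fE y : y \in ys -> f y = pair s f (kn y) +
    cbar (y ^+ 2 * pair s (refl f) (kn y) - y * pair s (refl f) (fun=> 1)).
  move=> yys; have [y1 _] := ysP _ yys.
  rewrite (@cauchy_split f y)// ?y1 ?s_lt1 ?invf_gt1// !knE//; congr (_ + _).
  apply: outer_unit => //; first exact: cc_id.
  move=> z zs; rewrite subr_eq0; apply: contraTneq s_lt1 => h.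
  by rewrite -zs -h y1 ltxx.
(* The derivative at y is w/y times the real number [logder l y]. *)
have kE y : y \in ys -> cbar (k y) * w ^- 2 = k y * y ^- 2.
  move=> yys; have [y1 Ty] := ysP _ yys; have y0 : y != 0 by rewrite -cabs_gt0 y1.
  have e : derive1 (bl_fun T) y = w * y^-1 * rc (logder l y).
    apply: cderiv_derive1; rewrite -Ty.
    have := cdM (cd_cst (bl_rot T) y) (bprod_cderiv hl y1).
    by rewrite mulr0 addr0 !mulrA.
  rewrite /k e; have L0 : rc (logder l y) != 0 :> C.
    by rewrite rc_eq0 gt_eqF// logder_gt0// bl_deg_gt0.
  rewrite cbarV !cbarM cbar_rc cbarV (unit_bar y1) (unit_bar w1).
  by field; rewrite L0 w0 y0.
(* The partial fraction identity at z = 0, where T takes the value [rot] times the conjugate of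
   q. *)
have key : c + w ^- 2 * cbar c - w^-1 + \sum_(y <- ys) k y / y = 0.
  have T0 : cabs (bl_fun T 0) < 1.
    case: (hrad) => r'0 r'R _ ss0 s01; have [] := hT 0.
      by rewrite cabs0 (lt_trans s_gt0).
    by move=> _ h; rewrite (le_lt_trans h)// (lt_trans r'R)// (lt_trans Rs).
  have := pf 0; rewrite cabs0 ler01 => /(_ isT T0).
  have -> : \sum_(y <- ys) k y / (y - 0) = \sum_(y <- ys) k y / y.
    by apply: eq_bigr => y _; rewrite subr0.
  move=> e; have -> : c + w ^- 2 * cbar c - w^-1 + \sum_(y <- ys) k y / y =
     (c + \sum_(y <- ys) k y / y) + w ^- 2 * cbar c - w^-1 by ring.
  rewrite -e; have rb := unit_bar (bl_rot_unit T).
  have r0 : bl_rot T != 0 by rewrite -cabs_gt0 bl_rot_unit.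
  have T0E : bl_fun T 0 = bl_rot T * cbar q.
    rewrite /bl_fun /q; congr (_ * _); rewrite cbar_prod.
    apply: eq_bigr => a _; rewrite mulr0 subr0 divr1 sub0r.
    by rewrite cbarN cbarK.
  have wT : w - bl_fun T 0 != 0.
    by rewrite subr_eq0; apply: contraTneq T0 => <-; rewrite w1 ltxx.
  rewrite T0E in wT *; rewrite /c cbarM cbarV cbarB cbarM rb (unit_bar w1).
  move: (cbar q) (bl_rot T) r0 wT {rb T0E} => u v v0 wT.
  have n1 : w^-1 * u - v^-1 != 0.
    have -> : w^-1 * u - v^-1 = - ((w - v * u) / (w * v)) by field; rewrite w0 v0.
    by rewrite oppr_eq0 !mulf_neq0// invr_eq0 mulf_neq0.
  have -> : w^-1 * u - v^-1 = - ((w - v * u) / (w * v)) by field; rewrite w0 v0.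
  by field; rewrite v0 wT w0.
rewrite /transfer (outer_unit w1 cf' cT Tw) !inE// (pair1_refl hrad hf).
set A := pair s f (fun=> 1).
have -> : \sum_(y <- ys) f y / derive1 (bl_fun T) y =
    \sum_(y <- ys) k y * pair s f (kn y) +
    \sum_(y <- ys) k y * y ^- 2 * cbar (pair s (refl f) (kn y)) - (\sum_(y <- ys) k y / y) * A.
  rewrite mulr_suml -sumrN -!big_split; apply: eq_big_seq => y yys.
  have [y1 Ty] := ysP _ yys; have y0 : y != 0 by rewrite -cabs_gt0 y1.
  rewrite fE// (pair1_refl hrad hf) -/A cbarB (cbarM (y ^+ 2)) (cbarM y) cbarX cbarK (unit_bar y1) /k /=.
  by set u := (derive1 (bl_fun T) y)^-1; clearbody u; field.
have -> : cbar (w ^+ 2 * (c * cbar A + \sum_(y <- ys) k y * pair s (refl f) (kn y)) - w * cbar A) =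
    w ^- 2 * cbar c * A + \sum_(y <- ys) k y * y ^- 2 * cbar (pair s (refl f) (kn y)) - w^-1 * A.
  rewrite cbarB (cbarM (w ^+ 2)) (cbarM w) cbarX cbarK (unit_bar w1) cbarD (cbarM c) cbarK.
  have -> : cbar (\sum_(y <- ys) k y * pair s (refl f) (kn y)) =
      \sum_(y <- ys) cbar (k y) * cbar (pair s (refl f) (kn y)).
    by rewrite cbar_sum; apply: eq_bigr => y _; rewrite cbarM.
  rewrite exprVn mulrDr mulr_sumr mulrA; congr (_ + _ - _).
  by apply: eq_big_seq => y yys; rewrite -kE//; ring.
have e : A * (c + w ^- 2 * cbar c - w^-1 + \sum_(y <- ys) k y / y) = 0 by rewrite key mulr0.
set S1 := \sum_(y <- ys) k y * pair s f (kn y) in e *.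
set S2 := \sum_(y <- ys) k y * y ^- 2 * _ in e *; set S3 := \sum_(y <- ys) k y / y in e *.
apply/eqP; rewrite -subr_eq0 -[X in _ == X]e; apply/eqP; ring.
Qed.

End PerronFrobenius.

(** * Square integrals over the angle and their comparison with circle means *)

Section Energy.
Variable K : realType.
Local Notation C := (Cplx K).
Local Notation mu := (@lebesgue_measure K).
Local Notation ang := (@angles K).
Implicit Types (g h : K -> C).

Definition sqmod g (t : K) : \bar K := ((cabs (g t)) ^+ 2)%:E.

Definition energy g : \bar K := (\int[mu]_(t in ang) ((cabs (g t)) ^+ 2)%:E)%E.
Definition cmeas g := cmeasurable ang g.

Lemma measurable_ang : measurable ang.
Proof. exact: measurable_itv. Qed.

Lemma cmeas_cabs2 g : cmeas g -> measurable_fun ang (sqmod g).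
Proof.
move=> [m1 m2]; apply/measurable_EFinP; under eq_fun do rewrite cabs2E.
by apply: measurable_funD; apply: measurable_funX.
Qed.

Lemma cmeas_cont g : continuous g -> cmeas g.
Proof.
move=> cg; split; apply: measurable_funTS; apply: continuous_measurable_fun => t.
  by have /cvg_reim[h _] := cg t.
by have /cvg_reim[_ h] := cg t.
Qed.

Lemma cmeasD g h : cmeas g -> cmeas h -> cmeas (fun t => g t + h t).
Proof.
move=> [g1 g2] [h1 h2]; split.
  rewrite (_ : (fun t => _) = (fun t => complex.Re (g t) + complex.Re (h t))).
    exact: measurable_funD.
  by apply/funext => t; case: (g t) (h t) => [? ?] [? ?].
rewrite (_ : (fun t => _) = (fun t => complex.Im (g t) + complex.Im (h t))).
  exact: measurable_funD.
by apply/funext => t; case: (g t) (h t) => [? ?] [? ?].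
Qed.

Lemma cmeasZ (a : C) g : cmeas g -> cmeas (fun t => a * g t).
Proof.
move=> [g1 g2]; split.
  rewrite (_ : (fun t => _) = (fun t => complex.Re a * complex.Re (g t) -
      complex.Im a * complex.Im (g t))).
    by apply: measurable_funB; apply: measurable_funM.
  by apply/funext => t; case: a (g t) => [? ?] [? ?].
rewrite (_ : (fun t => _) = (fun t => complex.Re a * complex.Im (g t) +
    complex.Im a * complex.Re (g t))).
  by apply: measurable_funD; apply: measurable_funM.
by apply/funext => t; case: a (g t) => [? ?] [? ?] /=; rewrite [X in _ + X]mulrC.
Qed.

Lemma energy_ge0 g : (0 <= energy g)%E.
Proof. by apply: integral_ge0 => t _; rewrite lee_fin exprn_ge0// cabs_ge0. Qed.

Lemma mu_ang : mu ang = (2 * pi)%:E.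
Proof.
rewrite /angles lebesgue_measure_itv /= lte_fin mulr_gt0 ?pi_gt0//.
by rewrite -EFinB subr0.
Qed.

Lemma le_energy g h : cmeas g -> cmeas h ->
  (forall t, ang t -> cabs (g t) <= cabs (h t)) -> (energy g <= energy h)%E.
Proof.
move=> mg mh gh; apply: ge0_le_integral.
- exact: measurable_ang.
- by move=> t _; rewrite lee_fin exprn_ge0// cabs_ge0.
- exact: cmeas_cabs2.
- exact: cmeas_cabs2.
- by move=> t /gh tt; rewrite lee_fin lerXn2r ?nnegrE ?cabs_ge0.
Qed.

Lemma energy_le g (M : K) : cmeas g -> (forall t, ang t -> cabs (g t) <= M) ->
  (energy g <= (2 * pi * M ^+ 2)%:E)%E.
Proof.
move=> mg gM.
have a0 : ang 0 by rewrite /angles /= in_itv /= lexx mulr_ge0// ltW// pi_gt0.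
have M0 : 0 <= M := le_trans (cabs_ge0 _) (gM _ a0).
have -> : (2 * pi * M ^+ 2)%:E = energy (fun=> rc M).
  rewrite /energy cabs_rc ger0_norm//.
  have e : (\int[mu]_(t in ang) (M ^+ 2)%:E = (M ^+ 2)%:E * mu ang)%E.
    exact: (integral_cst mu measurable_ang (M ^+ 2)%:E).
  by rewrite e mu_ang -EFinM; congr EFin; ring.
apply: le_energy => //; last by move=> t /gM; rewrite cabs_rc ger0_norm.
Qed.

Lemma energyD g h : cmeas g -> cmeas h ->
  (energy (fun t => (g t + h t)%R) <= 2%:E * energy g + 2%:E * energy h)%E.
Proof.
move=> mg mh; have m1 := cmeas_cabs2 mg; have m2 := cmeas_cabs2 mh.
have p (u : K -> C) t : (0 <= (cabs (u t) ^+ 2)%:E)%E by rewrite lee_fin exprn_ge0// cabs_ge0.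
have p2 (u : K -> C) t : (0 <= 2%:E * (cabs (u t) ^+ 2)%:E)%E by rewrite mule_ge0.
have mm (u : K -> C) : cmeas u -> measurable_fun ang (fun t => 2%:E * sqmod u t)%E.
  by move=> mu'; apply: measurable_funeM; exact: cmeas_cabs2.
rewrite /energy -!ge0_integralZl_EFin//; try exact: measurable_ang.
rewrite -ge0_integralD//; try exact: measurable_ang; try exact: mm.
apply: ge0_le_integral.
- exact: measurable_ang.
- by move=> t _; rewrite lee_fin exprn_ge0// cabs_ge0.
- exact: (cmeas_cabs2 (cmeasD mg mh)).
- exact: (emeasurable_funD (mm _ mg) (mm _ mh)).
- move=> t _; rewrite -!EFinM -EFinD lee_fin.
  have h1 := cabsD (g t) (h t).
  apply: (@le_trans _ _ ((cabs (g t) + cabs (h t)) ^+ 2)).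
    by rewrite lerXn2r ?nnegrE ?addr_ge0 ?cabs_ge0.
  rewrite -subr_ge0 (_ : _ - _ = (cabs (g t) - cabs (h t)) ^+ 2) ?sqr_ge0//; ring.
Qed.

Lemma energyZ (a : C) g : cmeas g ->
  energy (fun t => a * g t) = ((cabs a ^+ 2)%:E * energy g)%E.
Proof.
move=> mg; rewrite /energy -ge0_integralZl_EFin.
- by apply: eq_integral => t _; rewrite cabsM exprMn EFinM.
- exact: measurable_ang.
- by move=> t _; rewrite lee_fin exprn_ge0// cabs_ge0.
- exact: cmeas_cabs2.
- by rewrite exprn_ge0// cabs_ge0.
Qed.

Lemma dmean_jensen h N :
  2 ^+ N * cabs (dmean h N) ^+ 2 <= \sum_(k < 2 ^ N) cabs (h (k%:R / 2 ^+ N)) ^+ 2.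
Proof.
have p0 : 0 < (2 ^+ N : K) by rewrite exprn_gt0.
pose x (k : 'I_(2 ^ N)) := cabs (h (k%:R / 2 ^+ N)).
pose m := (2 ^+ N)^-1 * \sum_k x k.
have h1 : cabs (dmean h N) <= m.
  rewrite /dmean cabsM cabsV cabsX cabs_nat ler_wpM2l ?invr_ge0 ?(ltW p0)//.
  exact: cabs_sum.
have m0 : 0 <= m by exact: le_trans (cabs_ge0 _) h1.
apply: (@le_trans _ _ (2 ^+ N * m ^+ 2)).
  by rewrite ler_wpM2l ?(ltW p0)// lerXn2r ?nnegrE ?cabs_ge0.
have sx : \sum_k x k = 2 ^+ N * m by rewrite /m mulrA mulfV ?mul1r// gt_eqF.
rewrite -subr_ge0.
have -> : \sum_(k < 2 ^ N) cabs (h (k%:R / 2 ^+ N)) ^+ 2 - 2 ^+ N * m ^+ 2 =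
    \sum_k (x k - m) ^+ 2.
  have e k : (x k - m) ^+ 2 = x k ^+ 2 + (- (2 * m) * x k + m ^+ 2) by ring.
  under [RHS]eq_bigr do rewrite e.
  rewrite !big_split /= -mulr_sumr sx sumr_const card_ord -[m ^+ 2 *+ _]mulr_natl natrX.
  ring.
by apply: sumr_ge0 => k _; exact: sqr_ge0.
Qed.

(** The bridge from dyadic means to the Lebesgue integral. Jensen bounds the squared Riemann sum by
    the integral of a dyadic step function, and uniform continuity of |H|^2 keeps that function
    below |H|^2 + e. An inequality suffices, because means are only ever bounded by norms. *)
Lemma mean_energy (H : K -> C) : continuous H ->
  ((2 * pi * cabs (mean (fun t => H (2 * pi * t))) ^+ 2)%:E <= energy H)%E.
Proof.
move=> cH; pose h t := H (2 * pi * t).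
have pi2 : 0 < 2 * pi :> K by rewrite mulr_gt0// pi_gt0.
have ch : seg_cont h.
  split=> t _; apply: (@continuous_comp _ _ _ (fun t => 2 * pi * t) H); last exact: cH.
  exact: (cvgMr cvg_id).
have cq : seg_cont (fun t => rc (cabs (h t)) * rc (cabs (h t)) : C).
  have c1 : seg_cont (fun t => rc (cabs (h t))).
    split=> t t01; apply/cvg_cabs_lt => e e0.
    have /cvg_cabs_lt/(_ _ e0) := seg_contP ch t01; apply: filterS => x.
    apply: le_lt_trans; rewrite -rcB cabs_rc ler_norml; apply/andP; split.
      by rewrite lerNl opprB cabsBC cabs_sub_ge.
    exact: cabs_sub_ge.
  exact: scM.
have mH := cmeas_cont cH.
suff key (e : K) : 0 < e -> exists N0, forall N, (N0 <= N)%N ->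
    ((2 * pi * cabs (dmean h N) ^+ 2)%:E <= energy H + (2 * pi * e)%:E)%E.
  have [->|fin] := eqVneq (energy H) +oo%E; first by rewrite leey.
  have Ef : energy H \is a fin_num by rewrite ge0_fin_numE ?energy_ge0// ltey.
  rewrite -(fineK Ef) lee_fin; apply/ler_addgt0Pr => e e0.
  have e'0 : 0 < e / (2 * pi) by rewrite divr_gt0.
  have [N0 hN0] := key _ e'0.
  have hv : cabs (dmean h N) @[N --> \oo] --> cabs (mean h).
    have /cvg_cabsP hc := dmean_cvg ch.
    apply/cvgrPdist_lt => d d0; have /cvgrPdist_lt/(_ _ d0) := hc.
    apply: filterS => n; rewrite sub0r normrN ger0_norm ?cabs_ge0//.
    apply: le_lt_trans; rewrite ler_norml; apply/andP; split.
      by rewrite lerNl opprB cabs_sub_ge.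
    by rewrite cabsBC cabs_sub_ge.
  have cv : 2 * pi * cabs (dmean h N) ^+ 2 @[N --> \oo] --> 2 * pi * cabs (mean h) ^+ 2.
    by apply: cvgMr; exact: (cvgM hv hv).
  rewrite -(cvg_lim _ cv)//; apply: limr_le; first by apply/cvg_ex; eexists; exact: cv.
  exists N0 => // N /= /hN0; rewrite -(fineK Ef) -EFinD lee_fin [2 * pi * (e / _)]mulrC divfK//.
  by rewrite gt_eqF.
move=> e0; have [d d0 hd] := seg_cont_unif cq e0; have [N0 hN0] := exp2V_lt d0.
exists N0 => N NN0.
have p0 : 0 < (2 ^+ N : K) by rewrite exprn_gt0.
pose c (k : 'I_(2 ^ N)) := cabs (h (k%:R / 2 ^+ N)) ^+ 2.
have c0 k : 0 <= c k by rewrite exprn_ge0// cabs_ge0.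
(* Half-open, hence pairwise disjoint; the end point 2 pi lies in none of them and is the case [nk]
   below. *)
pose I (k : 'I_(2 ^ N)) : set K :=
  `[2 * pi * (k%:R / 2 ^+ N), 2 * pi * (k.+1%:R / 2 ^+ N)[%classic.
have mI k : measurable (I k) by exact: measurable_itv.
have IP k t : I k t -> k%:R <= t / (2 * pi) * 2 ^+ N < k.+1%:R.
  rewrite /I /= in_itv /= => /andP[h1 h2].
  by rewrite -ler_pdivrMr// ler_pdivlMr// mulrC h1 -ltr_pdivlMr// ltr_pdivrMr// mulrC h2.
have Iuniq k k' t : I k t -> I k' t -> k = k'.
  move=> /IP/andP[a1 a2] /IP/andP[b1 b2]; apply/val_inj/eqP => /=.
  rewrite eqn_leq; apply/andP; split; rewrite -ltnS -(ltr_nat K).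
    exact: le_lt_trans a1 b2.
  exact: le_lt_trans b1 a2.
have Iang k : I k `<=` ang.
  move=> t; rewrite /I /angles /= !in_itv /= => /andP[h1 h2]; apply/andP; split.
    by apply: le_trans h1; rewrite mulr_ge0 ?(ltW pi2)// divr_ge0// ltW.
  apply: le_trans (ltW h2) _; rewrite ler_piMr ?(ltW pi2)//.
  by rewrite ler_pdivrMr// mul1r -natrX ler_nat.
pose S : K := \sum_(k < 2 ^ N) c k * (2 * pi / 2 ^+ N).
have e1 : (\int[mu]_(t in ang) (\sum_(k < 2 ^ N) (c k)%:E * (\1_(I k) t)%:E) = S%:E)%E.
  rewrite ge0_integral_sum; last 3 first.
  - exact: measurable_ang.
  - move=> k; apply: measurable_funeM; apply/measurable_EFinP; apply: measurable_indic; exact: mI.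
  - by move=> k t _; rewrite mule_ge0 ?lee_fin.
  rewrite /S -sumEFin; apply: eq_bigr => k _.
  have m1 : measurable_fun ang (fun t => (\1_(I k) t)%:E : \bar K).
    by apply/measurable_EFinP; apply: measurable_indic; exact: mI.
  have p1 t : ang t -> (0 <= (\1_(I k) t)%:E :> \bar K)%E by move=> _; rewrite lee_fin.
  rewrite (ge0_integralZl_EFin mu measurable_ang p1 m1 (c0 k)).
  have ii : (\int[mu]_(t in ang) (\1_(I k) t)%:E = mu (I k `&` ang))%E.
    exact: (integral_indic mu measurable_ang (mI k)).
  rewrite ii.
  have muI : mu (I k) = (2 * pi / 2 ^+ N)%:E.
    rewrite /I lebesgue_measure_itv /= lte_fin ltr_pM2l// ltr_pM2r ?invr_gt0// ltr_nat ltnSn.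
    rewrite -EFinB; congr EFin.
    by rewrite -mulrBr -mulrBl -natrB ?leqnSn// subSnn mul1r.
  have -> : I k `&` ang = I k by apply: setIidl; exact: Iang.
  by rewrite muI -EFinM.
have e2 : 2 * pi * cabs (dmean h N) ^+ 2 <= S.
  rewrite /S -mulr_suml; have := dmean_jensen h N; rewrite -/c => jj.
  rewrite mulrC [leRHS]mulrA ler_pdivlMr// mulrAC [leRHS]mulrC [leLHS]mulrC ler_pM2l//.
  by rewrite mulrC.
rewrite -lee_fin in e2; apply: le_trans e2 _; rewrite -e1.
have -> : (2 * pi * e)%:E = (\int[mu]_(t in ang) cst e%:E t)%E.
  have -> : (\int[mu]_(t in ang) cst e%:E t = e%:E * mu ang)%E.
    exact: (integral_cst mu measurable_ang e%:E).
  by rewrite mu_ang -EFinM mulrC.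
rewrite /energy -ge0_integralD//; last 4 first.
- exact: measurable_ang.
- by move=> t _; rewrite lee_fin exprn_ge0// cabs_ge0.
- exact: cmeas_cabs2.
- by move=> t _; rewrite lee_fin ltW.
apply: ge0_le_integral.
- exact: measurable_ang.
- by move=> t _; apply: sume_ge0 => k _; rewrite mule_ge0 ?lee_fin.
- apply: emeasurable_fun_sum => k; apply: measurable_funeM; apply/measurable_EFinP.
  by apply: measurable_indic; exact: mI.
- by apply: emeasurable_funD; [exact: cmeas_cabs2|exact: measurable_cst].
move=> t at_; have [[k kt]|nk] := pselect (exists k, I k t); last first.
  rewrite big1 ?adde_ge0 ?lee_fin ?exprn_ge0 ?cabs_ge0 ?(ltW e0)// => k _.
  by rewrite indicE memNset ?mule0// => kt; apply: nk; exists k.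
rewrite (bigD1 k)//= big1 ?adde0; last first.
  move=> k' k'k; rewrite indicE memNset ?mule0// => k't.
  by move: k'k; rewrite (Iuniq _ _ _ k't kt) eqxx.
rewrite indicE mem_set// mule1 -EFinD lee_fin -lerBlDl.
have /andP[i1 i2] := IP _ _ kt.
pose u := t / (2 * pi).
have u01 : 0 <= u <= 1.
  move: at_; rewrite /angles /= in_itv /= => /andP[t0 t1].
  by rewrite divr_ge0 ?(ltW pi2)//= ler_pdivrMr// mul1r.
have k01 : 0 <= (k%:R / 2 ^+ N : K) <= 1.
  by rewrite divr_ge0 ?(ltW p0)//= ler_pdivrMr// mul1r -natrX ler_nat ltnW.
have uk : `|u - k%:R / 2 ^+ N| < d.
  have -> : u - k%:R / 2 ^+ N = (u * 2 ^+ N - k%:R) / 2 ^+ N by field; rewrite gt_eqF.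
  rewrite normrM ger0_norm ?subr_ge0// normfV (gtr0_norm p0).
  apply: (@le_lt_trans _ _ (2 ^- N)).
    by rewrite ler_piMl ?invr_ge0 ?(ltW p0)// lerBlDl natr1 ltW.
  by apply: le_lt_trans hN0; rewrite lef_pV2 ?posrE ?exprn_gt0// ler_eXn2l// ltr1n.
have := hd _ _ u01 k01 uk; rewrite -!rcM -rcB cabs_rc -!expr2 => hh.
have hu : h u = H t by rewrite /h /u mulrC divfK// gt_eqF.
rewrite hu distrC in hh; exact: le_trans (ler_norm _) (ltW hh).
Qed.

End Energy.

(** * Norm estimates in the Hardy space *)

Section Hardy.
Variables (K : realType) (R : K).
Hypotheses (R0 : 0 < R) (R1 : R < 1).
Local Notation C := (Cplx K).
Local Notation mu := (@lebesgue_measure K).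
Local Notation ang := (@angles K).
Implicit Types (f : C -> C) (g : K -> C).

Let RV : R < R^-1. Proof. by rewrite (lt_trans R1)// invf_gt1. Qed.

Lemma hardy_an f : hardy R f -> an R f.
Proof. by move=> [_ h _ _] z /h/holE. Qed.

Lemma trace_spec f (F : set_system K) : (exists g, is_L2_trace f F g) ->
  is_L2_trace f F (L2_trace f F).
Proof. by move=> [g hg]; exact: (xgetPex (cst 0) (ex_intro _ g hg)). Qed.

Lemma an_circle_cont f s : an R f -> R < s < R^-1 -> continuous (fun t => f (circle_pt s t)).
Proof.
move=> hf sR t; apply: (@continuous_comp _ _ _ (circle_pt s) f); first exact: circle_pt_cont.
apply/hol_cont/hf; rewrite /annulus /= cabs_circle_pt//.
by case/andP: sR => /(lt_trans R0)/ltW.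
Qed.

Lemma sub_mN1 g h : (fun t => g t - h t) = (fun t => g t + -1 * h t) :> (K -> C).
Proof. by apply/funext => t; rewrite mulN1r. Qed.

Lemma energyN1 g : cmeas g -> energy (fun t => -1 * g t) = energy g.
Proof. by move=> mg; rewrite energyZ// cabsN cabs1 expr1n mul1e. Qed.

(** From |a + b|^2 <= 2|a|^2 + 2|b|^2. Constants are given away freely here, since only exponential
    growth rates matter in the end. *)
Lemma trace_above f (F : set_system K) {FF : Filter F} g (e : K) : is_L2_trace f F g -> 0 < e ->
  \forall s \near F, cmeas (fun t => f (circle_pt s t)) ->
    (energy (fun t => f (circle_pt s t)) <= 2%:E * energy g + (2 * e)%:E)%E.
Proof.
move=> [mg _ cv] e0; have /fine_cvgP[fin /cvgrPdist_lt/(_ _ e0) near_e] := cv.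
apply: filterS2 fin near_e => s fin_s near_s ms.
have -> : (fun t => f (circle_pt s t)) = (fun t => g t + (f (circle_pt s t) - g t)).
  by apply/funext => t; rewrite addrC subrK.
have md : cmeas (fun t => f (circle_pt s t) - g t) by rewrite sub_mN1; exact: (cmeasD ms (cmeasZ _ mg)).
apply: (le_trans (energyD mg md)); rewrite leeD2l// EFinM lee_pmul2l//.
rewrite sub0r normrN in near_s; rewrite -[leLHS](fineK fin_s) lee_fin ltW//.
exact: le_lt_trans (ler_norm _) near_s.
Qed.

(** [L2_trace] is an unspecified choice among possible traces, so its energy is estimated through
    the defining limit alone. *)
Lemma trace_below f (F : set_system K) {FF : ProperFilter F} g (M : K) : is_L2_trace f F g ->
  (\forall s \near F, cmeas (fun t => f (circle_pt s t)) /\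
     forall t, ang t -> cabs (f (circle_pt s t)) <= M) ->
  (energy g <= (4 * pi * M ^+ 2)%:E)%E.
Proof.
move=> [mg _ cv] hM; apply/lee_addgt0Pr => e e0.
have e20 : 0 < e / 2 by rewrite divr_gt0.
have /fine_cvgP[fin /cvgrPdist_lt/(_ _ e20) near_e] := cv.
have [s [[ms sM] [fin_s near_s]]] := filter_ex (filterI hM (filterI fin near_e)).
have -> : g = (fun t => f (circle_pt s t) + -1 * (f (circle_pt s t) - g t)).
  by apply/funext => t; ring.
have md : cmeas (fun t => f (circle_pt s t) - g t) by rewrite sub_mN1; exact: (cmeasD ms (cmeasZ _ mg)).
apply: (le_trans (energyD ms (cmeasZ _ md))); rewrite (energyN1 md); apply: leeD.
  have -> : 4 * pi * M ^+ 2 = 2 * (2 * pi * M ^+ 2) by ring.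
  by rewrite EFinM lee_pmul2l//; exact: energy_le.
have -> : e = 2 * (e / 2) by field.
rewrite EFinM lee_pmul2l//; rewrite sub0r normrN in near_s.
rewrite -[leLHS](fineK fin_s) lee_fin ltW//; exact: le_lt_trans (ler_norm _) near_s.
Qed.

Lemma near_right_annulus c : R < c -> \forall s \near R^'+, R < s < c.
Proof.
move=> Rc; near=> s; apply/andP; split; first by near: s; exact: nbhs_right_gt.
by near: s; exact: nbhs_right_lt.
Unshelve. all: by end_near. Qed.

Lemma near_left_annulus c : c < R^-1 -> \forall s \near R^-1^'-, c < s < R^-1.
Proof.
move=> Rc; near=> s; apply/andP; split; first by near: s; exact: nbhs_left_gt.
by near: s; exact: nbhs_left_lt.
Unshelve. all: by end_near. Qed.

Lemma hardy_norm_ge0 f : 0 <= hardy_norm R f.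
Proof. exact: sqrtr_ge0. Qed.

Lemma trace_fin f (F : set_system K) : (exists g, is_L2_trace f F g) ->
  energy (L2_trace f F) \is a fin_num.
Proof. by move=> /trace_spec[_ h _]; rewrite ge0_fin_numE// energy_ge0. Qed.

Lemma hardy_norm_sq f : hardy R f ->
  (2 * pi * hardy_norm R f ^+ 2)%:E = (energy (L2_trace f R^'+) + energy (L2_trace f R^-1^'-))%E.
Proof.
move=> [_ _ h1 h2]; have f1 := trace_fin h1; have f2 := trace_fin h2.
rewrite -(fineK f1) -(fineK f2) -EFinD; congr EFin.
have p2 : 0 < 2 * pi :> K by rewrite mulr_gt0// pi_gt0.
rewrite /hardy_norm sqr_sqrtr; last first.
  rewrite mulr_ge0 ?invr_ge0 ?(ltW p2)// addr_ge0// fine_ge0//.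
    by rewrite -/(energy _) energy_ge0.
  by rewrite -/(energy _) energy_ge0.
by rewrite mulrA mulfV ?mul1r// gt_eqF.
Qed.

Lemma circle_kernel_energy f z s (k : K) : an R f -> R < s < R^-1 -> cabs z != s ->
  (forall x, cabs x = s -> cabs (x / (x - z)) <= k) ->
  ((2 * pi * cabs (cmean s (fun x => x * f x / (x - z))) ^+ 2)%:E <=
    (k ^+ 2)%:E * energy (fun t => f (circle_pt s t)))%E.
Proof.
move=> hf sR zs hk; have s0 : 0 < s by case/andP: sR => /(lt_trans R0).
have cf := an_circle_cont hf sR.
have cH : continuous (fun t => circle_pt s t * f (circle_pt s t) / (circle_pt s t - z)).
  have cc : circ_cont s (fun x => x * f x / (x - z)).
    apply: ccM; last exact: cc_kernel.
    apply: ccM; first exact: cc_id.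
    by apply: cc_hol => x xs; apply: hf; rewrite /annulus /= xs.
  move=> t; apply: (@continuous_comp _ _ _ (circle_pt s) (fun x => x * f x / (x - z))).
    exact: circle_pt_cont.
  by apply: (circ_contP cc); rewrite cabs_circle_pt// ltW.
have k0 : 0 <= k.
  apply: le_trans (cabs_ge0 _) (hk (rc s) _); by rewrite cabs_rc gtr0_norm.
apply: (le_trans (mean_energy cH)).
have -> : (k ^+ 2)%:E = (cabs (rc k : C) ^+ 2)%:E by rewrite cabs_rc ger0_norm.
rewrite -(energyZ (rc k) (cmeas_cont cf)).
apply: (le_energy (cmeas_cont cH) (cmeasZ (rc k) (cmeas_cont cf))).
move=> t _; set x := circle_pt s t; have xs : cabs x = s by rewrite cabs_circle_pt// ltW.
have -> : x * f x / (x - z) = x / (x - z) * f x by rewrite mulrAC.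
rewrite !cabsM cabs_rc (ger0_norm k0) ler_wpM2r ?cabs_ge0// -cabsM; exact: hk.
Qed.

(** Boundedness of point evaluation: the two circles of Cauchy's formula are moved towards the
    boundary, where the traces control the energy, while staying away from |z| = c by at least half
    the distance from c to the boundary radius. *)
Lemma hardy_sup c : R < c < R^-1 -> exists2 A : K, 0 <= A &
  forall f, hardy R f -> forall z, cabs z = c -> cabs (f z) <= A * hardy_norm R f.
Proof.
move=> /andP[Rc cR].
pose k1 := R^-1 * ((c - R) / 2)^-1; pose k2 := R^-1 * ((R^-1 - c) / 2)^-1.
have RV0 : 0 < R^-1 by rewrite invr_gt0.
have d1 : 0 < (c - R) / 2 by rewrite divr_gt0// subr_gt0.
have d2 : 0 < (R^-1 - c) / 2 by rewrite divr_gt0// subr_gt0.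
have k10 : 0 <= k1 by rewrite mulr_ge0// ltW// invr_gt0.
have k20 : 0 <= k2 by rewrite mulr_ge0// ltW// invr_gt0.
exists (2 * (k1 + k2)) => [|f hf z zc]; first by rewrite mulr_ge0// addr_ge0.
have fa := hardy_an hf; have nsq := hardy_norm_sq hf.
have p2 : 0 < 2 * pi :> K by rewrite mulr_gt0// pi_gt0.
have N0 := hardy_norm_ge0 f.
set N := hardy_norm R f in nsq N0 *.
have kh x : R < cabs x < R^-1 -> cabs x != cabs z -> hol (fun x => x * f x / (x - z)) x.
  move=> xR xz; apply: holM; first by apply: holM; [exact: hol_id|exact: fa].
  apply: holV; first by rewrite subr_eq0; apply: contraNneq xz => ->.
  by apply: holB; [exact: hol_id|exact: hol_cst].
have finish (A : C) (k : K) (G : K -> C) : 0 <= k -> (energy G <= (2 * pi * N ^+ 2)%:E)%E ->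
    (forall e : K, 0 < e -> ((2 * pi * cabs A ^+ 2)%:E <=
       (k ^+ 2)%:E * (2%:E * energy G + (2 * e)%:E))%E) -> cabs A <= 2 * k * N.
  move=> k0 GN hA; rewrite -(@ler_pXn2r _ 2)// ?nnegrE ?cabs_ge0 ?mulr_ge0//.
  apply/ler_addgt0Pr => e e0.
  have k1' : 0 < k ^+ 2 + 1 by rewrite ltr_wpDl ?sqr_ge0.
  have e'0 : 0 < e * pi / (k ^+ 2 + 1) by rewrite !mulr_gt0 ?pi_gt0// invr_gt0.
  have := hA _ e'0; set e' := e * pi / _.
  have le1 : ((k ^+ 2)%:E * (2%:E * energy G + (2 * e')%:E) <=
      (k ^+ 2)%:E * (2%:E * (2 * pi * N ^+ 2)%:E + (2 * e')%:E))%E.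
    by rewrite lee_wpmul2l ?lee_fin ?sqr_ge0// leeD2r// lee_pmul2l.
  move=> /le_trans/(_ le1); rewrite -!(EFinM, EFinD) lee_fin => h.
  rewrite -(ler_pM2l p2); apply: le_trans h _.
  have -> : 2 * pi * ((2 * k * N) ^+ 2 + e) =
     k ^+ 2 * (2 * (2 * pi * N ^+ 2)) + (2 * (e * pi) + 4 * pi * k ^+ 2 * N ^+ 2) by ring.
  rewrite mulrDr lerD2l; apply: (@le_trans _ _ (2 * (e * pi))); last first.
    by rewrite lerDl !mulr_ge0 ?sqr_ge0// ltW// pi_gt0.
  rewrite mulrCA ler_pM2l// /e' mulrCA ler_piMr//; first by rewrite mulr_ge0 ?(ltW e0)// ltW// pi_gt0.
  by rewrite ler_pdivrMr// mul1r lerDl.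
have eN1 : (energy (L2_trace f R^'+) <= (2 * pi * N ^+ 2)%:E)%E.
  by rewrite nsq leeDl// energy_ge0.
have eN2 : (energy (L2_trace f R^-1^'-) <= (2 * pi * N ^+ 2)%:E)%E.
  by rewrite nsq leeDr// energy_ge0.
have [_ _ /trace_spec t1 /trace_spec t2] := hf.
have Rm : R < (R + c) / 2 by lra.
have mc : (R + c) / 2 < c by lra.
have mR : (c + R^-1) / 2 < R^-1 by lra.
have cm : c < (c + R^-1) / 2 by lra.
pose s1 := (R + c) / 2; pose s2 := (c + R^-1) / 2.
rewrite (cauchy_annulus (ltW R0) fa (s1 := s1) (s2 := s2)) ?zc//.
have A2 : cabs (cmean s2 (fun x => x * f x / (x - z))) <= 2 * k2 * N.
  apply: (finish _ _ _ k20 eN2) => e e0.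
  have [s [sb hs]] := filter_ex (filterI (near_left_annulus mR) (trace_above t2 e0)).
  case/andP: sb => h1 h2; have cs : c < s by rewrite (lt_trans cm).
  have sR : R < s < R^-1 by rewrite h2 (lt_trans Rc).
  rewrite (@circle_const _ _ c R^-1 s2 s)//; last 4 first.
  - by rewrite ltW// (lt_trans R0).
  - move=> x /andP[x1 x2]; apply: kh; first by rewrite x2 (lt_trans Rc).
    by rewrite zc gt_eqF.
  - by rewrite cm mR.
  - by rewrite cs h2.
  apply: (le_trans (circle_kernel_energy fa sR _ (k := k2) _)); last 1 first.
  - by rewrite lee_wpmul2l ?lee_fin ?sqr_ge0//; exact: hs (cmeas_cont (an_circle_cont fa sR)).
  - by rewrite zc lt_eqF.
  move=> x xs; rewrite cabsM cabsV xs /k2 ler_pM ?invr_ge0 ?cabs_ge0//.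
  - by rewrite ltW// (lt_trans (lt_trans R0 Rc)).
  - by rewrite ltW.
  - have gap : (R^-1 - c) / 2 <= cabs (x - z).
      apply: le_trans (cabs_sub_ge _ _); rewrite xs zc.
      apply: le_trans (_ : s2 - c <= _); last by rewrite lerD2r ltW.
      by rewrite /s2; lra.
    by rewrite lef_pV2 ?posrE// (lt_le_trans d2).
have A1 : cabs (cmean s1 (fun x => x * f x / (x - z))) <= 2 * k1 * N.
  apply: (finish _ _ _ k10 eN1) => e e0.
  have [s [sb hs]] := filter_ex (filterI (near_right_annulus Rm) (trace_above t1 e0)).
  case/andP: sb => h1 h2; have cs : s < c by rewrite (lt_trans h2).
  have sR : R < s < R^-1 by rewrite h1 (lt_trans cs).
  rewrite (@circle_const _ _ R c s1 s)//; last 4 first.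
  - exact: ltW.
  - move=> x /andP[x1 x2]; apply: kh; first by rewrite x1 (lt_trans x2).
    by rewrite zc lt_eqF.
  - by rewrite Rm mc.
  - by rewrite cs h1.
  apply: (le_trans (circle_kernel_energy fa sR _ (k := k1) _)); last 1 first.
  - by rewrite lee_wpmul2l ?lee_fin ?sqr_ge0//; exact: hs (cmeas_cont (an_circle_cont fa sR)).
  - by rewrite zc gt_eqF.
  move=> x xs; rewrite cabsM cabsV xs /k1 ler_pM ?invr_ge0 ?cabs_ge0//.
  - by rewrite ltW// (lt_trans R0).
  - by rewrite ltW// (lt_trans cs).
  - have gap : (c - R) / 2 <= cabs (x - z).
      rewrite cabsBC; apply: le_trans (cabs_sub_ge _ _); rewrite xs zc.
      apply: le_trans (_ : c - s1 <= _); last by rewrite lerD2l lerN2 ltW.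
      by rewrite /s1; lra.
    by rewrite lef_pV2 ?posrE// (lt_le_trans d1).
apply: le_trans (cabsB _ _) _; apply: le_trans (lerD A2 A1) _.
by rewrite -mulrDl -mulrDr [k2 + k1]addrC.
Qed.

Lemma restrictE F z : annulus R z -> restrict_annulus R F z = F z.
Proof. by move=> zR; rewrite /restrict_annulus patchE mem_set. Qed.

Lemma restrict_out F z : ~ annulus R z -> restrict_annulus R F z = 0.
Proof. by move=> zR; rewrite /restrict_annulus patchE memNset. Qed.

Lemma annulus_open z : annulus R z ->
  exists2 d : K, 0 < d & forall x, cabs (x - z) < d -> annulus R x.
Proof.
move=> /andP[h1 h2]; exists (Num.min (cabs z - R) (R^-1 - cabs z)).
  by rewrite lt_min !subr_gt0 h1 h2.
move=> x; rewrite lt_min => /andP[x1 x2]; apply/andP; split.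
  rewrite -(ltrN2 (cabs x)) -(ltrD2l (cabs z)).
  by apply: le_lt_trans x1; rewrite cabsBC cabs_sub_ge.
rewrite -(ltrD2r (- cabs z)); apply: le_lt_trans x2; exact: cabs_sub_ge.
Qed.

Lemma restrict_hol F z : annulus R z -> hol F z -> hol (restrict_annulus R F) z.
Proof.
move=> zR hF; have [d d0 hd] := annulus_open zR.
by apply: (hol_ext d0 _ hF) => x /hd xR; rewrite restrictE.
Qed.

Lemma restrict_an F : an R F -> an R (restrict_annulus R F).
Proof. by move=> hF z zR; apply: restrict_hol => //; exact: hF. Qed.

Lemma circle_pt_circ s t : circle_pt s t = circ s (t / (2 * pi)) :> C.
Proof. by rewrite /circ mulrC divfK// mulf_neq0 ?pnatr_eq0// gt_eqF// pi_gt0. Qed.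

Lemma ang01 t : ang t -> 0 <= t / (2 * pi) <= 1.
Proof.
have p2 : 0 < 2 * pi :> K by rewrite mulr_gt0// pi_gt0.
rewrite /angles /= in_itv /= => /andP[t0 t1].
by rewrite divr_ge0 ?(ltW p2)//= ler_pdivrMr// mul1r.
Qed.

Lemma trace_of_cont (F : C -> C) (Fl : set_system K) {FF : Filter Fl} (c : K) : 0 <= c ->
  (forall z, cabs z = c -> hol F z) -> (\forall s \near Fl, R < s < R^-1) ->
  (forall d : K, 0 < d -> \forall s \near Fl, `|s - c| < d) -> an R F ->
  is_L2_trace (restrict_annulus R F) Fl (fun t => F (circle_pt c t)).
Proof.
move=> c0 hF nR nc aF.
have cg : continuous (fun t => F (circle_pt c t)).
  move=> t; apply: (@continuous_comp _ _ _ (circle_pt c) F); first exact: circle_pt_cont.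
  by apply/hol_cont/hF; rewrite cabs_circle_pt.
have p2 : 0 < 2 * pi :> K by rewrite mulr_gt0// pi_gt0.
have ccF : circ_cont c F by exact: cc_hol.
have mg := cmeas_cont cg.
have bound (e : K) : 0 < e -> \forall s \near Fl,
    (energy (fun t => (restrict_annulus R F (circle_pt s t) - F (circle_pt c t))%R) <=
     (2 * pi * e ^+ 2)%:E)%E.
  move=> e0.
  have hFt t : 0 <= t <= 1 -> {for circ c t, continuous F}.
    by move=> _; apply: (circ_contP ccF); rewrite cabs_circ.
  have [d d0 hd] := path_cont_unif (@circ_cont_t K c) hFt e0.
  apply: filterS2 nR (nc _ d0) => s sR sc.
  have sge : 0 <= s by case/andP: sR => /(lt_trans R0)/ltW.
  apply: energy_le.
    rewrite sub_mN1.
    exact: (cmeasD (cmeas_cont (an_circle_cont (restrict_an aF) sR)) (cmeasZ _ mg)).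
  move=> t /ang01 t01; rewrite restrictE; last by rewrite /annulus /= cabs_circle_pt.
  apply: ltW; rewrite [circle_pt c t]circle_pt_circ; apply: hd => //.
  rewrite -circle_pt_circ circle_ptE [X in _ - X]circle_ptE -mulrBl -rcB cabsM cabs_rc.
  by rewrite cabs_circle_pt// mulr1.
split; first exact: mg.
  have [B hB] := seg_bounded (seg_cont_circ c0 ccF).
  apply: (@le_lt_trans _ _ (2 * pi * B ^+ 2)%:E); last by rewrite ltry.
  by apply: (energy_le mg) => t /ang01/hB; rewrite -circle_pt_circ.
apply/fine_cvgP; split.
  apply: filterS (bound 1 ltr01) => s hs.
  by rewrite ge0_fin_numE ?energy_ge0//; apply: le_lt_trans hs _; rewrite ltry.
apply/cvgrPdist_lt => e e0; pose e' := Num.min 1 (e / (4 * pi)).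
have e'0 : 0 < e' by rewrite lt_min ltr01 divr_gt0// mulr_gt0// pi_gt0.
have e'1 : e' <= 1 by rewrite ge_min lexx.
apply: filterS (bound _ e'0) => s hs; rewrite sub0r normrN.
have fin : energy (fun t => restrict_annulus R F (circle_pt s t) - F (circle_pt c t)) \is a fin_num.
  by rewrite ge0_fin_numE ?energy_ge0//; apply: le_lt_trans hs _; rewrite ltry.
rewrite -(fineK fin) lee_fin in hs.
rewrite ger0_norm; last by apply: fine_ge0; exact: energy_ge0.
apply: le_lt_trans hs _.
have e'e : e' <= e / (4 * pi) by rewrite ge_min lexx orbT.
rewrite ler_pdivlMr ?mulr_gt0 ?pi_gt0// in e'e.
apply: (@le_lt_trans _ _ (2 * pi * e')).
  by rewrite ler_pM2l// expr2 ler_piMl// ltW.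
apply: lt_le_trans e'e; rewrite mulrC ltr_pM2l// ltr_pM2r ?pi_gt0// ltr_nat //.
Qed.

(** Holomorphy past the boundary provides the traces by uniform continuity. The two traces have
    energy at most 4 pi M^2 each, which already gives norm at most 2 M. *)
Lemma hardy_ext F (rho M : K) : 0 < rho -> rho < R ->
  (forall z, rho < cabs z < rho^-1 -> hol F z) ->
  (forall z, R <= cabs z <= R^-1 -> cabs (F z) <= M) ->
  hardy R (restrict_annulus R F) /\ hardy_norm R (restrict_annulus R F) <= 3 * M.
Proof.
move=> rho0 rhoR hF FM.
have RrV : R^-1 < rho^-1 by rewrite ltf_pV2 ?posrE.
have aF : an R F by move=> z /andP[h1 h2]; apply: hF; rewrite (lt_trans rhoR)//= (lt_trans h2).
have RV0 : 0 < R^-1 by rewrite invr_gt0.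
have nr1 : \forall s \near R^'+, R < s < R^-1 by exact: near_right_annulus.
have nl1 : \forall s \near R^-1^'-, R < s < R^-1 by exact: near_left_annulus.
have t1 : is_L2_trace (restrict_annulus R F) R^'+ (fun t => F (circle_pt R t)).
  apply: trace_of_cont => //; first exact: ltW.
    by move=> z zR; apply: hF; rewrite zR rhoR (lt_trans RV).
  move=> d d0; have h : R < R + d by rewrite ltrDl.
  apply: filterS (near_right_annulus h) => s /andP[s1 s2].
  by rewrite gtr0_norm ?subr_gt0// ltrBlDl.
have t2 : is_L2_trace (restrict_annulus R F) R^-1^'- (fun t => F (circle_pt R^-1 t)).
  apply: trace_of_cont => //; first exact: ltW.
    by move=> z zR; apply: hF; rewrite zR RrV (lt_trans rhoR).
  move=> d d0; have h : R^-1 - d < R^-1 by rewrite ltrBlDr ltrDl.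
  apply: filterS (near_left_annulus h) => s /andP[s1 s2].
  by rewrite distrC gtr0_norm ?subr_gt0// ltrBlDl -ltrBlDr.
have hh : hardy R (restrict_annulus R F).
  split.
  - exact: restrict_out.
  - by move=> z zR; apply/holE; exact: restrict_an.
  - by eexists; exact: t1.
  - by eexists; exact: t2.
split => //; have M0 : 0 <= M.
  apply: le_trans (cabs_ge0 _) (FM (rc 1) _).
  by rewrite cabs_rc normr1 (ltW R1) invf_ge1// ltW.
have [_ _ h1 h2] := hh.
have bd s : R < s < R^-1 -> cmeas (fun t => restrict_annulus R F (circle_pt s t)) /\
     forall t, ang t -> cabs (restrict_annulus R F (circle_pt s t)) <= M.
  move=> sR; split; first by exact: (cmeas_cont (an_circle_cont (restrict_an aF) sR)).
  move=> t _; have sge : 0 <= s by case/andP: sR => /(lt_trans R0)/ltW.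
  case/andP: (sR) => s1 s2.
  rewrite restrictE; last by rewrite /annulus /= cabs_circle_pt.
  by apply: FM; rewrite cabs_circle_pt// (ltW s1) (ltW s2).
have E1 : (energy (L2_trace (restrict_annulus R F) R^'+) <= (4 * pi * M ^+ 2)%:E)%E.
  by apply: (trace_below (trace_spec h1)); exact: filterS bd nr1.
have E2 : (energy (L2_trace (restrict_annulus R F) R^-1^'-) <= (4 * pi * M ^+ 2)%:E)%E.
  by apply: (trace_below (trace_spec h2)); exact: filterS bd nl1.
rewrite -(@ler_pXn2r _ 2)// ?nnegrE ?hardy_norm_ge0 ?mulr_ge0//.
have p2 : 0 < 2 * pi :> K by rewrite mulr_gt0// pi_gt0.
rewrite -(ler_pM2l p2) -lee_fin (hardy_norm_sq hh).
apply: (le_trans (leeD E1 E2)); rewrite -EFinD lee_fin.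
have -> : 4 * pi * M ^+ 2 + 4 * pi * M ^+ 2 = 2 * pi * (2 * M) ^+ 2 by ring.
by rewrite ler_pM2l// lerXn2r ?nnegrE ?mulr_ge0// ler_wpM2r// ler_nat.
Qed.

Lemma trace_lin f f' (Fl : set_system K) {FF : Filter Fl} g g' (a : C) :
  an R f -> an R f' -> (\forall s \near Fl, R < s < R^-1) ->
  is_L2_trace f Fl g -> is_L2_trace f' Fl g' ->
  is_L2_trace (a *: f + f') Fl (fun t => a * g t + g' t).
Proof.
move=> fa fa' nR [mg Eg cg] [mg' Eg' cg'].
have p2 (x y : \bar K) : (0 <= x)%E -> (0 <= y)%E -> (x < +oo)%E -> (y < +oo)%E ->
    (2%:E * ((cabs a ^+ 2)%:E * x) + 2%:E * y < +oo)%E.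
  move=> x0 y0; rewrite -(ge0_fin_numE x0) -(ge0_fin_numE y0) => fx fy.
  by rewrite -(fineK fx) -(fineK fy) -!EFinM -EFinD ltry.
have bound s : R < s < R^-1 ->
   (energy (fun t => ((a *: f + f') (circle_pt s t) - (a * g t + g' t))%R) <=
    2%:E * ((cabs a ^+ 2)%:E * energy (fun t => (f (circle_pt s t) - g t)%R)) +
    2%:E * energy (fun t => (f' (circle_pt s t) - g' t)%R))%E.
  move=> sR.
  have m1 : cmeas (fun t => f (circle_pt s t) - g t).
    by rewrite sub_mN1; exact: (cmeasD (cmeas_cont (an_circle_cont fa sR)) (cmeasZ _ mg)).
  have m2 : cmeas (fun t => f' (circle_pt s t) - g' t).
    by rewrite sub_mN1; exact: (cmeasD (cmeas_cont (an_circle_cont fa' sR)) (cmeasZ _ mg')).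
  have -> : (fun t => (a *: f + f') (circle_pt s t) - (a * g t + g' t)) =
      (fun t => a * (f (circle_pt s t) - g t) + (f' (circle_pt s t) - g' t)).
    apply/funext => t; rewrite -[(a *: f + f') _]/(a * f _ + f' _); ring.
  by rewrite -(energyZ a m1); exact: (energyD (cmeasZ a m1) m2).
split.
- exact: (cmeasD (cmeasZ a mg) mg').
- apply: le_lt_trans (energyD (cmeasZ a mg) mg') _.
  by rewrite energyZ//; apply: p2 => //; exact: energy_ge0.
- apply: (@squeeze_cvge _ _ _ _ (cst 0%E) _ (fun s =>
    (2%:E * ((cabs a ^+ 2)%:E * energy (fun t => (f (circle_pt s t) - g t)%R)) +
    2%:E * energy (fun t => (f' (circle_pt s t) - g' t)%R))%E)).
  + apply: filterS nR => s sR; rewrite energy_ge0 /=; exact: bound.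
  + exact: cvg_cst.
  + rewrite (_ : 0%E = (2%:E * ((cabs a ^+ 2)%:E * 0) + 2%:E * 0)%E); last by rewrite !mule0 adde0.
    apply: cvgeD; first by rewrite !mule0 fin_num_adde_defl.
      by apply: cvgeMl => //; apply: cvgeMl.
    exact: cvgeMl.
Qed.

Lemma hardy_lin a f f' : hardy R f -> hardy R f' -> hardy R (a *: f + f').
Proof.
move=> hf hf'; have fa := hardy_an hf; have fa' := hardy_an hf'.
have [h1 _ [g1 t1] [g2 t2]] := hf; have [h1' _ [g1' t1'] [g2' t2']] := hf'.
have E z : (a *: f + f') z = a * f z + f' z by [].
split.
- by move=> z zR; rewrite E h1// h1'// mulr0 addr0.
- move=> z zR; apply/holE.
  by apply: (@holD _ (fun z => a * f z) f'); [apply: holM; [exact: hol_cst|exact: fa]|exact: fa'].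
- exists (fun t => a * g1 t + g1' t); apply: trace_lin => //; exact: near_right_annulus.
- exists (fun t => a * g2 t + g2' t); apply: trace_lin => //; exact: near_left_annulus.
Qed.

End Hardy.

(** * Uniform bounds for Blaschke products and the choice of radii *)

Section BlaschkeBounds.
Variable K : realType.
Local Notation C := (Cplx K).
Implicit Types (T : blaschke K) (z w a b : C) (g : C -> C).

Lemma bl_hol T z : cabs z <= 1 -> hol (bl_fun T) z.
Proof.
move=> z1; apply: (@holM _ (fun=> bl_rot T) (bprod (bl_zeros T))); first exact: hol_cst.
exact: bprod_hol (@bl_zeros_disc _ T) z1.
Qed.

Lemma bl_le1 T z : cabs z <= 1 -> cabs (bl_fun T z) <= 1.
Proof.
move=> z1; rewrite /bl_fun cabsM bl_rot_unit mul1r.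
exact: bprod_le1 (@bl_zeros_disc _ T) z1.
Qed.

Lemma bl_max_ub T (R : K) z : R <= 1 -> cabs z = R -> cabs (bl_fun T z) <= bl_max T R.
Proof.
move=> R1 zR; rewrite /bl_max; apply: ub_le_sup; last by exists z.
by exists 1 => _ [w /= wR <-]; apply: bl_le1; rewrite wR.
Qed.

Lemma bl_disc_le T (R r : K) z : 0 < R < 1 -> bl_max T R <= r -> cabs z <= R ->
  cabs (bl_fun T z) <= r.
Proof.
move=> /andP[R0 R1] Tr zR.
have ub x : cabs x = R -> cabs (bl_fun T x) <= r.
  by move=> xR; apply: le_trans Tr; apply: bl_max_ub => //; exact: ltW.
have r0 : 0 <= r.
  by apply: le_trans (cabs_ge0 _) (ub (rc R) _); rewrite cabs_rc gtr0_norm.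
apply: (@max_principle _ _ 1 R) => //; last by rewrite R0.
by move=> x x1; apply: bl_hol; exact: ltW.
Qed.

(** The Cauchy bound for the difference quotient on the circle of radius (1 + rho)/2, which stays at
    distance (1 - rho)/2 from both points. The constant is the same for all T, whatever the
    degree. *)
Lemma bl_lipschitz T (rho : K) z a : rho < 1 -> cabs z <= rho -> cabs a <= rho ->
  cabs (bl_fun T z - bl_fun T a) <= 4 / (1 - rho) ^+ 2 * cabs (z - a).
Proof.
move=> rho1 zr ar; have rho0 := le_trans (cabs_ge0 _) zr.
pose s := (1 + rho) / 2; have sr : rho < s by rewrite /s; lra.
have s1 : s < 1 by rewrite /s; lra.
have hT x : cabs x < 1 -> hol (bl_fun T) x by move=> x1; apply: bl_hol; exact: ltW.
rewrite (@dqE _ _ 1 a z hT) addrAC subrr add0r cabsM mulrC ler_wpM2r ?cabs_ge0//.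
have ub x : cabs x = s -> cabs (bl_fun T x) <= 1.
  by move=> xs; apply: bl_le1; rewrite xs ltW.
have as_ := le_lt_trans ar sr; have zs := le_lt_trans zr sr.
apply: (le_trans (dq_bound hT as_ zs s1 ub)); rewrite mulr1.
have d0 : 0 < 1 - rho by rewrite subr_gt0.
have ha : (1 - rho) / 2 <= s - cabs a by rewrite /s; lra.
have hz : (1 - rho) / 2 <= s - cabs z by rewrite /s; lra.
have e : 4 / (1 - rho) ^+ 2 = (((1 - rho) / 2) * ((1 - rho) / 2))^-1.
  by field; rewrite gt_eqF.
have d2 : 0 < (1 - rho) / 2 by rewrite divr_gt0.
have da : 0 < s - cabs a by rewrite subr_gt0.
have dz : 0 < s - cabs z by rewrite subr_gt0.
have p0 : 0 < ((s - cabs a) * (s - cabs z))^-1 by rewrite invr_gt0 mulr_gt0.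
rewrite e; apply: (@le_trans _ _ ((s - cabs a) * (s - cabs z))^-1).
  by rewrite ler_piMl ?(ltW s1)// ltW.
rewrite lef_pV2 ?posrE ?mulr_gt0//.
by rewrite ler_pM// ltW.
Qed.

(** The bound r on the disc of radius R extends to a slightly larger disc at the cost of the
    Lipschitz constant, which is common to all T. So one set of radii serves the whole random
    family. *)
Lemma radii_exist (r R : K) : 0 <= r -> r < R -> R < 1 ->
  exists s s0 : K, [/\ 0 < (r + R) / 2, (r + R) / 2 < R, R < s, s < s0 & s0 < 1] /\
    forall T, bl_max T R <= r -> selfmap s0 ((r + R) / 2) (bl_fun T).
Proof.
move=> r0 rR R1; have R0 := le_lt_trans r0 rR.
pose rho := (1 + R) / 2; pose L := 4 / (1 - rho) ^+ 2.
have rho1 : rho < 1 by rewrite /rho; lra.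
have Rrho : R < rho by rewrite /rho; lra.
have L0 : 0 < L by rewrite divr_gt0// exprn_gt0// subr_gt0.
pose d := Num.min (rho - R) ((R - r) / 2 / L).
have Rr2 : 0 < (R - r) / 2 by lra.
have d0 : 0 < d by rewrite lt_min subr_gt0 Rrho divr_gt0.
have d1 : d <= rho - R by rewrite ge_min lexx.
have d2 : d * L <= (R - r) / 2 by rewrite -ler_pdivlMr// ge_min lexx orbT.
exists (R + d / 2), (R + d); split.
  by split; lra.
move=> T Tr z zs; have zrho : cabs z <= rho by lra.
split; first by apply: bl_hol; lra.
have [zR|Rz] := leP (cabs z) R.
  have h : cabs (bl_fun T z) <= r by apply: (bl_disc_le _ Tr zR); rewrite R0.
  by lra.
have z0 : 0 < cabs z := lt_trans R0 Rz.
pose a := rc (R / cabs z) * z.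
have aR : cabs a = R.
  by rewrite cabsM cabs_rc ger0_norm ?divfK ?gt_eqF// divr_ge0// ltW.
have za : cabs (z - a) = cabs z - R.
  have -> : z - a = rc (1 - R / cabs z) * z by rewrite /a rcB rc1; ring.
  rewrite cabsM cabs_rc ger0_norm; first by field; rewrite gt_eqF.
  by rewrite subr_ge0 ler_pdivrMr// mul1r ltW.
have h1 : cabs (bl_fun T a) <= r.
  by apply: (bl_disc_le _ Tr); rewrite ?R0// aR.
have arho : cabs a <= rho by rewrite aR ltW.
have h2 := bl_lipschitz T rho1 zrho arho; rewrite za -/L in h2.
have h3 : L * (cabs z - R) <= d * L by rewrite mulrC ler_pM2r//; lra.
have -> : bl_fun T z = bl_fun T a + (bl_fun T z - bl_fun T a) by ring.
apply: le_trans (cabsD _ _) _; lra.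
Qed.

End BlaschkeBounds.

(** * Schwarz-Pick estimates and contraction of the pseudo-hyperbolic distance *)

Section SchwarzPick.
Variable K : realType.
Local Notation C := (Cplx K).
Implicit Types (z w a b : C) (g h : C -> C).

Lemma schwarz h z : (forall x, cabs x < 1 -> hol h x) -> (forall x, cabs x < 1 -> cabs (h x) <= 1) ->
  h 0 = 0 -> cabs z < 1 -> cabs (h z) <= cabs z.
Proof.
move=> hh h1 h0 z1.
suff d1 : cabs (dq h 0 z) <= 1.
  by rewrite (dqE 0 z hh) h0 add0r subr0 cabsM ler_piMr// cabs_ge0.
have c0 : cabs (0 : C) < 1 by rewrite cabs0.
have hd x : cabs x < 1 -> hol (dq h 0) x by move=> x1; exact: (dq_hol hh).
apply/ler_addgt0Pr => e e0.
(* The quotient is at most 1/s on C_s. One entry puts z inside this circle, the other makes 1/s at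
   most 1 + e. *)
pose s := Num.max ((1 + cabs z) / 2) (1 + e)^-1.
have e1 : 0 < 1 + e by rewrite addr_gt0.
have zs : cabs z < s by rewrite lt_max; apply/orP; left; lra.
have s1 : s < 1 by rewrite gt_max invf_lt1// ltrDl e0 andbT; lra.
have s0 : 0 < s := le_lt_trans (cabs_ge0 _) zs.
have sV : s^-1 <= 1 + e.
  by rewrite -[leRHS]invrK lef_pV2 ?posrE ?invr_gt0// le_max lexx orbT.
apply: le_trans sV; apply: (@max_principle _ _ 1 s) => //.
- by rewrite s0.
- by rewrite invr_ge0 ltW.
- move=> x xs; have x0 : x != 0 by rewrite -cabs_gt0 xs.
  rewrite /dq (negbTE x0) h0 !subr0 cabsM cabsV xs -[leRHS]mul1r ler_wpM2r ?invr_ge0 ?(ltW s0)//.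
  by apply: h1; rewrite xs.
- exact: ltW.
Qed.

Definition moebius a z : C := (z - a) / (1 - cbar a * z).

Lemma moebius_le1 a z : cabs a < 1 -> cabs z <= 1 -> cabs (moebius a z) <= 1.
Proof.
move=> a1 z1; have := @bprod_le1 _ [:: a] z _ z1; rewrite /bprod big_seq1; apply.
by move=> b; rewrite inE => /eqP ->.
Qed.

Lemma moebius_lt1 a z : cabs a < 1 -> cabs z < 1 -> cabs (moebius a z) < 1.
Proof.
move=> a1 z1; rewrite cabsM cabsV ltr_pdivrMr ?mul1r; first exact: factor_lt.
by rewrite cabs_gt0 den_neq0// ltW.
Qed.

Lemma moebius_hol a z : cabs a < 1 -> cabs z <= 1 -> hol (moebius a) z.
Proof.
move=> a1 z1; apply: holM; first by apply: holB; [exact: hol_id|exact: hol_cst].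
apply: holV; first exact: den_neq0.
by apply: holB; [exact: hol_cst|apply: holM; [exact: hol_cst|exact: hol_id]].
Qed.

Lemma moebiusNK a z : cabs a < 1 -> cabs z < 1 -> moebius (- a) (moebius a z) = z.
Proof.
move=> a1 z1; rewrite /moebius cbarN mulNr !opprK.
have n1 : 1 - cbar a * z != 0 by rewrite den_neq0// ltW.
have n2 : 1 - a * cbar a != 0.
  rewrite mul_cbar -rc1 -rcB rc_eq0 gt_eqF// subr_gt0; exact: cabs_lt1_sq.
have e : 1 + cbar a * ((z - a) / (1 - cbar a * z)) = (1 - a * cbar a) / (1 - cbar a * z).
  by move: n1; move: (cbar a) => c n1; field.
rewrite e; move: n1 n2; move: (cbar a) => c n1 n2.
by field; apply/andP.
Qed.

Lemma schwarz_pick g (rho M : K) z a : 0 < rho -> 0 < M ->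
  (forall x, cabs x < rho -> hol g x) -> (forall x, cabs x < rho -> cabs (g x) <= M) ->
  cabs a < rho -> cabs z < rho -> cabs (g a) < M ->
  cabs (moebius (g a / rc M) (g z / rc M)) <= cabs (moebius (a / rc rho) (z / rc rho)).
Proof.
move=> rho0 M0 hg gM ar zr gaM.
have rn : rc rho != 0 :> C by rewrite rc_eq0 gt_eqF.
have Mn : rc M != 0 :> C by rewrite rc_eq0 gt_eqF.
have sc (x : C) (t : K) : 0 < t -> cabs x < t -> cabs (x / rc t) < 1.
  by move=> t0 xt; rewrite cabsM cabsV cabs_rc gtr0_norm// ltr_pdivrMr// mul1r.
have scle (x : C) (t : K) : 0 < t -> cabs x <= t -> cabs (x / rc t) <= 1.
  by move=> t0 xt; rewrite cabsM cabsV cabs_rc gtr0_norm// ler_pdivrMr// mul1r.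
pose al := a / rc rho; pose be := g a / rc M.
have al1 : cabs al < 1 by exact: sc.
have al1' : cabs (- al) < 1 by rewrite cabsN.
have be1 : cabs be < 1 by exact: sc.
pose m x := rc rho * moebius (- al) x.
have mr x : cabs x < 1 -> cabs (m x) < rho.
  move=> x1; rewrite cabsM cabs_rc gtr0_norm// -[ltRHS]mulr1 ltr_pM2l//.
  exact: moebius_lt1.
pose h x := moebius be (g (m x) / rc M).
have m0 : m 0 = a by rewrite /m /moebius mulr0 subr0 divr1 sub0r opprK /al mulrC divfK.
have hh x : cabs x < 1 -> hol h x.
  move=> x1; apply: (@hol_comp _ (fun x => g (m x) / rc M) (moebius be)); last first.
    by apply: moebius_hol => //; apply: scle => //; apply: gM; exact: mr.
  apply: holM; last exact: hol_cst.
  apply: (@hol_comp _ m g); last by apply: hg; exact: mr.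
  by apply: holM; [exact: hol_cst|apply: moebius_hol => //; exact: ltW].
have h1 x : cabs x < 1 -> cabs (h x) <= 1.
  by move=> x1; apply: moebius_le1 => //; apply: scle => //; apply: gM; exact: mr.
have h0 : h 0 = 0 by rewrite /h m0 /moebius subrr mul0r.
have z1 : cabs (z / rc rho) < 1 by exact: sc.
have := @schwarz h (moebius al (z / rc rho)) hh h1 h0 (moebius_lt1 al1 z1).
by rewrite /h /m moebiusNK// [rc rho * _]mulrC divfK.
Qed.

Lemma moebius_scaled (a z : C) (t : K) : 0 < t ->
  cabs (moebius (a / rc t) (z / rc t)) = t * cabs (z - a) / cabs (rc (t ^+ 2) - cbar a * z).
Proof.
move=> t0; have tn : rc t != 0 :> C by rewrite rc_eq0 gt_eqF.
rewrite /moebius cbarM cbarV cbar_rc.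
have -> : z / rc t - a / rc t = (z - a) / rc t by ring.
have -> : 1 - cbar a / rc t * (z / rc t) = (rc (t ^+ 2) - cbar a * z) / rc (t ^+ 2).
  by rewrite rcX; field.
rewrite !(cabsM, cabsV) !cabs_rc (gtr0_norm t0) ger0_norm ?sqr_ge0// invfM invrK.
move: (cabs (rc (t ^+ 2) - _))^-1 => B; by field; rewrite gt_eqF.
Qed.

(** The extreme case is c = -M^2, where equality holds. After squaring, the difference is a sum of
    two products of factors that are nonnegative because |c| <= M^2. *)
Lemma disc_compare (c : C) (M rho : K) : 0 < M -> M < rho -> cabs c <= M ^+ 2 ->
  (M ^+ 2 + rho ^+ 2) * cabs (rc (M ^+ 2) - c) <= 2 * M ^+ 2 * cabs (rc (rho ^+ 2) - c).
Proof.
move=> M0 Mr cM; have r0 := lt_trans M0 Mr.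
have s0 : 0 <= M ^+ 2 + rho ^+ 2 by rewrite addr_ge0 ?sqr_ge0.
have m0 : 0 <= 2 * M ^+ 2 by have := sqr_ge0 M; lra.
have n1 := mulr_ge0 s0 (cabs_ge0 (rc (M ^+ 2) - c)).
have n2 := mulr_ge0 m0 (cabs_ge0 (rc (rho ^+ 2) - c)).
rewrite -(@ler_pXn2r _ 2) ?nnegrE// {n1 n2} !exprMn !cabs2E.
have reE (t : K) : complex.Re (rc t - c) = t - complex.Re c by case: (c).
have imE (t : K) : complex.Im (rc t - c) = - complex.Im c by case: (c) => [? ?] /=; rewrite sub0r.
rewrite !reE !imE.
have h1 : complex.Re c ^+ 2 + complex.Im c ^+ 2 <= M ^+ 4.
  by rewrite -cabs2E -[4%N]/(2 * 2)%N exprM lerXn2r ?nnegrE ?cabs_ge0 ?sqr_ge0.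
have h2 : - M ^+ 2 <= complex.Re c.
  have := re_le_cabs c; rewrite ler_norml => /andP[h _].
  by apply: le_trans h; rewrite lerN2.
have k1 : 0 <= (M ^+ 2 + rho ^+ 2) ^+ 2 - 4 * M ^+ 4.
  have -> : (M ^+ 2 + rho ^+ 2) ^+ 2 - 4 * M ^+ 4 = (rho ^+ 2 - M ^+ 2) * (3 * M ^+ 2 + rho ^+ 2).
    ring.
  apply: mulr_ge0; last by have := sqr_ge0 M; have := sqr_ge0 rho; lra.
  by rewrite subr_ge0 lerXn2r ?nnegrE ?(ltW M0) ?(ltW r0)// ltW.
set x := complex.Re c in h1 h2 *; set y := complex.Im c in h1 *.
rewrite -subr_ge0.
have -> : 2 ^+ 2 * (M ^+ 2) ^+ 2 * ((rho ^+ 2 - x) ^+ 2 + (- y) ^+ 2) -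
    (M ^+ 2 + rho ^+ 2) ^+ 2 * ((M ^+ 2 - x) ^+ 2 + (- y) ^+ 2) =
    ((M ^+ 2 + rho ^+ 2) ^+ 2 - 4 * M ^+ 4) * (M ^+ 4 - (x ^+ 2 + y ^+ 2)) +
    2 * M ^+ 2 * (rho ^+ 2 - M ^+ 2) ^+ 2 * (x + M ^+ 2) by ring.
apply: addr_ge0; first by apply: mulr_ge0 => //; rewrite subr_ge0.
have M20 := sqr_ge0 M; have d20 := sqr_ge0 (rho ^+ 2 - M ^+ 2).
apply: mulr_ge0; last by rewrite -[M ^+ 2]opprK subr_ge0.
by apply: mulr_ge0 => //; rewrite pmulr_rge0.
Qed.

(** The pseudo-hyperbolic distance of the disc of radius rho. *)
Definition pdist (rho : K) z a := rho * cabs (z - a) / cabs (rc (rho ^+ 2) - cbar a * z).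

(** Schwarz-Pick from D_rho to D_M does not expand, and by [disc_compare] the distance of D_rho is
    smaller than that of D_M by the displayed factor, which is below 1 as M < rho. *)
Lemma pdist_contract g (rho M : K) z a : 0 < M -> M < rho ->
  (forall x, cabs x < rho -> hol g x) -> (forall x, cabs x < rho -> cabs (g x) < M) ->
  cabs a < rho -> cabs z < rho ->
  pdist rho (g z) (g a) <= 2 * M * rho / (M ^+ 2 + rho ^+ 2) * pdist rho z a.
Proof.
move=> M0 Mr hg gM ar zr; have r0 := lt_trans M0 Mr.
have := schwarz_pick r0 M0 hg (fun x xr => ltW (gM x xr)) ar zr (gM a ar).
rewrite !moebius_scaled// -/(pdist _ _ _) -/(pdist _ _ _) => h.
have s0 : 0 < M ^+ 2 + rho ^+ 2 by rewrite addr_gt0// exprn_gt0.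
have q0 : 0 <= 2 * M * rho / (M ^+ 2 + rho ^+ 2).
  by rewrite divr_ge0 ?(ltW s0)// !mulr_ge0// ltW.
apply: le_trans (ler_wpM2l q0 h); rewrite /pdist.
have cM : cabs (cbar (g a) * g z) <= M ^+ 2.
  by rewrite cabsM cabs_bar expr2 ler_pM ?cabs_ge0// ltW// gM.
have cM' : cabs (cbar (g a) * g z) < M ^+ 2.
  rewrite cabsM cabs_bar expr2; apply: (@le_lt_trans _ _ (cabs (g a) * M)).
    by rewrite ler_wpM2l ?cabs_ge0// ltW// gM.
  by rewrite ltr_pM2r// gM.
have := disc_compare M0 Mr cM.
set c := cbar (g a) * g z in cM' *.
have pos (t : K) : M <= t -> 0 < cabs (rc (t ^+ 2) - c).
  move=> Mt; rewrite cabs_gt0 subr_eq0; apply: contraTneq cM' => <-.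
  rewrite cabs_rc ger0_norm ?sqr_ge0// -leNgt lerXn2r ?nnegrE ?(ltW M0)//.
  exact: le_trans (ltW M0) Mt.
have p1 := pos _ (lexx M); have p2 := pos _ (ltW Mr).
set D := cabs (g z - g a); set A := cabs (rc (M ^+ 2) - c) in p1 *.
set B := cabs (rc (rho ^+ 2) - c) in p2 * => hAB.
rewrite ler_pdivrMr//.
have -> : 2 * M * rho / (M ^+ 2 + rho ^+ 2) * (M * D / A) * B =
   rho * D * (2 * M ^+ 2 * B / ((M ^+ 2 + rho ^+ 2) * A)) by field; rewrite !gt_eqF.
rewrite ler_peMr ?mulr_ge0 ?cabs_ge0 ?(ltW r0)//.
by rewrite ler_pdivlMr ?mulr_gt0// mul1r.
Qed.

(** The two-point inequality divided by |z - a| and taken to the limit z -> a; both sides [P] and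
    [Q] are continuous at a, the first thanks to [dq]. *)
Lemma schwarz_pick_derive g (rho M : K) a : 0 < rho -> 0 < M ->
  (forall x, cabs x < rho -> hol g x) -> (forall x, cabs x < rho -> cabs (g x) <= M) ->
  cabs a < rho -> cabs (g a) < M ->
  M * (rho ^+ 2 - cabs a ^+ 2) * cabs (derive1 g a) <= rho * (M ^+ 2 - cabs (g a) ^+ 2).
Proof.
move=> rho0 M0 hg gM ar gaM.
pose P z := rc M * (rc (rho ^+ 2) - cbar a * z) * dq g a z.
pose Q z := rc rho * (rc (M ^+ 2) - cbar (g a) * g z).
have sq (b : C) (t : K) : rc (t ^+ 2) - cbar b * b = rc (t ^+ 2 - cabs b ^+ 2).
  by rewrite [cbar b * b]mulrC mul_cbar rcB.
have posd (b x : C) (t : K) : 0 < t -> cabs b < t -> cabs x <= t ->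
    0 < cabs (rc (t ^+ 2) - cbar b * x).
  move=> t0 bt xt; rewrite cabs_gt0 subr_eq0.
  have : cabs (cbar b * x) < t ^+ 2.
    rewrite cabsM cabs_bar expr2; apply: (@le_lt_trans _ _ (cabs b * t)).
      by rewrite ler_wpM2l ?cabs_ge0.
    by rewrite ltr_pM2r.
  by apply: contraTneq => <-; rewrite cabs_rc ger0_norm ?sqr_ge0// ltxx.
have PQ z : cabs z < rho -> z != a -> cabs (P z) <= cabs (Q z).
  move=> zr za; have := schwarz_pick rho0 M0 hg gM ar zr gaM; rewrite !moebius_scaled//.
  have za0 : 0 < cabs (z - a) by rewrite cabs_gt0 subr_eq0.
  rewrite /P /Q /dq (negbTE za) !cabsM cabsV !cabs_rc (gtr0_norm M0) (gtr0_norm rho0).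
  rewrite ler_pdivrMr ?posd ?gM// mulrAC ler_pdivlMr ?posd ?(ltW zr)// => h.
  rewrite -(ler_pM2r za0) -!mulrA mulVf ?gt_eqF// mulr1.
  by move: h; congr (_ <= _); ring.
have Pa : cabs (P a) = M * (rho ^+ 2 - cabs a ^+ 2) * cabs (derive1 g a).
  rewrite /P dqyy !cabsM sq !cabs_rc (gtr0_norm M0) ger0_norm// subr_ge0.
  by rewrite lerXn2r ?nnegrE ?cabs_ge0 ?(ltW rho0)// ltW.
have Qa : cabs (Q a) = rho * (M ^+ 2 - cabs (g a) ^+ 2).
  rewrite /Q cabsM sq !cabs_rc (gtr0_norm rho0) ger0_norm// subr_ge0.
  by rewrite lerXn2r ?nnegrE ?cabs_ge0 ?(ltW M0)// ltW.
rewrite -Pa -Qa; apply/ler_addgt0Pr => e e0; have e20 : 0 < e / 2 by rewrite divr_gt0.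
have cP : hol P a.
  apply: holM; last exact: (dq_hol hg ar ar).
  apply: holM; first exact: hol_cst.
  by apply: holB; [exact: hol_cst|apply: holM; [exact: hol_cst|exact: hol_id]].
have cQ : hol Q a.
  apply: holM; first exact: hol_cst.
  by apply: holB; [exact: hol_cst|apply: holM; [exact: hol_cst|exact: hg]].
have /continuous_cabsP/(_ _ e20)[d1 d10 hd1] := hol_cont cP.
have /continuous_cabsP/(_ _ e20)[d2 d20 hd2] := hol_cont cQ.
pose d := Num.min (Num.min d1 d2) (rho - cabs a).
have d0 : 0 < d by rewrite !lt_min d10 d20 subr_gt0.
pose z := a + rc (d / 2).
have za : cabs (z - a) = d / 2.
  by rewrite /z addrAC subrr add0r cabs_rc ger0_norm// divr_ge0// ltW.
have zd : cabs (z - a) < d by rewrite za ltr_pdivrMr// mulr_natr mulr2n ltrDl.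
move: (zd); rewrite /d !lt_min => /andP[/andP[z1 z2] z3].
have zr : cabs z < rho.
  have -> : z = (z - a) + a by rewrite subrK.
  by rewrite (le_lt_trans (cabsD _ _))// -ltrBrDr.
have zna : z != a by rewrite -subr_eq0 -cabs_gt0 za divr_gt0.
have := PQ _ zr zna; have := hd1 _ z1; have := hd2 _ z2.
have k1 := cabs_sub_ge (P a) (P z); have k2 := cabs_sub_ge (Q z) (Q a).
rewrite cabsBC in k1 => h1 h2 h3.
by rewrite [e](splitr e); lra.
Qed.

End SchwarzPick.

(** * Exponential rates and logarithmic growth *)

Section Rates.
Variable K : realType.
Local Notation C := (Cplx K).
Implicit Types (v u : nat -> K) (L M e q : K) (Q : nat -> C).

(** The upper exponential growth rate of v is at most L. The form without logarithms admits zero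
    values and makes rates of products add. *)
Definition rate v L := forall e, 0 < e -> exists2 A : K, 0 <= A &
  forall n, `|v n| <= A * expR (L + e) ^+ n.

Lemma rate_le u v L : (forall n, `|u n| <= `|v n|) -> rate v L -> rate u L.
Proof.
move=> uv hv e e0; have [A A0 h] := hv e e0; exists A => // n.
exact: le_trans (uv n) (h n).
Qed.

Lemma rateM u v L M : rate u L -> rate v M -> rate (fun n => u n * v n) (L + M).
Proof.
move=> hu hv e e0; have e20 : 0 < e / 2 by rewrite divr_gt0.
have [A A0 hA] := hu _ e20; have [B B0 hB] := hv _ e20.
exists (A * B); first exact: mulr_ge0.
move=> n; rewrite normrM; have -> : L + M + e = (L + e / 2) + (M + e / 2) by field.
by rewrite expRD exprMn mulrACA ler_pM.
Qed.

Lemma rateD u v L : rate u L -> rate v L -> rate (fun n => u n + v n) L.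
Proof.
move=> hu hv e e0; have [A A0 hA] := hu _ e0; have [B B0 hB] := hv _ e0.
exists (A + B); first exact: addr_ge0.
by move=> n; rewrite mulrDl (le_trans (ler_normD _ _))// lerD.
Qed.

Lemma rate_cst (c : K) : rate (fun=> c) 0.
Proof.
move=> e e0; exists `|c| => // n; rewrite add0r ler_peMr// exprn_ege1// -expR0 ler_expR ltW//.
Qed.

Lemma rateZ (c : K) v L : rate v L -> rate (fun n => c * v n) L.
Proof. by move=> hv; rewrite -[L]add0r; apply: rateM hv; exact: rate_cst. Qed.

Lemma rateX v L i : rate v L -> rate (fun n => v n ^+ i) (i%:R * L).
Proof.
move=> hv; elim: i => [|i IH].
  rewrite mul0r; apply: (@rate_le _ (fun=> 1)) (rate_cst 1) => n.
  by rewrite expr0.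
rewrite -natr1 mulrDl mul1r addrC; apply: (@rate_le _ (fun n => v n * v n ^+ i)); last exact: rateM.
by move=> n; rewrite exprS.
Qed.

Lemma rate_sum (I : Type) (r : seq I) (F : I -> nat -> K) L :
  (forall i, rate (F i) L) -> rate (fun n => \sum_(i <- r) F i n) L.
Proof.
move=> hF; elim: r => [|i r IH].
  move=> e e0; exists 0 => // n; by rewrite big_nil normr0 mul0r.
apply: (@rate_le _ (fun n => F i n + \sum_(i <- r) F i n)); last exact: rateD.
by move=> n; rewrite big_cons.
Qed.

Lemma rate_shift v L : rate v L -> rate (fun n => v n.+1) L.
Proof.
move=> hv e e0; have [A A0 h] := hv e e0; exists (A * expR (L + e)).
  by rewrite mulr_ge0 ?expR_ge0.
by move=> n; rewrite -mulrA -exprS.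
Qed.

Lemma rate_geo (c q : K) : 0 < q -> 0 <= c -> rate (fun n => c * q ^+ n) (ln q).
Proof.
move=> q0 c0 e e0; exists c => // n; rewrite ger0_norm ?mulr_ge0 ?exprn_ge0 ?(ltW q0)//.
rewrite ler_wpM2l// lerXn2r ?nnegrE ?expR_ge0 ?(ltW q0)//.
by rewrite expRD lnK// ler_peMr ?(ltW q0)// -expR0 ler_expR ltW//.
Qed.

Lemma rate_neg v L M : rate v L -> L < M -> M < 0 -> exists A q : K,
  [/\ 0 <= A, 0 < q < 1, q = expR M & forall n, `|v n| <= A * q ^+ n].
Proof.
move=> hv LM M0; have e0 : 0 < M - L by rewrite subr_gt0.
have [A A0 h] := hv _ e0; exists A, (expR M); split => //.
- by rewrite expR_gt0 expR_lt1.
- by move=> n; have := h n; rewrite [L + _]addrC subrK.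
Qed.

Lemma rateP v L M A : 0 <= A -> L <= M -> (forall n, `|v n| <= A * expR L ^+ n) -> rate v M.
Proof.
move=> A0 LM h e e0; exists A => // n; apply: le_trans (h n) _; rewrite ler_wpM2l//.
rewrite lerXn2r ?nnegrE ?expR_ge0// ler_expR; by rewrite (le_trans LM)// lerDl ltW.
Qed.

Lemma geo_tail Q (A q : K) : 0 <= A -> 0 <= q < 1 ->
  (forall n, cabs (Q n.+1 - Q n) <= A * q ^+ n) ->
  forall n k, cabs (Q (n + k)%N - Q n) <= A / (1 - q) * q ^+ n.
Proof.
move=> A0 /andP[q0 q1] h n k; have d0 : 0 < 1 - q by rewrite subr_gt0.
suff : cabs (Q (n + k)%N - Q n) <= A / (1 - q) * (q ^+ n - q ^+ (n + k)).
  move=> /le_trans; apply; rewrite ler_wpM2l ?divr_ge0 ?(ltW d0)//.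
  by rewrite lerBlDr lerDl exprn_ge0.
elim: k => [|k IH]; first by rewrite addn0 !subrr cabs0 mulr0.
rewrite addnS; have -> : Q (n + k).+1 - Q n = (Q (n + k).+1 - Q (n + k)%N) + (Q (n + k)%N - Q n).
  by rewrite addrA subrK.
apply: le_trans (cabsD _ _) _.
have -> : A / (1 - q) * (q ^+ n - q ^+ (n + k).+1) =
    A * q ^+ (n + k) + A / (1 - q) * (q ^+ n - q ^+ (n + k)).
  by rewrite exprS; field; rewrite gt_eqF.
exact: lerD.
Qed.

Lemma geo_cvg0 (A q e : K) : 0 <= A -> 0 <= q < 1 -> 0 < e ->
  exists N, forall n, (N <= n)%N -> A * q ^+ n < e.
Proof.
move=> A0 /andP[q0 q1] e0.
have : (fun n => A * q ^+ n) @ \oo --> (0 : K).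
  rewrite -[X in _ --> X](mulr0 A); apply: cvgMr; apply: cvg_expr.
  by rewrite ger0_norm.
move=> /cvgrPdist_lt/(_ e e0)[N _ h]; exists N => n Nn; have := h n Nn.
by rewrite sub0r normrN; apply: le_lt_trans; exact: ler_norm.
Qed.

Lemma geo_lim Q (A q : K) : 0 <= A -> 0 <= q < 1 ->
  (forall n, cabs (Q n.+1 - Q n) <= A * q ^+ n) ->
  exists2 l : C, Q @ \oo --> l & forall n, cabs (Q n - l) <= A / (1 - q) * q ^+ n.
Proof.
move=> A0 q01 h; have /andP[q0 q1] := q01; have d0 : 0 < 1 - q by rewrite subr_gt0.
have t := geo_tail A0 q01 h; set B := A / (1 - q) in t *.
have B0 : 0 <= B by rewrite divr_ge0// ltW.
have [e e0|l hl] := @cauchy_cvg_cplx _ Q.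
  have e20 : 0 < e / 2 by rewrite divr_gt0.
  have [N hN] := geo_cvg0 B0 q01 e20; exists N => n m Nn Nm.
  have -> : Q n - Q m = (Q n - Q N) - (Q m - Q N) by rewrite opprB addrA subrK.
  apply: le_lt_trans (cabsB _ _) _; rewrite [e]splitr.
  have := t N (n - N)%N; have := t N (m - N)%N; rewrite !subnKC// => h1 h2.
  have := hN N (leqnn N); lra.
exists l => // n; rewrite cabsBC; apply: (cabs_lim_le hl).
by exists n => // m /= nm; have := t n (m - n)%N; rewrite subnKC.
Qed.

(** The tail of a geometric series decays like its first term, so the limit is approached at the
    rate of the increments. *)
Lemma rate_lim Q v L : L < 0 -> rate v L -> (forall n, cabs (Q n.+1 - Q n) <= `|v n|) ->
  exists2 l : C, Q @ \oo --> l & rate (fun n => cabs (Q n - l)) L.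
Proof.
move=> L0 hv hQ; have L2 : L < L / 2 by lra.
have L20 : L / 2 < 0 by lra.
have [A [q [A0 /andP[q0 q1] _ hA]]] := rate_neg hv L2 L20.
have q01 : 0 <= q < 1 by rewrite ltW.
have [l hl _] := geo_lim A0 q01 (fun n => le_trans (hQ n) (hA n)); exists l => // e e0.
(* The ratio exp M must be below 1 for summation, while L < M <= L + e. *)
pose M := Num.min (L + e) (L / 2).
have LM : L < M by rewrite lt_min ltrDl e0.
have M0 : M < 0 by rewrite gt_min L20 orbT.
have [B [p [B0 /andP[p0 p1] pE hB]]] := rate_neg hv LM M0.
have p01 : 0 <= p < 1 by rewrite ltW.
have [l' hl' h] := geo_lim B0 p01 (fun n => le_trans (hQ n) (hB n)).
have -> : l = l' by exact: (cvg_unique _ hl hl').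
have d0 : 0 < 1 - p by rewrite subr_gt0.
exists (B / (1 - p)); first by rewrite divr_ge0// ltW.
move=> n; rewrite ger0_norm ?cabs_ge0//; apply: le_trans (h n) _.
rewrite ler_wpM2l ?divr_ge0 ?(ltW d0)// lerXn2r ?nnegrE ?expR_ge0 ?(ltW p0)//.
by rewrite pE ler_expR ge_min lexx.
Qed.

(** The factors 1 + v n multiply up to at most the exponential of a geometric series. *)
Lemma prod_bound (E t v : nat -> K) (A q : K) : 0 <= A -> 0 <= q < 1 ->
  (forall n, 0 <= E n) -> (forall n, 0 <= t n) ->
  (forall n, E n.+1 <= E n * (t n * (1 + v n))) -> (forall n, v n <= A * q ^+ n) ->
  forall n, E n <= E 0%N * expR (A / (1 - q)) * \prod_(k < n) t k.
Proof.
move=> A0 /andP[q0 q1] E0 t0 hE hv n; have d0 : 0 < 1 - q by rewrite subr_gt0.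
have P0 m : 0 <= \prod_(k < m) t k by apply: prodr_ge0.
suff h : E n <= E 0%N * expR (A / (1 - q) * (1 - q ^+ n)) * \prod_(k < n) t k.
  apply: le_trans h _; rewrite ler_wpM2r// ler_wpM2l// ler_expR.
  by rewrite ler_piMr ?divr_ge0 ?(ltW d0)// gerBl exprn_ge0.
elim: n => [|n IH]; first by rewrite expr0 subrr mulr0 expR0 big_ord0 !mulr1.
apply: le_trans (hE n) _; rewrite big_ord_recr /=.
have -> : A / (1 - q) * (1 - q ^+ n.+1) = A / (1 - q) * (1 - q ^+ n) + A * q ^+ n.
  by rewrite exprS; field; rewrite gt_eqF.
rewrite expRD.
apply: (@le_trans _ _ (E n * (t n * expR (A * q ^+ n)))).
  rewrite ler_wpM2l// ler_wpM2l//; apply: le_trans (expR_ge1Dx _).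
  by rewrite lerD2l.
have -> : E 0%N * (expR (A / (1 - q) * (1 - q ^+ n)) * expR (A * q ^+ n)) * (\prod_(i < n) t i * t n) =
  E 0%N * expR (A / (1 - q) * (1 - q ^+ n)) * (\prod_(i < n) t i) * (t n * expR (A * q ^+ n)) by ring.
by rewrite ler_wpM2r// mulr_ge0// expR_ge0.
Qed.

Lemma scaled_log_le (v : nat -> \bar K) (A L e : K) : 0 < A -> 0 < e ->
  (forall n, 0 <= v n)%E -> (forall n, v n <= (A * expR L ^+ n)%:E)%E ->
  \forall n \near \oo, (n%:R^-1%:E * lne (v n) <= (L + e)%:E)%E.
Proof.
move=> A0 e0 v0 h; near=> n.
have n0 : 0 < n%:R :> K by rewrite ltr0n; near: n; exists 1%N.
have p0 : 0 < A * expR L ^+ n by rewrite mulr_gt0// exprn_gt0// expR_gt0.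
have hl : (lne (v n) <= (ln A + n%:R * L)%:E)%E.
  apply: (@le_trans _ _ (lne (A * expR L ^+ n)%:E)).
    by rewrite lee_lne ?in_itv/= ?v0 ?leey// lee_fin ltW.
  rewrite lne_EFin// lee_fin -expRM_natl lnM ?posrE ?expR_gt0//.
  by rewrite expRK.
apply: (@le_trans _ _ (n%:R^-1%:E * (ln A + n%:R * L)%:E)%E).
  by rewrite lee_wpmul2l// lee_fin invr_ge0 ltW.
rewrite -EFinM lee_fin mulrDr mulKf ?gt_eqF// addrC lerD2l.
rewrite mulrC ler_pdivrMr// mulrC -ler_pdivrMr//.
by near: n; exact: nbhs_infty_ger.
Unshelve. all: by end_near. Qed.

Lemma scaled_log_ge (v : nat -> \bar K) (A L e : K) : 0 < A -> 0 < e ->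
  (\forall n \near \oo, (A * expR L ^+ n)%:E <= v n)%E ->
  \forall n \near \oo, ((L - e)%:E <= n%:R^-1%:E * lne (v n))%E.
Proof.
move=> A0 e0 h; near=> n.
have n0 : 0 < n%:R :> K by rewrite ltr0n; near: n; exists 1%N.
have p0 : 0 < A * expR L ^+ n by rewrite mulr_gt0// exprn_gt0// expR_gt0.
have p0e : (0%:E <= (A * expR L ^+ n)%:E)%E by rewrite lee_fin ltW.
have hn : ((A * expR L ^+ n)%:E <= v n)%E by near: n.
have hl : ((ln A + n%:R * L)%:E <= lne (v n))%E.
  apply: (@le_trans _ _ (lne (A * expR L ^+ n)%:E)).
    rewrite lne_EFin// lee_fin -expRM_natl lnM ?posrE ?expR_gt0//.
    by rewrite expRK.
  by rewrite lee_lne ?in_itv/= ?leey ?p0e ?(le_trans p0e hn).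
apply: (@le_trans _ _ (n%:R^-1%:E * (ln A + n%:R * L)%:E)%E); last first.
  by rewrite lee_wpmul2l// lee_fin invr_ge0 ltW.
rewrite -EFinM lee_fin mulrDr mulKf ?gt_eqF// addrC lerD2r.
rewrite lerNl -mulrN mulrC ler_pdivrMr// mulrC -ler_pdivrMr//.
by near: n; exact: nbhs_infty_ger.
Unshelve. all: by end_near. Qed.

Lemma scaled_log_cvg (v : nat -> \bar K) (L : K) : (forall n, 0 <= v n)%E ->
  (forall e : K, 0 < e -> exists2 A : K, 0 < A & forall n, (v n <= (A * expR (L + e) ^+ n)%:E)%E) ->
  (forall e : K, 0 < e -> exists2 A : K, 0 < A & \forall n \near \oo, ((A * expR (L - e) ^+ n)%:E <= v n)%E) ->
  (n%:R^-1%:E * lne (v n))%E @[n --> \oo] --> L%:E.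
Proof.
move=> v0 hu hl.
have b (e : K) : 0 < e -> \forall n \near \oo, ((L - e)%:E <= n%:R^-1%:E * lne (v n) <= (L + e)%:E)%E.
  move=> e0; have e20 : 0 < e / 2 by rewrite divr_gt0.
  have [A A0 hA] := hu _ e20; have [B B0 hB] := hl _ e20.
  have k1 := scaled_log_le A0 e20 v0 hA; have k2 := scaled_log_ge B0 e20 hB.
  have -> : L - e = L - e / 2 - e / 2 by field.
  have -> : L + e = L + e / 2 + e / 2 by field.
  by near=> n; apply/andP; split; near: n.
have fin : \forall n \near \oo, (n%:R^-1%:E * lne (v n))%E \is a fin_num.
  have := b 1 ltr01; apply: filterS => n /andP[h1 h2].
  by rewrite fin_numE; apply/andP; split; apply/eqP => E; rewrite E in h1 h2.
apply/fine_cvgP; split => //; apply/cvgrPdist_le => e e0.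
have h := b _ e0; near=> n => /=.
have fn : (n%:R^-1%:E * lne (v n))%E \is a fin_num by near: n.
have : ((L - e)%:E <= n%:R^-1%:E * lne (v n) <= (L + e)%:E)%E by near: n.
by rewrite -(fineK fn) !lee_fin distrC ler_distl.
Unshelve. all: by end_near. Qed.

Lemma scaled_log_limsup (v : nat -> \bar K) (L : K) : (forall n, 0 <= v n)%E ->
  (forall e : K, 0 < e -> exists2 A : K, 0 <= A & forall n, (v n <= (A * expR (L + e) ^+ n)%:E)%E) ->
  (limn_esup (fun n => n%:R^-1%:E * lne (v n)) <= L%:E)%E.
Proof.
move=> v0 hu; apply/lee_addgt0Pr => e e0; have e20 : 0 < e / 2 by rewrite divr_gt0.
have [A A0 hA] := hu _ e20; have A1 : 0 < A + 1 by rewrite ltr_wpDl.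
have hA1 n : (v n <= ((A + 1) * expR (L + e / 2) ^+ n)%:E)%E.
  apply: le_trans (hA n) _; rewrite lee_fin ler_wpM2r ?exprn_ge0 ?expR_ge0//.
  by rewrite lerDl.
have h := scaled_log_le A1 e20 v0 hA1.
apply: ereal_inf_le; exists (ereal_sup ((fun n => n%:R^-1%:E * lne (v n))%E @`
   [set n | (n%:R^-1%:E * lne (v n) <= (L + e / 2 + e / 2)%:E)%E])).
  by exists [set n | (n%:R^-1%:E * lne (v n) <= (L + e / 2 + e / 2)%:E)%E].
apply: ge_ereal_sup => _ [n /= hn <-]; apply: le_trans hn _.
by rewrite -EFinD lee_fin -addrA -splitr.
Qed.

Lemma scaled_log_limsupNy (v : nat -> \bar K) : (forall n, 0 <= v n)%E ->
  (forall L : K, exists2 A : K, 0 <= A & forall n, (v n <= (A * expR L ^+ n)%:E)%E) ->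
  (limn_esup (fun n => n%:R^-1%:E * lne (v n)) <= -oo)%E.
Proof.
move=> v0 h; rewrite leeNy_eq; apply/eqP/eq_ninfty => x.
by apply: scaled_log_limsup => // e e0; exact: h.
Qed.

End Rates.

(** * Taylor expansion through iterated difference quotients *)

Section IteratedQuotients.
Variables (K : realType) (R s s0 r' : K).
Local Notation C := (Cplx K).
Hypothesis hrad : [/\ 0 < r', r' < R, R < s, s < s0 & s0 < 1].
Implicit Types (f h : C -> C) (z w y : C).

Let r'0 : 0 < r'. Proof. by case: hrad. Qed.
Let r'R : r' < R. Proof. by case: hrad. Qed.
Let Rs : R < s. Proof. by case: hrad. Qed.
Let ss0 : s < s0. Proof. by case: hrad. Qed.
Let s01 : s0 < 1. Proof. by case: hrad. Qed.
Let r's : r' < s. Proof. exact: lt_trans r'R Rs. Qed.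
Let s_gt0 : 0 < s. Proof. exact: lt_trans r'0 r's. Qed.
Let r's0 : r' < s0. Proof. exact: lt_trans r's ss0. Qed.

(** The price of one difference quotient: two values of the function divided by |z - y| >= s - r' on
    |z| = s. *)
Definition quot_cst : K := 2 / (s - r').

Lemma quot_cst_gt1 : 1 < quot_cst.
Proof.
have d0 : 0 < s - r' by rewrite subr_gt0.
by rewrite /quot_cst ltr_pdivlMr// mul1r; have := s01; have := ss0; have := r'0; lra.
Qed.

(** [dqs h y k y] is the k-th Taylor coefficient of h at y, and [dqs h y k] is the remainder after k
    terms divided by (z - y)^k. *)
Definition dqs h y k := iter k (fun f => dq f y) h.

Lemma dqs_hol h y k z : (forall z, cabs z < s0 -> hol h z) -> cabs y < s0 -> cabs z < s0 ->
  hol (dqs h y k) z.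
Proof.
move=> hh y0; elim: k z => [|k IH] z z0; first exact: hh.
exact: (dq_hol IH y0 z0).
Qed.

Lemma dq_bound_disc h y z (M : K) : (forall z, cabs z < s0 -> hol h z) -> cabs y <= r' ->
  (forall z, cabs z <= s -> cabs (h z) <= M) -> cabs z <= s ->
  cabs (dq h y z) <= quot_cst * M.
Proof.
move=> hh yr hM zs; have d0 : 0 < s - r' by rewrite subr_gt0.
have M0 : 0 <= M by apply: le_trans (cabs_ge0 _) (hM 0 _); rewrite cabs0 ltW.
have y0 := le_lt_trans yr r's0.
have c0 : 0 <= quot_cst by apply: ltW; apply: lt_trans quot_cst_gt1.
have hd x : cabs x < s0 -> hol (dq h y) x by move=> x0; exact: (dq_hol hh).
apply: (@max_principle _ _ s0 s) zs => //.
- by rewrite s_gt0.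
- exact: mulr_ge0.
move=> x xs; have xy : s - r' <= cabs (x - y).
  by apply: le_trans (cabs_sub_ge _ _); rewrite xs lerD2l lerN2.
have xy0 : x - y != 0 by rewrite -cabs_gt0 (lt_le_trans d0).
rewrite /dq -subr_eq0 (negbTE xy0) cabsM cabsV /quot_cst mulrAC.
have ym := hM y (le_trans yr (ltW r's)).
have xm : cabs (h x) <= M by apply: hM; rewrite xs.
apply: ler_pM; rewrite ?cabs_ge0 ?invr_ge0 ?cabs_ge0//.
  by apply: le_trans (cabsB _ _) _; lra.
by rewrite lef_pV2 ?posrE ?cabs_gt0.
Qed.

Lemma dqs_bound h y k z (M : K) : (forall z, cabs z < s0 -> hol h z) -> cabs y <= r' ->
  (forall z, cabs z <= s -> cabs (h z) <= M) -> cabs z <= s ->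
  cabs (dqs h y k z) <= quot_cst ^+ k * M.
Proof.
move=> hh yr hM; have y0 := le_lt_trans yr r's0.
elim: k z => [|k IH] z zs; first by rewrite expr0 mul1r; exact: hM.
rewrite exprS -mulrA; apply: (dq_bound_disc _ yr IH zs) => x x0.
exact: (dqs_hol _ hh).
Qed.

Lemma dqs_taylor h y m z : (forall z, cabs z < s0 -> hol h z) -> cabs y < s0 ->
  h z = \sum_(k < m) dqs h y k y * (z - y) ^+ k + (z - y) ^+ m * dqs h y m z.
Proof.
move=> hh y0; elim: m => [|m IH]; first by rewrite big_ord0 expr0 mul1r add0r.
have hk x : cabs x < s0 -> hol (dqs h y m) x by move=> x0; exact: (dqs_hol _ hh).
have e : dqs h y m z = dqs h y m y + (z - y) * dqs h y m.+1 z := dqE y z hk.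
have S : \sum_(k < m.+1) dqs h y k y * (z - y) ^+ k =
  \sum_(k < m) dqs h y k y * (z - y) ^+ k + dqs h y m y * (z - y) ^+ m by rewrite big_ord_recr.
rewrite IH e S exprSr; move: (\sum_(k < m) _) (dqs h y m.+1 z) (dqs h y m y) => a b c; ring.
Qed.

End IteratedQuotients.

(** * Nonautonomous orbits, multipliers and moments *)

Section Orbits.
Variables (K : realType) (R s s0 r' : K).
Local Notation C := (Cplx K).
Hypothesis hrad : [/\ 0 < r', r' < R, R < s, s < s0 & s0 < 1].
Implicit Types (f h : C -> C) (z w : C) (g : nat -> C -> C).

Let r'0 : 0 < r'. Proof. by case: hrad. Qed.
Let r'R : r' < R. Proof. by case: hrad. Qed.
Let Rs : R < s. Proof. by case: hrad. Qed.
Let ss0 : s < s0. Proof. by case: hrad. Qed.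
Let s01 : s0 < 1. Proof. by case: hrad. Qed.
Let r's : r' < s. Proof. exact: lt_trans r'R Rs. Qed.
Let s_gt0 : 0 < s. Proof. exact: lt_trans r'0 r's. Qed.
Let r's0 : r' < s0. Proof. exact: lt_trans r's ss0. Qed.

Fixpoint orb g n z := if n is m.+1 then g m (orb g m z) else z.

Lemma orb_shift g n z : orb (fun m => g m.+1) n (g 0%N z) = orb g n.+1 z.
Proof. by elim: n => [//|n /= ->]. Qed.

Definition selfmaps g := forall n, selfmap s0 r' (g n).

Lemma selfmaps_shift g : selfmaps g -> selfmaps (fun m => g m.+1).
Proof. by move=> gS n; exact: gS. Qed.

Lemma orb_disc g n z : selfmaps g -> cabs z < s0 -> cabs (orb g n z) < s0.
Proof.
move=> gS z0; elim: n => [//|n IH] /=.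
exact: le_lt_trans (gS n _ IH).2 r's0.
Qed.

Lemma orb_le g n z (c : K) : selfmaps g -> r' <= c -> c < s0 -> cabs z <= c ->
  cabs (orb g n z) <= c.
Proof.
move=> gS rc' c0 zc; case: n => [//|n] /=; apply: le_trans rc'.
by apply: (gS n _ _).2; apply: orb_disc => //; exact: le_lt_trans c0.
Qed.

Lemma orb_hol g n z : selfmaps g -> cabs z < s0 -> hol (orb g n) z.
Proof.
move=> gS; elim: n z => [|n IH] z z0; first exact: hol_id.
apply: (@hol_comp _ (orb g n) (g n)); first exact: IH.
by apply: (gS n _ _).1; exact: orb_disc.
Qed.

Lemma orb_selfmap g n : selfmaps g -> selfmap s0 r' (orb g n.+1).
Proof.
move=> gS z z0; split; first exact: orb_hol.
by apply: (gS n _ _).2; exact: orb_disc.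
Qed.

Lemma pdist_gt0 (t : K) (b z : C) : 0 < t -> cabs b < t -> cabs z < t ->
  0 < cabs (rc (t ^+ 2) - cbar b * z).
Proof.
move=> t0 bt zt; rewrite cabs_gt0 subr_eq0.
have : cabs (cbar b * z) < t ^+ 2.
  rewrite cabsM cabs_bar expr2; apply: (@le_lt_trans _ _ (cabs b * t)).
    by rewrite ler_wpM2l ?cabs_ge0// ltW.
  by rewrite ltr_pM2r.
by apply: contraTneq => <-; rewrite cabs_rc ger0_norm ?sqr_ge0// ltxx.
Qed.

(** Each step contracts the pseudo-hyperbolic distance of D_s0 by the same q, and on D_s that
    distance is comparable with the Euclidean one. The constants do not depend on the sequence of
    maps, as pullback limits require. *)
Lemma orb_contract : exists A q : K, [/\ 0 <= A, 0 < q < 1 &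
  forall g n z a, selfmaps g -> cabs z <= s -> cabs a <= s ->
    cabs (orb g n z - orb g n a) <= A * q ^+ n].
Proof.
have R0 := lt_trans r'0 r'R; have Rs0 := lt_trans Rs ss0; have s00 := lt_trans s_gt0 ss0.
have S0 : 0 < R ^+ 2 + s0 ^+ 2 by rewrite addr_gt0// exprn_gt0.
(* The factor of [pdist_contract] for M = R: a strict bound on the values is wanted, and they are at
   most r' < R. *)
pose q := 2 * R * s0 / (R ^+ 2 + s0 ^+ 2).
have q0 : 0 < q by rewrite divr_gt0// !mulr_gt0.
have q1 : q < 1.
  rewrite ltr_pdivrMr// mul1r -subr_gt0.
  have -> : R ^+ 2 + s0 ^+ 2 - 2 * R * s0 = (s0 - R) ^+ 2 by ring.
  by rewrite exprn_gt0// subr_gt0.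
have D0 : 0 < s0 ^+ 2 - s ^+ 2 by rewrite subr_gt0 ltrXn2r// ltW.
pose B := s0 * (s0 + s0) / (s0 ^+ 2 - s ^+ 2).
exists (2 * s0 * B), q; split; rewrite ?q0 ?q1//.
  by rewrite mulr_ge0// ?divr_ge0 ?(ltW D0)// ?mulr_ge0 ?addr_ge0 ?ltW.
move=> g n z a gS zs as_.
have z0 := le_lt_trans zs ss0; have a0 := le_lt_trans as_ ss0.
have hp : pdist s0 (orb g n z) (orb g n a) <= q ^+ n * pdist s0 z a.
  elim: n => [|n IH]; first by rewrite expr0 mul1r.
  rewrite exprS -mulrA /=; apply: le_trans (ler_wpM2l (ltW q0) IH).
  apply: pdist_contract => //; try exact: orb_disc.
    by move=> x x0; apply: (gS n _ x0).1.
  by move=> x x0; apply: le_lt_trans r'R; apply: (gS n _ x0).2.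
have hB : pdist s0 z a <= B.
  have d : s0 ^+ 2 - s ^+ 2 <= cabs (rc (s0 ^+ 2) - cbar a * z).
    apply: le_trans (cabs_sub_ge _ _); rewrite cabs_rc ger0_norm ?sqr_ge0// lerD2l lerN2.
    by rewrite cabsM cabs_bar expr2 ler_pM ?cabs_ge0.
  apply: ler_pM; rewrite ?invr_ge0 ?cabs_ge0 ?mulr_ge0 ?cabs_ge0 ?(ltW s00)//.
    rewrite ler_wpM2l ?(ltW s00)//; apply: le_trans (cabsB _ _) _.
    by rewrite lerD// ltW.
  by rewrite lef_pV2 ?posrE// (lt_le_trans D0).
set Z := orb g n z in hp *; set W := orb g n a in hp *.
have Z0 : cabs Z < s0 by exact: orb_disc.
have W0 : cabs W < s0 by exact: orb_disc.
have dZ := pdist_gt0 s00 W0 Z0.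
have dU : cabs (rc (s0 ^+ 2) - cbar W * Z) <= 2 * s0 ^+ 2.
  apply: le_trans (cabsB _ _) _; rewrite cabs_rc ger0_norm ?sqr_ge0// mulr_natl mulr2n lerD2l.
  by rewrite cabsM cabs_bar expr2 ler_pM ?cabs_ge0// ltW.
have h : cabs (Z - W) <= 2 * s0 * pdist s0 Z W.
  have -> : 2 * s0 * pdist s0 Z W =
      cabs (Z - W) * (2 * s0 ^+ 2 / cabs (rc (s0 ^+ 2) - cbar W * Z)).
    by rewrite /pdist; field; rewrite gt_eqF.
  by rewrite ler_peMr ?cabs_ge0// ler_pdivlMr// mul1r.
have e : 2 * s0 * B * q ^+ n = 2 * s0 * (q ^+ n * B) by ring.
rewrite e; apply: (le_trans h); apply: ler_wpM2l; first by rewrite mulr_ge0// ltW.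
apply: (le_trans hp); apply: ler_wpM2l hB.
by rewrite exprn_ge0// ltW.
Qed.

Variables (g : nat -> C -> C) (x : C).
Hypotheses (gS : selfmaps g) (xr : cabs x <= r').

Definition orb_diff n z := orb g n z - orb g n x.
Definition mult n := derive1 (g n) (orb g n x).
Definition mult_prod n := \prod_(k < n) mult k.
Definition step_quot n := dq (g n) (orb g n x).

Let yr n : cabs (orb g n x) <= r'. Proof. exact: (orb_le _ gS (lexx _) r's0 xr). Qed.
Let y0 n : cabs (orb g n x) < s0. Proof. exact: le_lt_trans (yr n) r's0. Qed.
Let gh n z : cabs z < s0 -> hol (g n) z. Proof. by move=> z0; apply: (gS n z0).1. Qed.
Let g1 n z : cabs z < s0 -> cabs (g n z) <= 1.
Proof.
move=> z0; apply: le_trans (gS n z0).2 _.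
by rewrite ltW// (lt_trans r's0).
Qed.
Let os n z : cabs z <= s -> cabs (orb g n z) <= s.
Proof. exact: (orb_le _ gS (ltW r's) ss0). Qed.

Lemma step_quot_hol n z : cabs z < s0 -> hol (step_quot n) z.
Proof. by move=> z0; apply: (dq_hol (gh n)). Qed.

Lemma step_quot_le n z : cabs z <= s -> cabs (step_quot n z) <= quot_cst s r'.
Proof.
move=> zs; rewrite -[leRHS]mulr1; apply: (dq_bound_disc hrad _ (yr n) _ zs); first exact: gh.
by move=> w ws; apply: g1; exact: le_lt_trans ss0.
Qed.

Lemma step_quot_mult n : step_quot n (orb g n x) = mult n.
Proof. exact: dqyy. Qed.

Lemma orb_diffS n z : orb_diff n.+1 z = orb_diff n z * step_quot n (orb g n z).
Proof. by rewrite /orb_diff /= (dqE (orb g n x) (orb g n z) (gh n)) addrAC subrr add0r. Qed.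

Lemma orb_diff_hol n z : cabs z < s0 -> hol (orb_diff n) z.
Proof. by move=> z0; apply: holB; [exact: orb_hol|exact: hol_cst]. Qed.

Lemma orb_diff_le n z : cabs z <= s -> cabs (orb_diff n z) <= 2.
Proof.
move=> zs; apply: le_trans (cabsB _ _) _.
have := os n zs; have := yr n; have := s01; have := ss0; have := r's; lra.
Qed.

Lemma orb_diff_step n z : cabs z <= s -> cabs (orb_diff n.+1 z) <=
  cabs (orb_diff n z) * (cabs (mult n) + quot_cst s r' ^+ 2 * cabs (orb_diff n z)).
Proof.
move=> zs; rewrite orb_diffS cabsM ler_wpM2l ?cabs_ge0//.
have hs w : cabs w < s0 -> hol (step_quot n) w by exact: step_quot_hol.
rewrite (dqE (orb g n x) (orb g n z) hs) step_quot_mult.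
apply: le_trans (cabsD _ _) _; rewrite lerD2l cabsM mulrC ler_wpM2r ?cabs_ge0//.
rewrite expr2; apply: (dq_bound_disc hrad hs (yr n) _ (os n zs)).
by move=> w; exact: step_quot_le.
Qed.

Lemma orb_diff_geo : exists A q : K, [/\ 0 <= A, 0 < q < 1 &
  forall n z, cabs z <= s -> cabs (orb_diff n z) <= A * q ^+ n].
Proof.
have [A [q [A0 q01 h]]] := orb_contract; exists A, q; split=> // n z zs.
by apply: h => //; exact: le_trans xr (ltW r's).
Qed.

(** Adding d bounds the factors away from 0, so the quadratic errors become relative errors with a
    convergent sum. This version admits vanishing multipliers. *)
Lemma orb_diff_prod (d : K) : 0 < d -> exists2 A : K, 0 <= A &
  forall n z, cabs z <= s -> cabs (orb_diff n z) <= A * \prod_(k < n) (cabs (mult k) + d).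
Proof.
move=> d0; have [A [q [A0 /andP[q0 q1] hA]]] := orb_diff_geo.
have q01 : 0 <= q < 1 by rewrite ltW.
pose B := quot_cst s r' ^+ 2 * A / d.
have c0 : 0 <= quot_cst s r' ^+ 2 by exact: sqr_ge0.
have B0 : 0 <= B by rewrite divr_ge0 ?(ltW d0)// mulr_ge0.
exists (2 * expR (B / (1 - q))); first by rewrite mulr_ge0 ?expR_ge0.
move=> n z zs.
have t0 k : 0 <= cabs (mult k) + d by rewrite addr_ge0 ?cabs_ge0// ltW.
have P0 : 0 <= \prod_(k < n) (cabs (mult k) + d) by apply: prodr_ge0.
have st m : cabs (orb_diff m.+1 z) <= cabs (orb_diff m z) *
    ((cabs (mult m) + d) * (1 + B * q ^+ m)).
  apply: le_trans (orb_diff_step m zs) _; rewrite ler_wpM2l ?cabs_ge0//.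
  have -> : (cabs (mult m) + d) * (1 + B * q ^+ m) =
    cabs (mult m) + d * (B * q ^+ m) + (d + cabs (mult m) * (B * q ^+ m)) by ring.
  apply: ler_wpDr.
    apply: addr_ge0; first exact: ltW.
    apply: mulr_ge0; first exact: cabs_ge0.
    by apply: mulr_ge0 => //; apply: exprn_ge0; exact: ltW.
  rewrite lerD2l /B; have -> : d * (quot_cst s r' ^+ 2 * A / d * q ^+ m) =
    quot_cst s r' ^+ 2 * (A * q ^+ m) by field; rewrite gt_eqF.
  by rewrite ler_wpM2l// hA.
have := prod_bound B0 q01 (fun m => cabs_ge0 (orb_diff m z)) t0 st (fun m => lexx _) n.
move=> /le_trans; apply; rewrite ler_wpM2r// ler_wpM2r ?expR_ge0//.
exact: (orb_diff_le 0).
Qed.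

(** The two rates together say that (1/n) log |mult_prod n| tends to L. *)
Definition regular (L : K) := [/\ L < 0, forall n, mult n != 0,
  rate (fun n => cabs (mult_prod n)) L & rate (fun n => (cabs (mult_prod n))^-1) (- L)].

Lemma mult_prodS n : mult_prod n.+1 = mult_prod n * mult n.
Proof. by rewrite /mult_prod big_ord_recr. Qed.

Lemma mult_prod_neq0 L n : regular L -> mult_prod n != 0.
Proof. by case=> _ t0 _ _; apply/prodf_neq0 => i _; exact: t0. Qed.

(** A multiplier is a quotient of consecutive products, and their rates L and -L cancel. *)
Lemma rate_multV L : regular L -> rate (fun n => (cabs (mult n))^-1) 0.
Proof.
move=> hr; have [L0 t0 h1 h2] := hr; rewrite -[0](subrr L).
apply: rate_le (rateM h1 (rate_shift h2)) => n.
rewrite mult_prodS cabsM invfM mulrA mulfV ?mul1r//.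
by rewrite cabs_eq0 (mult_prod_neq0 n hr).
Qed.

(** Orbit differences decay geometrically while 1/|mult n| grows subexponentially, so the errors
    relative to the multipliers are summable and no exponent is lost. *)
Lemma orb_diff_regular L : regular L -> exists2 A : K, 0 <= A &
  forall n z, cabs z <= s -> cabs (orb_diff n z) <= A * cabs (mult_prod n).
Proof.
move=> hr; have [L0 tn0 h1 h2] := hr.
have [A [q [A0 /andP[q0 q1] hA]]] := orb_diff_geo.
have c0 : 0 <= quot_cst s r' ^+ 2 by exact: sqr_ge0.
have lq : ln q < 0 by rewrite -ltr_expR lnK// expR0.
pose v n := (cabs (mult n))^-1 * (quot_cst s r' ^+ 2 * A * q ^+ n).
have hv : rate v (0 + ln q).
  by apply: rateM (rate_multV hr) _; apply: rate_geo => //; exact: mulr_ge0.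
rewrite add0r in hv; have l1 : ln q < ln q / 2 by lra.
have l2 : ln q / 2 < 0 by lra.
have [B [p [B0 /andP[p0 p1] _ hB]]] := rate_neg hv l1 l2.
have p01 : 0 <= p < 1 by rewrite ltW.
exists (2 * expR (B / (1 - p))); first by rewrite mulr_ge0 ?expR_ge0.
move=> n z zs.
have st m : cabs (orb_diff m.+1 z) <= cabs (orb_diff m z) * (cabs (mult m) * (1 + v m)).
  apply: le_trans (orb_diff_step m zs) _; rewrite ler_wpM2l ?cabs_ge0//.
  rewrite mulrDr mulr1 lerD2l /v mulrA mulfV ?mul1r ?cabs_eq0//.
  by rewrite -mulrA ler_wpM2l// hA.
have := prod_bound B0 p01 (fun m => cabs_ge0 (orb_diff m z)) (fun k => cabs_ge0 (mult k)) st
  (fun m => le_trans (ler_norm _) (hB m)) n.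
have -> : cabs (mult_prod n) = \prod_(k < n) cabs (mult k) by exact: cabs_prod.
have P0 : 0 <= \prod_(k < n) cabs (mult k) by apply: prodr_ge0 => k _; exact: cabs_ge0.
move=> /le_trans; apply; rewrite ler_wpM2r// ler_wpM2r ?expR_ge0//.
exact: (orb_diff_le 0).
Qed.

(** By duality this is the i-th moment, about the n-th orbit point, of the n-th image of f; see
    [moment_push]. *)
Definition moment i n f := pair s f (fun z => orb_diff n z ^+ i).

Lemma moment_cc i n : circ_cont s (fun z => orb_diff n z ^+ i).
Proof. by apply: (disc_cc hrad) => z z0; apply: holX; exact: orb_diff_hol. Qed.

Lemma moment_le i n f (M E : K) : circ_cont s f -> (forall z, cabs z = s -> cabs (f z) <= M) ->
  (forall z, cabs z = s -> cabs (orb_diff n z) <= E) -> cabs (moment i n f) <= M * E ^+ i.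
Proof.
move=> cf fM hE; apply: (pair_le hrad cf (moment_cc i n) fM) => z zs.
by rewrite cabsX lerXn2r ?nnegrE ?cabs_ge0 ?hE// (le_trans (cabs_ge0 _) (hE z zs)).
Qed.

(** Taylor expansion of the i-th power of [step_quot] at the orbit point: the leading coefficient
    multiplies the moment by mult^i, the others bring in higher moments. The order m is left free,
    because [moment_decay] takes it larger for lower i. *)
Lemma moment_step i m n f (M E : K) : circ_cont s f ->
  (forall z, cabs z = s -> cabs (f z) <= M) ->
  (forall z, cabs z = s -> cabs (orb_diff n z) <= E) ->
  cabs (moment i n.+1 f - mult n ^+ i * moment i n f) <=
  quot_cst s r' ^+ (i + m.+1) *
    (\sum_(k < m) cabs (moment (i + k.+1) n f) + M * E ^+ (i + m.+1)).
Proof.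
move=> cf fM hE; pose H := fun z => step_quot n z ^+ i; pose y := orb g n x.
pose c := quot_cst s r'.
have c1 : 1 <= c by rewrite ltW// (quot_cst_gt1 hrad).
have c0 : 0 <= c := le_trans ler01 c1.
have Hh z : cabs z < s0 -> hol H z by move=> z0; apply: holX; exact: step_quot_hol.
have HM z : cabs z <= s -> cabs (H z) <= c ^+ i.
  by move=> zs; rewrite cabsX lerXn2r ?nnegrE ?cabs_ge0//; exact: step_quot_le.
have D k z : cabs z <= s -> (k <= m.+1)%N -> cabs (dqs H y k z) <= c ^+ (i + m.+1).
  move=> zs km; apply: le_trans (dqs_bound hrad k Hh (yr n) HM zs) _.
  by rewrite -exprD; apply: ler_weXn2l => //; rewrite addnC leq_add2l.
have E0 z : cabs z = s -> 0 <= E by move=> zs; exact: le_trans (cabs_ge0 _) (hE z zs).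
pose rem z := orb_diff n z ^+ (i + m.+1) * dqs H y m.+1 (orb g n z).
have ch : circ_cont s (fun z => dqs H y m.+1 (orb g n z)).
  apply: (disc_cc hrad) => z z0; apply: (@hol_comp _ (orb g n) (dqs H y m.+1)).
    exact: orb_hol.
  by apply: (dqs_hol _ Hh (y0 n)); exact: orb_disc.
have crem : circ_cont s rem := ccM (moment_cc (i + m.+1) n) ch.
pose T k z := dqs H y k y * orb_diff n z ^+ (i + k).
have cT k : circ_cont s (T k) := ccM (cc_cst s _) (moment_cc (i + k) n).
have cS : circ_cont s (fun z => \sum_(k < m.+1) T k z).
  apply: (disc_cc hrad) => z z0; apply: hol_sum => k _.
  by apply: holM; [exact: hol_cst|apply: holX; exact: orb_diff_hol].
have e1 : moment i n.+1 f = pair s f (fun z => \sum_(k < m.+1) T k z + rem z).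
  apply: (eq_pair hrad) => // z zs; rewrite orb_diffS exprMn -/(H _).
  rewrite (@dqs_taylor _ s0 H y m.+1 _ Hh (y0 n)) mulrDr mulr_sumr; congr (_ + _).
    by apply: eq_bigr => k _; rewrite /T exprD mulrCA -/(orb_diff n z).
  by rewrite /rem exprD -/(orb_diff n z) mulrA.
rewrite e1 (pairDr hrad cf cS crem).
rewrite (@pair_sumr _ _ _ _ _ hrad _ _ (fun k : 'I_m.+1 => T k) f cf (fun k => cT k)).
have e2 k : pair s f (T k) = dqs H y k y * moment (i + k) n f.
  exact: (pairZr hrad _ cf (moment_cc (i + k) n)).
rewrite big_ord_recl /= e2 addn0.
have -> : dqs H y 0 y = mult n ^+ i by rewrite /= /H step_quot_mult.
set a := _ * moment i n f; set S := \sum_(k < m) _; set r := pair s f rem.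
have -> : a + S + r - a = S + r by ring.
apply: le_trans (cabsD _ _) _; rewrite mulrDr; apply: lerD.
  apply: le_trans (cabs_sum _ _ _) _; rewrite mulr_sumr; apply: ler_sum => k _.
  rewrite e2 cabsM ler_wpM2r ?cabs_ge0//; apply: D; first exact: le_trans (yr n) (ltW r's).
  exact: leqW (ltn_ord k).
have -> : quot_cst s r' ^+ (i + m.+1) * (M * E ^+ (i + m.+1)) =
  M * (E ^+ (i + m.+1) * quot_cst s r' ^+ (i + m.+1)) by ring.
apply: (pair_le hrad cf crem fM) => z zs.
rewrite cabsM cabsX ler_pM ?exprn_ge0 ?cabs_ge0//.
  by rewrite lerXn2r ?nnegrE ?cabs_ge0 ?(E0 z)// hE.
by apply: D => //; apply: os; rewrite zs.
Qed.

End Orbits.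

(** * Koenigs coefficient functionals and their dual polar functions *)

Section Coefficients.
Variables (K : realType) (R s s0 r' : K).
Local Notation C := (Cplx K).
Hypothesis hrad : [/\ 0 < r', r' < R, R < s, s < s0 & s0 < 1].
Implicit Types (f h : C -> C) (z w : C) (i j k m n : nat).

Let r'0 : 0 < r'. Proof. by case: hrad. Qed.
Let r'R : r' < R. Proof. by case: hrad. Qed.
Let Rs : R < s. Proof. by case: hrad. Qed.
Let ss0 : s < s0. Proof. by case: hrad. Qed.
Let s01 : s0 < 1. Proof. by case: hrad. Qed.
Let r's : r' < s. Proof. exact: lt_trans r'R Rs. Qed.
Let s_gt0 : 0 < s. Proof. exact: lt_trans r'0 r's. Qed.
Let r's0 : r' < s0. Proof. exact: lt_trans r's ss0. Qed.

Variables (g : nat -> C -> C) (x : C).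
Hypotheses (gS : selfmaps s0 r' g) (xr : cabs x <= r').

Let x0 : cabs x < s0. Proof. exact: le_lt_trans r's0. Qed.
Let xs : cabs x < s. Proof. exact: le_lt_trans r's. Qed.

Definition ratio i f n := moment s g x i n f / mult_prod g x n ^+ i.
(** The pairing of f with the i-th power of the Koenigs coordinate, the limit of orb_diff
    n/mult_prod n. Only the numerical limits are formed, not the coordinate itself. *)
Definition coef i f : C := lim (ratio i f @ \oo).

Lemma momentM i n f a f' : circ_cont s f -> circ_cont s f' ->
  moment s g x i n (fun z => a * f z + f' z) = a * moment s g x i n f + moment s g x i n f'.
Proof.
move=> cf cf'; have ce := moment_cc hrad x gS i n.
rewrite /moment (pairD hrad _ cf' ce); last exact: (ccM (cc_cst s a) cf).
by rewrite (pairZ hrad _ cf ce).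
Qed.

Lemma moment0 n f : moment s g x 0 n f = pair s f (fun=> 1).
Proof. exact: (eq_pair hrad). Qed.

Lemma circ_bound f : circ_cont s f -> exists2 M : K, 0 <= M & forall z, cabs z = s -> cabs (f z) <= M.
Proof. exact: circ_bounded. Qed.

Section Regular.
Variable L : K.
Hypothesis hL : regular g x L.

Let L0 : L < 0. Proof. by case: hL. Qed.
Let p0 n : mult_prod g x n != 0. Proof. exact: mult_prod_neq0 hL. Qed.

(** By [moment_step] the increments of [ratio] are governed by the next m moments; the faster these
    decay, the faster the convergence. The case m = 0 gives existence of the limit. *)
Lemma coef_rate i m f : circ_cont s f ->
  (forall k, (k < m)%N -> rate (fun n => cabs (moment s g x (i + k.+1) n f)) ((i + m.+1)%:R * L)) ->
  exists2 a : C, ratio i f @ \oo --> a & rate (fun n => cabs (ratio i f n - a)) (m.+1%:R * L).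
Proof.
move=> cf hm; have [M M0 fM] := circ_bound cf.
have [A A0 hA] := orb_diff_regular hrad gS xr hL.
pose c := quot_cst s r' ^+ (i + m.+1).
pose S n := \sum_(k < m) cabs (moment s g x (i + k.+1) n f).
pose v n := (c * (S n + M * (A * cabs (mult_prod g x n)) ^+ (i + m.+1))) *
  (cabs (mult_prod g x n.+1))^-1 ^+ i.
have [_ _ h1 h2] := hL.
have hv : rate v (m.+1%:R * L).
  have -> : m.+1%:R * L = (i + m.+1)%:R * L + i%:R * - L by rewrite natrD; ring.
  apply: rateM; last by apply: rateX; exact: (rate_shift h2).
  apply: rateZ; apply: rateD.
    by apply: rate_sum => k; apply: hm.
  by apply: rateZ; apply: rateX; apply: rateZ.
apply: (rate_lim _ hv); first by rewrite pmulr_rlt0// ltr0n.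
move=> n; apply: le_trans (ler_norm _).
have -> : ratio i f n.+1 - ratio i f n =
  (moment s g x i n.+1 f - mult g x n ^+ i * moment s g x i n f) / mult_prod g x n.+1 ^+ i.
  have tn : mult g x n != 0 by case: hL.
  rewrite /ratio mult_prodS exprMn; move: (p0 n) tn.
  move: (mult_prod g x n) (mult g x n) (moment s g x i n.+1 f) (moment s g x i n f) => p t b a pn tn.
  have pi0 := expf_neq0 i pn; have ti0 := expf_neq0 i tn.
  by move: (p ^+ i) (t ^+ i) pi0 ti0 => u v' u0 v'0; field; rewrite u0 v'0.
rewrite cabsM cabsV cabsX -exprVn ler_wpM2r ?exprn_ge0 ?invr_ge0 ?cabs_ge0//.
by apply: (moment_step hrad gS xr i m cf fM) => z zs; apply: hA; rewrite zs.
Qed.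

Lemma coefP i f : circ_cont s f -> ratio i f @ \oo --> coef i f.
Proof.
move=> cf; have [|a ha _] := @coef_rate i 0 f cf; first by move=> k.
by rewrite /coef (cvg_lim _ ha)//; exact: norm_hausdorff.
Qed.

Lemma coefE i f a : ratio i f @ \oo --> a -> coef i f = a.
Proof. by move=> ha; rewrite /coef (cvg_lim _ ha)//; exact: norm_hausdorff. Qed.

(** Induction downwards from i = j. Once the moments above i decay at rate (j + 1) L, [coef_rate]
    with m = j - i gives the same rate for the i-th one, because its limit coefficient is 0. *)
Lemma moment_decay j f : circ_cont s f -> (forall i, (i <= j)%N -> coef i f = 0) ->
  forall i, (i <= j)%N -> rate (fun n => cabs (moment s g x i n f)) (j.+1%:R * L).
Proof.
move=> cf h0; suff H m i : (i + m = j)%N ->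
    rate (fun n => cabs (moment s g x i n f)) (j.+1%:R * L).
  by move=> i ij; apply: (H (j - i)%N); rewrite subnKC.
elim/ltn_ind: m i => m IH i ijm.
have [k km|a ha] := @coef_rate i m f cf.
  rewrite (addnS i m) ijm; apply: (IH (m - k.+1)%N); first by rewrite ltn_subrL (leq_ltn_trans _ km).
  by rewrite -ijm -addnA subnKC.
have -> : a = 0 by rewrite -(coefE ha) h0// -ijm leq_addr.
move=> hr; have [_ _ h1 _] := hL.
have -> : j.+1%:R * L = m.+1%:R * L + i%:R * L by rewrite -ijm -addnS natrD mulrDl addrC.
apply: rate_le (rateM hr (rateX i h1)) => n.
rewrite subr0 -cabsX -cabsM /ratio divfK ?normr_id//; exact: expf_neq0.
Qed.

Lemma coefD i a f f' : circ_cont s f -> circ_cont s f' ->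
  coef i (fun z => a * f z + f' z) = a * coef i f + coef i f'.
Proof.
move=> cf cf'; apply: coefE.
have -> : ratio i (fun z => a * f z + f' z) = (fun n => a * ratio i f n + ratio i f' n).
  by apply/funext => n; rewrite /ratio (momentM i n a cf cf') mulrDl mulrA.
apply: cvgD; last exact: coefP.
by apply: cvgM; [exact: cvg_cst|exact: coefP].
Qed.

Lemma eq_coef i f f' : (forall z, cabs z = s -> f z = f' z) -> coef i f = coef i f'.
Proof.
move=> e; have er : ratio i f = ratio i f'; last by rewrite /coef er.
apply/funext => n; rewrite /ratio /moment.
by rewrite (eq_pair hrad e (fun z _ => erefl)).
Qed.

Lemma coef0 f : coef 0 f = pair s f (fun=> 1).
Proof.
apply: coefE; have -> : ratio 0 f = cst (pair s f (fun=> 1)); last exact: cvg_cst.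
by apply/funext => n; rewrite /ratio moment0 expr0 divr1.
Qed.

Lemma coef_bound i : exists2 A : K, 0 <= A & forall f (M : K), circ_cont s f ->
  (forall z, cabs z = s -> cabs (f z) <= M) -> cabs (coef i f) <= A * M.
Proof.
have [A A0 hA] := orb_diff_regular hrad gS xr hL.
exists (A ^+ i); first exact: exprn_ge0.
move=> f M cf fM; have -> : coef i f = coef i f - 0 by rewrite subr0.
apply: (cabs_lim_le (@coefP i f cf)).
exists 0%N => // n _; rewrite subr0 /ratio cabsM cabsV cabsX.
rewrite ler_pdivrMr; last by rewrite exprn_gt0// cabs_gt0 p0.
have -> : A ^+ i * M * cabs (mult_prod g x n) ^+ i = M * (A * cabs (mult_prod g x n)) ^+ i.
  by rewrite exprMn; ring.
by apply: (moment_le hrad gS i cf fM) => z zs; apply: hA; rewrite zs.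
Qed.

Lemma coef_disc i f h : (forall z, cabs z < s0 -> hol h z) -> (forall z, cabs z = s -> f z = h z) ->
  coef i f = 0.
Proof.
move=> hh fh; apply: coefE; have -> : ratio i f = cst 0; last exact: cvg_cst.
apply/funext => n; rewrite /ratio /moment (eq_pair hrad fh (fun z _ => erefl)).
rewrite (pair_disc hrad hh) ?mul0r// => z z0; apply: holX; exact: (orb_diff_hol hrad x gS).
Qed.

Lemma coef_eval i f : (forall h, (forall z, cabs z < s0 -> hol h z) -> pair s f h = h x) ->
  coef i f = (i == 0%N)%:R.
Proof.
move=> hf; apply: coefE; have -> : ratio i f = cst (i == 0%N)%:R; last exact: cvg_cst.
apply/funext => n; rewrite /ratio /moment hf /orb_diff ?subrr ?expr0n; last first.
  by move=> z z0; apply: holX; exact: (orb_diff_hol hrad x gS).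
by case: i => [|i]; rewrite ?expr0 ?divr1//= mul0r.
Qed.

End Regular.

(** The index is the order minus one: paired with the i-th power of z - x, it is detected exactly
    for i = k. *)
Definition pole k z := ((z - x) ^+ k.+1)^-1.

Let sx z : cabs z = s -> z - x != 0.
Proof. by move=> zs; rewrite subr_eq0; apply: contraTneq xs => <-; rewrite zs ltxx. Qed.

Lemma pole_hol k z : z - x != 0 -> hol (pole k) z.
Proof.
move=> zx; apply: holV; first exact: expf_neq0.
by apply: holX; apply: holB; [exact: hol_id|exact: hol_cst].
Qed.

Lemma pole_an k : an R (pole k).
Proof.
move=> z /andP[Rz _]; apply: pole_hol; rewrite subr_eq0; apply: contraTneq Rz => ->.
by rewrite -leNgt (le_trans xr)// ltW.
Qed.

Lemma pole_cc k : circ_cont s (pole k).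
Proof. by apply: cc_hol => z zs; apply: pole_hol; exact: sx. Qed.

(** For k > 0 this is the reflection of [pole k], in a form that is regular at 0 and keeps its
    meaning for x = 0. *)
Definition dual_pole k z := z ^+ k.-1 / (1 - cbar x * z) ^+ k.+1.

Lemma dual_den z : cabs z <= 1 -> 1 - cbar x * z != 0.
Proof. by move=> z1; apply: den_neq0 => //; exact: lt_trans x0 s01. Qed.

Lemma dual_pole_hol k z : cabs z < s0 -> hol (dual_pole k) z.
Proof.
move=> z0; apply: holM; first by apply: holX; exact: hol_id.
apply: holV; first by apply: expf_neq0; apply: dual_den; rewrite ltW// (lt_trans z0).
apply: holX; apply: holB; first exact: hol_cst.
by apply: holM; [exact: hol_cst|exact: hol_id].
Qed.

Lemma refl_pole k z : (0 < k)%N -> z != 0 -> refl (pole k) z = dual_pole k z.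
Proof.
case: k => // k _ z0; rewrite /refl /pole /dual_pole (cbarV ((cinv z - x) ^+ k.+2)) cbarX cbarB cbar_cinv.
have -> : z^-1 - cbar x = (1 - cbar x * z) / z by field.
have e : z^-1 ^+ 2 * z ^+ k.+2 = z ^+ k.
  by rewrite exprVn -[k.+2]/(2 + k)%N exprD mulKf// expf_neq0.
by rewrite expr_div_n invf_div mulrA e.
Qed.

Lemma pair_pole1 k : (0 < k)%N -> pair s (pole k) (fun=> 1) = 0.
Proof.
move=> k0; apply: (can_inj (@cbarK K)); rewrite -(pair1_refl hrad (pole_an k)) cbar0.
have e z : cabs z = s -> refl (pole k) z = dual_pole k z.
  by move=> zs; apply: refl_pole => //; rewrite -cabs_gt0 zs.
rewrite (eq_pair hrad e (fun z _ => erefl)).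
by apply: (pair_disc hrad); [exact: dual_pole_hol|move=> *; exact: hol_cst].
Qed.

Lemma derive_orb n : derive1 (orb g n) x = mult_prod g x n.
Proof.
elim: n => [|n IH].
  by rewrite /mult_prod big_ord0; apply: cderiv_derive1; exact: cd_id.
have [a ha] := orb_hol hrad n gS x0.
have [b hb] := (gS n (orb_disc hrad n gS x0)).1.
have e := cd_comp ha hb.
rewrite mult_prodS -IH (cderiv_derive1 ha) /mult (cderiv_derive1 hb) mulrC.
exact: (cderiv_derive1 e).
Qed.

Let W n := dq (orb g n) x.

Let oh n z : cabs z < s0 -> hol (orb g n) z. Proof. exact: (orb_hol hrad). Qed.

Let W_hol n z : cabs z < s0 -> hol (W n) z.
Proof. by move=> z0; apply: (dq_hol (oh n)). Qed.

Let diffE n z : orb_diff g x n z = (z - x) * W n z.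
Proof. by rewrite /orb_diff (dqE x z (oh n)) addrAC subrr add0r. Qed.

Lemma pair_pole_high k h n : (forall z, cabs z < s0 -> hol h z) ->
  pair s (pole k) (fun z => orb_diff g x n z ^+ k.+1 * h z) = 0.
Proof.
move=> hh; rewrite -[RHS](@pair_disc _ _ _ _ _ hrad (fun=> 1) (fun z => W n z ^+ k.+1 * h z)).
- rewrite /pair; apply: eq_cmean; first exact: ltW.
  move=> z zs; rewrite diffE exprMn /pole mulr1 -!mulrA; congr (z * _).
  by rewrite mulrA mulVf ?mul1r//; apply: expf_neq0; exact: sx.
- by move=> *; exact: hol_cst.
- by move=> z z0; apply: holM; [apply: holX; exact: W_hol|exact: hh].
Qed.

Lemma moment_pole_high i k n : (k < i)%N -> moment s g x i n (pole k) = 0.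
Proof.
move=> ki; rewrite -(pair_pole_high k n (h := fun z => orb_diff g x n z ^+ (i - k.+1))).
  by apply: (eq_pair hrad) => // z _; rewrite -exprD subnKC.
move=> z z0; apply: holX; exact: (orb_diff_hol hrad x gS).
Qed.

(** Writing the orbit difference as (z - x) W leaves W^k/(z - x); Cauchy's formula evaluates W at x,
    which is the derivative of the orbit map. *)
Lemma moment_pole k n : moment s g x k n (pole k) = mult_prod g x n ^+ k.
Proof.
have hw z : cabs z < s0 -> hol (fun z => W n z ^+ k) z by move=> z0; apply: holX; exact: W_hol.
rewrite -derive_orb -dqyy -/(W n) -(cauchy_disc hw xs ss0).
apply: eq_cmean; first exact: ltW.
move=> z zs; rewrite diffE exprMn /pole exprSr.
have zx := sx zs; rewrite mulrA; field; rewrite zx andTb; exact: expf_neq0.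
Qed.

Section RegularPoles.
Variable L : K.
Hypothesis hL : regular g x L.

Lemma coef_pole_high i k : (k < i)%N -> coef i (pole k) = 0.
Proof.
move=> ki; apply: coefE; have -> : ratio i (pole k) = cst 0; last exact: cvg_cst.
by apply/funext => n; rewrite /ratio moment_pole_high// mul0r.
Qed.

Lemma coef_pole k : coef k (pole k) = 1.
Proof.
apply: coefE; have -> : ratio k (pole k) = cst 1; last exact: cvg_cst.
apply/funext => n; rewrite /ratio moment_pole mulfV//; apply: expf_neq0.
exact: mult_prod_neq0 hL.
Qed.

Lemma coef0_pole k : (0 < k)%N -> coef 0 (pole k) = 0.
Proof. by move=> k0; rewrite coef0 pair_pole1. Qed.

(** The simple pole is left out: it pairs nontrivially with 1 and belongs to the equilibrium. *)
Definition polar (c : nat -> C) j z := \sum_(1 <= k < j.+1) c k * pole k z.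

Lemma polar_cc c j : circ_cont s (polar c j).
Proof.
apply: cc_hol => z zs; rewrite /polar; apply: hol_sum => k _.
by apply: holM; [exact: hol_cst|apply: pole_hol; exact: sx].
Qed.

Lemma polarS c j z : polar c j.+1 z = c j.+1 * pole j.+1 z + polar c j z.
Proof. by rewrite /polar big_nat_recr//= addrC. Qed.

Lemma coef_polarS c j i : coef i (polar c j.+1) = c j.+1 * coef i (pole j.+1) + coef i (polar c j).
Proof.
rewrite -(coefD hL i (c j.+1) (pole_cc j.+1) (polar_cc c j)); apply: eq_coef => z _.
exact: polarS.
Qed.

Lemma polar0 c z : polar c 0 z = 0.
Proof. by rewrite /polar big_geq. Qed.

Lemma coef_zero i f : (forall z, cabs z = s -> f z = 0) -> coef i f = 0.
Proof. by move=> f0; apply: (coef_disc i (h := fun=> 0)) => // z _; exact: hol_cst. Qed.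

Lemma coef_polar_high c j i : (j < i)%N -> coef i (polar c j) = 0.
Proof.
elim: j => [|j IH] ji; first by apply: coef_zero => z _; exact: polar0.
by rewrite coef_polarS coef_pole_high// mulr0 add0r IH// ltnW.
Qed.

Lemma polar_top c j : (0 < j)%N -> coef j (polar c j) = c j.
Proof.
by case: j => // j _; rewrite coef_polarS coef_pole mulr1 coef_polar_high// addr0.
Qed.

Lemma polar_eq0 c j : (forall i, (0 < i <= j)%N -> coef i (polar c j) = 0) ->
  forall k, (0 < k <= j)%N -> c k = 0.
Proof.
elim: j => [|j IH] h k; first by case: k.
have cj : c j.+1 = 0 by rewrite -(polar_top c (ltn0Sn j)) h// leqnn.
rewrite [(k <= _)%N]leq_eqVlt ltnS; case: eqP => [-> //|_] /= kj.
apply: IH kj => i /andP[i0 ij].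
have := h i; rewrite i0 (leqW ij) => /(_ isT); by rewrite coef_polarS cj mul0r add0r.
Qed.

(* Triangular elimination: the poles of order at most m.+1 correct the first m coefficients. *)
Lemma polar_correct f m : circ_cont s f -> exists c : nat -> C, forall i,
  coef i (fun z => f z + polar c m z) = if (0 < i <= m)%N then 0 else coef i f.
Proof.
elim: m f => [|m IH] f cf.
  exists (fun=> 0) => i; have -> : (0 < i <= 0)%N = false by case: i.
  by apply: eq_coef => z _; rewrite polar0 addr0.
pose b := - coef m.+1 f; pose f1 z := b * pole m.+1 z + f z.
have cf1 : circ_cont s f1 := ccD (ccM (cc_cst s b) (pole_cc m.+1)) cf.
have [c hc] := IH _ cf1; pose c2 k := if k == m.+1 then b else c k.
have c2E z : polar c2 m z = polar c m z.
  by apply: eq_big_nat => k /andP[_ km]; rewrite /c2 lt_eqF.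
exists c2 => i; have -> : coef i (fun z => f z + polar c2 m.+1 z) = coef i (fun z => f1 z + polar c m z).
  by apply: eq_coef => z _; rewrite polarS c2E /c2 eqxx /f1; ring.
rewrite hc (coefD hL i b (pole_cc m.+1) cf) [(i <= m.+1)%N]leq_eqVlt ltnS.
case: i => [|i]; first by rewrite coef0_pole// mulr0 add0r.
case: (ltngtP i.+1 m.+1) => [im|im|->] /=.
- by rewrite -ltnS im.
- by rewrite leqNgt (ltnW im) /= coef_pole_high// mulr0 add0r.
- by rewrite ltnn coef_pole /b mulr1 addNr.
Qed.

(** Poles of lower order clear the coefficients 1 to j - 1 of [pole j] and leave its own coefficient
    at 1. *)
Lemma polar_dual j : (0 < j)%N -> exists2 c : nat -> C, c j = 1 &
  forall i, coef i (polar c j) = (i == j)%:R.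
Proof.
case: j => // j _; have [c hc] := polar_correct j (pole_cc j.+1).
pose c2 k := if k == j.+1 then 1 else c k; exists c2; first by rewrite /c2 eqxx.
have c2E z : polar c2 j z = polar c j z.
  by apply: eq_big_nat => k /andP[_ km]; rewrite /c2 lt_eqF.
move=> i; have -> : coef i (polar c2 j.+1) = coef i (fun z => pole j.+1 z + polar c j z).
  by apply: eq_coef => z _; rewrite polarS c2E /c2 eqxx mul1r.
rewrite hc; case: i => [|i]; first by rewrite coef0_pole.
case: (ltngtP i.+1 j.+1) => [im|im|->] /=.
- by rewrite -ltnS im.
- by rewrite leqNgt (ltnW im) coef_pole_high.
- by rewrite ltnn coef_pole.
Qed.

End RegularPoles.

End Coefficients.

(** * Equivariance of the coefficients, decay of images, poles and equilibrium *)

Section Expansion.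
Variables (K : realType) (R s s0 r' : K).
Local Notation C := (Cplx K).
Hypothesis hrad : [/\ 0 < r', r' < R, R < s, s < s0 & s0 < 1].
Implicit Types (f h : C -> C) (z w : C) (i j k m n : nat).

Let r'0 : 0 < r'. Proof. by case: hrad. Qed.
Let r'R : r' < R. Proof. by case: hrad. Qed.
Let Rs : R < s. Proof. by case: hrad. Qed.
Let ss0 : s < s0. Proof. by case: hrad. Qed.
Let s01 : s0 < 1. Proof. by case: hrad. Qed.
Let r's : r' < s. Proof. exact: lt_trans r'R Rs. Qed.
Let s_gt0 : 0 < s. Proof. exact: lt_trans r'0 r's. Qed.
Let r's0 : r' < s0. Proof. exact: lt_trans r's ss0. Qed.
Let R0 : 0 < R. Proof. exact: lt_trans r'R. Qed.

Variables (g : nat -> C -> C) (x : C).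
Hypotheses (gS : selfmaps s0 r' g) (xr : cabs x <= r').

Let x0 : cabs x < s0. Proof. exact: le_lt_trans r's0. Qed.
Let xs : cabs x < s. Proof. exact: le_lt_trans r's. Qed.
Let yr n : cabs (orb g n x) <= r'. Proof. exact: (orb_le hrad n gS (lexx _) r's0 xr). Qed.

Local Notation g' := (fun n => g n.+1).
Local Notation x' := (g 0%N x).

Let gS' : selfmaps s0 r' g'. Proof. exact: selfmaps_shift. Qed.
Let x'r : cabs x' <= r'. Proof. exact: (yr 1). Qed.

Lemma mult_shift n : mult g' x' n = mult g x n.+1.
Proof. by rewrite /mult orb_shift. Qed.

Lemma mult_prod_shift n : mult_prod g x n.+1 = mult g x 0 * mult_prod g' x' n.
Proof.
elim: n => [|n IH].
  have e : mult_prod g x 0 = 1 by exact: big_ord0.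
  have e' : mult_prod g' x' 0 = 1 by exact: big_ord0.
  rewrite (mult_prodS g x 0) e e' mul1r mulr1; reflexivity.
rewrite (mult_prodS g x n.+1) IH (mult_prodS g' x' n) mult_shift mulrA; reflexivity.
Qed.

Lemma regular_shift L : regular g x L -> regular g' x' L.
Proof.
case=> L0 t0 h1 h2; split; [exact: L0|by move=> n; rewrite mult_shift| |].
  apply: (rate_le _ (rateZ (cabs (mult g x 0))^-1 (rate_shift h1))) => n.
  by rewrite mult_prod_shift cabsM mulKf// cabs_eq0.
apply: (rate_le _ (rateZ (cabs (mult g x 0)) (rate_shift h2))) => n.
by rewrite mult_prod_shift cabsM invfM mulVKf// cabs_eq0.
Qed.

Lemma moment_shift i n f : an R f ->
  moment s g' x' i n (transfer s (g 0%N) f) = moment s g x i n.+1 f.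
Proof.
move=> af; rewrite /moment (pair_transfer hrad (gS 0%N) af); last first.
  by move=> z z0; apply: holX; exact: (orb_diff_hol hrad x' gS').
by apply: (eq_pair hrad) => // z _; rewrite /orb_diff !orb_shift.
Qed.

(** Dual form of the linearisation: the Koenigs coordinate at the image point, composed with the
    map, is the multiplier times the coordinate at x. *)
Lemma coef_shift L i f : regular g x L -> an R f ->
  coef s g' x' i (transfer s (g 0%N) f) = mult g x 0 ^+ i * coef s g x i f.
Proof.
move=> hL af; have cf := an_cc hrad af; apply: coefE.
have e : ratio s g' x' i (transfer s (g 0%N) f) = (fun n => mult g x 0 ^+ i * ratio s g x i f n.+1).
  apply/funext => n; rewrite /ratio (moment_shift i n af) mult_prod_shift exprMn.
  have t0 : mult g x 0 ^+ i != 0 by apply: expf_neq0; case: hL.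
  by rewrite [mult g x 0 ^+ i * (_ / _)]mulrCA invfM mulVKf.
rewrite e; apply: cvgM; first exact: cvg_cst.
have h := @coefP _ _ _ _ _ hrad _ _ gS xr _ hL i f cf.
by rewrite (cvg_shiftS (ratio s g x i f)).
Qed.

Lemma geo_remainder (a e : C) m : a != 0 -> a - e != 0 ->
  (a - e)^-1 = \sum_(i < m) e ^+ i * (a ^+ i.+1)^-1 + e ^+ m * (a ^+ m * (a - e))^-1.
Proof.
move=> a0 b0; elim: m => [|m IH]; first by rewrite big_ord0 !expr0 !mul1r add0r.
rewrite IH big_ord_recr /= -addrA; congr (_ + _).
have am : a ^+ m != 0 by exact: expf_neq0.
rewrite !exprS; move: (a ^+ m) (e ^+ m) am => u v u0.
have {}b0 : a + - e != 0 by [].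
by field; rewrite a0 b0 u0.
Qed.

Definition resolvent_rest n m w z : C :=
  ((w - orb g n x) ^+ m * (w - orb g n z))^-1.

Lemma resolvent_neq0 n w : r' < cabs w -> w - orb g n x != 0.
Proof.
move=> rw; rewrite subr_eq0; apply: contraTneq rw => ->.
by rewrite -leNgt yr.
Qed.

Lemma resolvent_rest_hol n m w z : r' < cabs w -> cabs z < s0 ->
  hol (resolvent_rest n.+1 m w) z.
Proof.
move=> rw z0; apply: holV.
  apply: mulf_neq0; first by apply: expf_neq0; exact: resolvent_neq0.
  exact: (inner_neq0 (orb_selfmap hrad n gS) rw z0).
apply: holM; first exact: hol_cst.
by apply: holB; [exact: hol_cst|exact: (orb_hol hrad _ gS)].
Qed.

(** Geometric expansion of the resolvent about the orbit point: the image is a polar part with the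
    moments as coefficients, plus a remainder containing the m-th power of the orbit difference. *)
Lemma inner_expand n m f w : circ_cont s f -> r' < cabs w ->
  inner_op s (orb g n.+1) f w =
  \sum_(i < m) moment s g x i n.+1 f * pole (orb g n.+1 x) i w +
  pair s f (fun z => orb_diff g x n.+1 z ^+ m * resolvent_rest n.+1 m w z).
Proof.
move=> cf rw; have S := orb_selfmap hrad n gS.
pose T i z := pole (orb g n.+1 x) i w * orb_diff g x n.+1 z ^+ i.
have cT i : circ_cont s (T i) := ccM (cc_cst s _) (moment_cc hrad x gS i n.+1).
have cS : circ_cont s (fun z => \sum_(i < m) T i z).
  apply: (disc_cc hrad) => z z0; apply: hol_sum => k _.
  by apply: holM; [exact: hol_cst|apply: holX; exact: (orb_diff_hol hrad x gS)].
have cr : circ_cont s (resolvent_rest n.+1 m w).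
  by apply: (disc_cc hrad) => z z0; exact: resolvent_rest_hol.
have e : inner_op s (orb g n.+1) f w =
    pair s f (fun z => \sum_(i < m) T i z + orb_diff g x n.+1 z ^+ m * resolvent_rest n.+1 m w z).
  apply: (eq_pair hrad) => // z zs.
  have z0 : cabs z < s0 by rewrite zs.
  have nz := inner_neq0 S rw z0.
  have E : w - orb g n.+1 z = (w - orb g n.+1 x) - orb_diff g x n.+1 z.
    by rewrite /orb_diff; ring.
  have nz' := nz; rewrite E in nz'.
  rewrite {1}E (geo_remainder m (resolvent_neq0 n.+1 rw) nz') /resolvent_rest -E; congr (_ + _).
  by apply: eq_bigr => i _; rewrite /T mulrC.
rewrite e (pairDr hrad cf cS (ccM (moment_cc hrad x gS m n.+1) cr)); congr (_ + _).
rewrite (@pair_sumr _ _ _ _ _ hrad _ _ (fun k : 'I_m => T k) f cf (fun k : 'I_m => cT k)).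
apply: eq_bigr => i _; rewrite [RHS]mulrC.
exact: (pairZr hrad _ cf (moment_cc hrad x gS i n.+1)).
Qed.

Lemma inner_bound n m f w (M E : K) : circ_cont s f -> (forall z, cabs z = s -> cabs (f z) <= M) ->
  (forall z, cabs z = s -> cabs (orb_diff g x n.+1 z) <= E) -> R <= cabs w ->
  cabs (inner_op s (orb g n.+1) f w) <=
  (R - r')^-1 ^+ m.+1 * (\sum_(i < m) cabs (moment s g x i n.+1 f) + M * E ^+ m).
Proof.
move=> cf fM eE Rw; have rw := lt_le_trans r'R Rw.
have S := orb_selfmap hrad n gS.
rewrite (inner_expand n m cf rw); apply: le_trans (cabsD _ _) _.
have d0 : 0 < R - r' by rewrite subr_gt0.
have D1 : 1 <= (R - r')^-1.
  rewrite invf_ge1//; have := r'0; have := Rs; have := ss0; have := s01; lra.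
have D0 : 0 <= (R - r')^-1 by exact: le_trans ler01 D1.
have dw : (cabs (w - orb g n.+1 x))^-1 <= (R - r')^-1.
  rewrite lef_pV2 ?posrE// ?cabs_gt0 ?resolvent_neq0//.
  apply: le_trans (cabs_sub_ge _ _); rewrite lerB//; exact: (yr n.+1).
have iw0 : 0 <= (cabs (w - orb g n.+1 x))^-1 by rewrite invr_ge0 cabs_ge0.
rewrite mulrDr; apply: lerD.
  apply: le_trans (cabs_sum _ _ _) _; rewrite mulr_sumr; apply: ler_sum => i _.
  rewrite cabsM mulrC ler_wpM2r ?cabs_ge0// /pole cabsV cabsX -exprVn.
  apply: (@le_trans _ _ ((R - r')^-1 ^+ i.+1)); first by rewrite lerXn2r ?nnegrE.
  by apply: ler_weXn2l => //; rewrite ltnS ltnW.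
have -> : (R - r')^-1 ^+ m.+1 * (M * E ^+ m) = M * (E ^+ m * (R - r')^-1 ^+ m.+1) by ring.
have cr : circ_cont s (resolvent_rest n.+1 m w).
  by apply: (disc_cc hrad) => z z0; exact: resolvent_rest_hol.
apply: (pair_le hrad cf (ccM (moment_cc hrad x gS m n.+1) cr) fM) => z zs.
have z0 : cabs z < s0 by rewrite zs.
have E0 : 0 <= E := le_trans (cabs_ge0 _) (eE z zs).
rewrite cabsM cabsX; apply: ler_pM; rewrite ?exprn_ge0 ?cabs_ge0//.
  by rewrite lerXn2r ?nnegrE ?cabs_ge0 ?eE.
rewrite /resolvent_rest cabsV cabsM cabsX invfM -exprVn exprSr.
apply: ler_pM; rewrite ?exprn_ge0 ?invr_ge0 ?cabs_ge0//.
  by rewrite lerXn2r ?nnegrE.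
have nz := inner_neq0 S rw z0.
rewrite lef_pV2 ?posrE ?cabs_gt0//.
apply: le_trans (cabs_sub_ge _ _); rewrite lerB//; exact: (S z z0).2.
Qed.

(** Transfers bounds from the inner to the outer operator through the reflected point. The w^-1 term
    is the reason why the pairing of [refl f] with 1 is assumed to vanish below. *)
Lemma outer_inner G f w : w != 0 -> selfmap s0 r' G -> circ_cont s (refl f) -> cabs w < r'^-1 ->
  outer_op s G f w = w^-1 ^+ 2 * cbar (inner_op s G (refl f) (cinv w)) -
    w^-1 * cbar (pair s (refl f) (fun=> 1)).
Proof.
move=> w0 S cf rw; have cw : r' < cabs (cinv w).
  by rewrite cabs_cinv -[ltLHS]invrK ltf_pV2 ?posrE ?invr_gt0// cabs_gt0.
have ck := inner_kernel_cc hrad S cw.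
rewrite /outer_op /inner_op; have c1 : circ_cont s (fun=> 1 : C) := cc_cst s 1.
pose a := (cinv w) ^+ 2; pose b := - cinv w.
have e z : cabs z = s -> G z / (1 - cbar w * G z) = a * (cinv w - G z)^-1 + b * 1.
  move=> zs; have z0 : cabs z < s0 by rewrite zs.
  have n1 := inner_neq0 S cw z0; have n2 := outer_neq0 hrad S rw z0.
  rewrite /a /b; move: n1 n2; rewrite /cinv; have : cbar w != 0 by rewrite cbar_eq0.
  move: (cbar w) (G z) => u v u0 n1 n2; have n3 : 1 + - v * u != 0 by rewrite mulNr mulrC.
  by field; rewrite u0 n3.
rewrite (eq_pair hrad (fun z _ => erefl) e).
rewrite (pairDr hrad cf (ccM (cc_cst s a) ck) (ccM (cc_cst s b) c1)).
rewrite (pairZr hrad a cf ck) (pairZr hrad b cf c1).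
by rewrite cbarD (cbarM a) (cbarM b) /a /b cbarX cbarN cbar_cinv mulNr.
Qed.

Lemma transfer_bound n m f w (M E : K) : an R f ->
  (forall z, cabs z = s -> cabs (f z) <= M) ->
  (forall z, cabs z = s -> cabs (refl f z) <= M) ->
  (forall z, cabs z = s -> cabs (orb_diff g x n.+1 z) <= E) ->
  pair s (refl f) (fun=> 1) = 0 -> R <= cabs w <= R^-1 ->
  cabs (transfer s (orb g n.+1) f w) <=
  (1 + R^-1 ^+ 2) * (R - r')^-1 ^+ m.+1 *
   (\sum_(i < m) (cabs (moment s g x i n.+1 f) + cabs (moment s g x i n.+1 (refl f))) +
     M * E ^+ m).
Proof.
move=> af fM rfM eE f1 /andP[Rw wR]; have cf := an_cc hrad af.
have crf := an_cc hrad (an_refl hrad af).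
have w0 : w != 0 by rewrite -cabs_gt0 (lt_le_trans R0).
have rw : cabs w < r'^-1 by apply: le_lt_trans wR _; rewrite ltf_pV2 ?posrE.
rewrite /transfer (outer_inner w0 (orb_selfmap hrad n gS) crf rw) f1 cbar0 mulr0 subr0.
have cRw : R <= cabs (cinv w).
  by rewrite cabs_cinv -[leLHS]invrK lef_pV2 ?posrE ?invr_gt0// cabs_gt0.
have h1 := inner_bound m cf fM eE Rw; have h2 := inner_bound m crf rfM eE cRw.
apply: le_trans (cabsD _ _) _; rewrite cabsM cabs_bar cabsX cabsV big_split /=.
set A := \sum_(i < m) _ in h1 *; set B := \sum_(i < m) _ in h2 *.
set D := (R - r')^-1 ^+ m.+1 in h1 h2 *.
have D0 : 0 <= D by apply: exprn_ge0; rewrite invr_ge0 subr_ge0 ltW.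
have A0 : 0 <= A by apply: sumr_ge0 => i _; exact: cabs_ge0.
have B0 : 0 <= B by apply: sumr_ge0 => i _; exact: cabs_ge0.
have i0 : 0 <= (cabs w)^-1 by rewrite invr_ge0 cabs_ge0.
have q0 : 0 <= R^-1 ^+ 2 by exact: sqr_ge0.
have hw : (cabs w)^-1 ^+ 2 <= R^-1 ^+ 2.
  rewrite lerXn2r ?nnegrE ?invr_ge0 ?(ltW R0) ?cabs_ge0//.
  by rewrite lef_pV2 ?posrE// cabs_gt0.
have h3 : (cabs w)^-1 ^+ 2 * cabs (inner_op s (orb g n.+1) (refl f) (cinv w)) <=
    R^-1 ^+ 2 * (D * (B + M * E ^+ m)).
  by apply: ler_pM => //; rewrite ?sqr_ge0 ?cabs_ge0.
apply: le_trans (lerD h1 h3) _.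
have -> : (1 + R^-1 ^+ 2) * D * (A + B + M * E ^+ m) =
  D * (A + M * E ^+ m) + R^-1 ^+ 2 * (D * (B + M * E ^+ m)) + (D * B + R^-1 ^+ 2 * (D * A)).
  ring.
rewrite lerDl; apply: addr_ge0; apply: mulr_ge0 => //; exact: mulr_ge0.
Qed.

(** With j + 1 terms of the expansion, the moments decay at rate (j + 1) L by [moment_decay], and so
    does the remainder, which carries the (j + 1)-st power of the orbit difference. *)
Lemma transfer_decay L j f : regular g x L -> an R f ->
  (forall i, (i <= j)%N -> coef s g x i f = 0) ->
  (forall i, (i <= j)%N -> coef s g x i (refl f) = 0) ->
  exists2 v : nat -> K, rate v (j.+1%:R * L) &
    forall n w, R <= cabs w <= R^-1 -> cabs (transfer s (orb g n.+1) f w) <= v n.+1.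
Proof.
move=> hL af hf hrf; have cf := an_cc hrad af; have crf := an_cc hrad (an_refl hrad af).
have [M M0 fM] := circ_bounded s_gt0 cf; have [M' M'0 rfM] := circ_bounded s_gt0 crf.
have [A A0 hA] := orb_diff_regular hrad gS xr hL.
have [_ _ h1 _] := hL.
exists (fun n => (1 + R^-1 ^+ 2) * (R - r')^-1 ^+ j.+2 *
   (\sum_(i < j.+1) (cabs (moment s g x i n f) + cabs (moment s g x i n (refl f))) +
     (M + M') * (A * cabs (mult_prod g x n)) ^+ j.+1)).
  apply: rateZ; apply: rateD; last by apply: rateZ; apply: rateX; apply: rateZ.
  apply: rate_sum => i; have ij : (i <= j)%N by rewrite -ltnS.
  by apply: rateD; exact: (moment_decay hrad gS xr hL).
move=> n w hw; apply: transfer_bound => //.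
- by move=> z zs; apply: le_trans (fM z zs) _; rewrite lerDl.
- by move=> z zs; apply: le_trans (rfM z zs) _; rewrite lerDr.
- by move=> z zs; apply: hA; rewrite zs.
- by rewrite -(coef0 hrad g x) hrf.
Qed.

(** The expansion of the inner part stops after order k + 1 because higher powers cancel the pole,
    and its simple pole drops out by [pair_pole1]. The outer part is 0, since the reflected pole is
    holomorphic in the disc. *)
Lemma transfer_pole k w : (0 < k)%N -> annulus R w -> transfer s (g 0%N) (pole x k) w =
  polar x' (fun i => moment s g x i 1 (pole x k)) k w.
Proof.
move=> k0 hw; have /andP[rw wr] := annulus_radii hrad hw.
have -> : outer_op s (g 0%N) (pole x k) w = 0 -> transfer s (g 0%N) (pole x k) w =
    inner_op s (orb g 1) (pole x k) w by move=> h; rewrite /transfer h addr0.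
  rewrite (inner_expand 0 k.+1 (pole_cc hrad xr k) rw).
  rewrite (pair_pole_high hrad gS xr k 1 (h := resolvent_rest 1 k.+1 w)) ?addr0; last first.
    by move=> z z0; exact: resolvent_rest_hol.
  rewrite big_ord_recl (moment0 hrad) (pair_pole1 hrad xr k0) mul0r add0r /polar big_add1 big_mkord.
  by apply: eq_bigr.
rewrite /outer_op; have e z : cabs z = s -> refl (pole x k) z = dual_pole x k z.
  by move=> zs; apply: refl_pole => //; rewrite -cabs_gt0 zs.
rewrite (eq_pair hrad e (fun z _ => erefl)).
rewrite (pair_disc hrad); first exact: cbar0.
  exact: (dual_pole_hol hrad xr).
by move=> z z0; exact: (outer_kernel_hol hrad (gS 0%N) wr z0).
Qed.

Lemma polar_an c j : an R (polar x c j).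
Proof.
move=> z hz; apply: hol_sum => k _; apply: holM; first exact: hol_cst.
exact: (pole_an hrad xr).
Qed.

Lemma transfer_polar c j : exists c' : nat -> C, forall w, annulus R w ->
  transfer s (g 0%N) (polar x c j) w = polar x' c' j w.
Proof.
elim: j => [|j [c' hc']].
  exists (fun=> 0) => w hw; rewrite polar0.
  have h := transfer_lin hrad (-1) (gS 0%N) (polar_an c 0) (polar_an c 0) hw.
  rewrite (eq_transfer hrad w (fun z _ => erefl) (f' := fun z => -1 * polar x c 0 z + polar x c 0 z)).
    by rewrite h mulN1r addNr.
  by move=> z _; rewrite polar0; ring.
pose b i := moment s g x i 1 (pole x j.+1).
exists (fun i => c j.+1 * b i + (if i == j.+1 then 0 else c' i)) => w hw.
rewrite (eq_transfer hrad w (fun z _ => erefl) (f' := fun z => c j.+1 * pole x j.+1 z + polar x c j z));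
  last by move=> z _; exact: polarS.
rewrite (transfer_lin hrad _ (gS 0%N) (pole_an hrad xr j.+1) (polar_an c j) hw) hc'//.
rewrite (transfer_pole (ltn0Sn j) hw) -/b.
have -> : polar x' c' j w = polar x' (fun i => if i == j.+1 then 0 else c' i) j.+1 w.
  rewrite polarS eqxx mul0r add0r; apply: eq_big_nat => k /andP[_ kj].
  by rewrite lt_eqF.
rewrite /polar mulr_sumr -big_split /=; apply: eq_bigr => i _.
by rewrite mulrDl mulrA.
Qed.

(** The difference of the simple fractions at x and at its reflection, in a form valid for x = 0. It
    is fixed by [refl], and its pairing with h is h x, so duality carries it to the equilibrium of
    the image point. *)
Definition equil z := (z - x)^-1 + cbar x / (1 - cbar x * z).

Lemma equil_out_hol z : cabs z < s0 -> hol (fun z => cbar x / (1 - cbar x * z)) z.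
Proof.
move=> z0; apply: holM; first exact: hol_cst.
apply: holV; first by apply: (dual_den hrad xr); rewrite ltW// (lt_trans z0).
by apply: holB; [exact: hol_cst|apply: holM; [exact: hol_cst|exact: hol_id]].
Qed.

Lemma equil_den z : cabs z < r'^-1 -> 1 - cbar x * z != 0.
Proof.
move=> zr; rewrite subr_eq0; apply: contraTneq zr => e.
have : cabs (cbar x * z) = 1 by rewrite -e cabs1.
rewrite cabsM cabs_bar => h; rewrite -leNgt -[leLHS]mul1r ler_pdivrMr// -h mulrC.
by rewrite ler_wpM2l ?cabs_ge0.
Qed.

Lemma equil_hol z : r' < cabs z < r'^-1 -> hol equil z.
Proof.
move=> /andP[rz zr]; apply: holD.
  apply: holV; first exact: (resolvent_neq0 0 rz).
  by apply: holB; [exact: hol_id|exact: hol_cst].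
apply: holM; first exact: hol_cst.
apply: holV; first exact: equil_den.
by apply: holB; [exact: hol_cst|apply: holM; [exact: hol_cst|exact: hol_id]].
Qed.

Lemma pair_equil h : (forall z, cabs z < s0 -> hol h z) -> pair s equil h = h x.
Proof.
move=> hh; have c1 : circ_cont s (fun z => (z - x)^-1).
  by apply: cc_kernel; rewrite lt_eqF.
have c2 : circ_cont s (fun z => cbar x / (1 - cbar x * z)).
  exact: (disc_cc hrad equil_out_hol).
rewrite /equil (pairD hrad c1 c2 (disc_cc hrad hh)) (pair_disc hrad equil_out_hol hh) addr0.
rewrite -(cauchy_disc hh xs ss0); apply: eq_cmean; first exact: ltW.
by move=> z _; rewrite mulrAC.
Qed.

Lemma refl_equil z : r' < cabs z < r'^-1 -> refl equil z = equil z.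
Proof.
move=> /andP[rz zr]; have z0 : z != 0 by rewrite -cabs_gt0 (lt_trans r'0).
have n1 : z - x != 0 := resolvent_neq0 0 rz; have n2 := equil_den zr.
rewrite /refl /equil cbarD (cbarM (cbar x)) !cbarV !cbarB cbar_cinv cbarM !cbarK cbar1 cbar_cinv.
move: n2; move: (cbar x) => u n2.
have e1 : z^-1 - u = (1 - u * z) / z by field.
have e2 : 1 - x * z^-1 = (z - x) / z by field.
have n2' : 1 + - u * z != 0 by rewrite mulNr.
by rewrite e1 e2; field; rewrite ?n1 ?n2 ?n2' ?z0.
Qed.

Lemma transfer_equil w : annulus R w -> transfer s (g 0%N) equil w =
  (w - x')^-1 + cbar x' / (1 - cbar x' * w).
Proof.
move=> hw; have /andP[rw wr] := annulus_radii hrad hw; congr (_ + _).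
  rewrite /inner_op pair_equil// => z z0; exact: (inner_kernel_hol (gS 0%N) rw z0).
rewrite /outer_op (eq_pair hrad (f' := equil) (h' := fun z => g 0%N z / (1 - cbar w * g 0%N z)))//.
  rewrite pair_equil; first by rewrite (cbarM x') cbarV cbarB cbar1 cbarM cbarK mulrC [w * _]mulrC mulrC.
  by move=> z z0; exact: (outer_kernel_hol hrad (gS 0%N) wr z0).
move=> z zs; apply: refl_equil; apply: (annulus_radii hrad); exact: (s_annulus hrad).
Qed.

End Expansion.

(** * Linear algebra of a biorthogonal system *)

Section Biorthogonal.
Variables (K : realType) (R : K).
Hypotheses (R0 : 0 < R) (R1 : R < 1).
Local Notation C := (Cplx K).
Implicit Types (f u v : C -> C) (a b : C) (i j : nat).

Lemma lin_span1P v f : lin_span [:: v] f <-> exists a, f = a *: v.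
Proof.
split=> [[c ->]|[a ->]].
  by exists (c 0%N); rewrite big_ord_recl big_ord0 addr0.
by exists (fun=> a); rewrite big_ord_recl big_ord0 addr0.
Qed.

Lemma lin_span2P u v f : lin_span [:: u; v] f <-> exists a b, f = a *: u + b *: v.
Proof.
split=> [[c ->]|[a [b ->]]].
  by exists (c 0%N), (c 1%N); rewrite !big_ord_recl big_ord0 addr0.
exists (fun i => if i == 0%N then a else b).
by rewrite !big_ord_recl big_ord0 addr0.
Qed.

(** Two families of bounded functionals with their dual vectors. They agree at index 0, which makes
    that level a line, while every later level is a plane. *)
Variables (al be : nat -> (C -> C) -> C) (v0 : C -> C) (G H : nat -> C -> C).
Hypotheses
  (al_lin : forall i a f f', hardy R f -> hardy R f' ->
     al i (a *: f + f') = a * al i f + al i f')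
  (be_lin : forall i a f f', hardy R f -> hardy R f' ->
     be i (a *: f + f') = a * be i f + be i f')
  (al_bnd : forall i, exists2 A : K, 0 <= A &
     forall f, hardy R f -> cabs (al i f) <= A * hardy_norm R f)
  (be_bnd : forall i, exists2 A : K, 0 <= A &
     forall f, hardy R f -> cabs (be i f) <= A * hardy_norm R f)
  (be0 : forall f, hardy R f -> be 0 f = al 0 f)
  (hv0 : hardy R v0)
  (hG : forall j, (0 < j)%N -> hardy R (G j)) (hH : forall j, (0 < j)%N -> hardy R (H j))
  (al_v0 : forall i, al i v0 = (i == 0%N)%:R) (be_v0 : forall i, be i v0 = (i == 0%N)%:R)
  (al_G : forall i j, (0 < j)%N -> al i (G j) = (i == j)%:R)
  (be_G : forall i j, (0 < j)%N -> be i (G j) = 0)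
  (al_H : forall i j, (0 < j)%N -> al i (H j) = 0)
  (be_H : forall i j, (0 < j)%N -> be i (H j) = (i == j)%:R).

Definition basis j := if j == 0%N then [:: v0] else [:: G j; H j].
Definition slow j := lin_span (basis j).
Definition fast j : set (C -> C) :=
  [set f | hardy R f /\ forall i, (i <= j)%N -> al i f = 0 /\ be i f = 0].

Let v0N : -1 *: v0 + v0 = 0.
Proof. by rewrite scaleN1r addNr. Qed.

Lemma hardy0 : hardy R 0.
Proof. by have := hardy_lin R0 R1 (-1) hv0 hv0; rewrite v0N. Qed.

Lemma hardyZ a f : hardy R f -> hardy R (a *: f).
Proof. by move=> hf; rewrite -[a *: f]addr0; apply: (hardy_lin R0 R1) => //; exact: hardy0. Qed.

Lemma hardyD f f' : hardy R f -> hardy R f' -> hardy R (f + f').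
Proof. by move=> hf hf'; rewrite -[f]scale1r; exact: (hardy_lin R0 R1). Qed.

Lemma al0 i : al i 0 = 0.
Proof. by have := al_lin i (-1) hv0 hv0; rewrite v0N mulN1r addNr. Qed.

Lemma be00 i : be i 0 = 0.
Proof. by have := be_lin i (-1) hv0 hv0; rewrite v0N mulN1r addNr. Qed.

Lemma alZ i a f : hardy R f -> al i (a *: f) = a * al i f.
Proof. by move=> hf; rewrite -[a *: f]addr0 (al_lin i a hf hardy0) al0 addr0. Qed.

Lemma beZ i a f : hardy R f -> be i (a *: f) = a * be i f.
Proof. by move=> hf; rewrite -[a *: f]addr0 (be_lin i a hf hardy0) be00 addr0. Qed.

Lemma alD i f f' : hardy R f -> hardy R f' -> al i (f + f') = al i f + al i f'.
Proof. by move=> hf hf'; rewrite -[f in LHS]scale1r (al_lin i 1 hf hf') mul1r. Qed.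

Lemma beD i f f' : hardy R f -> hardy R f' -> be i (f + f') = be i f + be i f'.
Proof. by move=> hf hf'; rewrite -[f in LHS]scale1r (be_lin i 1 hf hf') mul1r. Qed.

Lemma slowP j f : slow j f <-> exists a b, f = if j == 0%N then a *: v0 else a *: G j + b *: H j.
Proof.
rewrite /slow /basis; case: eqP => _; last exact: lin_span2P.
split=> [/lin_span1P[a ->]|[a [_ ->]]]; first by exists a, 0.
by apply/lin_span1P; exists a.
Qed.

Lemma slow_comb_hardy j a b : hardy R (if j == 0%N then a *: v0 else a *: G j + b *: H j).
Proof.
case: j => [|j] /=; first exact: hardyZ.
by apply: hardyD; apply: hardyZ; [exact: hG|exact: hH].
Qed.

Lemma slow_hardy j f : slow j f -> hardy R f.
Proof. by move=> /slowP[a [b ->]]; exact: slow_comb_hardy. Qed.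

Lemma al_slow i j a b : al i (if j == 0%N then a *: v0 else a *: G j + b *: H j) =
  if i == j then a else 0.
Proof.
case: j => [|j] /=; first by rewrite (alZ i a hv0) al_v0; case: eqP => _; rewrite ?mulr1 ?mulr0.
have h1 := hG (ltn0Sn j); have h2 := hH (ltn0Sn j).
rewrite (alD i (hardyZ a h1) (hardyZ b h2)) (alZ i a h1) (alZ i b h2) (al_G i (ltn0Sn j)) (al_H i (ltn0Sn j)).
by rewrite mulr0 addr0; case: eqP => _; rewrite ?mulr1 ?mulr0.
Qed.

Lemma be_slow i j a b : be i (if j == 0%N then a *: v0 else a *: G j + b *: H j) =
  if i == j then (if j == 0%N then a else b) else 0.
Proof.
case: j => [|j] /=; first by rewrite (beZ i a hv0) be_v0; case: eqP => _; rewrite ?mulr1 ?mulr0.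
have h1 := hG (ltn0Sn j); have h2 := hH (ltn0Sn j).
rewrite (beD i (hardyZ a h1) (hardyZ b h2)) (beZ i a h1) (beZ i b h2) (be_G i (ltn0Sn j)) (be_H i (ltn0Sn j)).
by rewrite mulr0 add0r; case: eqP => _; rewrite ?mulr1 ?mulr0.
Qed.

Lemma slow_off i j f : slow j f -> i <> j -> al i f = 0 /\ be i f = 0.
Proof. by move=> /slowP[a [b ->]] /eqP/negbTE ij; rewrite al_slow be_slow ij. Qed.

Lemma slow_eq0 j f : slow j f -> al j f = 0 -> be j f = 0 -> f = 0.
Proof.
move=> /slowP[a [b ->]]; rewrite al_slow be_slow eqxx.
case: j => [|j] /= -> => [_|->]; first exact: scale0r.
by rewrite !scale0r addr0.
Qed.

Lemma slow_subspace j : hardy_subspace R (slow j).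
Proof.
split; first exact: slow_hardy.
  apply/slowP; exists 0, 0; case: eqP => _; first by rewrite scale0r.
  by rewrite !scale0r addr0.
move=> c _ _ /slowP[a [b ->]] /slowP[a' [b' ->]]; apply/slowP.
exists (c * a + a'), (c * b + b'); case: eqP => _; first by rewrite scalerDl scalerA.
by rewrite !scalerDl -!scalerA scalerDr addrACA.
Qed.

Lemma slow_dim j : has_dim (slow j) (if j == 0%N then 1%N else 2%N).
Proof.
exists (basis j); split => //; first by rewrite /basis; case: eqP.
move=> c h; have e : (if j == 0%N then c 0%N *: v0 else c 0%N *: G j + c 1%N *: H j) = 0.
  move: h; rewrite /basis; case: eqP => _.
    by rewrite /= big_ord_recl big_ord0 addr0.
  by rewrite /= !big_ord_recl big_ord0 addr0.
have := congr1 (al j) e; have := congr1 (be j) e; rewrite al_slow be_slow eqxx al0 be00 /basis.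
case: eqP => _ hb ha i /=; first by case: i.
by case: i => [//|[]].
Qed.

Lemma fast_subspace j : hardy_subspace R (fast j).
Proof.
split; first by move=> f [].
  by split=> [|i _]; [exact: hardy0|rewrite al0 be00].
move=> a f f' [hf f0] [hf' f'0]; split=> [|i ij]; first exact: (hardy_lin R0 R1).
have [a1 b1] := f0 i ij; have [a2 b2] := f'0 i ij.
by rewrite (al_lin i a hf hf') (be_lin i a hf hf') a1 b1 a2 b2 mulr0 addr0.
Qed.

Lemma bounded_kernel_closed (phi : (C -> C) -> C) (A : K) (u : nat -> C -> C) f : 0 <= A ->
  (forall f, hardy R f -> cabs (phi f) <= A * hardy_norm R f) ->
  (forall a f f', hardy R f -> hardy R f' -> phi (a *: f + f') = a * phi f + phi f') ->
  (forall n, hardy R (u n) /\ phi (u n) = 0) -> hardy R f -> hardy_cvg R u f -> phi f = 0.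
Proof.
move=> A0 hA lin hu hf cv; apply/eqP; rewrite -cabs_eq0 eq_le cabs_ge0 andbT.
apply/ler_addgt0Pr => e e0; rewrite add0r.
have A1 : 0 < A + 1 by rewrite ltr_wpDl.
have e1 : 0 < e / (A + 1) by rewrite divr_gt0.
have [n _ /(_ n (leqnn n))] := (cvgrPdist_lt _ _).1 cv _ e1.
rewrite sub0r normrN ger0_norm ?hardy_norm_ge0// => hn; have [hun un0] := hu n.
have e2 : u n - f = -1 *: f + u n by rewrite scaleN1r addrC.
have hd : hardy R (u n - f) by rewrite e2; exact: (hardy_lin R0 R1).
have := hA _ hd; rewrite {1}e2 lin// un0 addr0 mulN1r cabsN => h.
apply: (le_trans h); apply: (@le_trans _ _ ((A + 1) * (e / (A + 1)))).
  by apply: ler_pM => //; [exact: hardy_norm_ge0|rewrite lerDl|exact: ltW].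
by rewrite mulrC divfK// gt_eqF.
Qed.

Lemma fast_closed j : hardy_closed R (fast j).
Proof.
move=> u f hu hf cv; split=> // i ij.
have [A A0 hA] := al_bnd i; have [B B0 hB] := be_bnd i.
split.
  apply: (bounded_kernel_closed A0 hA _ _ hf cv); first by move=> *; exact: al_lin.
  by move=> n; have [h h'] := hu n; split=> //; have [] := h' i ij.
apply: (bounded_kernel_closed B0 hB _ _ hf cv); first by move=> *; exact: be_lin.
by move=> n; have [h h'] := hu n; split=> //; have [] := h' i ij.
Qed.

Lemma hardy_sumn (v : nat -> C -> C) n : (forall k, (k < n)%N -> hardy R (v k)) ->
  hardy R (\sum_(k < n) v k).
Proof.
elim: n => [|n IH] hv; first by rewrite big_ord0; exact: hardy0.
rewrite big_ord_recr; apply: hardyD; last exact: hv.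
by apply: IH => k kn; apply: hv; exact: ltnW.
Qed.

Lemma al_sum i (v : nat -> C -> C) n : (forall k, (k < n)%N -> hardy R (v k)) ->
  al i (\sum_(k < n) v k) = \sum_(k < n) al i (v k).
Proof.
elim: n => [|n IH] hv; first by rewrite !big_ord0 al0.
have hv' k : (k < n)%N -> hardy R (v k) by move=> kn; apply: hv; exact: ltnW.
by rewrite !big_ord_recr /= (alD i (hardy_sumn hv') (hv n (leqnn _))) (IH hv').
Qed.

Lemma be_sum i (v : nat -> C -> C) n : (forall k, (k < n)%N -> hardy R (v k)) ->
  be i (\sum_(k < n) v k) = \sum_(k < n) be i (v k).
Proof.
elim: n => [|n IH] hv; first by rewrite !big_ord0 be00.
have hv' k : (k < n)%N -> hardy R (v k) by move=> kn; apply: hv; exact: ltnW.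
by rewrite !big_ord_recr /= (beD i (hardy_sumn hv') (hv n (leqnn _))) (IH hv').
Qed.

Lemma sum_single (u : nat -> C) j i : (i <= j)%N -> (forall k, (k <= j)%N -> k <> i -> u k = 0) ->
  \sum_(k < j.+1) u k = u i.
Proof.
move=> ij u0; rewrite (bigD1 (Ordinal (ij : (i < j.+1)%N))) //= big1 ?addr0//.
by move=> k /eqP ki; apply: u0; [exact: (ltn_ord k)|move=> e; apply: ki; apply: val_inj].
Qed.

Lemma slow_sum_al j (v : nat -> C -> C) i : (i <= j)%N -> (forall k, (k <= j)%N -> slow k (v k)) ->
  al i (\sum_(k < j.+1) v k) = al i (v i) /\ be i (\sum_(k < j.+1) v k) = be i (v i).
Proof.
move=> ij hv; have hv' k : (k < j.+1)%N -> hardy R (v k) by move=> kj; exact: slow_hardy (hv k kj).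
rewrite (al_sum i hv') (be_sum i hv'); split; apply: (@sum_single (fun k => _ i (v k)) j i ij).
  by move=> k kj ki; apply: (slow_off (hv k kj) _).1 => e; apply: ki.
by move=> k kj ki; apply: (slow_off (hv k kj) _).2 => e; apply: ki.
Qed.

Lemma slow_fast_decomposition j : direct_decomposition R j slow (fast j).
Proof.
split=> [f hf|v f hv [hf f0] e].
  pose v i := if i == 0%N then al i f *: v0 else al i f *: G i + be i f *: H i.
  have hv i : slow i (v i) by apply/slowP; exists (al i f), (be i f).
  have hS : hardy R (\sum_(i < j.+1) v i) by apply: hardy_sumn => k _; exact: slow_hardy (hv k).
  exists v, (-1 *: (\sum_(i < j.+1) v i) + f); split; [by move=> i _; exact: hv| |];
    last by rewrite scaleN1r addrA addrN add0r.
  split=> [|i ij]; first exact: (hardy_lin R0 R1).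
  have [h1 h2] := slow_sum_al ij (fun k _ => hv k).
  rewrite (al_lin i (-1) hS hf) (be_lin i (-1) hS hf) h1 h2 /v al_slow be_slow eqxx !mulN1r addNr; split=> //.
  by case: i {ij h1 h2} => [|i] /=; rewrite -?be0// addNr.
have hv' k : (k < j.+1)%N -> hardy R (v k) by move=> kj; exact: slow_hardy (hv k kj).
have hS := hardy_sumn hv'.
have v0' i : (i <= j)%N -> v i = 0.
  move=> ij; have [h1 h2] := slow_sum_al ij hv; have [a1 b1] := f0 i ij.
  apply: (slow_eq0 (hv i ij)).
    by have := congr1 (al i) e; rewrite (alD i hS hf) h1 a1 addr0 al0.
  by have := congr1 (be i) e; rewrite (beD i hS hf) h2 b1 addr0 be00.
split=> //; move: e; rewrite big1 ?add0r// => i _; exact: v0' (ltn_ord i).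
Qed.

End Biorthogonal.

(** * The transfer operator on the Hardy space and its identification *)

Section Operator.
Variables (K : realType) (R s s0 r' : K).
Local Notation C := (Cplx K).
Hypothesis hrad : [/\ 0 < r', r' < R, R < s, s < s0 & s0 < 1].
Implicit Types (f F h : C -> C) (G H : C -> C) (z w : C).

Let r'0 : 0 < r'. Proof. by case: hrad. Qed.
Let r'R : r' < R. Proof. by case: hrad. Qed.
Let Rs : R < s. Proof. by case: hrad. Qed.
Let ss0 : s < s0. Proof. by case: hrad. Qed.
Let s01 : s0 < 1. Proof. by case: hrad. Qed.
Let R0 : 0 < R. Proof. exact: lt_trans r'R. Qed.
Let s_gt0 : 0 < s. Proof. exact: lt_trans Rs. Qed.
Let s1 : s < 1. Proof. exact: lt_trans s01. Qed.
Let R1 : R < 1. Proof. exact: lt_trans s1. Qed.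
Let sV : s < s^-1. Proof. by rewrite (lt_trans s1)// invf_gt1. Qed.
Let RsV : s^-1 < R^-1. Proof. by rewrite ltf_pV2 ?posrE. Qed.
Let hs : R < s < R^-1. Proof. by rewrite Rs (lt_trans sV). Qed.
Let hsV : R < s^-1 < R^-1. Proof. by rewrite RsV (lt_trans Rs). Qed.
Let RrV : R^-1 < r'^-1. Proof. by rewrite ltf_pV2 ?posrE. Qed.

(** The class in which images of [transfer] lie: holomorphic on an open annulus that contains the
    closed annulus of radii R and 1/R. *)
Definition thick F := forall z, r' < cabs z < r'^-1 -> hol F z.

Lemma thick_an F : thick F -> an R F.
Proof. by move=> hF z hz; apply: hF; exact: (annulus_radii hrad). Qed.

Lemma thick_refl F : thick F -> thick (refl F).
Proof.
move=> hF z /andP[rz zr]; have z0 : 0 < cabs z := lt_trans r'0 rz.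
apply: refl_hol; first by rewrite -cabs_gt0.
apply: hF; rewrite cabs_cinv ltf_pV2 ?posrE// rz andbT.
by rewrite -[ltLHS]invrK ltf_pV2 ?posrE ?invr_gt0.
Qed.

(** Cauchy's formula on two circles outside the closed annulus, on each of which F is bounded. *)
Lemma thick_bounded F : thick F -> exists2 M : K, 0 <= M &
  forall z, R <= cabs z <= R^-1 -> cabs (F z) <= M.
Proof.
move=> hF; pose c1 := (r' + R) / 2; pose c2 := (R^-1 + r'^-1) / 2.
have c10 : 0 < c1 by rewrite /c1; have := r'0; have := R0; lra.
have rc1 : r' < c1 by rewrite /c1; have := r'R; lra.
have c1R : c1 < R by rewrite /c1; have := r'R; lra.
have c2R : R^-1 < c2 by rewrite /c2; have := RrV; lra.
have c2r : c2 < r'^-1 by rewrite /c2; have := RrV; lra.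
have RRV : R < R^-1 by rewrite (lt_trans Rs)// (lt_trans sV).
have c20 : 0 < c2 by rewrite (lt_trans _ c2R)// invr_gt0.
have cF (c : K) : r' < c < r'^-1 -> circ_cont c F.
  by move=> hc; apply: cc_hol => z zc; apply: hF; rewrite zc.
have h1 : r' < c1 < r'^-1 by rewrite rc1 (lt_trans c1R)// (lt_trans RRV).
have h2 : r' < c2 < r'^-1 by rewrite c2r andbT (lt_trans r'R)// (lt_trans RRV).
have [M1 M10 hM1] := circ_bounded c10 (cF _ h1); have [M2 M20 hM2] := circ_bounded c20 (cF _ h2).
have d1 : 0 < R - c1 by rewrite subr_gt0.
have d2 : 0 < c2 - R^-1 by rewrite subr_gt0.
exists (c2 * M2 / (c2 - R^-1) + c1 * M1 / (R - c1)).
  by apply: addr_ge0; (apply: divr_ge0; last exact: ltW); apply: mulr_ge0 => //; exact: ltW.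
move=> z /andP[Rz zR].
have bd (c M d : K) : 0 < c -> r' < c < r'^-1 -> 0 < d -> cabs z != c ->
    (forall x, cabs x = c -> cabs (F x) <= M) -> (forall x, cabs x = c -> d <= cabs (x - z)) ->
    cabs (cmean c (fun x => x * F x / (x - z))) <= c * M / d.
  move=> c0 hc d0 zc hM hd; apply: cmean_le; first exact: ltW.
    exact: (ccM (ccM (cc_id c) (cF c hc)) (cc_kernel zc)).
  move=> x xc; rewrite !cabsM cabsV xc; apply: ler_pM; rewrite ?invr_ge0 ?mulr_ge0 ?cabs_ge0 ?(ltW c0)//.
    by rewrite ler_wpM2l ?(ltW c0)// hM.
  by rewrite lef_pV2 ?posrE ?(lt_le_trans d0)// hd.
have zc1 : c1 < cabs z := lt_le_trans c1R Rz.
have zc2 : cabs z < c2 := le_lt_trans zR c2R.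
rewrite (@cauchy_annulus _ F r' r'^-1 z c1 c2 (ltW r'0) hF rc1 zc1 zc2 c2r).
apply: le_trans (cabsB _ _) _; apply: lerD; apply: bd => //.
- by rewrite lt_eqF.
- by move=> x xc; apply: le_trans (cabs_sub_ge _ _); rewrite xc lerB.
- by rewrite gt_eqF.
- by move=> x xc; rewrite cabsBC; apply: le_trans (cabs_sub_ge _ _); rewrite xc lerB.
Qed.

Lemma thick_hardy F : thick F -> hardy R (restrict_annulus R F).
Proof. by move=> hF; have [M M0 hM] := thick_bounded hF; have [] := hardy_ext R0 R1 r'0 r'R hF hM. Qed.

Lemma hardy_circ : exists2 A : K, 0 <= A & forall f, hardy R f -> forall z, cabs z = s ->
  cabs (f z) <= A * hardy_norm R f /\ cabs (refl f z) <= A * hardy_norm R f.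
Proof.
have [A A0 hA] := hardy_sup R0 hs; have [B B0 hB] := hardy_sup R0 hsV.
have c0 : 0 <= s^-1 ^+ 2 by exact: sqr_ge0.
exists (A + s^-1 ^+ 2 * B); first by rewrite addr_ge0// mulr_ge0.
move=> f hf z zs; have n0 := hardy_norm_ge0 R f; split.
  by apply: le_trans (hA f hf z zs) _; rewrite ler_wpM2r// lerDl mulr_ge0.
rewrite cabsM cabs_bar cabsX cabsV zs.
have cz : cabs (cinv z) = s^-1 by rewrite cabs_cinv zs.
apply: le_trans (ler_wpM2l c0 (hB f hf _ cz)) _.
by rewrite mulrA ler_wpM2r// lerDr.
Qed.

Definition Lop G f := restrict_annulus R (transfer s G f).

Lemma transfer_thick G f : selfmap s0 r' G -> an R f -> thick (transfer s G f).
Proof.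
move=> hG af z hz; apply: (transfer_hol hrad hG _ _ hz); first exact: (an_cc hrad af).
exact: (an_cc hrad (an_refl hrad af)).
Qed.

Lemma Lop_hardy G f : selfmap s0 r' G -> hardy R f -> hardy R (Lop G f).
Proof. by move=> hG hf; apply: thick_hardy; apply: transfer_thick => //; exact: hardy_an. Qed.

Lemma transfer_sup : exists2 B : K, 0 <= B & forall G f, selfmap s0 r' G -> hardy R f ->
  forall w, R <= cabs w <= R^-1 -> cabs (transfer s G f w) <= B * hardy_norm R f.
Proof.
have [A A0 hA] := hardy_circ.
have d1 : 0 < R - r' by rewrite subr_gt0.
have d2 : 0 < 1 - r' / R by rewrite subr_gt0 ltr_pdivrMr// mul1r.
exists (A / (R - r') + A / (1 - r' / R)); first by rewrite addr_ge0 ?divr_ge0 ?(ltW d1) ?(ltW d2).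
move=> G f hG hf w /andP[Rw wR]; have af := hardy_an hf.
apply: le_trans (cabsD _ _) _.
have -> : (A / (R - r') + A / (1 - r' / R)) * hardy_norm R f =
  A * hardy_norm R f / (R - r') + A * hardy_norm R f / (1 - r' / R) by ring.
apply: lerD.
  by apply: (inner_le hrad hG (an_cc hrad af)) => // z zs; exact: (hA f hf z zs).1.
by apply: (outer_le hrad hG (an_cc hrad (an_refl hrad af))) => // z zs; exact: (hA f hf z zs).2.
Qed.

Lemma Lop_bound : exists2 B : K, 0 <= B & forall G f, selfmap s0 r' G -> hardy R f ->
  hardy_norm R (Lop G f) <= B * hardy_norm R f.
Proof.
have [B B0 hB] := transfer_sup; exists (3 * B); first exact: mulr_ge0.
move=> G f hG hf; rewrite -mulrA.
exact: (hardy_ext R0 R1 r'0 r'R (transfer_thick hG (hardy_an hf)) (hB G f hG hf)).2.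
Qed.

Lemma Lop_sup_norm G f (M : K) : selfmap s0 r' G -> an R f ->
  (forall w, R <= cabs w <= R^-1 -> cabs (transfer s G f w) <= M) -> hardy_norm R (Lop G f) <= 3 * M.
Proof. by move=> hG af hM; exact: (hardy_ext R0 R1 r'0 r'R (transfer_thick hG af) hM).2. Qed.

Lemma restrict_ext F F' : (forall z, annulus R z -> F z = F' z) ->
  restrict_annulus R F = restrict_annulus R F'.
Proof.
move=> e; apply/funext => z; have [hz|hz] := pselect (annulus R z).
  by rewrite !restrictE// e.
by rewrite !restrict_out.
Qed.

Lemma restrictZ a F : restrict_annulus R (fun z => a * F z) = a *: restrict_annulus R F.
Proof.
apply/funext => z.
have -> : (a *: restrict_annulus R F) z = a * restrict_annulus R F z by [].
have [hz|hz] := pselect (annulus R z); first by rewrite !restrictE.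
by rewrite (restrict_out _ hz) (restrict_out _ hz) mulr0.
Qed.

Lemma Lop_lin G a f f' : selfmap s0 r' G -> hardy R f -> hardy R f' ->
  Lop G (a *: f + f') = a *: Lop G f + Lop G f'.
Proof.
move=> hG hf hf'; apply/funext => w.
have -> : (a *: Lop G f + Lop G f') w = a * Lop G f w + Lop G f' w by [].
have [hw|hw] := pselect (annulus R w); last by rewrite /Lop !(restrict_out _ hw) mulr0 addr0.
rewrite /Lop !(restrictE _ hw).
exact: (transfer_lin hrad a hG (hardy_an hf) (hardy_an hf') hw).
Qed.

Lemma Lop_comp G H f : selfmap s0 r' G -> selfmap s0 r' H -> hardy R f ->
  Lop H (Lop G f) = Lop (fun z => H (G z)) f.
Proof.
move=> hG hH hf; apply: restrict_ext => w hw.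
rewrite -(transfer_comp hrad hG hH (hardy_an hf) hw).
by apply: (eq_transfer hrad w) => // z hz; exact: restrictE.
Qed.

Lemma refl_restrict F z : annulus R z -> refl (restrict_annulus R F) z = refl F z.
Proof. by move=> hz; rewrite /refl restrictE//; exact: annulus_cinv. Qed.

Lemma pair_Lop G f h : selfmap s0 r' G -> hardy R f -> (forall z, cabs z < s0 -> hol h z) ->
  pair s (Lop G f) h = pair s f (fun z => h (G z)).
Proof.
move=> hG hf hh; rewrite -(pair_transfer hrad hG (hardy_an hf) hh).
apply: (eq_pair hrad) => // z zs; apply: restrictE; exact: (s_annulus hrad).
Qed.

Lemma refl_Lop G f z : selfmap s0 r' G -> an R f -> annulus R z ->
  refl (Lop G f) z = transfer s G (refl f) z.
Proof. by move=> hG af hz; rewrite refl_restrict// (refl_transfer hrad hG af hz). Qed.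

Lemma pair_refl_Lop G f h : selfmap s0 r' G -> hardy R f -> (forall z, cabs z < s0 -> hol h z) ->
  pair s (refl (Lop G f)) h = pair s (refl f) (fun z => h (G z)).
Proof.
move=> hG hf hh; have af := hardy_an hf.
rewrite -(pair_transfer hrad hG (an_refl hrad af) hh).
apply: (eq_pair hrad) => // z zs; apply: refl_Lop => //; exact: (s_annulus hrad).
Qed.

Lemma pair_hardy_le : exists2 A : K, 0 < A & forall f h (N : K), hardy R f ->
  (forall z, cabs z < s0 -> hol h z) -> (forall z, cabs z = s -> cabs (h z) <= N) ->
  cabs (pair s f h) <= A * hardy_norm R f * N /\
  cabs (pair s (refl f) h) <= A * hardy_norm R f * N.
Proof.
have [A A0 hA] := hardy_circ; exists (A + 1); first by rewrite ltr_wpDl.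
move=> f h N hf hh hN; have af := hardy_an hf; have ch := disc_cc hrad hh.
have le1 : A * hardy_norm R f <= (A + 1) * hardy_norm R f.
  by rewrite ler_wpM2r ?hardy_norm_ge0// lerDl.
split; [apply: (pair_le hrad (an_cc hrad af) ch _ hN)|apply: (pair_le hrad (an_cc hrad (an_refl hrad af)) ch _ hN)] => z zs.
  exact: le_trans (hA f hf z zs).1 le1.
exact: le_trans (hA f hf z zs).2 le1.
Qed.

Lemma refl_lin a f f' z : refl (a *: f + f') z = cbar a * refl f z + refl f' z.
Proof.
have e : (a *: f + f') (cinv z) = a * f (cinv z) + f' (cinv z) by [].
rewrite /refl e.
by rewrite cbarD (cbarM a) mulrDr [_ * (cbar a * _)]mulrCA.
Qed.

Lemma pair_one f : hardy R f -> cbar (pair s (refl f) (fun=> 1)) = pair s f (fun=> 1).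
Proof. by move=> hf; rewrite (pair1_refl hrad (hardy_an hf)) cbarK. Qed.

(** The operator is picked by choice among elements with prescribed values on C_1. By
    [identity_circle] these values determine the element, so it coincides with [Lop]. *)
Lemma perron_frobenius_spec (T : blaschke K) f : selfmap s0 r' (bl_fun T) -> hardy R f ->
  is_perron_frobenius R T f (Lop (bl_fun T) f) /\ perron_frobenius R T f = Lop (bl_fun T) f.
Proof.
move=> hT hf; have af := hardy_an hf.
have A1 z : cabs z = 1 -> annulus R z by rewrite /annulus /= => ->; rewrite R1 invf_gt1.
have P : is_perron_frobenius R T f (Lop (bl_fun T) f).
  split; first exact: Lop_hardy.
  move=> z z1; rewrite /Lop (restrictE _ (A1 z z1)).
  have H := transfer_fiber hrad hT af z1; exact: H.
split=> //; rewrite /perron_frobenius; case: xgetP => [g _ [hg gE]|/(_ _ P) //].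
apply/funext => w; have [hw|hw] := pselect (annulus R w); last first.
  by rewrite /Lop restrict_out//; case: hg => ->.
have hL := Lop_hardy hT hf; pose D z := g z - Lop (bl_fun T) f z.
suff : D w = 0 by move/eqP; rewrite subr_eq0 => /eqP.
apply: (@identity_circle _ D R R^-1 1); [exact: ltW| | | |exact: hw].
- by move=> z hz; apply: holB; [exact: (hardy_an hg hz)|exact: (hardy_an hL hz)].
- by rewrite R1 andTb invf_gt1.
- by move=> z z1; rewrite /D (gE z z1) (P.2 z z1); exact: subrr.
Qed.

End Operator.

(** * Slow and fast spaces along one orbit and their growth *)

Section Fibre.
Variables (K : realType) (R s s0 r' : K).
Local Notation C := (Cplx K).
Hypothesis hrad : [/\ 0 < r', r' < R, R < s, s < s0 & s0 < 1].
Implicit Types (f F h : C -> C) (z w : C) (g : nat -> C -> C) (x : C) (i j n : nat).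

Let r'0 : 0 < r'. Proof. by case: hrad. Qed.
Let r'R : r' < R. Proof. by case: hrad. Qed.
Let Rs : R < s. Proof. by case: hrad. Qed.
Let ss0 : s < s0. Proof. by case: hrad. Qed.
Let s01 : s0 < 1. Proof. by case: hrad. Qed.
Let R0 : 0 < R. Proof. exact: lt_trans r'R. Qed.
Let s_gt0 : 0 < s. Proof. exact: lt_trans Rs. Qed.
Let s1 : s < 1. Proof. exact: lt_trans s01. Qed.
Let R1 : R < 1. Proof. exact: lt_trans s1. Qed.
Let r's : r' < s. Proof. exact: lt_trans Rs. Qed.
Let r's0 : r' < s0. Proof. exact: lt_trans ss0. Qed.

Definition al g x i f : C := coef s g x i f.
(** [refl] is antilinear; the outer conjugate makes the functional linear again. *)
Definition be g x i f : C := cbar (coef s g x i (refl f)).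
Definition dual_coefs g x j : nat -> C :=
  xget (fun=> 0) [set c | c j = 1 /\ forall i, coef s g x i (polar x c j) = (i == j)%:R].
Definition vzero x := restrict_annulus R (equil x).
Definition vpole g x j := restrict_annulus R (polar x (dual_coefs g x j) j).
Definition vdual g x j := restrict_annulus R (refl (polar x (dual_coefs g x j) j)).
Definition slowsp g x := slow (vzero x) (vpole g x) (vdual g x).
Definition fastsp g x := fast R (al g x) (be g x).
(** The n-fold product of operators as a single one. The case n = 0 is separate because the identity
    does not map D_s0 into the disc of radius r', as [selfmap] demands. *)
Definition push g n f := if n is m.+1 then Lop R s (orb g m.+1) f else f.

Let coef_restrict g x i F : coef s g x i (restrict_annulus R F) = coef s g x i F.
Proof. by apply: (eq_coef hrad) => z zs; apply: restrictE; exact: (s_annulus hrad). Qed.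

Let coef_refl_restrict g x i F : coef s g x i (refl (restrict_annulus R F)) = coef s g x i (refl F).
Proof.
by apply: (eq_coef hrad) => z zs; apply: (refl_restrict hrad); exact: (s_annulus hrad).
Qed.

Lemma polar_thick x (c : nat -> C) j : cabs x <= r' -> thick r' (polar x c j).
Proof.
move=> xr z /andP[rz _]; apply: hol_sum => k _; apply: holM; first exact: hol_cst.
apply: pole_hol; rewrite subr_eq0; apply: contraTneq rz => ->.
by rewrite -leNgt.
Qed.

Lemma refl_polar x (c : nat -> C) j z : z != 0 ->
  refl (polar x c j) z = \sum_(1 <= k < j.+1) cbar (c k) * dual_pole x k z.
Proof.
move=> z0; rewrite /refl /polar cbar_sum mulr_sumr; apply: eq_big_nat => k /andP[k1 _].
by rewrite (cbarM (c k)) mulrCA -(refl_pole x k1 z0).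
Qed.

Lemma dual_sum_hol x (c : nat -> C) j z : cabs x <= r' -> cabs z < s0 ->
  hol (fun z => \sum_(1 <= k < j.+1) cbar (c k) * dual_pole x k z) z.
Proof.
move=> xr z0; apply: hol_sum => k _; apply: holM; first exact: hol_cst.
exact: (dual_pole_hol hrad xr).
Qed.

Lemma nat_bar (b : bool) : cbar (b%:R : C) = b%:R.
Proof. by case: b; [exact: cbar1|exact: cbar0]. Qed.

Section Regular.
Variables (g : nat -> C -> C) (x : C) (L : K).
Hypotheses (gS : selfmaps s0 r' g) (xr : cabs x <= r') (hL : regular g x L).

Lemma dual_coefsP j : (0 < j)%N -> dual_coefs g x j j = 1 /\
  forall i, coef s g x i (polar x (dual_coefs g x j) j) = (i == j)%:R.
Proof.
move=> j0; rewrite /dual_coefs; case: xgetP => [c _ //|/= h].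
have [c c1 c2] := polar_dual hrad gS xr hL j0; by case: (h c).
Qed.

Lemma al_lin i a f f' : hardy R f -> hardy R f' ->
  al g x i (a *: f + f') = a * al g x i f + al g x i f'.
Proof.
move=> hf hf'; rewrite /al -(coefD hrad gS xr hL i a (an_cc hrad (hardy_an hf)) (an_cc hrad (hardy_an hf'))).
exact: (eq_coef hrad).
Qed.

Lemma be_lin i a f f' : hardy R f -> hardy R f' ->
  be g x i (a *: f + f') = a * be g x i f + be g x i f'.
Proof.
move=> hf hf'; rewrite /be.
have c1 := an_cc hrad (an_refl hrad (hardy_an hf)).
have c2 := an_cc hrad (an_refl hrad (hardy_an hf')).
have -> : coef s g x i (refl (a *: f + f')) = cbar a * coef s g x i (refl f) + coef s g x i (refl f').
  rewrite -(coefD hrad gS xr hL i (cbar a) c1 c2); apply: (eq_coef hrad) => z _.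
  exact: refl_lin.
by rewrite cbarD (cbarM (cbar a)) cbarK.
Qed.

Lemma al_bnd i : exists2 A : K, 0 <= A &
  forall f, hardy R f -> cabs (al g x i f) <= A * hardy_norm R f.
Proof.
have [A A0 hA] := hardy_circ hrad; have [B B0 hB] := coef_bound hrad gS xr hL i.
exists (B * A); first exact: mulr_ge0.
move=> f hf; rewrite -mulrA; apply: hB; first exact: (an_cc hrad (hardy_an hf)).
by move=> z zs; exact: (hA f hf z zs).1.
Qed.

Lemma be_bnd i : exists2 A : K, 0 <= A &
  forall f, hardy R f -> cabs (be g x i f) <= A * hardy_norm R f.
Proof.
have [A A0 hA] := hardy_circ hrad; have [B B0 hB] := coef_bound hrad gS xr hL i.
exists (B * A); first exact: mulr_ge0.
move=> f hf; rewrite -mulrA /be cabs_bar.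
apply: hB; first exact: (an_cc hrad (an_refl hrad (hardy_an hf))).
by move=> z zs; exact: (hA f hf z zs).2.
Qed.

Lemma be0 f : hardy R f -> be g x 0 f = al g x 0 f.
Proof. by move=> hf; rewrite /be /al !(coef0 hrad) (pair_one hrad hf). Qed.

Lemma vzero_hardy : hardy R (vzero x).
Proof. by apply: (thick_hardy hrad) => z; exact: (equil_hol hrad gS xr). Qed.

Lemma vpole_hardy j : (0 < j)%N -> hardy R (vpole g x j).
Proof. by move=> _; apply: (thick_hardy hrad); exact: polar_thick. Qed.

Lemma vdual_hardy j : (0 < j)%N -> hardy R (vdual g x j).
Proof. by move=> _; apply: (thick_hardy hrad); apply: (thick_refl hrad); exact: polar_thick. Qed.

Lemma al_vzero i : al g x i (vzero x) = (i == 0%N)%:R.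
Proof.
rewrite /al /vzero coef_restrict; apply: (coef_eval hrad gS) => h hh.
exact: (pair_equil hrad xr).
Qed.

Lemma be_vzero i : be g x i (vzero x) = (i == 0%N)%:R.
Proof.
rewrite /be /vzero coef_refl_restrict.
have -> : coef s g x i (refl (equil x)) = coef s g x i (equil x).
  apply: (eq_coef hrad) => z zs; apply: (refl_equil hrad gS xr); apply: (annulus_radii hrad).
  exact: (s_annulus hrad).
rewrite (coef_eval hrad gS) ?nat_bar// => h hh; exact: (pair_equil hrad xr).
Qed.

Lemma al_vpole i j : (0 < j)%N -> al g x i (vpole g x j) = (i == j)%:R.
Proof. by move=> j0; rewrite /al /vpole coef_restrict (dual_coefsP j0).2. Qed.

Let circ_neq0 z : cabs z = s -> z != 0.
Proof. by move=> zs; rewrite -cabs_gt0 zs. Qed.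

Lemma be_vpole i j : (0 < j)%N -> be g x i (vpole g x j) = 0.
Proof.
move=> j0; rewrite /be /vpole coef_refl_restrict.
rewrite (@coef_disc _ _ _ _ _ hrad g x gS i _ (fun z => \sum_(1 <= k < j.+1) cbar (dual_coefs g x j k) * dual_pole x k z)) ?cbar0//.
  by move=> z z0; exact: dual_sum_hol.
by move=> z zs; apply: refl_polar; exact: circ_neq0.
Qed.

Lemma al_vdual i j : (0 < j)%N -> al g x i (vdual g x j) = 0.
Proof.
move=> j0; rewrite /al /vdual coef_restrict.
rewrite (@coef_disc _ _ _ _ _ hrad g x gS i _ (fun z => \sum_(1 <= k < j.+1) cbar (dual_coefs g x j k) * dual_pole x k z))//.
  by move=> z z0; exact: dual_sum_hol.
by move=> z zs; apply: refl_polar; exact: circ_neq0.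
Qed.

Lemma be_vdual i j : (0 < j)%N -> be g x i (vdual g x j) = (i == j)%:R.
Proof.
move=> j0; rewrite /be /vdual coef_refl_restrict.
have -> : coef s g x i (refl (refl (polar x (dual_coefs g x j) j))) = coef s g x i (polar x (dual_coefs g x j) j).
  by apply: (eq_coef hrad) => z zs; apply: reflK; exact: circ_neq0.
by rewrite (dual_coefsP j0).2 nat_bar.
Qed.

Lemma slowsp_subspace j : hardy_subspace R (slowsp g x j).
Proof. exact: (slow_subspace R0 R1 vzero_hardy vpole_hardy vdual_hardy). Qed.

Lemma slowsp_dim j : has_dim (slowsp g x j) (if j == 0%N then 1%N else 2%N).
Proof.
exact: (slow_dim R0 R1 al_lin be_lin vzero_hardy vpole_hardy vdual_hardy al_vzero be_vzero
  al_vpole be_vpole al_vdual be_vdual).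
Qed.

Lemma fastsp_subspace j : hardy_subspace R (fastsp g x j).
Proof. exact: (fast_subspace R0 R1 al_lin be_lin vzero_hardy). Qed.

Lemma fastsp_closed j : hardy_closed R (fastsp g x j).
Proof. exact: (fast_closed R0 R1 al_lin be_lin al_bnd be_bnd). Qed.

Lemma fibre_decomposition j : direct_decomposition R j (slowsp g x) (fastsp g x j).
Proof.
exact: (slow_fast_decomposition R0 R1 al_lin be_lin be0 vzero_hardy vpole_hardy vdual_hardy
  al_vzero be_vzero al_vpole be_vpole al_vdual be_vdual).
Qed.

Lemma fastsp_rate j f (e : K) : 0 < e -> fastsp g x j f -> exists2 A : K, 0 <= A &
  forall n, hardy_norm R (push g n f) <= A * expR (j.+1%:R * L + e) ^+ n.
Proof.
move=> e0 [hf f0]; have af := hardy_an hf.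
have h1 i : (i <= j)%N -> coef s g x i f = 0 by move=> ij; have [] := f0 i ij.
have h2 i : (i <= j)%N -> coef s g x i (refl f) = 0.
  by move=> ij; have [_ /eqP] := f0 i ij; rewrite cbar_eq0 => /eqP.
have [v hv hb] := transfer_decay hrad gS xr hL af h1 h2.
have [A A0 hA] := hv e e0.
exists (3 * A + hardy_norm R f); first by rewrite addr_ge0 ?mulr_ge0 ?hardy_norm_ge0.
case=> [|n].
  by rewrite expr0 mulr1 lerDr mulr_ge0.
apply: (@le_trans _ _ (3 * v n.+1)).
  by apply: (Lop_sup_norm hrad (orb_selfmap hrad n gS) af) => w; exact: hb.
apply: (@le_trans _ _ (3 * A * expR (j.+1%:R * L + e) ^+ n.+1)).
  by rewrite -mulrA ler_wpM2l// (le_trans (ler_norm _))// hA.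
by rewrite ler_wpM2r ?exprn_ge0 ?expR_ge0// lerDl hardy_norm_ge0.
Qed.

Lemma slowsp_off i j f : slowsp g x j f -> i <> j -> al g x i f = 0 /\ be g x i f = 0.
Proof.
exact: (slow_off R0 R1 al_lin be_lin vzero_hardy vpole_hardy vdual_hardy al_vzero be_vzero
  al_vpole be_vpole al_vdual be_vdual).
Qed.

Lemma slowsp_eq0 j f : slowsp g x j f -> al g x j f = 0 -> be g x j f = 0 -> f = 0.
Proof.
exact: (slow_eq0 R0 R1 al_lin be_lin vzero_hardy vpole_hardy vdual_hardy al_vzero be_vzero
  al_vpole be_vpole al_vdual be_vdual).
Qed.

(** For j > 0 biorthogonality puts the slow space of index j inside the fast space of index j - 1;
    for j = 0 the operators are uniformly bounded. *)
Lemma slowsp_upper j f (e : K) : 0 < e -> slowsp g x j f -> exists2 A : K, 0 <= A &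
  forall n, hardy_norm R (push g n f) <= A * expR (j%:R * L + e) ^+ n.
Proof.
move=> e0 fj; have hf : hardy R f by have [h _ _] := slowsp_subspace j; exact: h.
case: j fj => [|j] fj; last first.
  apply: (fastsp_rate e0); split=> // i ij; apply: (slowsp_off fj) => ie.
  by rewrite ie ltnn in ij.
have [B B0 hB] := Lop_bound hrad.
have n0 := hardy_norm_ge0 R f.
exists ((B + 1) * hardy_norm R f); first by rewrite mulr_ge0// addr_ge0.
move=> n; rewrite mul0r add0r; apply: (@le_trans _ _ ((B + 1) * hardy_norm R f)).
  rewrite mulrDl mul1r; case: n => [|n]; first by rewrite lerDr mulr_ge0.
  by apply: le_trans (hB _ f (orb_selfmap hrad n gS) hf) _; rewrite lerDl.
by rewrite ler_peMr ?mulr_ge0 ?addr_ge0// exprn_ege1// -expR0 ler_expR ltW.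
Qed.

Lemma moment_push i n f : hardy R f ->
  pair s (push g n f) (fun z => (z - orb g n x) ^+ i) = moment s g x i n f /\
  pair s (refl (push g n f)) (fun z => (z - orb g n x) ^+ i) = moment s g x i n (refl f).
Proof.
move=> hf; case: n => [//|n].
have hh z : cabs z < s0 -> hol (fun z => (z - orb g n.+1 x) ^+ i) z.
  by move=> _; apply: holX; apply: holB; [exact: hol_id|exact: hol_cst].
by split; [rewrite (pair_Lop hrad (orb_selfmap hrad n gS) hf hh)
          |rewrite (pair_refl_Lop hrad (orb_selfmap hrad n gS) hf hh)].
Qed.

Lemma push_hardy n f : hardy R f -> hardy R (push g n f).
Proof. by case: n => [//|n] hf; exact: (Lop_hardy hrad (orb_selfmap hrad n gS)). Qed.

(** A moment is at most a constant times the norm of the image, and with a nonzero coefficient it is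
    comparable with |mult_prod n|^j. The function f1 is later f or its reflection. *)
Lemma coef_lower j f f1 (e : K) : 0 < e -> circ_cont s f1 -> coef s g x j f1 != 0 -> hardy R f ->
  (exists2 B : K, 0 < B & forall n, cabs (moment s g x j n f1) <= B * hardy_norm R (push g n f)) ->
  exists2 A : K, 0 < A & \forall n \near \oo, A * expR (j%:R * L - e) ^+ n <= hardy_norm R (push g n f).
Proof.
move=> e0 cf a0 hf [B B0 hB]; set a := coef _ _ _ _ _ in a0.
have ap : 0 < cabs a by rewrite cabs_gt0.
have a2 : 0 < cabs a / 2 by rewrite divr_gt0.
have [_ _ _ h2] := hL; have [D D0 hD] := rateX j h2 e0.
have D1 : 0 < D + 1 by rewrite ltr_wpDl.
exists (cabs a / 2 / B / (D + 1)); first by rewrite !divr_gt0.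
have cv := @coefP _ _ _ _ _ hrad _ _ gS xr _ hL j f1 cf.
have [N _ hN] := (cvg_cabs_lt _ _).1 cv _ a2.
exists N => // n /hN; rewrite -/a => hn.
have p0 : 0 < cabs (mult_prod g x n) by rewrite cabs_gt0; exact: mult_prod_neq0 hL.
have hr : cabs a / 2 <= cabs (ratio s g x j f1 n).
  have := cabs_sub_ge a (a - ratio s g x j f1 n); rewrite subKr.
  by rewrite [cabs (a - _)]cabsBC; lra.
have hm : cabs a / 2 * cabs (mult_prod g x n) ^+ j <= B * hardy_norm R (push g n f).
  apply: le_trans (hB n); move: hr; rewrite /ratio cabsM cabsV cabsX.
  by rewrite ler_pdivlMr// exprn_gt0.
have hp : expR (j%:R * L - e) ^+ n <= (D + 1) * cabs (mult_prod g x n) ^+ j.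
  have := hD n; rewrite ger0_norm ?exprn_ge0 ?invr_ge0 ?(ltW p0)// => h.
  have e1 : expR (j%:R * - L + e) = (expR (j%:R * L - e))^-1.
    by rewrite -expRN opprB mulrN addrC.
  move: h; rewrite e1 !exprVn ler_pdivlMr ?exprn_gt0 ?expR_gt0// mulrC ler_pdivrMr ?exprn_gt0//.
  move=> /le_trans; apply; rewrite ler_wpM2r ?exprn_ge0 ?(ltW p0)// lerDl//.
have q0 : 0 <= cabs a / 2 / B / (D + 1) by rewrite ltW// !divr_gt0.
apply: le_trans (ler_wpM2l q0 hp) _.
have -> : cabs a / 2 / B / (D + 1) * ((D + 1) * cabs (mult_prod g x n) ^+ j) =
    cabs a / 2 * cabs (mult_prod g x n) ^+ j / B by field; rewrite !gt_eqF.
by rewrite ler_pdivrMr// [leRHS]mulrC.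
Qed.

Lemma moment_push_le j f : hardy R f -> exists2 B : K, 0 < B & forall n,
  cabs (moment s g x j n f) <= B * hardy_norm R (push g n f) /\
  cabs (moment s g x j n (refl f)) <= B * hardy_norm R (push g n f).
Proof.
move=> hf; have [A A0 hA] := pair_hardy_le hrad.
exists (A * 2 ^+ j); first by rewrite mulr_gt0// exprn_gt0.
move=> n; have [<- <-] := moment_push j n hf.
have yr : cabs (orb g n x) <= r' by exact: (orb_le hrad n gS (lexx _) r's0 xr).
have -> : A * 2 ^+ j * hardy_norm R (push g n f) = A * hardy_norm R (push g n f) * 2 ^+ j by ring.
apply: hA; first exact: push_hardy.
  by move=> z _; apply: holX; apply: holB; [exact: hol_id|exact: hol_cst].
move=> z zs; rewrite cabsX lerXn2r ?nnegrE ?cabs_ge0//.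
by apply: le_trans (cabsB _ _) _; rewrite zs; have := s1; have := r's; lra.
Qed.

Lemma slowsp_lower j f (e : K) : 0 < e -> slowsp g x j f -> f <> 0 ->
  exists2 A : K, 0 < A & \forall n \near \oo, A * expR (j%:R * L - e) ^+ n <= hardy_norm R (push g n f).
Proof.
move=> e0 fj fn0; have hf : hardy R f by have [h _ _] := slowsp_subspace j; exact: h.
have af := hardy_an hf; have [B B0 hB] := moment_push_le j hf.
have [a0|a0] := eqVneq (al g x j f) 0; last first.
  apply: (coef_lower e0 (an_cc hrad af) a0 hf).
  by exists B => // n; exact: (hB n).1.
have [b0|b0] := eqVneq (be g x j f) 0; first by case: fn0; exact: (slowsp_eq0 fj).
apply: (coef_lower e0 (an_cc hrad (an_refl hrad af)) _ hf).
  by move: b0; rewrite /be cbar_eq0.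
by exists B => // n; exact: (hB n).2.
Qed.

Lemma slowsp_growth j f : slowsp g x j f -> f <> 0 ->
  (n%:R^-1%:E * lne (hardy_norm R (push g n f))%:E)%E @[n --> \oo] --> (j%:R * L)%:E.
Proof.
move=> fj fn0; apply: (@scaled_log_cvg _ (fun n => (hardy_norm R (push g n f))%:E)).
- by move=> n; rewrite lee_fin hardy_norm_ge0.
- move=> e e0; have [A A0 hA] := slowsp_upper e0 fj; exists (A + 1); first by rewrite ltr_wpDl.
  move=> n; rewrite lee_fin; apply: le_trans (hA n) _.
  by rewrite ler_wpM2r ?exprn_ge0 ?expR_ge0// lerDl.
- move=> e e0; have [A A0 hA] := slowsp_lower e0 fj fn0; by exists A.
Qed.

Lemma fastsp_growth j f : fastsp g x j f ->
  (limn_esup (fun n => n%:R^-1%:E * lne (hardy_norm R (push g n f))%:E) <= (j.+1%:R * L)%:E)%E.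
Proof.
move=> fj; apply: (@scaled_log_limsup _ (fun n => (hardy_norm R (push g n f))%:E)).
  by move=> n; rewrite lee_fin hardy_norm_ge0.
move=> e e0; have [A A0 hA] := fastsp_rate e0 fj; by exists A.
Qed.

End Regular.

Lemma Lop_vzero g x : selfmaps s0 r' g -> cabs x <= r' ->
  Lop R s (g 0%N) (vzero x) = vzero (g 0%N x).
Proof.
move=> gS xr; apply: (restrict_ext) => w hw.
transitivity (transfer s (g 0%N) (equil x) w); last exact: (transfer_equil hrad gS xr hw).
by apply: (eq_transfer hrad w) => // z hz; exact: restrictE.
Qed.

Section Shift.
Variables (g : nat -> C -> C) (x : C) (L : K).
Hypotheses (gS : selfmaps s0 r' g) (xr : cabs x <= r') (hL : regular g x L).
Local Notation g' := (fun n => g n.+1).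
Local Notation x' := (g 0%N x).

Let gS' : selfmaps s0 r' g'. Proof. exact: selfmaps_shift. Qed.
Let x'r : cabs x' <= r'. Proof. by apply: (gS 0%N _).2; exact: le_lt_trans r's0. Qed.
Let hL' : regular g' x' L. Proof. exact: (regular_shift hL). Qed.

Lemma al_Lop i f : hardy R f -> al g' x' i (Lop R s (g 0%N) f) = mult g x 0 ^+ i * al g x i f.
Proof.
move=> hf; rewrite /al /Lop coef_restrict; exact: (coef_shift hrad gS xr i hL (hardy_an hf)).
Qed.

Lemma be_Lop i f : hardy R f ->
  be g' x' i (Lop R s (g 0%N) f) = cbar (mult g x 0 ^+ i) * be g x i f.
Proof.
move=> hf; have af := hardy_an hf; rewrite /be -(cbarM (mult g x 0 ^+ i)).
have -> : coef s g' x' i (refl (Lop R s (g 0%N) f)) = coef s g' x' i (transfer s (g 0%N) (refl f)).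
  by apply: (eq_coef hrad) => z zs; apply: (refl_Lop hrad (gS 0%N) af); exact: (s_annulus hrad).
by rewrite (coef_shift hrad gS xr i hL (an_refl hrad af)).
Qed.

Lemma fastsp_image j : Lop R s (g 0%N) @` fastsp g x j `<=` fastsp g' x' j.
Proof.
move=> _ [f [hf f0] <-]; split; first exact: (Lop_hardy hrad (gS 0%N)).
by move=> i ij; have [a0 b0] := f0 i ij; rewrite (al_Lop i hf) (be_Lop i hf) a0 b0 !mulr0.
Qed.

Lemma polar_lin (c1 c2 : nat -> C) b j z :
  polar x' (fun k => c1 k - b * c2 k) j z = polar x' c1 j z - b * polar x' c2 j z.
Proof.
rewrite /polar mulr_sumr -sumrB; apply: eq_bigr => k _.
by rewrite mulrBl mulrA.
Qed.

(** Both sides are polar functions at the image point with the same coefficients 1 to j, by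
    [transfer_polar] and [coef_shift]; [polar_eq0] says that these determine a polar function. *)
Lemma transfer_dual j w : (0 < j)%N -> annulus R w ->
  transfer s (g 0%N) (polar x (dual_coefs g x j) j) w =
  mult g x 0 ^+ j * polar x' (dual_coefs g' x' j) j w.
Proof.
move=> j0 hw; have [c' hc'] := transfer_polar hrad gS xr (dual_coefs g x j) j.
set b := mult g x 0 ^+ j; set c2 := dual_coefs g' x' j.
have ap := polar_an hrad xr (dual_coefs g x j) j.
have cc c := polar_cc hrad x'r c j.
have h i : (0 < i <= j)%N -> coef s g' x' i (polar x' (fun k => c' k - b * c2 k) j) = 0.
  move=> ij; have -> : coef s g' x' i (polar x' (fun k => c' k - b * c2 k) j) =
      coef s g' x' i (fun z => - b * polar x' c2 j z + polar x' c' j z).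
    by apply: (eq_coef hrad) => z _; rewrite polar_lin mulNr addrC.
  rewrite (coefD hrad gS' x'r hL' i (- b) (cc c2) (cc c')).
  have -> : coef s g' x' i (polar x' c' j) = coef s g' x' i (transfer s (g 0%N) (polar x (dual_coefs g x j) j)).
    by apply: (eq_coef hrad) => z zs; rewrite hc'//; exact: (s_annulus hrad).
  rewrite (coef_shift hrad gS xr i hL ap) (dual_coefsP gS xr hL j0).2 (dual_coefsP gS' x'r hL' j0).2.
  case: eqP => [->|_]; last by rewrite !mulr0 addr0.
  by rewrite !mulr1 addNr.
have z0 := polar_eq0 hrad gS' x'r hL' h.
rewrite hc'//; apply/eqP; rewrite -subr_eq0 -polar_lin; apply/eqP.
by rewrite /polar big_nat big1// => k kj; rewrite z0 ?mul0r.
Qed.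

Lemma Lop_vpole j : (0 < j)%N ->
  Lop R s (g 0%N) (vpole g x j) = mult g x 0 ^+ j *: vpole g' x' j.
Proof.
move=> j0; rewrite -restrictZ; apply: restrict_ext => w hw; rewrite -(transfer_dual j0 hw).
by apply: (eq_transfer hrad w) => // z hz; exact: restrictE.
Qed.

Lemma Lop_vdual j : (0 < j)%N ->
  Lop R s (g 0%N) (vdual g x j) = cbar (mult g x 0 ^+ j) *: vdual g' x' j.
Proof.
move=> j0; rewrite -restrictZ; apply: restrict_ext => w hw.
set F := polar x (dual_coefs g x j) j; have aF : an R F := polar_an hrad xr _ j.
have -> : transfer s (g 0%N) (vdual g x j) w = transfer s (g 0%N) (refl F) w.
  by apply: (eq_transfer hrad w) => // z hz; exact: restrictE.
rewrite -(refl_transfer hrad (gS 0%N) aF hw) /refl (transfer_dual j0 (annulus_cinv R0 hw)).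
by rewrite (cbarM (mult g x 0 ^+ j)) mulrCA.
Qed.

Lemma slowsp_image j : Lop R s (g 0%N) @` slowsp g x j = slowsp g' x' j.
Proof.
have t0 : mult g x 0 != 0 by case: hL.
have tj : mult g x 0 ^+ j != 0 by exact: expf_neq0.
have hv := vzero_hardy gS xr.
have img a b : Lop R s (g 0%N) (if j == 0%N then a *: vzero x else a *: vpole g x j + b *: vdual g x j) =
   if j == 0%N then a *: vzero x' else (a * mult g x 0 ^+ j) *: vpole g' x' j
     + (b * cbar (mult g x 0 ^+ j)) *: vdual g' x' j.
  have Z c f : hardy R f -> Lop R s (g 0%N) (c *: f) = c *: Lop R s (g 0%N) f.
    move=> hf; have hf0 := hardyZ R0 R1 hv 0 hf; rewrite scale0r in hf0.
    have e := Lop_lin hrad (-1) (gS 0%N) hf0 hf0; rewrite scaler0 addr0 in e.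
    have {}e : Lop R s (g 0%N) 0 = 0 by rewrite e scaleN1r addNr.
    by have := Lop_lin hrad c (gS 0%N) hf hf0; rewrite e !addr0.
  case: eqP => [_|/eqP]; first by rewrite Z// Lop_vzero.
  rewrite -lt0n => j0; have h1 := vpole_hardy g xr j0; have h2 := vdual_hardy g xr j0.
  have h2' := hardyZ R0 R1 hv b h2.
  rewrite (Lop_lin hrad a (gS 0%N) h1 h2') Z// Lop_vpole// Lop_vdual//.
  by rewrite !scalerA.
apply/seteqP; split=> [_ [f /slowP[a [b ->]] <-]|f /slowP[a [b ->]]].
  apply/slowP; rewrite img.
  exists (if j == 0%N then a else a * mult g x 0 ^+ j), (b * cbar (mult g x 0 ^+ j)).
  by case: eqP.
exists (if j == 0%N then a *: vzero x else (a / mult g x 0 ^+ j) *: vpole g x j +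
   (b / cbar (mult g x 0 ^+ j)) *: vdual g x j).
  by apply/slowP; case: eqP => _; [exists a, 0|exists (a / mult g x 0 ^+ j), (b / cbar (mult g x 0 ^+ j))].
have := img (if j == 0%N then a else a / mult g x 0 ^+ j) (b / cbar (mult g x 0 ^+ j)).
case: eqP => // _ ->; rewrite !divfK// cbar_eq0//.
Qed.

End Shift.
End Fibre.

(** * Limits of bounded sequences along an ultrafilter *)

Section UltraLimits.
Variable K : realType.
Local Notation C := (Cplx K).
Implicit Types (u : nat -> C -> C) (f : C -> C) (z w : C).

Lemma ultra_lim_real (U : set_system nat) (a : nat -> K) (M : K) : UltraFilter U ->
  (forall n, `|a n| <= M) -> exists l : K, a @ U --> l.
Proof.
move=> UU aM; have PU : ProperFilter U by case: UU.
have PF : ProperFilter (a @ U) by exact: fmap_proper_filter.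
have [|p [_ clp]] := @segment_compact K (- M) M (a @ U) PF.
  by rewrite /fmap /=; apply: filterE => n /=; rewrite in_itv /= -ler_norml.
exists p => B Bp; rewrite /fmap /=.
case: (in_ultra_setVsetC (a @^-1` B) UU) => // h.
have hB : (a @ U) (~` B) by [].
by have [y [nB yB]] := clp _ _ hB Bp.
Qed.

Lemma ultra_lim (U : set_system nat) (a : nat -> C) (M : K) : UltraFilter U ->
  (forall n, cabs (a n) <= M) -> exists l : C, a @ U --> l.
Proof.
move=> UU aM; have PU : ProperFilter U by case: UU.
have [x hx] := @ultra_lim_real U (fun n => complex.Re (a n)) M UU
  (fun n => le_trans (re_le_cabs _) (aM n)).
have [y hy] := @ultra_lim_real U (fun n => complex.Im (a n)) M UU
  (fun n => le_trans (im_le_cabs _) (aM n)).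
by exists (Complex x y); apply/cvg_reim.
Qed.

Lemma ultra_le (U : set_system nat) (a : nat -> C) (l c : C) (M : K) : UltraFilter U ->
  a @ U --> l -> (forall n, cabs (a n - c) <= M) -> cabs (l - c) <= M.
Proof.
move=> UU /cvg_cabs_lt h aM; have PU : ProperFilter U by case: UU.
apply/ler_addgt0Pr => e e0; have [n hn] := filter_ex (h e e0).
have -> : l - c = (a n - c) - (a n - l) by ring.
apply: le_trans (cabsB _ _) _; have := aM n; lra.
Qed.

(* Otherwise, bad points z_n would converge along the ultrafilter, and the Lipschitz bound would
   contradict the convergence at their limit. *)
Lemma ultra_uniform (U : set_system nat) u f (s B e : K) : UltraFilter U -> 0 < e ->
  (forall n z z', cabs z = s -> cabs z' = s -> cabs (u n z - u n z') <= B * cabs (z - z')) ->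
  (forall z, cabs z = s -> (fun n => u n z) @ U --> f z) ->
  \forall n \near U, forall z, cabs z = s -> cabs (u n z - f z) <= e.
Proof.
move=> UU e0 lip cv; have PU : ProperFilter U by case: UU.
set S := fun n => forall z, cabs z = s -> cabs (u n z - f z) <= e.
case: (in_ultra_setVsetC [set n | S n] UU) => [hS|nS]; first exact: hS.
have [[z0 z0s]|no] := pselect (exists z0 : C, cabs z0 = s); last first.
  have allS n : S n by move=> z zs; case: no; exists z.
  by apply: (@filterE _ U _ S).
have /choice[z hz] n : exists z : C, cabs z = s /\ (~ S n -> e < cabs (u n z - f z)).
  have [h|/existsNP[z /not_implyP[zs /negP]]] := pselect (S n); first by exists z0.
  by rewrite -ltNge => h; exists z.
have B0 : 0 <= `|B| by [].
have [zl hzl] := @ultra_lim U z s UU (fun n => eq_ind_r (fun x => x <= s) (lexx s) (hz n).1).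
have zls : cabs zl = s.
  apply/eqP; rewrite -subr_eq0 -normr_le0; apply/ler_addgt0Pr => d d0; rewrite add0r.
  have [n hn] := filter_ex ((cvg_cabs_lt _ _).1 hzl d d0).
  rewrite ler_norml; have := cabs_sub_ge (z n) zl; have := cabs_sub_ge zl (z n).
  by rewrite [cabs (zl - _)]cabsBC (hz n).1; lra.
have flip : forall n, cabs (f (z n) - f zl) <= B * cabs (z n - zl).
  move=> n; have h1 := cv _ (hz n).1; have h2 := cv _ zls.
  have h3 : (fun m => u m (z n) - u m zl) @ U --> f (z n) - f zl by apply: (cvgB h1 h2).
  rewrite -[X in cabs X]subr0; apply: (ultra_le UU h3) => m; rewrite subr0.
  by apply: lip; [exact: (hz n).1|].
have d0 : 0 < e / (4 * (`|B| + 1)) by rewrite divr_gt0// mulr_gt0// ltr_wpDl.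
have e20 : 0 < e / 4 by rewrite divr_gt0.
have c1 : \forall n \near U, cabs (z n - zl) < e / (4 * (`|B| + 1)).
  by apply: ((cvg_cabs_lt _ _).1 hzl).
have c2 : \forall n \near U, cabs (u n zl - f zl) < e / 4.
  by apply: ((cvg_cabs_lt _ _).1 (cv _ zls)).
have [n [[h1 h2] h3]] := filter_ex (filterI (filterI c1 c2) nS).
have := (hz n).2 h3.
have -> : u n (z n) - f (z n) = (u n (z n) - u n zl) + (u n zl - f zl) - (f (z n) - f zl) by ring.
have k1 := lip n _ _ (hz n).1 zls; have k2 := flip n.
have k3 : B * cabs (z n - zl) <= e / 4.
  apply: (@le_trans _ _ ((`|B| + 1) * cabs (z n - zl))).
    by rewrite ler_wpM2r ?cabs_ge0// (le_trans (ler_norm _))// lerDl.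
  rewrite mulrC -ler_pdivlMr ?ltr_wpDl//; apply: le_trans (ltW h1) _.
  by rewrite invfM mulrA.
move=> h; exfalso; have := cabsB ((u n (z n) - u n zl) + (u n zl - f zl)) (f (z n) - f zl).
have := cabsD (u n (z n) - u n zl) (u n zl - f zl); lra.
Qed.

End UltraLimits.

(** * Compactness of the operator *)

Section Compactness.
Variables (K : realType) (R s s0 r' : K).
Local Notation C := (Cplx K).
Hypothesis hrad : [/\ 0 < r', r' < R, R < s, s < s0 & s0 < 1].
Implicit Types (f h : C -> C) (G : C -> C) (z w : C).

Let r'0 : 0 < r'. Proof. by case: hrad. Qed.
Let r'R : r' < R. Proof. by case: hrad. Qed.
Let Rs : R < s. Proof. by case: hrad. Qed.
Let ss0 : s < s0. Proof. by case: hrad. Qed.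
Let s01 : s0 < 1. Proof. by case: hrad. Qed.
Let R0 : 0 < R. Proof. exact: lt_trans r'R. Qed.
Let s_gt0 : 0 < s. Proof. exact: lt_trans Rs. Qed.
Let s1 : s < 1. Proof. exact: lt_trans s01. Qed.
Let R1 : R < 1. Proof. exact: lt_trans s1. Qed.
Let sV : s < s^-1. Proof. by rewrite (lt_trans s1)// invf_gt1. Qed.

(** Radii R < c1 < a1 < s: bounds on the circles of radius c1 and 1/c1 give a Lipschitz bound on a1
    <= |z| <= 1/a1, a set that contains C_s and is stable under reflection. *)
Let c1 := (R + s) / 2.
Let a1 := (c1 + s) / 2.
Let R_c1 : R < c1. Proof. by rewrite /c1; have := Rs; lra. Qed.
Let c1_a1 : c1 < a1. Proof. by rewrite /a1 /c1; have := Rs; lra. Qed.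
Let a1_s : a1 < s. Proof. by rewrite /a1 /c1; have := Rs; lra. Qed.
Let c10 : 0 < c1. Proof. exact: lt_trans R_c1. Qed.
Let a10 : 0 < a1. Proof. exact: lt_trans c1_a1. Qed.
Let c1R : c1^-1 < R^-1. Proof. by rewrite ltf_pV2 ?posrE. Qed.
Let a1c : a1^-1 < c1^-1. Proof. by rewrite ltf_pV2 ?posrE. Qed.
Let c1c1 : c1 < c1^-1.
Proof. by rewrite (lt_trans c1_a1)// (lt_trans a1_s)// (lt_trans sV)// ltf_pV2 ?posrE// (lt_trans c1_a1). Qed.

Definition lip_cst : K := c1^-1 / ((c1^-1 - a1^-1) * (c1^-1 - a1^-1)) + c1 / ((a1 - c1) * (a1 - c1)).

Lemma an_lipschitz f (M : K) z z' : an R f -> 0 <= M ->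
  (forall x, cabs x = c1 -> cabs (f x) <= M) -> (forall x, cabs x = c1^-1 -> cabs (f x) <= M) ->
  a1 <= cabs z <= a1^-1 -> a1 <= cabs z' <= a1^-1 ->
  cabs (f z - f z') <= lip_cst * M * cabs (z - z').
Proof.
move=> af M0 M1 M2 hz hz'.
have cf (c : K) : R < c < R^-1 -> circ_cont c f.
  by move=> hc; apply: cc_hol => x xc; apply: af; rewrite /annulus /= xc.
have hc1 : R < c1 < R^-1 by rewrite R_c1 (lt_trans c1c1).
have hc2 : R < c1^-1 < R^-1 by rewrite c1R andbT (lt_trans R_c1).
have rep x : a1 <= cabs x <= a1^-1 -> f x = cmean c1^-1 (fun y => y * f y / (y - x)) -
    cmean c1 (fun y => y * f y / (y - x)).
  move=> /andP[h1 h2]; apply: (@cauchy_annulus _ f R R^-1 x c1 c1^-1 (ltW R0)) => //.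
  - exact: lt_le_trans h1.
  - exact: le_lt_trans a1c.
have bd (c d : K) : 0 < c -> R < c < R^-1 -> 0 < d -> (forall x, cabs x = c -> cabs (f x) <= M) ->
    (forall y x, cabs x = c -> a1 <= cabs y <= a1^-1 -> d <= cabs (x - y)) ->
    cabs (cmean c (fun y => y * f y / (y - z)) - cmean c (fun y => y * f y / (y - z'))) <=
    c / (d * d) * M * cabs (z - z').
  move=> c0 hc d0 hM hd.
  have nz y : a1 <= cabs y <= a1^-1 -> cabs y != c.
    move=> hy; apply/eqP => yc; have := hd y y yc hy.
    by rewrite subrr cabs0 leNgt d0.
  have cc y : a1 <= cabs y <= a1^-1 -> circ_cont c (fun x => x * f x / (x - y)).
    by move=> hy; exact: (ccM (ccM (cc_id c) (cf c hc)) (cc_kernel (nz y hy))).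
  rewrite -(cmeanB (ltW c0) (cc z hz) (cc z' hz')); apply: (cmean_le (ltW c0)).
    exact: (ccB (cc z hz) (cc z' hz')).
  move=> x xc; have n1 := lt_le_trans d0 (hd z x xc hz); have n2 := lt_le_trans d0 (hd z' x xc hz').
  have -> : x * f x / (x - z) - x * f x / (x - z') = x * f x * (z - z') / ((x - z) * (x - z')).
    by field; rewrite -!cabs_gt0 n1 n2.
  rewrite !cabsM cabsV cabsM xc.
  have -> : c / (d * d) * M * cabs (z - z') = c * M * cabs (z - z') * (d * d)^-1 by ring.
  have cM0 : 0 <= c * cabs (f x) * cabs (z - z') by rewrite !mulr_ge0 ?cabs_ge0 ?ltW.
  apply: ler_pM => //; first by rewrite invr_ge0 mulr_ge0 ?cabs_ge0.
    by rewrite ler_wpM2r ?cabs_ge0// ler_wpM2l ?(ltW c0)// hM.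
  rewrite lef_pV2 ?posrE ?mulr_gt0//; apply: ler_pM; rewrite ?(ltW d0)//; exact: hd.
have d1 : 0 < a1 - c1 by rewrite subr_gt0.
have d2 : 0 < c1^-1 - a1^-1 by rewrite subr_gt0.
have c1V : 0 < c1^-1 by rewrite invr_gt0.
have b1 := bd c1 (a1 - c1) c10 hc1 d1 M1.
have b2 := bd c1^-1 (c1^-1 - a1^-1) c1V hc2 d2 M2.
rewrite (rep z hz) (rep z' hz').
set A := cmean _ _ in b2 *; set B := cmean _ _ in b1 *; set A' := cmean _ _ in b2 *; set B' := cmean _ _ in b1 *.
have -> : A - B - (A' - B') = (A - A') - (B - B') by ring.
apply: le_trans (cabsB _ _) _; rewrite /lip_cst -mulrA mulrDl !mulrA; apply: lerD.
  apply: b2 => y x xc /andP[_ ya]; apply: le_trans (cabs_sub_ge _ _); rewrite xc; exact: lerB.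
apply: b1 => y x xc /andP[ya _]; rewrite cabsBC; apply: le_trans (cabs_sub_ge _ _).
by rewrite xc; exact: lerB.
Qed.

Lemma hardy_circles : exists2 A : K, 0 <= A & forall f, hardy R f ->
  (forall z, cabs z = c1 \/ cabs z = c1^-1 -> cabs (f z) <= A * hardy_norm R f) /\
  (forall z, cabs z = c1 \/ cabs z = c1^-1 -> cabs (refl f z) <= A * hardy_norm R f).
Proof.
have hc1 : R < c1 < R^-1 by rewrite R_c1 (lt_trans c1c1).
have hc2 : R < c1^-1 < R^-1 by rewrite c1R andbT (lt_trans R_c1).
have [A A0 hA] := hardy_sup R0 hc1; have [B B0 hB] := hardy_sup R0 hc2.
have q0 : 0 <= c1^-1 ^+ 2 by exact: sqr_ge0.
have AB0 : 0 <= A + B by exact: addr_ge0.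
exists ((1 + c1^-1 ^+ 2) * (A + B)); first by rewrite mulr_ge0// addr_ge0.
move=> f hf; have n0 := hardy_norm_ge0 R f.
have h z : cabs z = c1 \/ cabs z = c1^-1 -> cabs (f z) <= (A + B) * hardy_norm R f.
  case=> zc; first by apply: le_trans (hA f hf z zc) _; rewrite ler_wpM2r// lerDl.
  by apply: le_trans (hB f hf z zc) _; rewrite ler_wpM2r// lerDr.
have m0 : 0 <= (A + B) * hardy_norm R f by exact: mulr_ge0.
split=> z hz; first by apply: le_trans (h z hz) _; rewrite -mulrA; apply: ler_peMl => //; rewrite lerDl.
rewrite -mulrA cabsM cabs_bar cabsX cabsV.
have hz' : cabs (cinv z) = c1 \/ cabs (cinv z) = c1^-1.
  by rewrite cabs_cinv; case: hz => ->; [right|left; rewrite invrK].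
apply: ler_pM; rewrite ?cabs_ge0 ?h// ?exprn_ge0 ?invr_ge0 ?cabs_ge0//.
apply: (@le_trans _ _ (c1^-1 ^+ 2)); last by rewrite lerDr.
rewrite lerXn2r ?nnegrE ?invr_ge0 ?cabs_ge0 ?(ltW c10)// lef_pV2 ?posrE//.
  by case: hz => -> //; exact: ltW.
by case: hz => -> //; rewrite invr_gt0.
Qed.

Lemma transfer_close G f f' (e : K) w : selfmap s0 r' G -> circ_cont s f -> circ_cont s f' ->
  circ_cont s (refl f) -> circ_cont s (refl f') ->
  (forall z, cabs z = s -> cabs (f z - f' z) <= e) ->
  (forall z, cabs z = s -> cabs (refl f z - refl f' z) <= e) -> R <= cabs w <= R^-1 ->
  cabs (transfer s G f w - transfer s G f' w) <= ((R - r')^-1 + (1 - r' / R)^-1) * e.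
Proof.
move=> hG cf cf' crf crf' h1 h2 /andP[Rw wR].
have rw : r' < cabs w := lt_le_trans r'R Rw.
have wr : cabs w < r'^-1 by rewrite (le_lt_trans wR)// ltf_pV2 ?posrE.
have ck := inner_kernel_cc hrad hG rw; have co := outer_kernel_cc hrad hG wr.
have cm (h : C -> C) : circ_cont s h -> circ_cont s (fun z => -1 * h z) := fun ch => ccM (cc_cst s (-1)) ch.
have lin h h' k : circ_cont s h -> circ_cont s h' -> circ_cont s k ->
    pair s h k - pair s h' k = pair s (fun z => h z + -1 * h' z) k.
  by move=> ch ch' hk; rewrite (pairD hrad ch (cm h' ch') hk) (pairZ hrad (-1) ch' hk) mulN1r.
have -> : transfer s G f w - transfer s G f' w =
  inner_op s G (fun z => f z + -1 * f' z) w +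
  cbar (pair s (fun z => refl f z + -1 * refl f' z) (fun z => G z / (1 - cbar w * G z))).
  rewrite /inner_op -(lin _ _ _ cf cf' ck) -(lin _ _ _ crf crf' co) cbarB.
  by rewrite /transfer /inner_op /outer_op; ring.
apply: le_trans (cabsD _ _) _; rewrite mulrDl; apply: lerD.
  rewrite mulrC; apply: (inner_le hrad hG (ccD cf (cm f' cf'))) => // z zs.
  by rewrite mulN1r h1.
rewrite cabs_bar mulrC.
have d0 : 0 < 1 - r' / R by rewrite subr_gt0 ltr_pdivrMr// mul1r.
apply: (pair_le hrad (ccD crf (cm _ crf')) co) => z zs.
  by rewrite mulN1r h2.
have z0 : cabs z < s0 by rewrite zs.
have gz := outer_gap w hG z0.
have gap : 1 - r' / R <= cabs (1 - cbar w * G z).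
  apply: le_trans gz; rewrite lerD2l lerN2 mulrC ler_wpM2l ?(ltW r'0)//.
rewrite cabsM cabsV -[leRHS]mul1r; apply: ler_pM; rewrite ?invr_ge0 ?cabs_ge0//.
  by apply: le_trans (hG z z0).2 _; rewrite ltW// (lt_trans r'R).
by rewrite lef_pV2 ?posrE// (lt_le_trans d0).
Qed.

(** A Montel argument: bounded values have limits along an ultrafilter, and the common Lipschitz
    bound makes these limits continuous and the convergence uniform on C_s. The limit f is
    controlled, with its reflection, only near C_s and its reflected circle; [transfer] uses nothing
    but the values on C_s, and its image is the limit in the Hardy norm. *)
Lemma Lop_compact G u (M : K) : selfmap s0 r' G -> (forall n : nat, hardy R (u n)) ->
  (forall n, hardy_norm R (u n) <= M) ->
  exists (phi : nat -> nat) f, [/\ {homo phi : m n / (m < n)%N}, hardy R f &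
    hardy_cvg R (fun n => Lop R s G (u (phi n))) f].
Proof.
move=> hG hu uM; have [A A0 hA] := hardy_circles.
have M0 : 0 <= M := le_trans (hardy_norm_ge0 R _) (uM 0%N).
have AM0 : 0 <= A * M by exact: mulr_ge0.
have bnd n : (forall z, cabs z = c1 \/ cabs z = c1^-1 -> cabs (u n z) <= A * M) /\
    (forall z, cabs z = c1 \/ cabs z = c1^-1 -> cabs (refl (u n) z) <= A * M).
  have [h1 h2] := hA _ (hu n); have le1 : A * hardy_norm R (u n) <= A * M by rewrite ler_wpM2l.
  by split=> z hz; [exact: le_trans (h1 z hz) le1|exact: le_trans (h2 z hz) le1].
have au n : an R (u n) := hardy_an (hu n); have aru n : an R (refl (u n)) := an_refl hrad (au n).
have lipu n z z' : a1 <= cabs z <= a1^-1 -> a1 <= cabs z' <= a1^-1 ->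
    cabs (u n z - u n z') <= lip_cst * (A * M) * cabs (z - z').
  apply: an_lipschitz => // x xc; apply: (bnd n).1; [by left|by right].
have lipr n z z' : a1 <= cabs z <= a1^-1 -> a1 <= cabs z' <= a1^-1 ->
    cabs (refl (u n) z - refl (u n) z') <= lip_cst * (A * M) * cabs (z - z').
  apply: an_lipschitz => // x xc; apply: (bnd n).2; [by left|by right].
have [U [UU sU]] := @ultraFilterLemma _ (\oo : set_system nat) _.
have PU : ProperFilter U by case: UU.
set D := lip_cst * (A * M) in lipu lipr.
have s_in : a1 <= s <= a1^-1.
  by rewrite (ltW a1_s) (le_trans (ltW sV))// lef_pV2 ?posrE// ltW.
have limu z : exists l : C, a1 <= cabs z <= a1^-1 -> (fun n => u n z) @ U --> l.
  have [hz|hz] := pselect (a1 <= cabs z <= a1^-1); last by exists 0 => h; case: hz.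
  have hc : a1 <= cabs (rc s : C) <= a1^-1 by rewrite cabs_rc ger0_norm ?(ltW s_gt0).
  have hsR : R < s < R^-1 by rewrite Rs (lt_trans sV)// ltf_pV2 ?posrE.
  have [B B0 hB] := hardy_sup R0 hsR.
  have [n|l hl] := @ultra_lim K U (fun n => u n z) (D * cabs (z - rc s) + B * M) UU; last by exists l.
  have -> : u n z = (u n z - u n (rc s)) + u n (rc s) by ring.
  apply: le_trans (cabsD _ _) _; apply: lerD; first exact: lipu.
  apply: le_trans (hB _ (hu n) _ _) _; last by rewrite ler_wpM2l.
  by rewrite cabs_rc ger0_norm// ltW.
have [f hf] := choice limu.
have fr z : a1 <= cabs z <= a1^-1 -> (fun n => refl (u n) z) @ U --> refl f z.
  move=> hz; have hz' : a1 <= cabs (cinv z) <= a1^-1.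
    have z0 : 0 < cabs z by have /andP[h _] := hz; exact: lt_le_trans h.
    have /andP[h1 h2] := hz; rewrite cabs_cinv lef_pV2 ?posrE// h1 andbT.
    by rewrite -[leLHS]invrK lef_pV2 ?posrE ?invr_gt0.
  apply/cvg_cabs_lt => e e0.
  have p0 : 0 < cabs (z^-1 ^+ 2) + 1 by rewrite ltr_wpDl ?cabs_ge0.
  have hd := divr_gt0 e0 p0.
  have nh : \forall n \near U, cabs (u n (cinv z) - f (cinv z)) < e / (cabs (z^-1 ^+ 2) + 1).
    by apply: ((cvg_cabs_lt _ _).1 (hf _ hz')).
  apply: filterS nh => n hn; rewrite /refl -mulrBr -cbarB cabsM cabs_bar.
  apply: (@le_lt_trans _ _ ((cabs (z^-1 ^+ 2) + 1) * cabs (u n (cinv z) - f (cinv z)))).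
    by rewrite ler_wpM2r ?cabs_ge0// lerDl.
  by rewrite mulrC -ltr_pdivlMr.
have cont (v : nat -> C -> C) (h : C -> C) :
    (forall z, a1 <= cabs z <= a1^-1 -> (fun n => v n z) @ U --> h z) ->
    (forall n z z', a1 <= cabs z <= a1^-1 -> a1 <= cabs z' <= a1^-1 ->
      cabs (v n z - v n z') <= D * cabs (z - z')) -> circ_cont s h.
  move=> hv lip; split=> z zs; apply/continuous_cabsP => e e0.
  have D1 : 0 < `|D| + 1 by rewrite ltr_wpDl.
  have dd : 0 < s - a1 by rewrite subr_gt0.
  have dd2 : 0 < a1^-1 - s.
    by rewrite subr_gt0 (lt_trans sV)// ltf_pV2 ?posrE.
  exists (Num.min (e / (`|D| + 1)) (Num.min (s - a1) (a1^-1 - s))).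
    by rewrite !lt_min divr_gt0//= dd dd2.
  move=> y; rewrite !lt_min => /andP[y1 /andP[y2 y3]].
  have hy : a1 <= cabs y <= a1^-1.
    have := cabs_sub_ge z y; have := cabs_sub_ge y z; rewrite [cabs (z - y)]cabsBC zs => k1 k2.
    by apply/andP; split; lra.
  have hz : a1 <= cabs z <= a1^-1 by rewrite zs.
  have h3 : (fun m => v m y - v m z) @ U --> h y - h z by apply: (cvgB (hv _ hy) (hv _ hz)).
  apply: (@le_lt_trans _ _ (D * cabs (y - z))).
    rewrite -[X in cabs X]subr0; apply: (ultra_le UU h3) => m; rewrite subr0.
    exact: lip.
  apply: (@le_lt_trans _ _ ((`|D| + 1) * cabs (y - z))).
    by rewrite ler_wpM2r ?cabs_ge0// (le_trans (ler_norm _))// lerDl.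
  by rewrite mulrC -ltr_pdivlMr.
have cf := cont u f hf lipu; have crf := cont (fun n => refl (u n)) (refl f) fr lipr.
have thf : thick r' (transfer s G f) by move=> z hz; exact: (transfer_hol hrad hG cf crf hz).
have on z : cabs z = s -> a1 <= cabs z <= a1^-1 by move=> ->.
pose S k n := (forall z, cabs z = s -> cabs (u n z - f z) <= k.+1%:R^-1) /\
  (forall z, cabs z = s -> cabs (refl (u n) z - refl f z) <= k.+1%:R^-1).
have US k : \forall n \near U, S k n.
  have e0 : 0 < k.+1%:R^-1 :> K by rewrite invr_gt0 ltr0n.
  have h1 := @ultra_uniform K U u f s D _ UU e0 (fun n z z' zs zs' => lipu n z z' (on z zs) (on z' zs'))
    (fun z zs => hf z (on z zs)).
  have h2 := @ultra_uniform K U (fun n => refl (u n)) (refl f) s D _ UU e0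
    (fun n z z' zs zs' => lipr n z z' (on z zs) (on z' zs')) (fun z zs => fr z (on z zs)).
  exact: (filterI h1 h2).
(* The ultrafilter contains all tails, so a good index can be found beyond any given one; this turns
   the ultralimit into a subsequence. *)
have /choice[p hp] (km : nat * nat) : exists n, (km.2 < n)%N /\ S km.1 n.
  have h : U [set n | (km.2 < n)%N] by apply: sU; exists km.2.+1.
  by have [n [h1 h2]] := filter_ex (filterI h (US km.1)); exists n.
pose phi := fix phi k := if k is k'.+1 then p (k, phi k') else p (0%N, 0%N).
have Sphi k : S k (phi k) by case: k => [|k]; [exact: (hp (0%N, 0%N)).2|exact: (hp (k.+1, phi k)).2].
exists phi, (Lop R s G f); split.
- by apply: (homo_ltn ltn_trans) => k; exact: (hp (k.+1, phi k)).1.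
- exact: (thick_hardy hrad thf).
pose Q := (R - r')^-1 + (1 - r' / R)^-1.
have hQ n : hardy_norm R (Lop R s G (u (phi n)) - Lop R s G f) <= 3 * (Q * n.+1%:R^-1).
  have tu := transfer_thick hrad hG (au (phi n)).
  have -> : Lop R s G (u (phi n)) - Lop R s G f =
    restrict_annulus R (fun w => transfer s G (u (phi n)) w - transfer s G f w).
    apply/funext => w.
    have -> : (Lop R s G (u (phi n)) - Lop R s G f) w = Lop R s G (u (phi n)) w - Lop R s G f w by [].
    have [hw|hw] := pselect (annulus R w); first by rewrite /Lop !(restrictE _ hw).
    by rewrite /Lop !(restrict_out _ hw) subrr.
  refine (hardy_ext R0 R1 r'0 r'R _ _).2; first by move=> z hz; apply: holB; [exact: tu|exact: thf].
  move=> z hz; have [S1 S2] := Sphi n.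
  exact: (transfer_close hG (an_cc hrad (au _)) cf (an_cc hrad (aru _)) crf S1 S2 hz).
rewrite /hardy_cvg; apply: (@squeeze_cvgr _ _ _ _ (fun=> 0) (fun n => 3 * (Q * n.+1%:R^-1))).
- by apply: nearW => n; rewrite hardy_norm_ge0 hQ.
- exact: cvg_cst.
- rewrite -[X in _ --> X](mulr0 3); apply: cvgMr; rewrite -[X in _ --> X](mulr0 Q); apply: cvgMr.
  exact: cvg_harmonic.
Qed.

End Compactness.

(** * Growth of the operator norm and superexponential decay *)

Section Trivial.
Variables (K : realType) (R s s0 r' : K).
Local Notation C := (Cplx K).
Hypothesis hrad : [/\ 0 < r', r' < R, R < s, s < s0 & s0 < 1].
Implicit Types (f h : C -> C) (g : nat -> C -> C) (x z w : C).

Let r'0 : 0 < r'. Proof. by case: hrad. Qed.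
Let r'R : r' < R. Proof. by case: hrad. Qed.
Let Rs : R < s. Proof. by case: hrad. Qed.
Let ss0 : s < s0. Proof. by case: hrad. Qed.
Let s01 : s0 < 1. Proof. by case: hrad. Qed.
Let R0 : 0 < R. Proof. exact: lt_trans r'R. Qed.
Let s_gt0 : 0 < s. Proof. exact: lt_trans Rs. Qed.
Let R1 : R < 1. Proof. by rewrite (lt_trans Rs)// (lt_trans ss0). Qed.

Lemma pair_one_push g n f : selfmaps s0 r' g -> hardy R f ->
  pair s (push R s g n f) (fun=> 1) = pair s f (fun=> 1).
Proof.
move=> gS hf; case: n => [//|n].
by rewrite (pair_Lop hrad (orb_selfmap hrad n gS) hf)// => z _; exact: hol_cst.
Qed.

Lemma push_bound : exists2 B : K, 0 < B & forall g n f, selfmaps s0 r' g -> hardy R f ->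
  hardy_norm R (push R s g n f) <= B * hardy_norm R f.
Proof.
have [B B0 hB] := Lop_bound hrad; exists (B + 1); first by rewrite ltr_wpDl.
move=> g n f gS hf; have n0 := hardy_norm_ge0 R f; rewrite mulrDl mul1r.
case: n => [|n]; first by rewrite lerDr mulr_ge0.
by apply: le_trans (hB _ f (orb_selfmap hrad n gS) hf) _; rewrite lerDl.
Qed.

(** The pairing with 1 is conserved by every operator and bounded by the norm. *)
Lemma push_lower : exists2 A : K, 0 < A & forall g n f, selfmaps s0 r' g -> hardy R f ->
  cabs (pair s f (fun=> 1)) <= A * hardy_norm R (push R s g n f).
Proof.
have [A A0 hA] := pair_hardy_le hrad; exists A => // g n f gS hf.
have hp : hardy R (push R s g n f).
  by case: n => [//|n]; exact: (Lop_hardy hrad (orb_selfmap hrad n gS)).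
rewrite -(pair_one_push n gS hf) -[leRHS]mulr1.
have H1 z : cabs z < s0 -> hol (fun=> 1 : C) z by move=> _; exact: hol_cst.
have H2 z : cabs z = s -> cabs (1 : C) <= 1 by rewrite cabs1.
by have [h _] := hA _ (fun=> 1) 1 hp H1 H2.
Qed.

Lemma eq_op_norm (F F' : (C -> C) -> C -> C) : (forall f, hardy R f -> F f = F' f) ->
  op_norm R F = op_norm R F'.
Proof.
move=> e; have E : [set (hardy_norm R (F f))%:E | f in [set f | hardy R f /\ hardy_norm R f <= 1]] =
    [set (hardy_norm R (F' f))%:E | f in [set f | hardy R f /\ hardy_norm R f <= 1]].
  by apply: eq_imagel => f [hf _]; rewrite (e f hf).
exact: (congr1 (@ereal_sup K) E).
Qed.

(** The test function is [equil 0], that is 1/z, scaled to norm at most 1. Conservation of its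
    pairing with 1 gives one lower bound for all sequences of maps. *)
Lemma op_norm_ge : exists2 c : K, 0 < c & forall g n, selfmaps s0 r' g ->
  (c%:E <= op_norm R (push R s g n))%E.
Proof.
have [A A0 hA] := push_lower; have x0 : cabs (0 : C) <= r' by rewrite cabs0 ltW.
have gS0 : selfmaps s0 r' (fun _ _ => 0 : C).
  by move=> n z _; split; [exact: hol_cst|rewrite cabs0 ltW].
have tv : thick r' (equil (0 : C)) by move=> z; exact: (equil_hol hrad gS0 x0).
have [M M0 hM] := thick_bounded hrad tv.
pose t := (3 * M + 1)^-1; have t1 : 0 < 3 * M + 1 by rewrite ltr_wpDl// mulr_ge0.
have t0 : 0 < t by rewrite invr_gt0.
pose F (z : C) := rc t * equil 0 z.
have tF : thick r' F by move=> z hz; apply: holM; [exact: hol_cst|exact: tv].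
have bF z : R <= cabs z <= R^-1 -> cabs (F z) <= t * M.
  by move=> hz; rewrite cabsM cabs_rc gtr0_norm// ler_wpM2l ?hM// ltW.
have [hF nF] := hardy_ext R0 R1 r'0 r'R tF bF.
have nF1 : hardy_norm R (restrict_annulus R F) <= 1.
  by apply: le_trans nF _; rewrite /t mulrCA mulrC ler_pdivrMr// mul1r lerDl.
have pF : pair s (restrict_annulus R F) (fun=> 1) = rc t.
  have ce := an_cc hrad (thick_an hrad tv).
  rewrite (eq_pair hrad (f' := F) (h' := fun=> 1))//; last first.
    by move=> z zs; apply: restrictE; exact: (s_annulus hrad).
  rewrite /F (pairZ hrad (rc t) ce (cc_cst s 1)) (pair_equil hrad x0) ?mulr1// => z _.
  exact: hol_cst.
exists (t / A); first by rewrite divr_gt0.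
move=> g n gS; apply: (@le_trans _ _ (hardy_norm R (push R s g n (restrict_annulus R F)))%:E).
  rewrite lee_fin ler_pdivrMr// mulrC; have := hA g n _ gS hF.
  by rewrite pF cabs_rc gtr0_norm.
by apply: ereal_sup_ubound; exists (restrict_annulus R F).
Qed.

Lemma op_norm_cvg g : selfmaps s0 r' g ->
  (n%:R^-1%:E * lne (op_norm R (push R s g n)))%E @[n --> \oo] --> 0%:E.
Proof.
move=> gS; have [c c0 hc] := op_norm_ge; have [B B0 hB] := push_bound.
apply: scaled_log_cvg.
- by move=> n; apply: le_trans (hc g n gS); rewrite lee_fin ltW.
- move=> e e0; exists B => // n; apply: (@le_trans _ _ B%:E).
    apply: ge_ereal_sup => _ [f [hf f1] <-]; rewrite lee_fin.
    by apply: le_trans (hB g n f gS hf) _; rewrite ler_piMr// ltW.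
  by rewrite lee_fin add0r ler_peMr ?(ltW B0)// exprn_ege1// -expR0 ler_expR ltW.
- move=> e e0; exists c => //; apply: nearW => n; apply: le_trans (hc g n gS).
  rewrite lee_fin sub0r ler_piMr ?(ltW c0)// exprn_ile1 ?expR_ge0//.
  by rewrite -expR0 ler_expR oppr_le0 ltW.
Qed.

Lemma pair_one_growth g f : selfmaps s0 r' g -> hardy R f -> pair s f (fun=> 1) != 0 ->
  (n%:R^-1%:E * lne (hardy_norm R (push R s g n f))%:E)%E @[n --> \oo] --> 0%:E.
Proof.
move=> gS hf p0; have [A A0 hA] := push_lower; have [B B0 hB] := push_bound.
have n0 := hardy_norm_ge0 R f.
apply: (@scaled_log_cvg _ (fun n => (hardy_norm R (push R s g n f))%:E)).
- by move=> n; rewrite lee_fin hardy_norm_ge0.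
- move=> e e0; exists (B * (hardy_norm R f + 1)); first by rewrite mulr_gt0// ltr_wpDl.
  move=> n; rewrite lee_fin; apply: le_trans (hB g n f gS hf) _.
  rewrite add0r -mulrA ler_wpM2l ?(ltW B0)//; apply: (@le_trans _ _ (hardy_norm R f + 1)).
    by rewrite lerDl.
  by rewrite ler_peMr ?addr_ge0// exprn_ege1// -expR0 ler_expR ltW.
- move=> e e0; exists (cabs (pair s f (fun=> 1)) / A); first by rewrite divr_gt0// cabs_gt0.
  apply: nearW => n; rewrite lee_fin; apply: (@le_trans _ _ (cabs (pair s f (fun=> 1)) / A)).
    rewrite sub0r ler_piMr ?divr_ge0 ?cabs_ge0 ?(ltW A0)// exprn_ile1 ?expR_ge0//.
    by rewrite -expR0 ler_expR oppr_le0 ltW.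
  by rewrite ler_pdivrMr// mulrC hA.
Qed.

(** For zero pairing with 1, [transfer_bound] with m = 1 leaves a single power of the orbit
    difference, and [orb_diff_prod] bounds it by products that decay at any prescribed rate. *)
Lemma superfast_growth g x f : selfmaps s0 r' g -> cabs x <= r' -> hardy R f ->
  pair s f (fun=> 1) = 0 ->
  (forall M : K, exists2 d : K, 0 < d & rate (fun n => \prod_(k < n) (cabs (mult g x k) + d)) M) ->
  (limn_esup (fun n => n%:R^-1%:E * lne (hardy_norm R (push R s g n f))%:E) <= -oo)%E.
Proof.
move=> gS xr hf f1 hr; apply: (@scaled_log_limsupNy _ (fun n => (hardy_norm R (push R s g n f))%:E)).
  by move=> n; rewrite lee_fin hardy_norm_ge0.
move=> L; have [d d0 hd] := hr (L - 1); have [A A0 hA] := orb_diff_prod hrad gS xr d0.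
have [D D0 hD] := hd 1 ltr01; rewrite subrK in hD.
have af := hardy_an hf; have cf := an_cc hrad af; have crf := an_cc hrad (an_refl hrad af).
have [M M0 fM] := circ_bounded s_gt0 cf; have [M' M'0 rfM] := circ_bounded s_gt0 crf.
have rf1 : pair s (refl f) (fun=> 1) = 0 by rewrite (pair1_refl hrad af) f1 cbar0.
pose c := (1 + R^-1 ^+ 2) * (R - r')^-1 ^+ 2.
have c0 : 0 <= c.
  by rewrite mulr_ge0 ?addr_ge0 ?sqr_ge0.
pose Q := 3 * (c * ((M + M') * (A * D))).
have Q0 : 0 <= Q.
  apply: mulr_ge0 => //; apply: mulr_ge0 => //; apply: mulr_ge0; first exact: addr_ge0.
  exact: mulr_ge0.
exists (Q + hardy_norm R f); first by rewrite addr_ge0 ?hardy_norm_ge0.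
case=> [|n].
  by rewrite lee_fin expr0 mulr1 lerDr.
have P0 : 0 <= \prod_(k < n.+1) (cabs (mult g x k) + d).
  by apply: prodr_ge0 => k _; rewrite addr_ge0 ?cabs_ge0// ltW.
rewrite lee_fin; apply: (@le_trans _ _ (Q * expR L ^+ n.+1)); last first.
  by rewrite ler_wpM2r ?exprn_ge0 ?expR_ge0// lerDl hardy_norm_ge0.
have -> : Q * expR L ^+ n.+1 = 3 * (c * ((M + M') * (A * (D * expR L ^+ n.+1)))).
  by rewrite /Q; ring.
apply: (Lop_sup_norm hrad (orb_selfmap hrad n gS) af) => w hw.
have MM : 0 <= M + M' by exact: addr_ge0.
have tb := @transfer_bound _ _ _ _ _ hrad g x gS xr n 1 f w (M + M')
  (A * \prod_(k < n.+1) (cabs (mult g x k) + d)) af.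
apply: le_trans (tb _ _ _ rf1 hw) _.
- by move=> z zs; apply: le_trans (fM z zs) _; rewrite lerDl.
- by move=> z zs; apply: le_trans (rfM z zs) _; rewrite lerDr.
- by move=> z zs; apply: hA; rewrite zs.
rewrite -/c; apply: ler_wpM2l => //; rewrite big_ord1 !(moment0 hrad) f1 rf1 cabs0 !add0r expr1.
apply: ler_wpM2l => //; apply: ler_wpM2l => //.
by apply: le_trans (hD n.+1); exact: ler_norm.
Qed.

Definition linear_map x (c : K) z := x + rc c * (z - x).

(* A fictitious orbit, used only to decompose the space into the line spanned by the
   equilibrium and the functions with vanishing pairing against 1. *)
Lemma linear_regular x (rho : K) : cabs x <= rho -> rho < r' ->
  let g := fun _ : nat => linear_map x ((r' - rho) / 2) in
  selfmaps s0 r' g /\ regular g x (ln ((r' - rho) / 2)).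
Proof.
move=> xr rr g; set c := (r' - rho) / 2 in g *.
have c0 : 0 < c by rewrite divr_gt0// subr_gt0.
have rho0 : 0 <= rho := le_trans (cabs_ge0 _) xr.
have c1 : c < 1 by rewrite /c; have := r'R; have := Rs; have := ss0; case: hrad => _ _ _ _; lra.
have d z : cderiv (linear_map x c) z (rc c).
  have h := cdD (cd_cst x z) (cdM (cd_cst (rc c) z) (cdB (cd_id z) (cd_cst x z))).
  by move: h; rewrite subr0 mulr1 mulr0 addr0 add0r.
have gx n : orb g n x = x.
  elim: n => [|n IH]; first by [].
  have -> : orb g n.+1 x = linear_map x c (orb g n x) by [].
  by rewrite IH /linear_map addrN mulr0 addr0.
have mE n : mult g x n = rc c by rewrite /mult gx; exact: cderiv_derive1.
have pE n : cabs (mult_prod g x n) = c ^+ n.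
  elim: n => [|n IH]; first by rewrite /mult_prod big_ord0 cabs1.
  by rewrite mult_prodS cabsM IH mE cabs_rc gtr0_norm// exprSr.
have rate1 (q : K) : 0 < q -> rate (fun n => q ^+ n) (ln q).
  move=> q0; apply: rate_le (rate_geo q0 ler01) => n.
  by rewrite mul1r.
split.
  move=> n z z0; split; first exact: cderiv_hol (d z).
  apply: le_trans (cabsD _ _) _; rewrite cabsM cabs_rc gtr0_norm//.
  have zx : cabs (z - x) <= 2.
    apply: le_trans (cabsB _ _) _; have := r'R; have := Rs; have := ss0; case: hrad => _ _ _ _; lra.
  have := ler_wpM2l (ltW c0) zx; rewrite /c; lra.
split.
- by rewrite -ltr_expR lnK// expR0.
- by move=> n; rewrite mE rc_eq0 gt_eqF.
- by apply: (rate_le _ (rate1 c c0)) => n; rewrite pE.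
- have -> : - ln c = ln c^-1 by rewrite lnV.
  have cV : 0 < c^-1 by rewrite invr_gt0.
  by apply: (rate_le _ (rate1 _ cV)) => n; rewrite pE exprVn.
Qed.

End Trivial.

(** * Maximal ergodic inequality and growth of Birkhoff sums *)

Section Ergodic.
Variables (K : realType) (d : measure_display) (Omega : measurableType d).
Variables (P : probability Omega K) (sigma sigmaV : Omega -> Omega).
Hypothesis hsigma : invertible_ergodic P sigma sigmaV.
Implicit Types (f u : Omega -> K) (w : Omega).

Let msigma : measurable_fun setT sigma. Proof. by case: hsigma => _ []. Qed.

Lemma ge0_integral_shift (F : Omega -> \bar K) : measurable_fun setT F ->
  (forall w, (0 <= F w)%E) -> (\int[P]_w F (sigma w) = \int[P]_w F w)%E.
Proof.
move=> mF F0; have := @ge0_integral_pushforward _ _ _ _ _ sigma msigma P setT F measurableT mF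
  (fun y _ => F0 y).
rewrite preimage_setT => <-; apply: eq_measure_integral => A mA _.
by case: hsigma => _ _ h _; exact: h.
Qed.

Lemma integrable_shift f : P.-integrable setT (EFin \o f) ->
  P.-integrable setT (EFin \o (f \o sigma)).
Proof.
move=> /integrableP[mf fi]; apply/integrableP; split.
  exact: (measurableT_comp mf msigma).
have -> : (\int[P]_w `|(EFin \o (f \o sigma)) w| = \int[P]_w `|(EFin \o f) w|)%E; last by [].
apply: (@ge0_integral_shift (fun w => `|(EFin \o f) w|)%E); last by move=> w; exact: abse_ge0.
exact: (measurableT_comp _ mf).
Qed.

Lemma bounded_integrable f (M : K) : measurable_fun setT f -> (forall w, `|f w| <= M) ->
  P.-integrable setT (EFin \o f).
Proof.
move=> mf fM; have := @finite_measure_integrable_cst _ _ _ P setT M measurableT.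
apply: le_integrable => //; first exact/measurable_EFinP.
by move=> w _ /=; rewrite lee_fin (le_trans (fM w))// ler_norm.
Qed.

Lemma nat_above (x : K) : exists b : nat, x < b%:R.
Proof. by exists (Num.truncn x).+1; exact: Num.Theory.truncnS_gt. Qed.

Lemma integral_prob_cst (c : K) : (\int[P]_w c%:E = c%:E)%E.
Proof.
have e : (c%:E * P setT = c%:E)%E by rewrite probability_setT mule1.
rewrite integral_cst//; exact: e.
Qed.

Definition birkhoff f n w := \sum_(k < n) f (iter k sigma w).

(** The largest of the Birkhoff sums of length 0 to n, defined directly by the recursion that the
    maximal inequality uses. *)
Fixpoint birkhoff_max f n w := if n is m.+1 then Num.max 0 (f w + birkhoff_max f m (sigma w)) else 0.

Lemma birkhoffS f n w : birkhoff f n.+1 w = f w + birkhoff f n (sigma w).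
Proof.
rewrite /birkhoff big_ord_recl; congr (_ + _); apply: eq_bigr => k _.
by rewrite /= -iterSr.
Qed.

Lemma birkhoff_max_ge0 f n w : 0 <= birkhoff_max f n w.
Proof. by case: n => [//|n] /=; rewrite le_max lexx. Qed.

Lemma birkhoff_le_max f n w : birkhoff f n w <= birkhoff_max f n w.
Proof.
elim: n w => [|n IH] w; first by rewrite /birkhoff big_ord0.
by rewrite birkhoffS /= le_max lerD2l IH orbT.
Qed.

Lemma birkhoff_max_mono f m n w : (m <= n)%N -> birkhoff_max f m w <= birkhoff_max f n w.
Proof.
elim: n m w => [|n IH] [|m] w //; first by move=> _; exact: birkhoff_max_ge0.
move=> mn /=; rewrite ge_max !le_max lexx /=; apply/orP; right.
by rewrite lerD2l IH.
Qed.

Lemma birkhoff_max_integrable f n : P.-integrable setT (EFin \o f) ->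
  P.-integrable setT (EFin \o birkhoff_max f n).
Proof.
move=> fi; elim: n => [|n IH].
  exact: (@finite_measure_integrable_cst _ _ _ P setT 0 measurableT).
have si := integrable_shift IH.
have := integrableD measurableT fi si; apply: le_integrable => //.
  have /integrableP[mf _] := fi; have /integrableP[ms _] := si.
  apply/measurable_EFinP; apply: measurable_maxr; first exact: measurable_cst.
  by apply: measurable_funD; apply/measurable_EFinP.
move=> w _; rewrite lee_fin ger0_norm ?birkhoff_max_ge0//=.
by rewrite ge_max normr_ge0 ler_norm.
Qed.

(* The maximal Birkhoff sums satisfy M_{n+1} - M_n o sigma = max (f, - M_n o sigma), which
   tends to f where they are unbounded, while its integral is nonnegative. *)
Lemma birkhoff_bounded f : P.-integrable setT (EFin \o f) -> (\int[P]_w (f w)%:E < 0)%E ->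
  {ae P, forall w, exists B : K, forall n, birkhoff f n w <= B}.
Proof.
move=> fi fneg; have /integrableP[/measurable_EFinP mf _] := fi.
pose M := birkhoff_max f.
have Mi n := birkhoff_max_integrable n fi.
have mM n : measurable_fun setT (M n) by have /integrableP[/measurable_EFinP h _] := Mi n.
pose A := [set w | forall B : nat, exists n, B%:R < M n w].
have mA : measurable A.
  have -> : A = \bigcap_B \bigcup_n [set w | B%:R < M n w].
    apply/seteqP; split=> w /= h; first by move=> B _; have [n hn] := h B; exists n.
    by move=> B; have [n _ hn] := h B I; exists n.
  apply: bigcapT_measurable => B; apply: bigcupT_measurable => n.
  have := measurable_fun_ltr (@measurable_cst _ _ _ _ setT (B%:R : K)) (mM n).
  move=> /(_ measurableT [set true] I); rewrite setTI.
  by congr measurable; apply/seteqP; split => w.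
have invA : sigma @^-1` A = A.
  apply/seteqP; split=> w /= h B.
    have [b hb] := nat_above (B%:R - f w); have [n hn] := h b; exists n.+1.
    by rewrite /M /= lt_max -/(M n _); apply/orP; right; lra.
  have [b hb] := nat_above (B%:R + f w); have [[|n]] := h b.
    by rewrite /M /= ltNge ler0n.
  rewrite /M /= lt_max ltNge ler0n /= => hn; exists n.
  by have := lt_trans hb hn; rewrite addrC ltrD2l.
have [_ _ _ /(_ A mA invA)[PA|PA]] := hsigma.
  exists A; split=> // w /= nb B; apply: contrapT => h; apply: nb.
  exists B%:R => n; apply: le_trans (birkhoff_le_max f n w) _.
  by rewrite leNgt; apply/negP => hn; apply: h; exists n.
exfalso; pose h n w := M n.+1 w - M n (sigma w).
have hE n w : h n w = Num.max (- M n (sigma w)) (f w).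
  by rewrite /h /M /= -/(M n _) addr_maxl add0r addrK.
have hf n w : `|h n w| <= `|f w|.
  rewrite hE; have m0 := birkhoff_max_ge0 f n (sigma w); rewrite -/(M n _) in m0.
  rewrite /Num.max; case: ltP => // fm.
  by rewrite ler0_norm ?oppr_le0// ler0_norm ?lerN2// (le_trans fm)// oppr_le0.
have mh n : measurable_fun setT (h n).
  by apply: measurable_funB => //; exact: measurableT_comp.
have ih n : (0 <= \int[P]_w (h n w)%:E)%E.
  have si := integrable_shift (Mi n).
  have -> : (\int[P]_w (h n w)%:E = \int[P]_w (M n.+1 w)%:E - \int[P]_w (M n (sigma w))%:E)%E.
    exact: (integralB measurableT (Mi n.+1) si).
  rewrite (@ge0_integral_shift (fun w => (M n w)%:E)); last first.
  - by move=> w; rewrite lee_fin birkhoff_max_ge0.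
  - exact/measurable_EFinP.
  rewrite sube_ge0; last by apply/orP; left; exact: (integrable_fin_num measurableT (Mi n)).
  apply: ge0_le_integral => //.
  - by move=> w _; rewrite lee_fin birkhoff_max_ge0.
  - exact/measurable_EFinP.
  - exact/measurable_EFinP.
  - by move=> w _; rewrite lee_fin birkhoff_max_mono.
have cvA w : A w -> (h n w)%:E @[n --> \oo] --> (f w)%:E.
  rewrite -invA => hw; apply: cvg_near_cst.
  have [B fB] := nat_above (- f w).
  have [N hN] := hw B; exists N => // n /= Nn; congr EFin.
  rewrite hE; apply/max_idPr; rewrite lerNl.
  by apply: ltW; apply: lt_trans fB _; apply: lt_le_trans hN _; exact: birkhoff_max_mono.
have [| | | | |_ _ cv] := @dominated_convergence _ _ _ P setT measurableT (fun n w => (h n w)%:E)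
    (EFin \o f) (fun w => `|(f w)%:E|)%E.
- by move=> n; exact/measurable_EFinP.
- exact/measurable_EFinP.
- exists (~` A); split; first exact: measurableC.
    have h0 := probability_setC P mA; rewrite PA subee// in h0.
  by move=> w /= nw hA; apply: nw => _; exact: cvA.
- exact: integrable_abse.
- by apply: aeW => w n _; rewrite lee_fin; exact: hf.
have : (0 <= \int[P]_w (f w)%:E)%E.
  have e := cvg_lim (@ereal_hausdorff K) cv.
  rewrite -[X in (_ <= X)%E]e; apply: lime_ge; first by apply/cvg_ex; eexists; exact: cv.
  by apply: nearW => n; exact: ih.
by rewrite leNgt fneg.
Qed.

Lemma birkhoff_lt f (c : K) : P.-integrable setT (EFin \o f) -> (\int[P]_w (f w)%:E < c%:E)%E ->
  {ae P, forall w, exists B : K, forall n, birkhoff f n w <= B + n%:R * c}.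
Proof.
move=> fi fc; pose g w := f w - c.
have ci := @finite_measure_integrable_cst _ _ _ P setT c measurableT.
have gi : P.-integrable setT (EFin \o g) by exact: (integrableB measurableT fi ci).
have g0 : (\int[P]_w (g w)%:E < 0)%E.
  have -> : (\int[P]_w (g w)%:E = \int[P]_w (f w)%:E - \int[P]_w c%:E)%E.
    exact: (integralB measurableT fi ci).
  have fn : (\int[P]_w (f w)%:E)%E \is a fin_num := integrable_fin_num measurableT fi.
  by move: fc; rewrite integral_prob_cst -(fineK fn) -EFinB !lte_fin subr_lt0.
apply: filterS (birkhoff_bounded gi g0) => w [B hB]; exists B => n.
rewrite -lerBlDr; apply: le_trans (hB n).
by rewrite /birkhoff big_split /= sumr_const card_ord mulNrn mulr_natl.
Qed.

(** One-sided bounds for f and for -f. Restricting to e = 1/(m + 1) gives countably many null sets,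
    hence a single exceptional set for all e. *)
Lemma birkhoff_rate f (L : K) : P.-integrable setT (EFin \o f) -> (\int[P]_w (f w)%:E = L%:E)%E ->
  {ae P, forall w, forall e : K, 0 < e -> exists B : K, forall n,
     birkhoff f n w <= B + n%:R * (L + e) /\ - birkhoff f n w <= B + n%:R * (- L + e)}.
Proof.
move=> fi fL; pose f' w := - f w.
have fi' : P.-integrable setT (EFin \o f') by exact: (integrableN fi).
have fL' : (\int[P]_w (f' w)%:E = (- L)%:E)%E.
  have zi := @finite_measure_integrable_cst _ _ _ P setT 0 measurableT.
  have -> : (\int[P]_w (f' w)%:E = \int[P]_w (0%:E - (f w)%:E))%E.
    by apply: eq_integral => w _; rewrite -EFinB sub0r.
  by rewrite (integralB measurableT zi fi) integral_prob_cst fL -EFinB sub0r.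
have e0 m : 0 < m.+1%:R^-1 :> K by rewrite invr_gt0 ltr0n.
have h1 : {ae P, forall w, forall m : nat, exists B : K, forall n, birkhoff f n w <= B + n%:R * (L + m.+1%:R^-1)}.
  apply: ae_foralln => m; apply: birkhoff_lt => //; by rewrite fL lte_fin ltrDl.
have h2 : {ae P, forall w, forall m : nat, exists B : K, forall n, birkhoff f' n w <= B + n%:R * (- L + m.+1%:R^-1)}.
  apply: ae_foralln => m; apply: birkhoff_lt => //; by rewrite fL' lte_fin ltrDl.
apply: filterS2 h1 h2 => w k1 k2 e e_gt0.
have [m hm] := nat_above e^-1.
have me : m.+1%:R^-1 <= e.
  rewrite -[leRHS]invrK lef_pV2 ?posrE ?invr_gt0 ?ltr0n//; apply: le_trans (ltW hm) _.
  by rewrite ler_nat.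
have [B1 hB1] := k1 m; have [B2 hB2] := k2 m.
exists (`|B1| + `|B2|) => n; have n0 : 0 <= n%:R :> K by exact: ler0n.
have q : n%:R * m.+1%:R^-1 <= n%:R * e :> K by rewrite ler_wpM2l.
have a1 := ler_norm B1; have a2 := ler_norm B2; have b1 := normr_ge0 B1; have b2 := normr_ge0 B2.
have fN : birkhoff f' n w = - birkhoff f n w by rewrite /birkhoff sumrN.
have := hB1 n; have := hB2 n; rewrite fN !mulrDr mulrN => i1 i2; move: q i1 i2.
move: (n%:R * m.+1%:R^-1) (n%:R * L) (n%:R * e) (birkhoff f n w) => p1 p2 p3 p4 q i1 i2.
by split; lra.
Qed.

Lemma ln_shift_cvg (u : K) : 0 <= u ->
  (ln (u + k.+1%:R^-1))%:E @[k --> \oo] --> lne u%:E.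
Proof.
rewrite le_eqVlt => /predU1P[<-|u0]; last first.
  have v : (fun k => u + k.+1%:R^-1) @ \oo --> u.
    by rewrite -[X in _ --> X]addr0; apply: cvgD; [exact: cvg_cst|exact: cvg_harmonic].
  have h : (fun k => ln (u + k.+1%:R^-1)) @ \oo --> ln u.
    by apply: (@continuous_cvg _ _ _ _ _ _ (@ln K) _ _ v); exact: continuous_ln.
  by rewrite lne_EFin//; apply/fine_cvgP; split; [exact: nearW|exact: h].
rewrite le0_lneNy// ; apply/cvgeNyPle => M.
have [b hb] := nat_above (expR (- M)); exists b => // k /= bk; rewrite lee_fin add0r.
rewrite lnV ?posrE ?ltr0n// lerNl -[leLHS]expRK ler_ln ?posrE ?expR_gt0 ?ltr0n//.
by apply: le_trans (ltW hb) _; rewrite ler_nat leqW.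
Qed.

Section Shifted.
Variables (u : Omega -> K) (D : K).
Hypotheses (mu : measurable_fun setT u) (u0 : forall w, 0 <= u w) (uD : forall w, u w <= D).

Lemma measurable_ln_shift (c : K) : measurable_fun setT (fun w => ln (u w + c)).
Proof.
by apply: (measurableT_comp (@measurable_ln K)); apply: measurable_funD => //; exact: measurable_cst.
Qed.

Lemma measurable_lne_comp : measurable_fun setT (fun w => lne (u w)%:E).
Proof.
apply: (@emeasurable_fun_cvg _ _ _ _ (fun k w => (ln (u w + k.+1%:R^-1))%:E)) => [k|w _].
  by apply/measurable_EFinP; exact: measurable_ln_shift.
exact: ln_shift_cvg.
Qed.

Let top := ln (D + 1).
Let D0 w : 0 <= D. Proof. exact: le_trans (u0 w) (uD w). Qed.

Let ln_le k w : ln (u w + k.+1%:R^-1) <= top.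
Proof.
have k0 : 0 < k.+1%:R^-1 :> K by rewrite invr_gt0 ltr0n.
have k1 : k.+1%:R^-1 <= 1 :> K by rewrite invf_le1 ?ltr0n// ler1n.
move: k0 k1 (D0 w) (u0 w) (uD w); move: (k.+1%:R^-1) (u w) => a v k0 k1 h1 h2 h3.
have v1 : 0 < v + a by lra.
have v2 : 0 < D + 1 by lra.
by rewrite /top ler_ln ?posrE//; lra.
Qed.

Lemma ln_shift_integrable k : P.-integrable setT (EFin \o (fun w => ln (u w + k.+1%:R^-1))).
Proof.
apply: (@bounded_integrable _ (`|top| + ln k.+1%:R)); first exact: measurable_ln_shift.
move=> w; have h := ln_le k w; have t := ler_norm top.
have l0 : 0 <= ln k.+1%:R :> K by rewrite ln_ge0// ler1n.
have h2 : - ln k.+1%:R <= ln (u w + k.+1%:R^-1).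
  by rewrite -lnV ?posrE ?ltr0n// ler_ln ?posrE ?ltr_wpDl ?invr_gt0 ?ltr0n// lerDr.
have t0 := normr_ge0 top; move: h h2 t l0 t0.
by move: (ln (u w + _)) (ln k.+1%:R) `|top| => a b c h h2 t l0 t0; rewrite ler_norml; apply/andP; split; lra.
Qed.

(** The shifted logarithms are bounded and decrease to log u as the shift tends to 0. Monotone
    convergence sends their integrals to minus infinity. *)
Lemma ln_shift_unbounded (m : K) :
  (\int[P]_w lne (u w)%:E = -oo)%E \/ (0 < P [set w | (u w = 0)%R])%E ->
  exists k : nat, (\int[P]_w (ln (u w + k.+1%:R^-1))%:E < m%:E)%E.
Proof.
move=> hu; pose top' := `|top|; have top0 : 0 <= top' by exact: normr_ge0.
have mf := measurable_lne_comp; pose f w := lne (u w)%:E.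
have f_top w : (f w <= top'%:E)%E.
  rewrite /f; have := uD w; have := u0 w; rewrite le_eqVlt => /predU1P[<-|p] uDw.
    by rewrite le0_lneNy// leNye.
  rewrite lne_EFin// lee_fin (le_trans _ (ler_norm _))// ler_ln ?posrE//; have := D0 w; [lra|lra].
(* Either hypothesis makes the negative part nonintegrable: in the first case because the positive
   part is bounded by [top'], in the second because the negative part is infinite on a set of
   positive measure. *)
have neg : (\int[P]_w f^\- w = +oo)%E.
  case: hu => [hL|hc].
    apply/eqP; rewrite -leye_eq leNgt; apply/negP => fin.
    have n0 : (0 <= \int[P]_w f^\- w)%E by apply: integral_ge0.
    have pfin : (\int[P]_w f^\+ w <= top'%:E)%E.
      have -> : top'%:E = (\int[P]_w top'%:E)%E by rewrite integral_prob_cst.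
      apply: ge0_le_integral => //; first exact: measurable_funepos.
      by move=> w _; rewrite funeposE ge_max f_top lee_fin.
    have p0 : (0 <= \int[P]_w f^\+ w)%E by apply: integral_ge0.
    have : (\int[P]_w f w)%E \is a fin_num.
      rewrite integralE fin_numB !ge0_fin_numE//; apply/andP; split=> //.
      exact: le_lt_trans pfin (ltry _).
    by rewrite hL.
  have mc : measurable [set w | (u w = 0)%R].
    have -> : [set w | (u w = 0)%R] = setT `&` u @^-1` [set 0] by rewrite setTI.
    exact: mu.
  apply/eqP; rewrite -leye_eq.
  have <- : (\int[P]_(w in [set w | (u w = 0)%R]) (+oo : \bar K) = +oo)%E.
    by rewrite integral_cst// gt0_mulye.
  apply: (@le_trans _ _ (\int[P]_(w in [set w | (u w = 0)%R]) f^\- w)%E).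
    apply: ge0_le_integral => //.
      by apply: measurable_funTS; exact: measurable_funeneg.
    by move=> w /= e; rewrite funenegE /f e le0_lneNy.
  by apply: ge0_subset_integral => //; exact: measurable_funeneg.
pose F k w := (top'%:E - (ln (u w + k.+1%:R^-1))%:E)%E.
have mF k : measurable_fun setT (F k).
  by apply: emeasurable_funB; [exact: measurable_cst|apply/measurable_EFinP; exact: measurable_ln_shift].
have F0 k w : (0 <= F k w)%E.
  by rewrite /F -EFinB lee_fin subr_ge0 (le_trans (ln_le k w))// ler_norm.
have cF w : F ^~ w @ \oo --> (top'%:E - f w)%E.
  by apply: cvgeB; [exact: fin_num_adde_defr|exact: cvg_cst|exact: ln_shift_cvg].
have cv : (\int[P]_w F k w)%E @[k --> \oo] --> (\int[P]_w (limn (F ^~ w)))%E.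
  apply: cvg_monotone_convergence => // w _ a b ab.
  rewrite /F -!EFinB lee_fin lerD2l lerN2 ler_ln ?posrE ?ltr_wpDl ?invr_gt0 ?ltr0n//.
  by rewrite lerD2l lef_pV2 ?posrE ?ltr0n// ler_nat.
have inf : (\int[P]_w (limn (F ^~ w)) = +oo)%E.
  apply/eqP; rewrite -leye_eq -neg.
  have -> : (\int[P]_w limn (F ^~ w) = \int[P]_w (top'%:E - f w))%E.
    by apply: eq_integral => w _; apply/cvg_lim => //; exact: cF.
  apply: ge0_le_integral => //; first exact: measurable_funeneg.
    by apply: emeasurable_funB => //; exact: measurable_cst.
  move=> w _; rewrite funenegE; have := f_top w; case: (f w) => [y| |].
  - by rewrite lee_fin => h; rewrite -EFinB -EFinN ge_max !lee_fin lerDr top0 subr_ge0.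
  - by rewrite leye_eq.
  - by move=> _; rewrite leey.
rewrite inf in cv; have [k _ /(_ k (leqnn k))] := (cvgeyPgt _).1 cv (top' - m).
have -> : (\int[P]_w F k w = top'%:E - \int[P]_w (ln (u w + k.+1%:R^-1))%:E)%E.
  rewrite /F (integralB measurableT (finite_measure_integrable_cst P top' measurableT) (ln_shift_integrable k)).
  by rewrite integral_prob_cst.
move=> h; exists k; move: h.
have fn := integrable_fin_num measurableT (ln_shift_integrable k).
by rewrite -(fineK fn) -EFinB !lte_fin ltrD2l ltrN2.
Qed.

Lemma birkhoff_superfast :
  (\int[P]_w lne (u w)%:E = -oo)%E \/ (0 < P [set w | (u w = 0)%R])%E ->
  {ae P, forall w, forall M : K, exists2 c : K, 0 < c & exists B : K, forall n,
    birkhoff (fun w => ln (u w + c)) n w <= B + n%:R * M}.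
Proof.
move=> hu; have h : {ae P, forall w, forall m : nat, exists2 c : K, 0 < c & exists B : K, forall n,
    birkhoff (fun w => ln (u w + c)) n w <= B + n%:R * - m%:R}.
  apply: ae_foralln => m; have [k hk] := ln_shift_unbounded (- m%:R) hu.
  apply: filterS (birkhoff_lt (ln_shift_integrable k) hk) => w [B hB].
  by exists k.+1%:R^-1; [rewrite invr_gt0 ltr0n|exists B].
apply: filterS h => w h M; have [m hm] := nat_above (- M).
have [c c0 [B hB]] := h m; exists c => //; exists B => n; apply: le_trans (hB n) _.
by rewrite lerD2l ler_wpM2l ?ler0n// lerNl ltW.
Qed.

End Shifted.

End Ergodic.

(** * Measurability of complex-valued functions and of the random maps *)

Section ComplexMeasurability.
Variables (K : realType) (d : measure_display) (Omega : measurableType d).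
Local Notation C := (Cplx K).
Implicit Types (D : set Omega) (f g : Omega -> C).

Lemma reM (z w : C) : complex.Re (z * w) = complex.Re z * complex.Re w - complex.Im z * complex.Im w.
Proof. by case: z w => [a b] [c e]. Qed.

Lemma imM (z w : C) : complex.Im (z * w) = complex.Re z * complex.Im w + complex.Im z * complex.Re w.
Proof. by case: z w => [a b] [c e]. Qed.

Lemma cm_cst D (c : C) : cmeasurable D (fun=> c).
Proof. by split; exact: measurable_cst. Qed.

Lemma cmD D f g : cmeasurable D f -> cmeasurable D g -> cmeasurable D (fun w => f w + g w).
Proof.
move=> [f1 f2] [g1 g2]; split.
  have -> : (fun w => complex.Re (f w + g w)) = (fun w => complex.Re (f w) + complex.Re (g w)).
    by apply/funext => w; case: (f w) (g w) => [? ?] [? ?].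
  exact: measurable_funD.
have -> : (fun w => complex.Im (f w + g w)) = (fun w => complex.Im (f w) + complex.Im (g w)).
  by apply/funext => w; case: (f w) (g w) => [? ?] [? ?].
exact: measurable_funD.
Qed.

Lemma cmM D f g : cmeasurable D f -> cmeasurable D g -> cmeasurable D (fun w => f w * g w).
Proof.
move=> [f1 f2] [g1 g2]; split.
  rewrite (funext (fun w => reM (f w) (g w))).
  by apply: measurable_funB; exact: measurable_funM.
rewrite (funext (fun w => imM (f w) (g w))).
by apply: measurable_funD; exact: measurable_funM.
Qed.

Lemma cmB D f g : cmeasurable D f -> cmeasurable D g -> cmeasurable D (fun w => f w - g w).
Proof.
move=> cf cg; have := cmD cf (cmM (cm_cst D (-1)) cg).
have e : (fun w => f w + -1 * g w) = (fun w => f w - g w) by apply/funext => w; rewrite mulN1r.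
by rewrite e.
Qed.

Lemma cm_rc D (a : Omega -> K) : measurable_fun D a -> cmeasurable D (fun w => rc (a w)).
Proof. by move=> ma; split => //; exact: measurable_cst. Qed.

Lemma measurable_neg D (a : Omega -> K) : measurable_fun D a -> measurable_fun D (fun w => - a w).
Proof.
move=> ma; have -> : (fun w => - a w) = (fun w => 0 - a w) by apply/funext => w; rewrite sub0r.
by apply: measurable_funB => //; exact: measurable_cst.
Qed.

Lemma cm_bar D f : cmeasurable D f -> cmeasurable D (fun w => cbar (f w)).
Proof.
move=> [f1 f2]; split.
  have -> : (fun w => complex.Re (cbar (f w))) = (fun w => complex.Re (f w)) by apply/funext => w; case: (f w).
  exact: f1.
have -> : (fun w => complex.Im (cbar (f w))) = (fun w => - complex.Im (f w)) by apply/funext => w; case: (f w).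
exact: measurable_neg.
Qed.

Lemma measurable_sqabs D f : cmeasurable D f -> measurable_fun D (fun w => cabs (f w) ^+ 2).
Proof.
move=> [f1 f2]; rewrite (funext (fun w => cabs2E (f w))).
by apply: measurable_funD; apply: measurable_funX.
Qed.

Lemma measurable_cabs D f : cmeasurable D f -> measurable_fun D (fun w => cabs (f w)).
Proof.
move=> cf; have -> : (fun w => cabs (f w)) = (fun w => Num.sqrt (cabs (f w) ^+ 2)).
  by apply/funext => w; rewrite sqrtr_sqr ger0_norm ?cabs_ge0.
apply: (@measurableT_comp _ _ _ _ _ _ (@Num.sqrt K)); last exact: measurable_sqabs.
by apply: continuous_measurable_fun; exact: sqrt_continuous.
Qed.

(* expR (- ln n) stands for n^-1, which the numerator makes irrelevant at n = 0. *)
Lemma cmV D f : cmeasurable D f -> cmeasurable D (fun w => (f w)^-1).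
Proof.
move=> cf; pose a w := expR (- ln (cabs (f w) ^+ 2)).
have ma : measurable_fun D a.
  apply: (measurableT_comp (@measurable_expR K)); apply: measurable_neg.
  by apply: (measurableT_comp (@measurable_ln K)); exact: measurable_sqabs.
have := cmM (cm_bar cf) (cm_rc ma).
have -> : (fun w => cbar (f w) * rc (a w)) = (fun w => (f w)^-1); last by [].
apply/funext => w; have [->|f0] := eqVneq (f w) 0; first by rewrite cbar0 mul0r invr0.
have n0 : 0 < cabs (f w) ^+ 2 by rewrite exprn_gt0// cabs_gt0.
rewrite /a expRN lnK ?posrE// rcV -mul_cbar invfM mulrCA mulfV ?mulr1//.
by rewrite cbar_eq0.
Qed.

Lemma cm_prod D (I : Type) (r : seq I) (F : I -> Omega -> C) : (forall i, cmeasurable D (F i)) ->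
  cmeasurable D (fun w => \prod_(i <- r) F i w).
Proof.
move=> hF; elim: r => [|i r IH].
  have -> : (fun w => \prod_(i <- [::]) F i w) = (fun=> 1) by apply/funext => w; rewrite big_nil.
  exact: cm_cst.
have -> : (fun w => \prod_(j <- i :: r) F j w) = (fun w => F i w * \prod_(j <- r) F j w).
  by apply/funext => w; rewrite big_cons.
exact: cmM.
Qed.

Lemma cm_comp f (s : Omega -> Omega) : measurable_fun setT s -> cmeasurable setT f ->
  cmeasurable setT (fun w => f (s w)).
Proof. by move=> ms [f1 f2]; split; [exact: (measurableT_comp f1)|exact: (measurableT_comp f2)]. Qed.

Lemma cm_lim (F : nat -> Omega -> C) f : (forall n, cmeasurable setT (F n)) ->
  (forall w, (fun n => F n w) @ \oo --> f w) -> cmeasurable setT f.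
Proof.
move=> mF cF; split.
  apply: (@measurable_fun_cvg _ _ _ _ (fun n w => complex.Re (F n w))) => [n|w _].
    exact: (mF n).1.
  by have [h _] := (cvg_reim _ _).1 (cF w).
apply: (@measurable_fun_cvg _ _ _ _ (fun n w => complex.Im (F n w))) => [n|w _].
  exact: (mF n).2.
by have [_ h] := (cvg_reim _ _).1 (cF w).
Qed.

Lemma cmS D D' f : measurable D' -> D `<=` D' -> cmeasurable D' f -> cmeasurable D f.
Proof. by move=> mD DD [f1 f2]; split; [exact: (measurable_funS mD DD f1)|exact: (measurable_funS mD DD f2)]. Qed.

Lemma cm_bigcup (D : nat -> set Omega) f : (forall m, measurable (D m)) -> \bigcup_m D m = setT ->
  (forall m, cmeasurable (D m) f) -> cmeasurable setT f.
Proof.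
move=> mD DT h; rewrite /cmeasurable -DT; split; apply/(measurable_fun_bigcup _ mD) => m.
  exact: (h m).1.
exact: (h m).2.
Qed.

Lemma eq_cm D f g : (forall w, D w -> f w = g w) -> cmeasurable D f -> cmeasurable D g.
Proof.
move=> e [f1 f2]; split.
  by apply: (eq_measurable_fun _ _ f1) => w; rewrite inE => /e ->.
by apply: (eq_measurable_fun _ _ f2) => w; rewrite inE => /e ->.
Qed.

(** The space is cut into the level sets of the degree. On each of them the product has a fixed
    number of factors, whose zeros are measurable there. *)
Lemma measurable_blaschke (T : Omega -> blaschke K) (z : Omega -> C) : measurable_family T ->
  cmeasurable setT z -> cmeasurable setT (fun w => bl_fun (T w) (z w)).
Proof.
move=> [mn mrot mz] cz; pose D m := [set w | size (bl_zeros (T w)) = m].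
have mD m : measurable (D m).
  have -> : D m = setT `&` (fun w => size (bl_zeros (T w))) @^-1` [set m] by rewrite setTI.
  exact: mn.
apply: (@cm_bigcup D) => //.
  by apply/seteqP; split=> // w _; exists (size (bl_zeros (T w))).
move=> m; have sub g : cmeasurable setT g -> cmeasurable (D m) g by exact: cmS.
pose a j w : C := nth 0 (bl_zeros (T w)) j.
have ma j : (j < m)%N -> cmeasurable (D m) (a j).
  move=> jm; apply: (cmS _ _ (mz j)); last by move=> w /= ->.
  have -> : [set w | (j < size (bl_zeros (T w)))%N] =
      setT `&` (fun w => size (bl_zeros (T w))) @^-1` [set n | (j < n)%N] by rewrite setTI.
  exact: mn.
apply: (@eq_cm _ (fun w => bl_rot (T w) *
    \prod_(j < m) ((z w - a j w) / (1 - cbar (a j w) * z w)))).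
  by move=> w Dw; rewrite /bl_fun (big_nth 0) Dw big_mkord.
apply: cmM; first exact: sub.
apply: (@cm_prod _ _ _ (fun (j : 'I_m) w => (z w - a j w) / (1 - cbar (a j w) * z w))) => j.
have h := ma j (ltn_ord j); have hz := sub _ cz.
apply: (cmM (cmB hz h)); apply: cmV; apply: (cmB (cm_cst _ 1)); exact: (cmM (cm_bar h) hz).
Qed.

End ComplexMeasurability.

(** * Invariant sets of full measure and the random fixed point *)

Section RandomFixedPoint.
Variables (K : realType) (d : measure_display) (Omega : measurableType d).
Variables (P : probability Omega K) (sigma sigmaV : Omega -> Omega).
Hypothesis hsigma : invertible_ergodic P sigma sigmaV.
Variables (R s s0 r' : K).
Hypothesis hrad : [/\ 0 < r', r' < R, R < s, s < s0 & s0 < 1].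
Local Notation C := (Cplx K).
Implicit Types (w : Omega) (z : C).

Let sK : cancel sigma sigmaV. Proof. by case: hsigma => [[]]. Qed.
Let sVK : cancel sigmaV sigma. Proof. by case: hsigma => [[]]. Qed.
Let ms : measurable_fun setT sigma. Proof. by case: hsigma => _ []. Qed.
Let msV : measurable_fun setT sigmaV. Proof. by case: hsigma => _ []. Qed.

Lemma iterVK n w : iter n sigma (iter n sigmaV w) = w.
Proof. by elim: n w => [//|n IH] w; rewrite iterSr /= sVK IH. Qed.

Lemma measurable_iter (f : Omega -> Omega) n : measurable_fun setT f -> measurable_fun setT (iter n f).
Proof. by move=> mf; elim: n => [|n IH]; [exact: measurable_id|exact: (measurableT_comp mf IH)]. Qed.

Lemma measure_iterV (A : set Omega) n : measurable A -> P (iter n sigmaV @^-1` A) = P A.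
Proof.
move=> mA; elim: n => [//|n IH].
have [_ _ inv _] := hsigma.
have mB : measurable (iter n sigmaV @^-1` A) by rewrite -[X in measurable X]setTI; exact: measurable_iter.
have mB' : measurable (iter n.+1 sigmaV @^-1` A) by rewrite -[X in measurable X]setTI; exact: (measurable_iter n.+1 msV).
rewrite -(inv _ mB') -IH; congr (P _); apply/seteqP; split => w /=.
  by rewrite -iterS iterSr sK.
by rewrite -iterS iterSr sK.
Qed.

Lemma measure_iter (A : set Omega) n : measurable A -> P (iter n sigma @^-1` A) = P A.
Proof.
move=> mA; elim: n => [//|n IH]; have [_ _ inv _] := hsigma.
have mB : measurable (iter n sigma @^-1` A) by rewrite -[X in measurable X]setTI; exact: measurable_iter.
by rewrite -IH -(inv _ mB); congr (P _); apply/seteqP; split => w /=; rewrite -iterS iterSr.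
Qed.

(** All forward and backward translates of the exceptional set form a null invariant set. A property
    valid almost everywhere then holds along entire two-sided orbits. *)
Lemma invariant_full (Q : Omega -> Prop) : {ae P, forall w, Q w} -> exists A : set Omega,
  [/\ measurable A, P (~` A) = 0%E, A `<=` Q & forall w, A (sigma w) <-> A w].
Proof.
move=> [N [mN N0 hN]].
have mf n : measurable (iter n sigma @^-1` N) by rewrite -[X in measurable X]setTI; exact: measurable_iter.
have mb n : measurable (iter n sigmaV @^-1` N) by rewrite -[X in measurable X]setTI; exact: measurable_iter.
pose B := (\bigcup_n (iter n sigma @^-1` N)) `|` (\bigcup_n (iter n sigmaV @^-1` N)).
have mB : measurable B by apply: measurableU; exact: bigcup_measurable.
exists (~` B); split.
- exact: measurableC.
- rewrite setCK; apply/negligibleP => //; apply: negligibleU; apply: negligible_bigcup => n.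
    by apply/negligibleP => //; rewrite -N0; exact: measure_iter.
  by apply/negligibleP => //; rewrite -N0; exact: measure_iterV.
- by move=> w nB; apply: contrapT => nQ; apply: nB; left; exists 0%N => //=; exact: hN.
- move=> w; split=> nB bw; apply: nB.
    case: bw => [[[|n] _ h]|[n _ h]].
    + by right; exists 1%N => //=; rewrite sK.
    + by left; exists n => //; move: h; rewrite /= -iterS iterSr.
    + by right; exists n.+1 => //; rewrite /= -iterS iterSr sK.
  case: bw => [[n _ h]|[[|n] _ h]].
  + by left; exists n.+1 => //; move: h; rewrite /= -iterS iterSr.
  + by left; exists 1%N.
  + by right; exists n => //; move: h; rewrite /= -iterS iterSr sK.
Qed.

Variables (A : set Omega) (T : Omega -> blaschke K).
Hypotheses (mA : measurable A) (invA : forall w, A (sigma w) <-> A w)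
  (AT : forall w, A w -> selfmap s0 r' (bl_fun (T w))) (hT : measurable_family T).

(** Off A the map becomes the constant 0, which is again a selfmap. The fixed point therefore exists
    and is measurable on the whole space. *)
Definition cut w z : C := rc (\1_A w) * bl_fun (T w) z.
Definition forward w n := cut (iter n sigma w).
Definition pullback N w z := orb (forward (iter N sigmaV w)) N z.

Lemma cut_in w : A w -> cut w = bl_fun (T w).
Proof. by move=> wA; apply/funext => z; rewrite /cut indicE mem_set// rc1 mul1r. Qed.

Lemma cut_out w z : ~ A w -> cut w z = 0.
Proof. by move=> wA; rewrite /cut indicE memNset// rc0 mul0r. Qed.

Lemma cut_selfmap w : selfmap s0 r' (cut w).
Proof.
have [wA|wA] := pselect (A w); first by rewrite cut_in//; exact: AT.
move=> z z0; have -> : cut w = (fun=> 0) by apply/funext => y; exact: cut_out.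
by split; [exact: hol_cst|rewrite cabs0 ltW//; case: hrad].
Qed.

Lemma forward_selfmaps w : selfmaps s0 r' (forward w).
Proof. by move=> n; exact: cut_selfmap. Qed.

Lemma forward_pullback N w : forward (iter N sigmaV w) N = cut w.
Proof. by rewrite /forward iterVK. Qed.

Lemma pullbackS_fixed N w z : pullback N.+1 (sigma w) z = cut w (pullback N w z).
Proof. by rewrite /pullback iterSr sK /= forward_pullback. Qed.

Lemma pullbackS N w z : pullback N.+1 w z = pullback N w (cut (iter N.+1 sigmaV w) z).
Proof.
rewrite /pullback -orb_shift; congr orb; apply/funext => n.
by rewrite /forward iterSr /= sVK.
Qed.

(** Raising N only changes the starting point of the last N maps, so [orb_contract] makes the
    pullbacks a geometric Cauchy sequence whose limit is independent of the starting point. *)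
Lemma fixed_point_exists : exists x : Omega -> C, [/\ forall w, cabs (x w) <= r',
  forall w z, cabs z <= s -> pullback N w z @[N --> \oo] --> x w &
  forall w, cut w (x w) = x (sigma w)].
Proof.
have [r0 r1 r2 r3 r4] := hrad; have s_0 : 0 < s by rewrite (lt_trans r0)// (lt_trans r1).
have [B [q [B0 /andP[q0 q1] hB]]] := orb_contract hrad.
have q01 : 0 <= q < 1 by rewrite ltW.
have z0 : cabs (0 : C) <= s by rewrite cabs0 ltW.
have le_s w z : cabs z <= s -> cabs (cut w z) <= s.
  move=> zs; apply: le_trans (cut_selfmap w (le_lt_trans zs r3)).2 _.
  by rewrite ltW// (lt_trans r1).
have ex w : exists2 l : C, (fun N => pullback N w 0) @ \oo --> l &
    forall N, cabs (pullback N w 0 - l) <= B / (1 - q) * q ^+ N.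
  apply: (geo_lim B0 q01) => N; rewrite pullbackS.
  by apply: hB => //; [exact: forward_selfmaps|exact: le_s].
have /choice[x hx] w : exists l : C, (fun N => pullback N w 0) @ \oo --> l by have [l hl _] := ex w; exists l.
have cv w z : cabs z <= s -> pullback N w z @[N --> \oo] --> x w.
  move=> zs; apply/cvg_cabs_lt => e e0; have e20 : 0 < e / 2 by rewrite divr_gt0.
  have h1 : \forall N \near \oo, cabs (pullback N w 0 - x w) < e / 2 by apply: ((cvg_cabs_lt _ _).1 (hx w)).
  have [N0 hN] := geo_cvg0 B0 q01 e20.
  near=> N; have -> : pullback N w z - x w = (pullback N w z - pullback N w 0) + (pullback N w 0 - x w) by ring.
  apply: le_lt_trans (cabsD _ _) _; rewrite [e]splitr; apply: ltrD.
    apply: le_lt_trans (hB _ N _ _ (forward_selfmaps _) zs z0) _.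
    by apply: hN; near: N; exact: nbhs_infty_ge.
  by near: N.
have xr w : cabs (x w) <= r'.
  have -> : x w = x w - 0 by rewrite subr0.
  apply: (cabs_lim_le (hx w)); exists 1%N => // -[//|N] _; rewrite subr0.
  by apply: (orb_selfmap hrad N (forward_selfmaps _) _).2; exact: le_lt_trans r3.
exists x; split=> // w.
have [_ gx] := cut_selfmap w (le_lt_trans (xr w) (lt_trans (lt_trans r1 r2) r3)).
have c1 : (fun N => pullback N.+1 (sigma w) 0) @ \oo --> x (sigma w).
  by rewrite (cvg_shiftS (fun N => pullback N (sigma w) 0)); exact: cv.
have c2 : (fun N => pullback N.+1 (sigma w) 0) @ \oo --> cut w (x w).
  rewrite (funext (fun N => pullbackS_fixed N w 0)).
  apply: (@continuous_cvg _ _ _ _ _ _ (cut w) _ _ (hx w)); apply: hol_cont.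
  exact: (cut_selfmap w (le_lt_trans (xr w) (lt_trans (lt_trans r1 r2) r3))).1.
exact: (cvg_unique _ c2 c1).
Unshelve. all: by end_near. Qed.

Lemma measurable_cut (z : Omega -> C) : cmeasurable setT z -> cmeasurable setT (fun w => cut w (z w)).
Proof.
move=> cz; apply: cmM; last exact: measurable_blaschke.
by apply: cm_rc; exact: measurable_indic.
Qed.

Lemma measurable_orb N : cmeasurable setT (fun w => orb (forward w) N 0).
Proof.
elim: N => [|N IH]; first exact: cm_cst.
(* After a shift by sigma^-N the next map to apply is [cut w]; the result is shifted back
   afterwards. *)
have h := measurable_cut (cm_comp (measurable_iter N msV) IH).
have := cm_comp (measurable_iter N ms) h.
have e : (fun w => cut (iter N sigma w) (orb (forward (iter N sigmaV (iter N sigma w))) N 0)) =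
    (fun w => orb (forward w) N.+1 0).
  apply/funext => w; suff -> : iter N sigmaV (iter N sigma w) = w by [].
  by elim: N w {IH h} => [//|N IH] w; rewrite iterSr /= sK.
by rewrite e.
Qed.

Lemma measurable_fixed (x : Omega -> C) :
  (forall w z, cabs z <= s -> pullback N w z @[N --> \oo] --> x w) -> cmeasurable setT x.
Proof.
move=> hx; apply: (@cm_lim _ _ _ (fun N w => pullback N w 0)) => [N|w].
  exact: (cm_comp (measurable_iter N msV) (measurable_orb N)).
by apply: hx; rewrite cabs0; case: hrad => r0 r1 r2 _ _; rewrite ltW// (lt_trans r0)// (lt_trans r1).
Qed.

Lemma measurable_derive (x : Omega -> C) : cmeasurable setT x -> (forall w, cabs (x w) <= r') ->
  measurable_fun setT (fun w => cabs (derive1 (bl_fun (T w)) (x w))).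
Proof.
move=> mx xr; apply: measurable_cabs; have [r0 r1 r2 r3 r4] := hrad.
pose e k : C := rc k.+1%:R^-1.
(* For small k the shifted point may leave the disc; division being total, the quotient is
   measurable all the same, and only its limit matters. *)
apply: (@cm_lim _ _ _ (fun k w => (bl_fun (T w) (x w + e k) - bl_fun (T w) (x w)) * (e k)^-1)) => [k|w].
  apply: cmM; last exact: cm_cst.
  apply: cmB; apply: measurable_blaschke => //.
  by apply: cmD => //; exact: cm_cst.
have x1 : cabs (x w) <= 1 by have := xr w; lra.
have [l hl] := bl_hol (T w) x1; rewrite (cderiv_derive1 hl).
apply/cvg_cabs_lt => eps eps0; have e20 : 0 < eps / 2 by rewrite divr_gt0.
have [dl dl0 hd] := (cderivP _ _ _).1 hl _ e20.
have hk : \forall k \near \oo, k.+1%:R^-1 < dl.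
  have := @cvg_harmonic K; move=> /cvgrPdist_lt/(_ _ dl0); apply: filterS => k.
  by rewrite sub0r normrN ger0_norm// invr_ge0 ler0n.
apply: filterS hk => k kd; have k0 : 0 < k.+1%:R^-1 :> K by rewrite invr_gt0 ltr0n.
have en : e k != 0 by rewrite rc_eq0 gt_eqF.
have ek : cabs (e k) = k.+1%:R^-1 by rewrite cabs_rc gtr0_norm.
have := hd (e k); rewrite ek => /(_ kd) h.
have -> : (bl_fun (T w) (x w + e k) - bl_fun (T w) (x w)) * (e k)^-1 - l =
   (bl_fun (T w) (x w + e k) - bl_fun (T w) (x w) - l * e k) * (e k)^-1.
  by rewrite [RHS]mulrBl -[l * e k * _]mulrA mulfV// mulr1.
rewrite cabsM cabsV ek ltr_pdivrMr//; apply: le_lt_trans h _.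
by rewrite ltr_pM2r// ltr_pdivrMr// mulr_natr mulr2n ltrDl.
Qed.

End RandomFixedPoint.

(** * Orders of poles, including infinity *)

Section PoleOrders.
Variable K : realType.
Local Notation C := (Cplx K).
Implicit Types (x z a b : C) (c : nat -> C) (q F : C -> C).

Lemma punctured_limit q F a b : hol q a -> q a = b -> (forall z, z != a -> F z = q z) ->
  F z @[z --> a^'] --> b.
Proof.
move=> /hol_cont/continuous_cabsP hq qa e; apply/cvg_cabs_lt => eps eps0.
have [dl dl0 hd] := hq eps eps0.
have h : nbhs a (fun z => z != a -> cabs (F z - b) < eps).
  by apply/nbhs_cabs; exists dl => // z zd za; rewrite e// -qa; exact: hd.
exact: h.
Qed.

Lemma hol_shiftX x n z : hol (fun z => (z - x) ^+ n) z.
Proof. by apply: holX; apply: holB; [exact: hol_id|exact: hol_cst]. Qed.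

Lemma pole_order_finite x j c : c j != 0 -> (0 < j)%N ->
  pole_of_order (Some x) j.+1 (fun z => \sum_(2 <= k < j.+2) c k.-1 * ((z - x) ^+ k)^-1).
Proof.
move=> cj j0; split=> //; exists (c j) => //.
apply: (@punctured_limit (fun z => \sum_(2 <= k < j.+2) c k.-1 * (z - x) ^+ (j.+1 - k))).
- by apply: hol_sum => k _; apply: holM; [exact: hol_cst|exact: hol_shiftX].
- rewrite big_nat_recr//= big_nat big1 ?add0r => [|k /andP[_ kj]].
    by rewrite subnn expr0 mulr1.
  by rewrite addrN expr0n subn_eq0 leqNgt kj mulr0.
move=> z zx; rewrite mulr_sumr; apply: eq_big_nat => k /andP[_ kj].
have zx0 : z - x != 0 by rewrite subr_eq0.
rewrite mulrCA; congr (_ * _).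
by rewrite -{1}(subnK (kj : (k <= j.+1)%N)) exprD mulfK// expf_neq0.
Qed.

(** Each term is multiplied out against the power of the distance to the pole, and only k = j
    survives. For x = 0 the sum is a polynomial of degree j - 1 = (j + 1) - 2, of order j + 1 at
    infinity by the convention. *)
Lemma pole_order_dual x j c : c j != 0 -> (0 < j)%N ->
  pole_of_order (inv_conj x) j.+1
    (fun z => \sum_(1 <= k < j.+1) c k * (z ^+ k.-1 / (1 - cbar x * z) ^+ k.+1)).
Proof.
move=> cj j0; split=> //; rewrite /inv_conj; case: eqP => [->|/eqP x0].
  exists (c j) => //; apply: (@punctured_limit (fun u => \sum_(1 <= k < j.+1) c k * u ^+ (j - k))).
  - by apply: hol_sum => k _; apply: holM; [exact: hol_cst|apply: holX; exact: hol_id].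
  - rewrite big_nat_recr//= big_nat big1 ?add0r => [|k /andP[_ kj]].
      by rewrite subnn expr0 mulr1.
    by rewrite expr0n subn_eq0 leqNgt kj mulr0.
  move=> u u0; rewrite mulr_sumr; apply: eq_big_nat => -[//|k] /andP[_ kj].
  rewrite cbar0 mul0r subr0 expr1n divr1 mulrCA /= exprVn; congr (_ * _).
  have -> : j.+1 = ((j - k.+1) + (2 + k))%N by rewrite add2n addnS subnK.
  by rewrite !exprD; field; rewrite u0 expf_neq0.
have xb : cbar x != 0 by rewrite cbar_eq0.
set p := (cbar x)^-1; have p0 : p != 0 by rewrite invr_eq0.
exists (c j * (p ^+ j.-1 * (- cbar x)^-1 ^+ j.+1)).
  by rewrite !mulf_neq0// expf_neq0// invr_eq0 oppr_eq0.
apply: (@punctured_limit (fun z => \sum_(1 <= k < j.+1)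
    c k * (z ^+ k.-1 * (- cbar x)^-1 ^+ k.+1 * (z - p) ^+ (j - k)))).
- apply: hol_sum => k _; apply: holM; first exact: hol_cst.
  apply: holM; last exact: hol_shiftX.
  by apply: holM; [apply: holX; exact: hol_id|exact: hol_cst].
- rewrite big_nat_recr//= big_nat big1 ?add0r => [|k /andP[_ kj]].
    by rewrite subnn expr0 mulr1.
  by rewrite addrN expr0n subn_eq0 leqNgt kj !mulr0.
move=> z zp; rewrite mulr_sumr; apply: eq_big_nat => k /andP[_ kj].
have zp0 : z - p != 0 by rewrite subr_eq0.
have -> : 1 - cbar x * z = - cbar x * (z - p).
  by rewrite mulrBr mulNr /p mulNr mulfV// opprK addrC.
rewrite mulrCA exprMn invfM -exprVn; congr (_ * _).
have kj' : (k <= j)%N by [].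
have -> : (z - p) ^+ j.+1 = (z - p) ^+ (j - k) * (z - p) ^+ k.+1 by rewrite -exprD addnS subnK.
have q0 : (z - p) ^+ k.+1 != 0 by rewrite expf_neq0.
move: ((- cbar x)^-1 ^+ k.+1) ((z - p) ^+ (j - k)) ((z - p) ^+ k.+1) (z ^+ k.-1) q0 => u v y t y0.
by field.
Qed.

End PoleOrders.

(** * From the random cocycle to orbits in one fibre *)

Section Cocycle.
Variables (K : realType) (d : measure_display) (Omega : measurableType d).
Variables (P : probability Omega K) (sigma sigmaV : Omega -> Omega).
Hypothesis hsigma : invertible_ergodic P sigma sigmaV.
Variables (R s s0 r' : K).
Hypothesis hrad : [/\ 0 < r', r' < R, R < s, s < s0 & s0 < 1].
Local Notation C := (Cplx K).
Implicit Types (w : Omega) (z : C).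
Variables (A : set Omega) (T : Omega -> blaschke K) (x : Omega -> C).
Hypotheses (mA : measurable A) (invA : forall w, A (sigma w) <-> A w)
  (AT : forall w, A w -> selfmap s0 r' (bl_fun (T w))) (xr : forall w, cabs (x w) <= r')
  (hx : forall w, cut A T w (x w) = x (sigma w)).
Local Notation L := (fun w => perron_frobenius R (T w)).
Local Notation fwd := (forward sigma A T).

Let fS w : selfmaps s0 r' (fwd w). Proof. exact: (forward_selfmaps sigma hrad AT). Qed.

Lemma perron_Lop w f : A w -> hardy R f -> L w f = Lop R s (fwd w 0%N) f.
Proof.
move=> wA hf; rewrite /forward /= (cut_in T wA).
exact: (perron_frobenius_spec hrad (AT wA) hf).2.
Qed.

Lemma iter_in n w : A w -> A (iter n sigma w).
Proof. by move=> wA; elim: n => [//|n IH]; apply/invA. Qed.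

Lemma cocycle_push n w f : A w -> hardy R f -> cocycle sigma L n w f = push R s (fwd w) n f.
Proof.
move=> wA hf; elim: n => [//|n IH] /=; rewrite IH.
have An := iter_in n wA; have hp := push_hardy hrad (fS w) n hf.
rewrite (perron_frobenius_spec hrad (AT An) hp).2 -(cut_in T An).
case: n IH An hp => [|n] _ An hp; first by [].
exact: (Lop_comp hrad (orb_selfmap hrad n (fS w)) (cut_selfmap hrad AT _) hf).
Qed.

Lemma orb_fixed n w : orb (fwd w) n (x w) = x (iter n sigma w).
Proof. by elim: n => [//|n /= ->]; exact: hx. Qed.

Definition speed w := cabs (derive1 (bl_fun (T w)) (x w)).

Lemma mult_speed n w : A w -> cabs (mult (fwd w) (x w) n) = speed (iter n sigma w).
Proof. by move=> wA; rewrite /mult orb_fixed /forward cut_in//; exact: iter_in. Qed.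

Lemma speed_ge0 w : 0 <= speed w. Proof. exact: cabs_ge0. Qed.

Lemma speed_bounded w : speed w <= s / ((s - r') * (s - r')).
Proof.
have [r0 r1 r2 r3 r4] := hrad; have hT z : cabs z < 1 -> hol (bl_fun (T w)) z.
  by move=> z1; apply: bl_hol; exact: ltW.
have xs : cabs (x w) < s by rewrite (le_lt_trans (xr w))// (lt_trans r1).
have ss : s < 1 by rewrite (lt_trans r3).
have s0' : 0 < s by rewrite (le_lt_trans (cabs_ge0 _) xs).
have b1 z : cabs z = s -> cabs (bl_fun (T w) z) <= 1 by move=> zs; apply: bl_le1; rewrite zs ltW.
have := dq_bound hT xs xs ss b1; rewrite dqyy mulr1 => /le_trans; apply.
have dr : 0 < s - r' by rewrite subr_gt0 (lt_trans r1).
have dx : s - r' <= s - cabs (x w) by rewrite lerD2l lerN2.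
rewrite ler_wpM2l ?(ltW s0')// lef_pV2 ?posrE ?mulr_gt0 ?subr_gt0 ?(lt_trans r1)//.
by rewrite ler_pM// ltW.
Qed.

Lemma birkhoff_prod (c : K) n w : A w -> (forall k, 0 < speed (iter k sigma w) + c) ->
  \prod_(k < n) (cabs (mult (fwd w) (x w) k) + c) =
  expR (birkhoff sigma (fun w => ln (speed w + c)) n w).
Proof.
move=> wA h; rewrite /birkhoff expR_sum; apply: eq_bigr => k _.
by rewrite mult_speed// lnK// posrE.
Qed.

Lemma regular_fibre (l : K) w : A w -> l < 0 -> (forall k, speed (iter k sigma w) != 0) ->
  (forall e : K, 0 < e -> exists B : K, forall n,
     birkhoff sigma (fun w => ln (speed w)) n w <= B + n%:R * (l + e) /\
     - birkhoff sigma (fun w => ln (speed w)) n w <= B + n%:R * (- l + e)) ->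
  regular (fwd w) (x w) l.
Proof.
move=> wA l0 sp0 hb; have sp k : 0 < speed (iter k sigma w) by rewrite lt0r sp0 speed_ge0.
have pE n : cabs (mult_prod (fwd w) (x w) n) = expR (birkhoff sigma (fun w => ln (speed w)) n w).
  have -> : cabs (mult_prod (fwd w) (x w) n) = \prod_(k < n) cabs (mult (fwd w) (x w) k) by exact: cabs_prod.
  rewrite /birkhoff expR_sum; apply: eq_bigr => k _.
  by rewrite mult_speed// lnK// posrE.
split=> //.
- by move=> n; rewrite -cabs_eq0 mult_speed.
- move=> e e0; have [B hB] := hb e e0; exists (expR B); first exact: expR_ge0.
  move=> n; rewrite pE ger0_norm ?expR_ge0// -expRM_natl -expRD ler_expR.
  exact: (hB n).1.
- move=> e e0; have [B hB] := hb e e0; exists (expR B); first exact: expR_ge0.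
  move=> n; rewrite pE -expRN ger0_norm ?expR_ge0// -expRM_natl -expRD ler_expR.
  exact: (hB n).2.
Qed.

Lemma superfast_fibre w : A w ->
  (forall M : K, exists2 c : K, 0 < c & exists B : K, forall n,
    birkhoff sigma (fun w => ln (speed w + c)) n w <= B + n%:R * M) ->
  forall M : K, exists2 c : K, 0 < c &
    rate (fun n => \prod_(k < n) (cabs (mult (fwd w) (x w) k) + c)) M.
Proof.
move=> wA h M; have [c c0 [B hB]] := h M; exists c => //.
apply: (@rateP _ _ M M (expR B) (expR_ge0 B) (lexx M)) => n.
have pos k : 0 < speed (iter k sigma w) + c by rewrite ltr_wpDl ?speed_ge0.
by rewrite birkhoff_prod// ger0_norm ?expR_ge0// -expRM_natl -expRD ler_expR.
Qed.

Lemma equil_simple w z : annulus R z -> equil (x w) z =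
  simple_fraction (Some (x w)) z - simple_fraction (inv_conj (x w)) z.
Proof.
move=> hz; have /andP[_ zr] := annulus_radii hrad hz.
rewrite /equil /simple_fraction /inv_conj; case: eqP => [->|/eqP x0].
  by rewrite cbar0 mul0r !subr0 addr0.
congr (_ + _); have n1 := equil_den hrad (xr w) zr.
have u0 : cbar (x w) != 0 by rewrite cbar_eq0.
move: (cbar (x w)) n1 u0 => u n1 u0.
have -> : z - u^-1 = - ((1 - u * z) / u) by field.
by rewrite invrN opprK invf_div.
Qed.

Hypothesis mx : cmeasurable setT x.
Hypothesis mspeed : measurable_fun setT speed.

(* Schwarz-Pick on the disc of radius R, written with a coboundary of log (R^2 - |x|^2). *)
Lemma speed_pick (r M : K) w : A w -> (forall z, cabs z <= R -> cabs (bl_fun (T w) z) <= r) ->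
  (forall w, cabs (x w) <= r) -> r < M -> M <= R ->
  speed w <= M / R * ((R ^+ 2 - cabs (x (sigma w)) ^+ 2) / (R ^+ 2 - cabs (x w) ^+ 2)).
Proof.
move=> wA Tr xrr rM MR; have [r0 r1 r2 r3 r4] := hrad; have R0 := lt_trans r0 r1.
have r00 : 0 <= r := le_trans (cabs_ge0 _) (xrr w); have M0 := le_lt_trans r00 rM.
have R1 : R < 1 by rewrite (lt_trans r2)// (lt_trans r3).
have gx : bl_fun (T w) (x w) = x (sigma w) by rewrite -hx cut_in.
have xR : cabs (x w) < R by rewrite (le_lt_trans (xrr w))// (lt_le_trans rM).
have gM : cabs (bl_fun (T w) (x w)) < M by rewrite gx (le_lt_trans (xrr _)).
have := schwarz_pick_derive R0 M0 _ _ xR gM; rewrite gx -/(speed w) => h.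
have {}h : M * (R ^+ 2 - cabs (x w) ^+ 2) * speed w <= R * (M ^+ 2 - cabs (x (sigma w)) ^+ 2).
  apply: h => z zR; first by apply: bl_hol; rewrite ltW// (lt_trans zR).
  by apply: le_trans (Tr z (ltW zR)) (ltW rM).
set X := cabs (x w) ^+ 2 in h *; set Y := cabs (x (sigma w)) ^+ 2 in h *.
have X0 : 0 < R ^+ 2 - X by rewrite subr_gt0 ltrXn2r ?cabs_ge0// ltW.
have Y0 : 0 <= Y by exact: sqr_ge0.
have MR2 : M ^+ 2 <= R ^+ 2 by rewrite lerXn2r ?nnegrE ?(ltW M0) ?(ltW R0).
rewrite mulrA ler_pdivlMr// mulrAC ler_pdivlMr//.
rewrite -(ler_pM2l M0); apply: (@le_trans _ _ (R * (R * (M ^+ 2 - Y)))).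
  by rewrite [M * _](_ : _ = R * (M * (R ^+ 2 - X) * speed w)); [rewrite ler_wpM2l ?(ltW R0)|ring].
rewrite -subr_ge0; have -> : M * (M * (R ^+ 2 - Y)) - R * (R * (M ^+ 2 - Y)) = (R ^+ 2 - M ^+ 2) * Y by ring.
by rewrite mulr_ge0// subr_ge0.
Qed.

End Cocycle.

(** * The Lyapunov exponent and the two kinds of spectrum *)

Section Spectrum.
Variables (K : realType) (d : measure_display) (Omega : measurableType d).
Variables (P : probability Omega K) (sigma sigmaV : Omega -> Omega).
Hypothesis hsigma : invertible_ergodic P sigma sigmaV.
Variables (R s s0 r' : K).
Hypothesis hrad : [/\ 0 < r', r' < R, R < s, s < s0 & s0 < 1].
Local Notation C := (Cplx K).
Implicit Types (w : Omega) (z : C).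
Variables (A : set Omega) (T : Omega -> blaschke K) (x : Omega -> C) (r : K).
Hypotheses (mA : measurable A) (PA : P (~` A) = 0%E) (invA : forall w, A (sigma w) <-> A w)
  (AT : forall w, A w -> selfmap s0 r' (bl_fun (T w)))
  (Tr : forall w, A w -> forall z, cabs z <= R -> cabs (bl_fun (T w) z) <= r)
  (xr : forall w, cabs (x w) <= r) (rr' : r < r')
  (hx : forall w, cut A T w (x w) = x (sigma w)) (mx : cmeasurable setT x)
  (mspeed : measurable_fun setT (speed T x)).
Local Notation L := (fun w => perron_frobenius R (T w)).
Local Notation fwd := (forward sigma A T).
Local Notation sp := (speed T x).

Let R0 : 0 < R. Proof. by case: hrad => h1 h2 _ _ _; exact: lt_trans h2. Qed.
Let xr' w : cabs (x w) <= r'. Proof. exact: le_trans (xr w) (ltW rr'). Qed.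
Let fS w : selfmaps s0 r' (fwd w). Proof. exact: (forward_selfmaps sigma hrad AT). Qed.
Let sp0 w : 0 <= sp w. Proof. exact: speed_ge0. Qed.
Let spD w : sp w <= s / ((s - r') * (s - r')). Proof. exact: (speed_bounded hrad T xr'). Qed.

Lemma ae_full (Q : Omega -> Prop) : (forall w, A w -> Q w) -> {ae P, forall w, Q w}.
Proof.
move=> h; exists (~` A); split => //; first exact: measurableC.
by move=> w /= nQ wA; apply: nQ; exact: h.
Qed.

Local Notation Lambda := (\int[P]_w lne (sp w)%:E)%E.

(** The logarithm is bounded above by |log (D + 1)|, so only the value minus infinity could prevent
    integrability. *)
Lemma lne_integrable (u : Omega -> K) (D : K) : measurable_fun setT u -> (forall w, 0 <= u w) ->
  (forall w, u w <= D) -> (\int[P]_w lne (u w)%:E != -oo)%E ->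
  P.-integrable setT (fun w => lne (u w)%:E).
Proof.
move=> mu u0 uD fin; have mf := measurable_lne_comp mu u0; pose f w := lne (u w)%:E.
pose top := `|ln (D + 1)|; have top0 : 0 <= top by exact: normr_ge0.
have f_top w : (f w <= top%:E)%E.
  rewrite /f; move: (u0 w) (uD w); rewrite le_eqVlt => /predU1P[<-|p] uDw.
    by rewrite le0_lneNy// leNye.
  have D1 : 0 < D + 1 by lra.
  rewrite lne_EFin// lee_fin (le_trans _ (ler_norm _))// ler_ln ?posrE//; lra.
have pfin : (\int[P]_w f^\+ w <= top%:E)%E.
  have -> : top%:E = (\int[P]_w top%:E)%E by rewrite integral_prob_cst.
  apply: ge0_le_integral => //; first exact: measurable_funepos.
  by move=> w _; rewrite funeposE ge_max f_top lee_fin.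
have p0 : (0 <= \int[P]_w f^\+ w)%E by apply: integral_ge0.
have n0 : (0 <= \int[P]_w f^\- w)%E by apply: integral_ge0.
have pf : (\int[P]_w f^\+ w)%E \is a fin_num by rewrite ge0_fin_numE// (le_lt_trans pfin)// ltry.
have nfin : (\int[P]_w f^\- w < +oo)%E.
  rewrite ltNge leye_eq; apply/negP => /eqP h; move/negP: fin; apply.
  by rewrite -/(f) integralE h -(fineK pf).
apply/integrableP; split=> //.
have -> : (\int[P]_w `|f w| = \int[P]_w (f^\+ w + f^\- w))%E.
  by apply: eq_integral => w _; have := congr1 (fun h => h w) (fune_abse f).
rewrite ge0_integralD//; [|exact: measurable_funepos|exact: measurable_funeneg].
by rewrite lte_add_pinfty// (le_lt_trans pfin)// ltry.
Qed.

(** [speed_pick] bounds the logarithm of the speed by log (M/R) plus a coboundary, which integrates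
    to 0. Schwarz-Pick wants M > r strictly, so M = r + R/(k + 1) is used and k tends to
    infinity. *)
Lemma exponent_le : (Lambda <= lne (r / R)%:E)%E.
Proof.
have [->|fin] := eqVneq Lambda -oo%E; first exact: leNye.
have r0 w : 0 <= r by exact: le_trans (cabs_ge0 _) (xr w).
have [r'0 r'R Rs ss s1] := hrad.
(* Off A the logarithm of u is minus infinity, so the pointwise bound holds everywhere and not only
   almost everywhere. *)
pose u w := \1_A w * sp w.
have i01 w : 0 <= (\1_A w : K) <= 1 by rewrite indicE; case: (w \in A); rewrite ?lexx ?ler01.
have mu : measurable_fun setT u by apply: measurable_funM => //; exact: measurable_indic.
have u0 w : 0 <= u w by have /andP[h _] := i01 w; rewrite mulr_ge0.
have uD w : u w <= s / ((s - r') * (s - r')).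
  by apply: le_trans (spD w); have /andP[h h1] := i01 w; rewrite ler_piMl.
have uE : (\int[P]_w lne (u w)%:E)%E = Lambda.
  apply: ae_eq_integral => //; [exact: (measurable_lne_comp mu u0)|exact: (measurable_lne_comp mspeed sp0)|].
  by apply: ae_full => w wA _; rewrite /u indicE mem_set// mul1r.
have iu : P.-integrable setT (fun w => lne (u w)%:E) by apply: (lne_integrable mu u0 uD); rewrite uE.
have [w0|noW] := pselect (exists w : Omega, True); last first.
  have : P setT = 0%E by rewrite (_ : setT = set0) ?measure0//; apply/seteqP; split=> // w _; case: noW; exists w.
  by rewrite probability_setT => /eqP; rewrite onee_eq0.
have {}r0 : 0 <= r by case: w0 => w _; exact: r0 w.
have rR : r < R by exact: lt_trans r'R.
have W0 : 0 < R ^+ 2 - r ^+ 2 by rewrite subr_gt0 ltrXn2r// ltW.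
(* Normalised to be at least 1, so that [phi] is nonnegative, as the invariance lemma
   [ge0_integral_shift] requires. *)
pose W w := (R ^+ 2 - cabs (x w) ^+ 2) / (R ^+ 2 - r ^+ 2).
have W1 w : 1 <= W w.
  by rewrite ler_pdivlMr// mul1r lerD2l lerN2 lerXn2r ?nnegrE ?cabs_ge0.
have Wp w : 0 < W w := lt_le_trans ltr01 (W1 w).
pose phi w := ln (W w).
have phi0 w : 0 <= phi w by exact: ln_ge0.
have mphi : measurable_fun setT phi.
  apply: (measurableT_comp (@measurable_ln K)); apply: measurable_funM; last exact: measurable_cst.
  by apply: measurable_funB; [exact: measurable_cst|exact: measurable_sqabs].
have phiB w : `|phi w| <= ln (R ^+ 2 / (R ^+ 2 - r ^+ 2)).
  have p2 : 0 < R ^+ 2 / (R ^+ 2 - r ^+ 2) by rewrite divr_gt0 ?exprn_gt0.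
  rewrite (ger0_norm (phi0 w)) (ler_ln (Wp w) p2).
  by rewrite ler_wpM2r ?invr_ge0 ?(ltW W0)// gerBl sqr_ge0.
have iphi : P.-integrable setT (EFin \o phi) by exact: (bounded_integrable P mphi phiB).
have isphi := integrable_shift hsigma iphi.
have key k : k.+1%:R^-1 <= (R - r) / R -> (Lambda <= (ln (r / R + k.+1%:R^-1))%:E)%E.
  move=> hk; have k0 : 0 < k.+1%:R^-1 :> K by rewrite invr_gt0 ltr0n.
  pose M := r + R * k.+1%:R^-1.
  have rM : r < M by rewrite ltrDl mulr_gt0.
  have MR : M <= R by rewrite /M -lerBrDl mulrC -ler_pdivlMr.
  have ME : M / R = r / R + k.+1%:R^-1 by rewrite /M mulrDl mulrAC mulfV ?mul1r// gt_eqF.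
  rewrite -ME -uE; set c := ln (M / R).
  have M0 : 0 < M / R by rewrite divr_gt0// (le_lt_trans r0).
  have ic := finite_measure_integrable_cst P c measurableT.
  have ipsi := integrableB measurableT (integrableD measurableT ic isphi) iphi.
  apply: (@le_trans _ _ (\int[P]_w ((c%:E + (phi (sigma w))%:E) - (phi w)%:E))%E).
    apply: le_integral => // w _.
    have -> : ((c%:E + (phi (sigma w))%:E) - (phi w)%:E = (c + phi (sigma w) - phi w)%:E)%E by [].
    have [wA|nA] := pselect (A w); last first.
      by rewrite /u indicE memNset// mul0r le0_lneNy// leNye.
    rewrite /u indicE mem_set// mul1r.
    have h := speed_pick hrad hx wA (Tr wA) xr rM MR.
    have h2 : sp w <= M / R * (W (sigma w) / W w).
      apply: le_trans h _; rewrite le_eqVlt; apply/orP; left; apply/eqP; congr (_ * _).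
      have Xn : R ^+ 2 - cabs (x w) ^+ 2 != 0.
        by apply/eqP => e; have := Wp w; rewrite /W e mul0r ltxx.
      rewrite /W; move: Xn (R ^+ 2 - cabs (x (sigma w)) ^+ 2) W0; move: (R ^+ 2 - cabs (x w) ^+ 2) (R ^+ 2 - r ^+ 2) => a b a0 e b0.
      by field; rewrite a0 gt_eqF.
    move: (sp0 w); rewrite le_eqVlt => /predU1P[<-|spp]; first by rewrite le0_lneNy// leNye.
    rewrite lne_EFin// lee_fin /phi /c -addrA.
    have W2 : 0 < W (sigma w) / W w := divr_gt0 (Wp _) (Wp _).
    rewrite -(ln_div (Wp (sigma w)) (Wp w)) -(lnM M0 W2) (ler_ln spp (mulr_gt0 M0 W2)).
    exact: h2.
  rewrite (integralB measurableT (integrableD measurableT ic isphi) iphi).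
  rewrite (integralD measurableT ic isphi) integral_prob_cst.
  have -> : (\int[P]_w (phi (sigma w))%:E = \int[P]_w (phi w)%:E)%E.
    apply: (ge0_integral_shift hsigma (F := fun w => (phi w)%:E)); first exact/measurable_EFinP.
    by move=> w; rewrite lee_fin.
  by rewrite addeK// integrable_fin_num.
have cv := @ln_shift_cvg K (r / R) (divr_ge0 r0 (ltW R0)).
rewrite -[X in (_ <= X)%E](cvg_lim (@ereal_hausdorff K) cv).
apply: lime_ge; first by apply/cvg_ex; eexists; exact: cv.
have q0 : 0 < (R - r) / R by rewrite divr_gt0// subr_gt0.
have := @cvg_harmonic K; move=> /cvgrPdist_lt/(_ _ q0); apply: filterS => k.
rewrite sub0r normrN ger0_norm ?invr_ge0 ?ler0n// => hk.
exact: key (ltW hk).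
Qed.

Let push_growth w f : A w -> hardy R f ->
  growth R sigma L w f = (fun n => n%:R^-1%:E * lne (hardy_norm R (push R s (fwd w) n f))%:E)%E.
Proof.
by move=> wA hf; apply/funext => n; rewrite /growth (cocycle_push hrad invA AT n wA hf).
Qed.

Let op_limit w : A w ->
  (n%:R^-1%:E * lne (op_norm R (cocycle sigma L n w)))%E @[n --> \oo] --> 0%:E.
Proof.
move=> wA; have h := op_norm_cvg hrad (fS w).
have e : (fun n => n%:R^-1%:E * lne (op_norm R (cocycle sigma L n w)))%E =
    (fun n => n%:R^-1%:E * lne (op_norm R (push R s (fwd w) n)))%E.
  apply/funext => n; rewrite (eq_op_norm (F' := push R s (fwd w) n))// => f hf.
  exact: (cocycle_push hrad invA AT n wA hf).
by rewrite e.
Qed.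

Let image_eq w (V : set (C -> C)) : A w -> V `<=` hardy R -> L w @` V = Lop R s (fwd w 0%N) @` V.
Proof.
move=> wA hV; apply/seteqP; split=> _ [f Vf <-]; exists f => //.
  exact: esym (perron_Lop sigma hrad AT wA (hV _ Vf)).
exact: (perron_Lop sigma hrad AT wA (hV _ Vf)).
Qed.

Let Lop_scale (G : C -> C) (c : C) (f : C -> C) : selfmap s0 r' G -> hardy R f ->
  Lop R s G (c *: f) = c *: Lop R s G f.
Proof.
have R1 : R < 1 by case: hrad => _ _ h1 h2 h3; exact: lt_trans h1 (lt_trans h2 h3).
move=> hG hf; have hf0 := hardyZ R0 R1 hf 0 hf; rewrite scale0r in hf0.
have e := Lop_lin hrad (-1) hG hf0 hf0; rewrite scaler0 addr0 in e.
have {}e : Lop R s G 0 = 0 by rewrite e scaleN1r addNr.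
by have := Lop_lin hrad c hG hf hf0; rewrite e !addr0.
Qed.

(** Both alternatives give superexponential decay on the hyperplane of functions with zero pairing
    with 1, and the equilibrium spans an invariant complement. The decomposition is read off at
    level 0 of the linear orbit about x w, where the spaces depend on x w only. *)
Lemma trivial_case :
  Lambda = -oo%E \/ (0 < P [set w | (sp w = 0)%R])%E -> trivial_spectrum R P sigma L.
Proof.
move=> hu; have hsf := birkhoff_superfast hsigma mspeed sp0 spD hu.
pose c := (r' - r) / 2; pose fk w := fun _ : nat => linear_map (x w) c.
have fk1 w := (linear_regular hrad (xr w) rr').1; have fk2 w := (linear_regular hrad (xr w) rr').2.
have x0E w : x (sigma w) = fwd w 0%N (x w) by rewrite -hx.
have fastP w f : fastsp R s (fk w) (x w) 0 f <-> hardy R f /\ pair s f (fun=> 1) = 0.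
  have e1 g y : coef s g y 0 f = pair s f (fun=> 1) by exact: (coef0 hrad).
  split=> [[hf f0]|[hf f0]]; split=> //; first by have [] := f0 0%N isT; rewrite /al e1.
  move=> i; rewrite leqn0 => /eqP ->.
  by rewrite (be0 hrad (fk w) (x w) hf) /al e1.
exists (fun i w => slowsp R s (fk w) (x w) i), (fun i w => fastsp R s (fk w) (x w) i).
split.
- by [].
- by case=> [|i]; [left; rewrite ltNyr|right].
- by apply: ae_full => w wA; exact: op_limit.
- by [].
- case=> // _; apply: ae_full => w wA.
  have sub := slowsp_subspace hrad (fk1 w) (xr' w) 0; have [hV _ _] := sub.
  split=> //; first exact: (slowsp_dim hrad (fk1 w) (xr' w) (fk2 w) 0).
    rewrite (image_eq wA hV); have hv := vzero_hardy hrad (fk1 w) (xr' w).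
    have Z a : Lop R s (fwd w 0%N) (a *: vzero R (x w)) = a *: vzero R (x (sigma w)).
      by rewrite (Lop_scale a (fS w 0%N) hv) (Lop_vzero hrad (fS w) (xr' w)) -x0E.
    apply/seteqP; split=> [_ [f /lin_span1P[a ->] <-]|f /lin_span1P[a ->]].
      by apply/lin_span1P; exists a; exact: Z.
    by exists (a *: vzero R (x w)); [apply/lin_span1P; exists a|exact: Z].
  move=> f Vf fn0; have hf := hV _ Vf; rewrite (push_growth wA hf).
  apply: (pair_one_growth hrad (fS w) hf); apply/eqP => p0; apply: fn0.
  have [ff1 ff2] : al s (fk w) (x w) 0 f = 0 /\ be s (fk w) (x w) 0 f = 0.
    by have [_ h] := (fastP w f).2 (conj hf p0); exact: (h 0%N isT).
  exact: (slowsp_eq0 hrad (fk1 w) (xr' w) (fk2 w) Vf).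
- case=> // _; apply: filterS2 (ae_full (fun w h => h)) hsf => w wA hw.
  split.
  + exact: (fastsp_subspace hrad (fk1 w) (xr' w) (fk2 w)).
  + exact: (fastsp_closed hrad (fk1 w) (xr' w) (fk2 w)).
  + exact: (fibre_decomposition hrad (fk1 w) (xr' w) (fk2 w) 0).
  + move=> _ [f /fastP[hf f0] <-]; apply/fastP; rewrite (perron_Lop sigma hrad AT wA hf).
    split; first exact: (Lop_hardy hrad (fS w 0%N) hf).
    by rewrite (pair_Lop hrad (fS w 0%N) hf)// => z _; exact: hol_cst.
  + move=> f /fastP[hf f0]; rewrite (push_growth wA hf).
    apply: (superfast_growth hrad (fS w) (xr' w) hf f0).
    exact: (superfast_fibre invA hx wA hw).
Qed.

Lemma lne_lt1 (u : K) : u < 1 -> (lne u%:E < 0)%E.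
Proof.
move=> u1; have [u0|u0] := leP u 0; first by rewrite le0_lneNy// ltNy0.
by rewrite lne_EFin// lte_fin ln_lt0// u0.
Qed.

Lemma generic_case (l : K) : Lambda = l%:E -> l < 0 -> P [set w | sp w = 0] = 0%E ->
  exists V F : nat -> Omega -> set (C -> C),
    oseledets_splitting R P sigma L (fun n => n%:R%:E * Lambda)%E
      (fun n => if n == 0%N then 1%N else 2%N) V F /\
    {ae P, forall w, V 0%N w = lin_span [:: restrict_annulus R
         (fun z => simple_fraction (Some (x w)) z - simple_fraction (inv_conj (x w)) z)] /\
       forall j : nat, (1 <= j)%N -> exists a b : nat -> C,
         let g := fun z => \sum_(2 <= k < j.+2) a k * ((z - x w) ^+ k)^-1 in
         let h := fun z => \sum_(1 <= k < j.+1)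
           b k * (z ^+ k.-1 / (1 - cbar (x w) * z) ^+ k.+1) in
         [/\ pole_of_order (Some (x w)) j.+1 g, pole_of_order (inv_conj (x w)) j.+1 h &
             V j w = lin_span [:: restrict_annulus R g; restrict_annulus R h]]}.
Proof.
move=> lE l0 P0; pose f w := ln (sp w).
have iL : P.-integrable setT (fun w => lne (sp w)%:E) by apply: (lne_integrable mspeed sp0 spD); rewrite lE.
have hne : {ae P, forall w, sp w != 0}.
  exists [set w | sp w = 0]; split=> //.
    have -> : [set w | sp w = 0] = setT `&` sp @^-1` [set 0] by rewrite setTI.
    exact: mspeed.
  by move=> w /= /negP/negPn/eqP.
have mf : measurable_fun setT f by exact: (measurableT_comp (@measurable_ln K) mspeed).
have fi : P.-integrable setT (EFin \o f).
  apply: (le_integrable measurableT _ _ iL); first exact/measurable_EFinP.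
  (* At speed 0 the real [ln] has the default value 0, which is dominated by the infinite absolute
     value of [lne]. *)
  move=> w _; have [e|n0] := eqVneq (sp w) 0.
    by rewrite /comp /f e ln0// abse0; exact: abse_ge0.
  by rewrite /comp /f lne_EFin// lt0r n0 sp0.
have fL : (\int[P]_w (f w)%:E = l%:E)%E.
  rewrite -lE; apply: ae_eq_integral => //.
  - exact/measurable_EFinP.
  - exact: (measurable_lne_comp mspeed sp0).
  - by apply: filterS hne => w n0 _; rewrite lne_EFin// lt0r n0 sp0.
have hb := birkhoff_rate hsigma fi fL.
(* Regularity concerns the multipliers along the whole orbit, so nonvanishing is needed at every
   iterate. *)
have [B [mB PB hB iB]] := invariant_full hsigma hne.
have aeB : {ae P, forall w, B w} by exists (~` B); split=> //; exact: measurableC.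
have aeA : {ae P, forall w, A w} by apply: ae_full.
have reg : {ae P, forall w, A w /\ regular (fwd w) (x w) l}.
  apply: filterS3 aeA aeB hb => w wA wB hw; split=> //.
  apply: (regular_fibre invA hx wA l0) => // k; apply: hB.
  by elim: k => [//|k IH]; apply/iB.
have fsh w : fwd (sigma w) = (fun n => fwd w n.+1) by apply/funext => n; rewrite /forward iterSr.
have x0E w : x (sigma w) = fwd w 0%N (x w) by rewrite -hx.
have fE : (fun n : nat => n%:R%:E * Lambda)%E = (fun n : nat => (n%:R * l)%:E) by apply/funext => n; rewrite lE.
rewrite fE.
exists (fun i w => slowsp R s (fwd w) (x w) i), (fun i w => fastsp R s (fwd w) (x w) i); split.
  split.
  - by [].
  - by move=> i; left; rewrite lte_fin ltr_nM2r// ltr_nat.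
  - apply: filterS aeA => w wA; have h := op_limit wA.
    have e0 : 0%:E = (0%:R * l)%:E by rewrite mul0r.
    by rewrite e0 in h; exact: h.
  - by case.
  - move=> j _; apply: filterS reg => w [wA hL].
    have sub := slowsp_subspace hrad (fS w) (xr' w) j; have [hV _ _] := sub.
    split=> //; first exact: (slowsp_dim hrad (fS w) (xr' w) hL j).
      rewrite (image_eq wA hV) (slowsp_image hrad (fS w) (xr' w) hL j).
      by rewrite fsh x0E.
    move=> u Vu un0; rewrite (push_growth wA (hV _ Vu)).
    exact: (slowsp_growth hrad (fS w) (xr' w) hL Vu un0).
  - move=> j _; apply: filterS reg => w [wA hL].
    have sub := fastsp_subspace hrad (fS w) (xr' w) hL j; have [hF _ _] := sub.
    split=> //.
    + exact: (fastsp_closed hrad (fS w) (xr' w) hL).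
    + exact: (fibre_decomposition hrad (fS w) (xr' w) hL j).
    + rewrite (image_eq wA hF) fsh x0E; exact: (fastsp_image hrad (fS w) (xr' w) hL).
    + move=> u Fu; rewrite (push_growth wA (hF _ Fu)).
      exact: (fastsp_growth hrad (fS w) (xr' w) hL Fu).
apply: filterS reg => w [wA hL]; split.
  have -> : restrict_annulus R (fun z => simple_fraction (Some (x w)) z -
      simple_fraction (inv_conj (x w)) z) = vzero R (x w); last by [].
  by apply: restrict_ext => z hz; exact: esym (equil_simple hrad xr' w hz).
case=> // j _; pose c := dual_coefs s (fwd w) (x w) j.+1.
have [cj _] := dual_coefsP hrad (fS w) (xr' w) hL (isT : (0 < j.+1)%N).
(* The first sum is indexed by the order of the pole and [pole] by the order minus one; the
   coefficients of the reflected function are conjugated. *)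
exists (fun k => c k.-1), (fun k => cbar (c k)); split.
- by apply: (@pole_order_finite _ (x w) j.+1 c) => //; rewrite /c cj oner_eq0.
- by apply: (@pole_order_dual _ (x w) j.+1 (fun k => cbar (c k))) => //; rewrite /c cj cbar1 oner_eq0.
have e1 : restrict_annulus R (fun z => \sum_(2 <= k < j.+3) c k.-1 * ((z - x w) ^+ k)^-1) =
    vpole R s (fwd w) (x w) j.+1.
  by apply: restrict_ext => z hz; rewrite big_add1.
have e2 : restrict_annulus R (fun z => \sum_(1 <= k < j.+2)
    cbar (c k) * (z ^+ k.-1 / (1 - cbar (x w) * z) ^+ k.+1)) = vdual R s (fwd w) (x w) j.+1.
  apply: restrict_ext => z hz; have z0 : z != 0.
    by apply: contraTneq hz => ->; apply/negP; rewrite /annulus /= cabs0; move=> /andP[]; rewrite ltNge ltW.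
  by rewrite (refl_polar (x w) c j.+1 z0).
by rewrite e1 e2.
Qed.

End Spectrum.

(** * Choice of the invariant set and of the radii, and assembly of the three cases *)

Theorem theorem1 (K : realType) (d : measure_display) (Omega : measurableType d)
    (P : probability Omega K) (sigma sigmaV : Omega -> Omega)
    (hsigma : invertible_ergodic P sigma sigmaV)
    (R : K) (hR0 : 0 < R) (hR1 : R < 1)
    (T : Omega -> blaschke K) (hT : measurable_family T)
    (r : K) (hr : ess_sup P (fun w => (bl_max (T w) R)%:E) = r%:E)
    (hrR : r < R) :
  let L := fun w => perron_frobenius R (T w) in
  (* the cocycle acts on H^2(A_R) and is compact *)
  {ae P, forall w f, hardy R f -> is_perron_frobenius R (T w) f (L w f)} /\
  compact_cocycle R P L /\
  exists x : Omega -> Cplx K,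
    let critical := [set w | derive1 (bl_fun (T w)) (x w) = 0] in
    (* (1) *)
    [/\ cmeasurable setT x,
        forall w, cabs (x w) <= r,
        {ae P, forall w, bl_fun (T w) (x w) = x (sigma w)} &
        {ae P, forall w, forall z : Cplx K, cabs z < R ->
          cocycle sigma (fun w' => bl_fun (T w')) N (iter N sigmaV w) z
            @[N --> \oo] --> x w}] /\
    (* (2) *)
    ((0 < P critical)%E ->
       trivial_spectrum R P sigma L) /\
    (* (3) *)
    (P critical = 0%E ->
       let Lambda :=
         (\int[P]_w lne (cabs (derive1 (bl_fun (T w)) (x w)))%:E)%E in
       [/\ (Lambda <= lne (r / R)%:E)%E /\ (lne (r / R)%:E < 0)%E,
           Lambda = -oo%E -> trivial_spectrum R P sigma L &
           (-oo < Lambda)%E ->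
           exists V F : nat -> Omega -> set (Cplx K -> Cplx K),
             oseledets_splitting R P sigma L
               (fun n => n%:R%:E * Lambda)%E
               (fun n => if n == 0%N then 1%N else 2%N) V F /\
             {ae P, forall w,
               V 0%N w = lin_span [::
                 restrict_annulus R
                   (fun z => simple_fraction (Some (x w)) z
                             - simple_fraction (inv_conj (x w)) z)] /\
               forall j : nat, (1 <= j)%N ->
                 exists a b : nat -> Cplx K,
                   let g := fun z =>
                     \sum_(2 <= k < j.+2) a k * ((z - x w) ^+ k)^-1 in
                   let h := fun z =>
                     \sum_(1 <= k < j.+1)
                       b k * (z ^+ k.-1 / (1 - cbar (x w) * z) ^+ k.+1) in
                   [/\ pole_of_order (Some (x w)) j.+1 g,
                       pole_of_order (inv_conj (x w)) j.+1 h &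
                       V j w = lin_span [:: restrict_annulus R g;
                                            restrict_annulus R h]]}]).
Proof.
move=> L; have hR01 : 0 < R < 1 by rewrite hR0.
have ae_max : {ae P, forall w, bl_max (T w) R <= r}.
  have := ess_sup_ge P (fun w => (bl_max (T w) R)%:E).
  by apply: filterS => w; rewrite hr lee_fin.
have [A [mA PA hA invA]] := invariant_full hsigma ae_max.
have [w0 Aw0] : exists w, A w.
  apply: contrapT => nA; have e : ~` A = setT.
    by apply/seteqP; split=> // w _ wA; apply: nA; exists w.
  by move: PA; rewrite e probability_setT => /eqP; rewrite onee_eq0.
have r0 : 0 <= r.
  have c0 : cabs (rc R : Cplx K) = R by rewrite cabs_rc gtr0_norm.
  exact: le_trans (cabs_ge0 _) (le_trans (bl_max_ub (T w0) (ltW hR1) c0) (hA w0 Aw0)).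
have [s [s0 [hrad hself]]] := radii_exist r0 hrR hR1.
have AT w : A w -> selfmap s0 ((r + R) / 2) (bl_fun (T w)) by move=> wA; exact: hself _ (hA w wA).
have rr' : r < (r + R) / 2 := (midf_lt hrR).1.
have r'R : (r + R) / 2 < R := (midf_lt hrR).2.
have Rs : R < s by case: hrad.
move: ((r + R) / 2) hrad AT rr' r'R {hself} => r' hrad AT rr' r'R.
have [x [xr' xcv xfix]] := fixed_point_exists hsigma hrad AT.
have [[sK sVK] _ _ _] := hsigma.
(* [fixed_point_exists] only gives the bound r'. As x w is the image of a point of the disc of
   radius R, or 0 off A, the bound improves to r. *)
have xr w : cabs (x w) <= r.
  rewrite -[w]sVK -xfix; have [wA|nA] := pselect (A (sigmaV w)); last by rewrite cut_out// cabs0.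
  by rewrite (cut_in T wA); apply: (bl_disc_le hR01 (hA _ wA)); exact: le_trans (xr' _) (ltW r'R).
have Tr w : A w -> forall z, cabs z <= R -> cabs (bl_fun (T w) z) <= r.
  by move=> wA z zR; exact: (bl_disc_le hR01 (hA w wA) zR).
have mx : cmeasurable setT x := measurable_fixed hsigma hrad mA hT xcv.
have msp : measurable_fun setT (speed T x) by exact: (measurable_derive hrad hT mx xr').
have pf w f : A w -> hardy R f -> L w f = Lop R s (bl_fun (T w)) f.
  by move=> wA hf; exact: (perron_frobenius_spec hrad (AT w wA) hf).2.
have triv := trivial_case hsigma hrad mA PA invA AT xr rr' xfix msp.
split; [|split].
- apply: (ae_full mA PA) => w wA f hf; rewrite (pf w f wA hf).
  exact: (perron_frobenius_spec hrad (AT w wA) hf).1.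
- apply: (ae_full mA PA) => w wA; split.
  + by move=> f hf; rewrite (pf w f wA hf); exact: (Lop_hardy hrad (AT w wA) hf).
  + move=> a f g hf hg; have hfg : hardy R (a *: f + g) by apply: (hardy_lin hR0 hR1).
    rewrite (pf w _ wA hfg) (pf w _ wA hf) (pf w _ wA hg).
    exact: (Lop_lin hrad a (AT w wA) hf hg).
  + move=> u hu [M uM]; have [phi [g [h1 h2 h3]]] := Lop_compact hrad (AT w wA) hu uM.
    exists phi, g; split; [exact: h1|exact: h2|].
    have -> : (fun n => L w (u (phi n))) = (fun n => Lop R s (bl_fun (T w)) (u (phi n))).
      by apply/funext => n; exact: (pf w _ wA (hu _)).
    exact: h3.
exists x => critical; have ce : critical = [set w | speed T x w = 0].
  apply/seteqP; split=> w; rewrite /critical /speed /=; first by move=> ->; rewrite cabs0.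
  by move=> /eqP; rewrite cabs_eq0 => /eqP.
split; [|split].
- split; [exact: mx|exact: xr| |].
  + by apply: (ae_full mA PA) => w wA; rewrite -(cut_in T wA) xfix.
  + apply: (ae_full mA PA) => w wA z zR.
    have cE N v : A v -> cocycle sigma (fun w' => bl_fun (T w')) N v z = orb (forward sigma A T v) N z.
      move=> vA; elim: N => [//|N IH] /=; rewrite IH /forward (cut_in T) //.
      exact: (iter_in invA N vA).
    have AV N : A (iter N sigmaV w).
      by elim: N => [//|N IH]; rewrite iterS; apply: (invA _).1; rewrite sVK.
    have -> : (fun N => cocycle sigma (fun w' => bl_fun (T w')) N (iter N sigmaV w) z) =
        (fun N => pullback sigma sigmaV A T N w z) by apply/funext => N; exact: (cE N _ (AV N)).
    by apply: xcv; rewrite ltW// (lt_trans zR).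
- by move=> hc; apply: triv; right; rewrite -ce.
move=> hc Lambda.
have Lr : (Lambda <= lne (r / R)%:E)%E := exponent_le hsigma hrad mA PA Tr xr rr' xfix mx msp.
have r1 : (lne (r / R)%:E < 0)%E by apply: lne_lt1; rewrite ltr_pdivrMr// mul1r.
split; [exact: conj Lr r1|by move=> h; apply: triv; left|].
move=> fin; have L0 := le_lt_trans Lr r1.
have LE : Lambda = (fine Lambda)%:E.
  by rewrite fineK// fin_numE gt_eqF// lt_eqF// (lt_trans L0)// ltry.
have l0 : fine Lambda < 0 by rewrite -lte_fin -LE.
have P0 : P [set w | speed T x w = 0] = 0%E by rewrite -ce.
exact: (generic_case hsigma hrad mA PA invA AT xr rr' xfix msp LE l0 P0).
Qed.
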